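(* Let $r=6$. There exists $\delta>0$ such that every domain $\Omega\in\mathcal{AS}^r_\delta$ is area spectrally rigid in $\mathcal{AS}^r_\delta$; that is, every area-isospectral $C^1$ parametric family $(\Omega_\tau)_{|\tau|\le 1}\subset\mathcal{AS}^r_\delta$ with $\Omega_0=\Omega$ is equi-affine. In other words, every normalized area-isospectral family of domains $(\Omega_\tau)_{|\tau|\le 1}\subset\mathcal{AS}^r_\delta$ with $\Omega_0=\Omega$ is constant (i.e. $\Omega_\tau=\Omega_0$ for all $\tau\in[-1,1]$).
   Context: **Domains.** For $r\ge 2$, $\mathcal{D}^r$ is the set of strictly convex planar domains with $C^{r+1}$ boundary of everywhere positive curvature. The affine arc length of $\partial\Omega$ is $s(t)=\int_0^t\kappa^{1/3}(v)\,dv$, where $t$ is Euclidean arc length and $\kappa$ the Euclidean curvature; the affine perimeter is its total value. Standing assumption: every domain has affine perimeter $1$ and its boundary is parametrized (counterclockwise) by affine arc length, $\gamma_\Omega:\mathbb{T}=\mathbb{R}/\mathbb{Z}\to\partial\Omega$ (a $C^r$ map). **Symplectic billiard.** Let $\omega(x,y)=\det(x,y)$ on $\mathbb{R}^2$. For $x\in\partial\Omega$ let $x^*\ne x$ be the other boundary point at which the tangent line is parallel to that at $x$. On $\mathcal{P}=\{(x,y)\in\partial\Omega\times\partial\Omega: x<y<x^*\}$ (cyclic order for the positive orientation) the symplectic billiard map is $\Phi(x,y)=(y,z)$, where $z\in\partial\Omega$ is the unique point such that $z-x$ is parallel to the tangent line of $\partial\Omega$ at $y$; it extends continuously to $\overline{\mathcal{P}}$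 by $\Phi(x,x)=(x,x)$, $\Phi(x,x^* )=(x^*,x)$. The action of a closed trajectory $\{x_j\}_{j=0}^q$ ($x_0=x_q$) is $\sum_{j=0}^{q-1}\omega(x_j,x_{j+1})$. **Area spectrum.** $\mathcal{A}(\Omega)=\mathbb{N}\{\text{actions of all closed trajectories of }\Phi\}\cup\mathbb{N}\{A_\Omega\}$, where $A_\Omega$ is the area of $\Omega$ (i.e. all positive integer multiples of the actions and of $A_\Omega$). **Families.** For a $C^1$ parametric family $(\Omega_\tau)_{|\tau|\le1}\subset\mathcal{D}^r$ write $\gamma(\tau,s)=\gamma_{\Omega_\tau}(s)$; $\gamma(\cdot,s)$ is $C^1$ for every $s$ and $\gamma(\tau,\cdot)$ is $C^r$ for every $\tau$. The family is *area-isospectral* if $\mathcal{A}(\Omega_\tau)=\mathcal{A}(\Omega_{\tau'})$ for all $\tau,\tau'\in[-1,1]$. It is *equi-affine* if there are $B_\tau\in SL(2,\mathbb{R})$ and $b_\tau\in\mathbb{R}^2$ with $\Omega_\tau=B_\tau\Omega_0+b_\tau$ for all $\tau\in[-1,1]$. **Axial symmetry.** $\Omega$ is axially symmetric if it is invariant under the reflection along some line $\Delta$. Then $\Delta\cap\partial\Omega$ consists of two points; one of them, chosen arbitrarily, is called the marked point and the other the auxiliary point. The affine parametrization is chosen so that $\gamma_\Omega(0)$ is the marked point and $\gamma_\Omega(1/2)$ the auxiliary point. **Closeness to the circle.** For $\Omega_0,\Omega_1\in\mathcal{D}^r$ let $d(\Omega_0,\Omega_1)=\sum_{k=0}^r\sup_{s\in[0,1]}\|\gamma^{(k)}_{\Omega_1}(s)-\gamma^{(k)}_{\Omega_0}(s)\|$.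 Given $\Omega$ of unit affine perimeter, let $D$ be the disk of affine perimeter $1$ tangent to $\Omega$ at $\gamma_\Omega(0)$ (with $\gamma_D(0)=\gamma_\Omega(0)$ and the same tangent direction there). $\Omega$ is $\delta$-close to the circle if $d(\Omega,D)\le\delta$. $\mathcal{AS}^r_\delta$ is the set of axially symmetric domains in $\mathcal{D}^r$ that are $\delta$-close to the circle. **Normalized families.** A family of axially symmetric domains is normalized if for every $\tau\in[-1,1]$: the marked point is $\gamma(\tau,0)=(0,0)$, the axis of symmetry is the $x$-axis with $\Omega_\tau$ lying on the side $x>0$, and the auxiliary point is $\gamma(\tau,1/2)=(2(2\pi)^{-3/2},0)$. *)

(* Defs.v *)
From HB Require Import structures.
From mathcomp Require Import all_boot all_order all_algebra.
From mathcomp Require Import all_classical all_reals all_analysis.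

Set Implicit Arguments.
Unset Strict Implicit.
Unset Printing Implicit Defensive.

Import Order.TTheory GRing.Theory Num.Theory.
Import numFieldNormedType.Exports.

Local Open Scope ring_scope.
Local Open Scope classical_set_scope.

Notation plane R := (R * R)%type.

Definition omega {R : realType} (u v : plane R) : R := u.1 * v.2 - u.2 * v.1.

Definition dotp {R : realType} (u v : plane R) : R := u.1 * v.1 + u.2 * v.2.

(* The canonical norm of R * R is the max norm, hence this one. *)
Definition enorm {R : realType} (u : plane R) : R := Num.sqrt (dotp u u).

Definition of_class_C {R : realType} {V : normedModType R} (k : nat)
    (f : R -> V) : Prop :=
  (forall j, (j < k)%N -> forall t, derivable (f^`(j)) t 1) /\
  continuous (f^`(k)).

(* A function is C^1 on a compact interval (one-sided derivatives at the
   endpoints) iff it is the restriction of a C^1 function on the line. *)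
Definition C1_on_segment {R : realType} {V : normedModType R} (a b : R)
    (f : R -> V) : Prop :=
  exists F : R -> V,
    of_class_C 1 F /\ forall t, a <= t <= b -> F t = f t.

Definition boundary {R : realType} (Omega : set (plane R)) : set (plane R) :=
  closure Omega `\` interior Omega.

Definition strictly_convex_domain {R : realType} (Omega : set (plane R)) :
    Prop :=
  [/\ open Omega, bounded_set Omega &
      forall x y : plane R, closure Omega x -> closure Omega y -> x <> y ->
      forall t : R, 0 < t < 1 -> Omega ((1 - t) *: x + t *: y)].

(* Signed curvature of a curve parametrized by Euclidean arc length. *)
Definition curvature {R : realType} (c : R -> plane R) (t : R) : R :=
  omega (c^`() t) (c^`(2) t).

(* [c] is an L-periodic parametrization by Euclidean arc length of the boundary
   of [Omega], a simple closed curve. When [Omega] is convex, positivity of the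
   signed curvature also says that [c] runs counterclockwise. *)
Definition arclength_param {R : realType} (Omega : set (plane R)) (L : R)
    (c : R -> plane R) : Prop :=
  [/\ 0 < L /\ (forall t, c (t + L) = c t),
      {in `[0, L[%R &, injective c} /\ c @` `[0, L[ = boundary Omega,
      of_class_C 2 c,
      forall t, enorm (c^`() t) = 1 &
      forall t, 0 < curvature c t].

Definition affine_arclength {R : realType} (c : R -> plane R) (t : R) : R :=
  \int[@lebesgue_measure R]_(v in `[0, t]) (curvature c v `^ 3^-1).

(* Domains of affine perimeter 1. Arc-length parametrizations with positive
   curvature differ by a shift, so the choice of [c] does not matter. *)
Definition calD {R : realType} (r : nat) (Omega : set (plane R)) : Prop :=
  strictly_convex_domain Omega /\
  exists L c, [/\ arclength_param Omega L c, of_class_C r.+1 c &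
                  affine_arclength c L = 1].

(* Functions on R/Z are 1-periodic functions on R. The base point [gamma 0] is
   not determined by [Omega]. *)
Definition affine_param {R : realType} (Omega : set (plane R))
    (gamma : R -> plane R) : Prop :=
  exists L c, [/\ arclength_param Omega L c,
                  affine_arclength c L = 1,
                  (forall s, gamma (s + 1) = gamma s) &
                  forall t, 0 <= t <= L -> gamma (affine_arclength c t) = c t].

(* [opposite gamma x x'] : x' is the point x^*. *)
Definition opposite {R : realType} (gamma : R -> plane R) (x x' : plane R) :
    Prop :=
  x <> x' /\ exists a b, [/\ gamma a = x, gamma b = x' &
                             omega (gamma^`() a) (gamma^`() b) = 0].

Definition cyclically_ordered {R : realType} (gamma : R -> plane R)
    (x y z : plane R) : Prop :=
  exists a b c, [/\ gamma a = x, gamma b = y, gamma c = z &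
                    a < b /\ b < c /\ c < a + 1].

Definition phase_space {R : realType} (gamma : R -> plane R) (x y : plane R) :
    Prop :=
  exists x', opposite gamma x x' /\ cyclically_ordered gamma x y x'.

(* [billiard_step gamma x y z] : Phi (x, y) = (y, z), the three cases being the
   phase space P and the two components x = y and y = x^* of the boundary of P,
   to which Phi extends continuously. In the first case z <> x is needed for
   uniqueness, as the zero vector is parallel to every line. *)
Definition billiard_step {R : realType} (gamma : R -> plane R)
    (x y z : plane R) : Prop :=
  [\/ phase_space gamma x y /\
      [/\ range gamma z, z <> x &
          exists b, gamma b = y /\ omega (gamma^`() b) (z - x) = 0],
      [/\ range gamma x, y = x & z = x] |
      opposite gamma x y /\ z = x].

Definition closed_trajectory {R : realType} (gamma : R -> plane R) (q : nat)
    (x : nat -> plane R) : Prop :=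
  [/\ (0 < q)%N, (forall j, x (j + q)%N = x j) &
      forall j, billiard_step gamma (x j) (x j.+1) (x j.+2)].

Definition action {R : realType} (q : nat) (x : nat -> plane R) : R :=
  \sum_(0 <= j < q) omega (x j) (x j.+1).

Definition area {R : realType} (Omega : set (plane R)) : R :=
  fine ((@lebesgue_measure R \x @lebesgue_measure R)%E Omega).

Definition area_spectrum {R : realType} (Omega : set (plane R)) : set R :=
  [set a | exists n : nat, (0 < n)%N /\
     ((exists gamma q x, [/\ affine_param Omega gamma,
                             closed_trajectory gamma q x &
                             a = n%:R * action q x]) \/
      a = n%:R * area Omega)].

Definition line {R : realType} (p u : plane R) : set (plane R) :=
  range (fun l : R => p + l *: u).

(* Reflection along [line p u], for a unit vector [u]. *)
Definition reflection {R : realType} (p u x : plane R) : plane R :=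
  p + (2 * dotp (x - p) u) *: u - (x - p).

(* [gamma 0] is the marked point and [gamma (1/2)] the auxiliary one. *)
Definition axially_marked {R : realType} (Omega : set (plane R))
    (gamma : R -> plane R) : Prop :=
  affine_param Omega gamma /\
  exists p u, [/\ enorm u = 1, reflection p u @` Omega = Omega &
                  line p u `&` boundary Omega = [set gamma 0; gamma 2^-1]].

Definition Cr_distance {R : realType} (r : nat) (gamma0 gamma1 : R -> plane R) :
    R :=
  \sum_(k < r.+1)
    sup [set enorm (derive1n k gamma1 s - derive1n k gamma0 s) | s in `[0, 1]].

Definition disk {R : realType} (p : plane R) (rho : R) : set (plane R) :=
  [set x | enorm (x - p) < rho].

(* [gammaD] is the affine parametrization of the disk D of affine perimeter 1
   tangent to the domain at [gamma 0]; D and [gammaD] exist and are unique. *)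
Definition close_to_circle {R : realType} (r : nat) (delta : R)
    (gamma : R -> plane R) : Prop :=
  exists p rho gammaD,
    [/\ affine_param (disk p rho) gammaD,
        gammaD 0 = gamma 0,
        (exists l : R, 0 < l /\ derive1 gammaD 0 = l *: derive1 gamma 0) &
        Cr_distance r gamma gammaD <= delta].

(* Elements of AS^r_delta together with the affine parametrization given by the
   choice of the marked point. *)
Definition marked_AS {R : realType} (r : nat) (delta : R)
    (Omega : set (plane R)) (gamma : R -> plane R) : Prop :=
  [/\ calD r Omega, axially_marked Omega gamma & close_to_circle r delta gamma].

Definition calAS {R : realType} (r : nat) (delta : R) (Omega : set (plane R)) :
    Prop :=
  exists gamma, marked_AS r delta Omega gamma.

(* Families are indexed by R, but only tau in [-1, 1] is relevant. *)
Definition C1_family {R : realType} (r : nat) (Omega : R -> set (plane R))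
    (gamma : R -> R -> plane R) : Prop :=
  (forall tau : R, -1 <= tau <= 1 ->
     [/\ calD r (Omega tau), affine_param (Omega tau) (gamma tau) &
         of_class_C r (gamma tau)]) /\
  (forall s, C1_on_segment (-1) 1 (fun tau => gamma tau s)).

Definition AS_family {R : realType} (r : nat) (delta : R)
    (Omega : R -> set (plane R)) (gamma : R -> R -> plane R) : Prop :=
  C1_family r Omega gamma /\
  forall tau : R, -1 <= tau <= 1 -> marked_AS r delta (Omega tau) (gamma tau).

Definition area_isospectral {R : realType} (Omega : R -> set (plane R)) :
    Prop :=
  forall tau tau' : R, -1 <= tau <= 1 -> -1 <= tau' <= 1 ->
    area_spectrum (Omega tau) = area_spectrum (Omega tau').

Definition affine_map {R : realType} (B : 'M[R]_2) (b x : plane R) : plane R :=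
  (B 0 0 * x.1 + B 0 1 * x.2 + b.1, B 1 0 * x.1 + B 1 1 * x.2 + b.2).

Definition equi_affine {R : realType} (Omega : R -> set (plane R)) : Prop :=
  forall tau : R, -1 <= tau <= 1 ->
    exists (B : 'M[R]_2) (b : plane R),
      \det B = 1 /\ Omega tau = affine_map B b @` Omega 0.

Definition constant_family {R : realType} (Omega : R -> set (plane R)) : Prop :=
  forall tau : R, -1 <= tau <= 1 -> Omega tau = Omega 0.

Definition normalized {R : realType} (Omega : R -> set (plane R))
    (gamma : R -> R -> plane R) : Prop :=
  forall tau : R, -1 <= tau <= 1 ->
    [/\ gamma tau 0 = (0, 0),
        reflection (0, 0) (1, 0) @` Omega tau = Omega tau,
        (forall x, Omega tau x -> 0 < x.1) &
        gamma tau 2^-1 = (2 * (2 * pi) `^ (- (3 / 2)), 0)].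

Definition spectrally_rigid {R : realType} (r : nat) (delta : R)
    (Omega : set (plane R)) : Prop :=
  forall (Omegas : R -> set (plane R)) (gamma : R -> R -> plane R),
    AS_family r delta Omegas gamma -> area_isospectral Omegas ->
    Omegas 0 = Omega -> equi_affine Omegas.

Definition normalized_rigid {R : realType} (r : nat) (delta : R)
    (Omega : set (plane R)) : Prop :=
  forall (Omegas : R -> set (plane R)) (gamma : R -> R -> plane R),
    AS_family r delta Omegas gamma -> normalized Omegas gamma ->
    area_isospectral Omegas -> Omegas 0 = Omega -> constant_family Omegas.

(* Main.v *)
Require Import Defs.
From mathcomp Require Import all_boot all_order all_algebra.
From mathcomp Require Import all_classical all_reals all_analysis.
From mathcomp Require Import zify ring lra.

Set Implicit Arguments.
Unset Strict Implicit.
Unset Printing Implicit Defensive.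

Import Order.TTheory GRing.Theory Num.Theory.
Import numFieldNormedType.Exports.
Local Open Scope ring_scope.
Local Open Scope classical_set_scope.

(* Affine normalization turns the boundaries into curves G with omega (G', G'') = 1,
   close to the unit circle, symmetric about the x-axis, with marked and auxiliary
   points (1, 0) and (-1, 0).

   Closed trajectories are critical polygons of the action. Two critical polygons
   whose first two vertices are at distance t have actions that differ by O(t^3), so
   the area spectrum is negligible. The largest action of an axially symmetric q-gon
   through the marked point is an element of the spectrum which is continuous in tau,
   hence it is constant.

   Suppose that G0 and G1 have the same largest action for every q, and let m be
   their mean and n = omega (G1 - G0, m'), where n'' is 1/2-Hoelder with constant B.
   The maximizers are O(eps h^2)-close to the equidistant q-gon, h = 2 pi / q, so the
   actions of the equidistant q-gons for G0 and G1 differ by O(eps B h^(7/2)). This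
   difference is a combination of averages over the q-gon of n and of a similar
   lower-order term, so that the averages of n are O(eps B q^(-7/2)). Averages over
   q-gons are sums of Fourier coefficients at multiples of q; inverting this relation
   bounds the k-th coefficient by O(eps B k^(-7/2)), and then n'' is 1/2-Hoelder with
   constant B / 2. Hence n = 0 and G0 = G1. *)

(** * Derivatives of real functions *)

(** The Hoelder exponent makes the argument close on itself. A 1/2-Hoelder second derivative of n
    makes the gradient of the action change by O(h^(5/2)) at each of about 1/h vertices, and
    displacements of O(eps h^2) turn this into O(eps h^(7/2)). Conversely, coefficients O(k^(-7/2))
    give back a 1/2-Hoelder second derivative, since the sum of k^(-3/2) min(2, k t) is O(sqrt t);
    integer exponents would lose a logarithm. The factor eps behind the contraction has two sources:
    the displacement of the maximizers, and m''' + m', which vanishes on the circle and weights the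
    lower-order term. That term and the average of n occur in a single relation; they are separated
    by the different rates at which they converge along multiples of q. The averages for q = 1 and q
    = 2, which no polygon provides, vanish because the marked and auxiliary points are common.
    Differences are taken at the mean of the two curves because the constraint omega (G', G'') = 1
    and the action are quadratic, so that their linearizations there are exact. *)

Definition der {R : realType} (f f' : R -> R) : Prop :=
  forall t : R, is_derive t 1 f (f' t).

Section Calculus.
Context {R : realType}.
Implicit Types (f g : R -> R).

Lemma der_eq f f' f'' : der f f' -> (forall t, f' t = f'' t) -> der f f''.
Proof. by move=> df e t; rewrite -e. Qed.

Lemma der_ext f g f' : (forall t, f t = g t) -> der f f' -> der g f'.
Proof. by move=> /funext ->. Qed.

Lemma der_cst (c : R) : der (fun=> c) (fun=> 0).
Proof. by move=> t; exact: is_derive_cst. Qed.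

Lemma der_id : der (fun t : R => t) (fun=> 1).
Proof. by move=> t; exact: is_derive_id. Qed.

Lemma der_add f f' g g' : der f f' -> der g g' ->
  der (fun t => f t + g t) (fun t => f' t + g' t).
Proof. by move=> df dg t; apply: is_deriveD. Qed.

Lemma der_opp f f' : der f f' -> der (fun t => - f t) (fun t => - f' t).
Proof. by move=> df t; apply: is_deriveN. Qed.

Lemma der_sub f f' g g' : der f f' -> der g g' ->
  der (fun t => f t - g t) (fun t => f' t - g' t).
Proof. by move=> df dg; apply: der_add => //; apply: der_opp. Qed.

Lemma der_mul f f' g g' : der f f' -> der g g' ->
  der (fun t => f t * g t) (fun t => f' t * g t + f t * g' t).
Proof.
move=> df dg t; have [] := df t; have [] := dg t => dg1 dg2 df1 df2.
have := is_deriveM (df t) (dg t) => H.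
apply: is_derive_eq; rewrite /GRing.scale /=; ring.
Qed.

Lemma der_scale (c : R) f f' : der f f' -> der (fun t => c * f t) (fun t => c * f' t).
Proof.
move=> df; apply: (der_eq (der_mul (der_cst c) df)) => t; ring.
Qed.

Lemma der_comp f f' g g' : der f f' -> der g g' ->
  der (fun t => f (g t)) (fun t => f' (g t) * g' t).
Proof. 
move=> df dg t; have H1 := df (g t); have H2 := dg t.
have := @is_derive1_comp R f g t (f' (g t)) (g' t) H1 H2.
by move=> ?; apply: is_derive_eq; rewrite mulrC.
Qed.

Lemma der_sum (F F' : nat -> R -> R) (a b : nat) :
  (forall i, (a <= i < b)%N -> der (F i) (F' i)) ->
  der (fun t => \sum_(a <= i < b) F i t) (fun t => \sum_(a <= i < b) F' i t).
Proof.
elim: b => [|b IH] H.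
  apply: (der_ext (f := fun=> 0)) => [t|]; first by rewrite big_geq.
  by apply: (der_eq (der_cst 0)) => t; rewrite big_geq.
have [ab|ba] := leqP a b; last first.
  apply: (der_ext (f := fun=> 0)) => [t|]; first by rewrite big_geq.
  by apply: (der_eq (der_cst 0)) => t; rewrite big_geq.
apply: (der_ext (f := fun t => \sum_(a <= i < b) F i t + F b t)) => [t|].
  by rewrite big_nat_recr.
apply: (der_eq (der_add (IH _) (H b _))) => [i /andP[ai ib]||t].
- by apply: H; rewrite ai ltnS ltnW.
- by rewrite ab ltnSn.
- by rewrite big_nat_recr.
Qed.

Lemma der_uniq f f1 f2 : der f f1 -> der f f2 -> forall t, f1 t = f2 t.
Proof. by move=> d1 d2 t; have [_ <-] := d1 t; have [_ <-] := d2 t. Qed.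

Lemma der_sin : der (@sin R) (@cos R).
Proof. by move=> t; exact: is_derive_sin. Qed.

Lemma der_cos : der (@cos R) (fun t => - sin t).
Proof. by move=> t; exact: is_derive_cos. Qed.

Lemma der_continuous f f' : der f f' -> continuous f.
Proof.
move=> df t; apply: differentiable_continuous; apply/derivable1_diffP.
by have [] := df t.
Qed.

Lemma mvt f f' (a b : R) : der f f' -> a <= b ->
  exists2 c, a <= c <= b & f b - f a = f' c * (b - a).
Proof.
move=> df ab.
have [|c cab e] := @MVT_segment R f f' a b ab (fun x _ => df x).
  by apply: continuous_subspaceT; exact: der_continuous df.
by exists c => //; move: cab; rewrite in_itv.
Qed.

Lemma mvt_le f f' (B a b : R) : der f f' ->
  (forall t, (a <= t <= b) || (b <= t <= a) -> `|f' t| <= B) ->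
  `|f b - f a| <= B * `|b - a|.
Proof.
move=> df H; have [ab|/ltW ba] := leP a b.
  have [c cab ->] := mvt df ab.
  by rewrite normrM ler_wpM2r// H// cab.
have [c cab] := mvt df ba.
rewrite distrC => ->.
by rewrite normrM [`|b - a|]distrC ler_wpM2r// H// cab orbT.
Qed.

Lemma mvt_le_glob f f' (B a b : R) : der f f' -> (forall t, `|f' t| <= B) ->
  `|f b - f a| <= B * `|b - a|.
Proof. by move=> df H; apply: mvt_le => // t _; apply: H. Qed.

Lemma der_incr f f' (a b : R) : der f f' -> a <= b ->
  (forall t, a <= t <= b -> 0 <= f' t) -> f a <= f b.
Proof.
move=> df ab H; have [c cab e] := mvt df ab.
by rewrite -subr_ge0 e mulr_ge0 ?H// subr_ge0.
Qed.

Lemma rolle f f' (a b : R) : der f f' -> a < b -> f a = f b ->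
  exists2 c, a <= c <= b & f' c = 0.
Proof.
move=> df ab e; have [c cab] := mvt df (ltW ab).
rewrite e subrr => /esym/eqP; rewrite mulf_eq0 subr_eq0 (gt_eqF ab) orbF => /eqP c0.
by exists c.
Qed.

Lemma ivt f (a b : R) : continuous f -> a <= b ->
  0 <= f a -> f b <= 0 -> exists2 c, a <= c <= b & f c = 0.
Proof.
move=> cf ab fa fb.
have [||c cab e] := @IVT R f a b 0 ab.
- by apply: continuous_subspaceT.
- by rewrite ge_min fb orbT le_max fa.
by exists c => //; move: cab; rewrite in_itv.
Qed.

End Calculus.

(** * Elementary bounds for sine and cosine *)

Section Trig.
Context {R : realType}.

Lemma pi_lt4 : pi < 4 :> R.
Proof. by have := @pihalf_lt2 R; lra. Qed.

Lemma sin_le_id (x : R) : 0 <= x -> sin x <= x.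
Proof.
move=> x0; suff: (fun t : R => t - sin t) 0 <= x - sin x by rewrite /= sin0; lra.
by apply: (der_incr (der_sub der_id der_sin)) => // t _; have := cos_le1 t; lra.
Qed.

Lemma cos_ge_quad (x : R) : 0 <= x -> 1 - x ^+ 2 / 2 <= cos x.
Proof.
move=> x0.
have d : der (fun t : R => cos t + 1 / 2 * (t * t)) (fun t => t - sin t).
  apply: (der_eq (der_add der_cos (der_scale (1/2) (der_mul der_id der_id)))) => t.
  by field.
have : 1 <= cos x + 1 / 2 * (x * x).
  have := der_incr d x0; rewrite /= cos0 mul0r mulr0 addr0; apply.
  by move=> t /andP[t0 _]; have := sin_le_id t0; lra.
by rewrite expr2; lra.
Qed.

Lemma sin_ge_cubic (x : R) : 0 <= x -> x - x ^+ 3 / 6 <= sin x.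
Proof.
move=> x0.
have d : der (fun t : R => sin t - t + 1 / 6 * (t * (t * t)))
             (fun t => cos t - 1 + t ^+ 2 / 2).
  apply: (der_eq (der_add (der_sub der_sin der_id)
    (der_scale (1/6) (der_mul der_id (der_mul der_id der_id))))) => t.
  by field.
have : 0 <= sin x - x + 1 / 6 * (x * (x * x)).
  have := der_incr d x0; rewrite /= sin0 mul0r mulr0 subr0 addr0; apply.
  by move=> t /andP[t0 _]; have := cos_ge_quad t0; lra.
by rewrite !exprS expr0; lra.
Qed.

Lemma sin_ge_third (x : R) : 0 <= x <= 2 -> x / 3 <= sin x.
Proof.
move=> /andP[x0 x2]; have := sin_ge_cubic x0.
have : x ^+ 3 <= 4 * x.
  by rewrite !exprS expr0 mulr1; nra.
lra.
Qed.

(** The range of [x] is that of the steps of an admissible polygon with at least three vertices.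
    Since pi is at least 3 h / 2, both [x] and [pi - x] are at least h / 4, and one of them is at
    most pi / 2, where the sine is at least a third of its argument. *)
Lemma sin_ge_step (h x : R) : 0 < h <= 2 * pi / 3 -> 3 * h / 4 <= x <= 5 * h / 4 ->
  h / 12 <= sin x.
Proof.
move=> /andP[h0 h1] /andP[x0 x1]; have p4 := pi_lt4.
have [xp|xp] := leP x (pi / 2).
  have := @sin_ge_third x; have -> : 0 <= x <= 2 by apply/andP; lra.
  by move/(_ isT); lra.
have := @sin_ge_third (pi - x); rewrite sinB sinpi cospi.
have -> : 0 <= pi - x <= 2 by apply/andP; lra.
by move/(_ isT); lra.
Qed.

Lemma one_sub_cos_ge (x : R) : `|x| <= pi -> x ^+ 2 / 18 <= 1 - cos x.
Proof.
move=> xp; have p4 := pi_lt4.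
wlog x0 : x xp / 0 <= x.
  move=> H; have [x0|/ltW x0] := leP 0 x; first exact: H.
  by have := H (- x); rewrite normrN sqrrN cosN; apply => //; lra.
rewrite ger0_norm// in xp.
have := @sin_ge_third (x / 2).
have -> : 0 <= x / 2 <= 2 by apply/andP; lra.
move=> /(_ isT) s.
have -> : cos x = 1 - 2 * sin (x / 2) ^+ 2.
  have -> : cos x = cos (x / 2 + x / 2) by congr cos; lra.
  by rewrite cosD -!expr2 cos2sin2; ring.
by rewrite !expr2; nra.
Qed.

End Trig.

(** * Curves close to the circle *)

Definition vder {R : realType} (u u' : R -> plane R) : Prop :=
  der (fun t => (u t).1) (fun t => (u' t).1) /\
  der (fun t => (u t).2) (fun t => (u' t).2).

Section Plane.
Context {R : realType}.
Implicit Types (u v w : plane R).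

Lemma norm_planeE u : `|u| = Num.max `|u.1| `|u.2|.
Proof. by []. Qed.

Lemma norm_plane_le u (B : R) : (`|u| <= B) = (`|u.1| <= B) && (`|u.2| <= B).
Proof. by rewrite norm_planeE ge_max. Qed.

Lemma norm1_le u : `|u.1| <= `|u|.
Proof. by have := lexx `|u|; rewrite {1}norm_plane_le => /andP[]. Qed.

Lemma norm2_le u : `|u.2| <= `|u|.
Proof. by have := lexx `|u|; rewrite {1}norm_plane_le => /andP[]. Qed.

Lemma normD_le u v (a b : R) : `|u| <= a -> `|v| <= b -> `|u + v| <= a + b.
Proof. by move=> ua vb; apply: (le_trans (ler_normD _ _)); apply: lerD. Qed.

Lemma normB_le u v (a b : R) : `|u| <= a -> `|v| <= b -> `|u - v| <= a + b.
Proof. by move=> ua vb; apply: (le_trans (ler_normB _ _)); apply: lerD. Qed.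

Lemma omega_le u v (a b : R) : `|u| <= a -> `|v| <= b -> `|omega u v| <= 2 * a * b.
Proof.
rewrite !norm_plane_le => /andP[u1 u2] /andP[v1 v2].
rewrite /omega; apply: (le_trans (ler_normB _ _)); rewrite !normrM.
have : `|u.1| * `|v.2| <= a * b by apply: ler_pM.
have : `|u.2| * `|v.1| <= a * b by apply: ler_pM.
lra.
Qed.

Lemma omegaC u v : omega u v = - omega v u.
Proof. rewrite /omega; ring. Qed.
Lemma omegaDl u v w : omega (u + v) w = omega u w + omega v w.
Proof. rewrite /omega /=; ring. Qed.
Lemma omegaDr u v w : omega w (u + v) = omega w u + omega w v.
Proof. rewrite /omega /=; ring. Qed.
Lemma omegaNl u w : omega (- u) w = - omega u w.
Proof. rewrite /omega /=; ring. Qed.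
Lemma omegaNr u w : omega w (- u) = - omega w u.
Proof. rewrite /omega /=; ring. Qed.
Lemma omegaBl u v w : omega (u - v) w = omega u w - omega v w.
Proof. by rewrite omegaDl omegaNl. Qed.
Lemma omegaBr u v w : omega w (u - v) = omega w u - omega w v.
Proof. by rewrite omegaDr omegaNr. Qed.
Lemma omegaZl (c : R) u w : omega (c *: u) w = c * omega u w.
Proof. rewrite /omega /= /GRing.scale /=; ring. Qed.
Lemma omegaZr (c : R) u w : omega w (c *: u) = c * omega w u.
Proof. rewrite /omega /= /GRing.scale /=; ring. Qed.
Lemma omegavv u : omega u u = 0.
Proof. rewrite /omega; ring. Qed.

Lemma cramer u v w : omega u v *: w = omega w v *: u - omega w u *: v.
Proof.
case: u v w => [u1 u2] [v1 v2] [w1 w2]; rewrite /omega /=; congr pair => /=;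
by rewrite /GRing.scale /=; ring.
Qed.

Lemma der_omega (u u' v v' : R -> plane R) : vder u u' -> vder v v' ->
  der (fun t => omega (u t) (v t)) (fun t => omega (u' t) (v t) + omega (u t) (v' t)).
Proof.
move=> [u1 u2] [v1 v2].
apply: (der_eq (der_sub (der_mul u1 v2) (der_mul u2 v1))) => t.
by rewrite /omega; ring.
Qed.

Lemma vder_cst (c : plane R) : vder (fun=> c) (fun=> 0).
Proof. by split; apply: der_cst. Qed.

Lemma vder_add (u u' v v' : R -> plane R) : vder u u' -> vder v v' ->
  vder (fun t => u t + v t) (fun t => u' t + v' t).
Proof. by move=> [u1 u2] [v1 v2]; split; apply: der_add. Qed.

Lemma vder_sub (u u' v v' : R -> plane R) : vder u u' -> vder v v' ->
  vder (fun t => u t - v t) (fun t => u' t - v' t).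
Proof. by move=> [u1 u2] [v1 v2]; split; apply: der_sub. Qed.

Lemma vder_scale (c : R) (u u' : R -> plane R) : vder u u' ->
  vder (fun t => c *: u t) (fun t => c *: u' t).
Proof. by move=> [u1 u2]; split; apply: der_scale. Qed.

Lemma vder_comp (u u' : R -> plane R) g g' : vder u u' -> der g g' ->
  vder (fun t => u (g t)) (fun t => g' t *: u' (g t)).
Proof.
by move=> [u1 u2] dg; split; [apply: (der_eq (der_comp u1 dg))|apply: (der_eq (der_comp u2 dg))] => t;
rewrite mulrC.
Qed.

Lemma vder_shift (u u' : R -> plane R) (a : R) : vder u u' ->
  vder (fun t => u (a + t)) (fun t => u' (a + t)).
Proof.
move=> du; have [h1 h2] := vder_comp du (der_add (der_cst a) der_id).
by split; [apply: (der_eq h1)|apply: (der_eq h2)] => t; rewrite add0r scale1r.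
Qed.

Lemma vmvt_le (u u' : R -> plane R) (B a b : R) : vder u u' ->
  (forall t, (a <= t <= b) || (b <= t <= a) -> `|u' t| <= B) ->
  `|u b - u a| <= B * `|b - a|.
Proof.
move=> [u1 u2] H; rewrite norm_plane_le; apply/andP; split.
  by apply: (mvt_le u1) => t /H; apply: le_trans; exact: norm1_le.
by apply: (mvt_le u2) => t /H; apply: le_trans; exact: norm2_le.
Qed.

Lemma periodic_int (V : Type) (f : R -> V) (T : R) : (forall t, f (t + T) = f t) ->
  forall (k : int) t, f (t + k%:~R * T) = f t.
Proof.
move=> H; have Hn : forall (n : nat) t, f (t + n%:R * T) = f t.
  elim=> [|n IH] t; first by rewrite mul0r addr0.
  by rewrite -natr1 mulrDl mul1r addrA H IH.
case=> [n|n] t; first exact: Hn.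
by rewrite NegzE -(Hn n.+1) mulrNz mulNr subrK.
Qed.

Lemma period_reduce (T x : R) : 0 < T ->
  exists y, exists k : int, 0 <= y < T /\ x = y + k%:~R * T.
Proof.
move=> T0; exists (x - (Num.floor (x / T))%:~R * T), (Num.floor (x / T)).
split; last by rewrite subrK.
rewrite subr_ge0 -ler_pdivlMr// floor_le_tmp /=.
have : x < (Num.floor (x / T) + 1)%:~R * T by rewrite -ltr_pdivrMr// lt_succ_floor.
by rewrite intrD mulrDl mul1r; lra.
Qed.

(** The a priori bound [M], however large, makes the supremum of |p| finite; with [P] equal to this
    supremum, half of it can be moved to the other side. *)
Lemma absorb (p : R -> R) (M a : R) : (forall t, `|p t| <= M) ->
  (forall P : R, (forall t, `|p t| <= P) -> forall t, `|p t| <= a + P / 2) ->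
  forall t, `|p t| <= 2 * a.
Proof.
move=> pM H.
have hs : has_sup (range (fun t => `|p t|)).
  by split; [exists `|p 0|; exists 0|exists M => _ [t _ <-]].
have ub t : `|p t| <= sup (range (fun t => `|p t|)).
  by apply: ub_le_sup; [exact: hs.2|exists t].
have : sup (range (fun t => `|p t|)) <= a + sup (range (fun t => `|p t|)) / 2.
  by apply: ge_sup; [exact: hs.1|move=> _ [t _ <-]; exact: H].
by move=> h t; have := ub t; lra.
Qed.

End Plane.

Section Curve.
Context {R : realType}.

(* [ek k] is the k-th derivative of the unit circle t |-> (cos t, sin t). *)
Definition ek (k : nat) (t : R) : plane R :=
  (cos (t + k%:R * (pi / 2)), sin (t + k%:R * (pi / 2))).

Lemma ek_der k : vder (ek k) (ek k.+1).
Proof.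
have d : der (fun t : R => t + k%:R * (pi / 2)) (fun=> 1).
  by apply: (der_eq (der_add der_id (der_cst _))) => t; rewrite addr0.
have e (t : R) : t + k.+1%:R * (pi / 2) = t + k%:R * (pi / 2) + pi / 2.
  by rewrite -natr1 mulrDl mul1r addrA.
split.
  by apply: (der_eq (der_comp der_cos d)) => t; rewrite /= e cosDpihalf mulr1.
by apply: (der_eq (der_comp der_sin d)) => t; rewrite /= e sinDpihalf mulr1.
Qed.

Lemma ekSS k t : ek k.+2 t = - ek k t.
Proof.
rewrite /ek; have -> : t + k.+2%:R * (pi / 2) = t + k%:R * (pi / 2) + pi.
  by rewrite -addn2 natrD; field.
by rewrite sinDpi cosDpi.
Qed.

Lemma ek0 t : ek 0 t = (cos t, sin t).
Proof. by rewrite /ek mul0r addr0. Qed.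

Lemma ek1 t : ek 1 t = (- sin t, cos t).
Proof. by rewrite /ek mul1r cosDpihalf sinDpihalf. Qed.

Lemma ek_periodic k t : ek k (t + 2 * pi) = ek k t.
Proof.
rewrite /ek -addrA [2 * pi + _]addrC addrA.
have -> (x : R) : x + 2 * pi = x + pi *+ 2 by rewrite mulr2n; ring.
by rewrite cosD2pi sinD2pi.
Qed.

Lemma ek_le1 k t : `|ek k t| <= 1.
Proof. by rewrite norm_plane_le !ler_norml cos_geN1 cos_le1 sin_geN1 sin_le1. Qed.

Lemma omega_ek k (s t : R) : omega (ek k s) (ek k t) = sin (t - s).
Proof.
have -> : t - s = (t + k%:R * (pi / 2)) - (s + k%:R * (pi / 2)) by ring.
by rewrite sinB /omega /=; ring.
Qed.

Lemma omega_ekS k (s t : R) : omega (ek k s) (ek k.+1 t) = cos (t - s).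
Proof.
have -> : t - s = (t + k.+1%:R * (pi / 2)) - (s + k%:R * (pi / 2)) - pi / 2.
  by rewrite -natr1; ring.
by rewrite cosBpihalf sinB /omega /=; ring.
Qed.

(* [G] bundles a curve with its first six derivatives. *)
Record curve (eps : R) (G : nat -> R -> plane R) : Prop := Curve {
  curve_der : forall k, (k < 6)%N -> vder (G k) (G k.+1);
  curve_omega : forall t, omega (G 1%N t) (G 2%N t) = 1;
  curve_per : forall k t, (k <= 6)%N -> G k (t + 2 * pi) = G k t;
  curve_near : forall k t, (k <= 6)%N -> `|G k t - ek k t| <= eps }.

Lemma curve_ek (eps : R) : 0 <= eps -> curve eps ek.
Proof.
move=> e0; split.
- by move=> k _; exact: ek_der.
- by move=> t; rewrite omega_ekS subrr cos0.
- by move=> k t _; exact: ek_periodic.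
- by move=> k t _; rewrite subrr normr0.
Qed.

Lemma curve_le (eps : R) G k t : curve eps G -> (k <= 6)%N -> `|G k t| <= 1 + eps.
Proof.
move=> cG k6; have -> : G k t = ek k t + (G k t - ek k t) by rewrite addrC subrK.
apply: (le_trans (ler_normD _ _)); apply: lerD; first exact: ek_le1.
exact: curve_near.
Qed.

End Curve.

(** * The difference of two curves in the moving frame of their mean *)

Section Pair.
Context {R : realType}.
Variables (eps : R) (G0 G1 : nat -> R -> plane R).
Hypotheses (c0 : curve eps G0) (c1 : curve eps G1).
Hypothesis eps_small : eps <= 1 / 1000.

Definition mid k t := (1 / 2) *: (G0 k t + G1 k t) : plane R.
Definition dif k t := G1 k t - G0 k t : plane R.

Local Notation m := mid.
Local Notation d := dif.

Lemma eps_ge0 : 0 <= eps.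
Proof. exact: (le_trans (normr_ge0 _) (@curve_near _ _ _ c0 0%N 0 isT)). Qed.

Lemma mid_der k : (k < 6)%N -> vder (m k) (m k.+1).
Proof. by move=> k6; apply: vder_scale; apply: vder_add; apply: curve_der; eassumption. Qed.

Lemma dif_der k : (k < 6)%N -> vder (d k) (d k.+1).
Proof. by move=> k6; apply: vder_sub; apply: curve_der; eassumption. Qed.

Lemma mid_per k t : (k <= 6)%N -> m k (t + 2 * pi) = m k t.
Proof. by move=> k6; rewrite /mid (curve_per c0)// (curve_per c1). Qed.

Lemma dif_per k t : (k <= 6)%N -> d k (t + 2 * pi) = d k t.
Proof. by move=> k6; rewrite /dif (curve_per c0)// (curve_per c1). Qed.

Lemma mid_near k t : (k <= 6)%N -> `|m k t - ek k t| <= eps.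
Proof.
move=> k6; have -> : m k t - ek k t = (1 / 2) *: ((G0 k t - ek k t) + (G1 k t - ek k t)).
  rewrite /mid; case: (G0 k t) (G1 k t) (ek k t) => [a1 a2] [b1 b2] [e1 e2].
  by congr pair => /=; rewrite /GRing.scale /=; field.
rewrite normrZ ger0_norm; last lra.
have := normD_le (@curve_near _ _ _ c0 k t k6) (@curve_near _ _ _ c1 k t k6); lra.
Qed.

Lemma mid_le k t : (k <= 6)%N -> `|m k t| <= 2.
Proof.
move=> k6; have -> : m k t = ek k t + (m k t - ek k t) by rewrite addrC subrK.
by have h := eps_small; have := normD_le (ek_le1 k t) (@mid_near k t k6); lra.
Qed.

Lemma dif_le k t : (k <= 6)%N -> `|d k t| <= 2 * eps.
Proof.
move=> k6; have -> : d k t = (G1 k t - ek k t) - (G0 k t - ek k t).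
  by rewrite /dif opprB addrA subrK.
by have := normB_le (@curve_near _ _ _ c1 k t k6) (@curve_near _ _ _ c0 k t k6); lra.
Qed.

(* The linearization of omega (G', G'') = 1 holds exactly at the midpoint. *)
Lemma dif_constraint t : omega (d 1 t) (m 2 t) + omega (m 1 t) (d 2 t) = 0.
Proof.
have := curve_omega c0 t; have := curve_omega c1 t.
rewrite /dif /mid /omega /= /GRing.scale /= => h1 h0.
transitivity ((G1 1%N t).1 * (G1 2%N t).2 - (G1 1%N t).2 * (G1 2%N t).1
  - ((G0 1%N t).1 * (G0 2%N t).2 - (G0 1%N t).2 * (G0 2%N t).1)); first by field.
by rewrite h1 h0 subrr.
Qed.

(* (fp, - fn) and (ff, fe) are, up to the factor 1 / fW, the coordinates of G1 - G0 and
   of its derivative in the frame (m', m''). *)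
Definition fW t := omega (m 1 t) (m 2 t).
Definition fn t := omega (d 0 t) (m 1 t).
Definition fp t := omega (d 0 t) (m 2 t).
Definition fs t := omega (d 0 t) (m 3 t).
Definition ff t := omega (d 1 t) (m 2 t).
Definition fe t := omega (m 1 t) (d 1 t).
Definition fn1 t := fp t - fe t.
Definition fn2 t := 3 * ff t + fs t.

(** Parallelogram identity for omega (G', G''): the determinant of the frame differs from 1 only by
    a term quadratic in the difference of the curves. *)
Lemma fW_eq t : fW t = 1 - omega (d 1 t) (d 2 t) / 4.
Proof.
have := curve_omega c0 t; have := curve_omega c1 t.
rewrite /fW /dif /mid /omega /= /GRing.scale /= => h1 h0.
transitivity (1 / 2 * ((G1 1%N t).1 * (G1 2%N t).2 - (G1 1%N t).2 * (G1 2%N t).1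
  + ((G0 1%N t).1 * (G0 2%N t).2 - (G0 1%N t).2 * (G0 2%N t).1))
  - ((G1 1%N t).1 - (G0 1%N t).1) * ((G1 2%N t).2 - (G0 2%N t).2) / 4
  + ((G1 1%N t).2 - (G0 1%N t).2) * ((G1 2%N t).1 - (G0 2%N t).1) / 4); first by field.
by rewrite h1 h0; field.
Qed.

Lemma fW_ge t : 1 / 2 <= fW t.
Proof.
have h0 := eps_small; rewrite fW_eq; have := omega_le (@dif_le 1 t isT) (@dif_le 2 t isT).
have e0 := eps_ge0.
rewrite ler_norml => /andP[_ h].
have : 2 * (2 * eps) * (2 * eps) <= 1 by nra.
lra.
Qed.

Lemma der_fn : der fn fn1.
Proof.
apply: (der_eq (der_omega (@dif_der 0 isT) (@mid_der 1 isT))) => t.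
by rewrite /fn1 /fp /fe [omega (m 1 t) _]omegaC; ring.
Qed.

Lemma der_fe : der fe (fun t => - (2 * ff t)).
Proof.
apply: (der_eq (der_omega (@mid_der 1 isT) (@dif_der 1 isT))) => t.
have := dif_constraint t; rewrite /ff [omega (m 2 t) _]omegaC; lra.
Qed.

Lemma der_fp : der fp (fun t => ff t + fs t).
Proof. exact: (der_omega (@dif_der 0 isT) (@mid_der 2 isT)). Qed.

(** This formula lets [fn] control everything: [fs] is - [fn] up to O(eps), so [ff] can be read off
    [fn2], while [fe] is the difference of [fp] and [fn1]. *)
Lemma der_fn1 : der fn1 fn2.
Proof. by apply: (der_eq (der_sub der_fp der_fe)) => t; rewrite /fn2; ring. Qed.

Lemma der_fs : der fs (fun t => omega (d 1 t) (m 3 t) + omega (d 0 t) (m 4 t)).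
Proof. exact: (der_omega (@dif_der 0 isT) (@mid_der 3 isT)). Qed.

Lemma der_fW : der fW (fun t => omega (m 1 t) (m 3 t)).
Proof.
by apply: (der_eq (der_omega (@mid_der 1 isT) (@mid_der 2 isT))) => t; rewrite omegavv add0r.
Qed.

Lemma dif0E t : fW t *: d 0 t = fp t *: m 1 t - fn t *: m 2 t.
Proof. exact: cramer. Qed.

Lemma dif1E t : fW t *: d 1 t = ff t *: m 1 t + fe t *: m 2 t.
Proof. by rewrite /fW cramer [omega (d 1 t) (m 1 t)]omegaC scaleNr opprK. Qed.

Lemma from_frame (u v w : plane R) t (x y X Y : R) :
  fW t *: w = x *: u + y *: v -> `|u| <= 2 -> `|v| <= 2 -> `|x| <= X -> `|y| <= Y ->
  `|w| <= 4 * (X + Y).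
Proof.
move=> E u2 v2 xX yY; have W := fW_ge t.
have := ler_normD (x *: u) (y *: v); rewrite -E !normrZ (@ger0_norm _ (fW t)); last lra.
have : `|x| * `|u| <= X * 2 by apply: ler_pM.
have : `|y| * `|v| <= Y * 2 by apply: ler_pM.
have : 1 / 2 * `|w| <= fW t * `|w| by rewrite ler_wpM2r.
lra.
Qed.

Lemma dif0_le t P N : `|fp t| <= P -> `|fn t| <= N -> `|d 0 t| <= 4 * (P + N).
Proof.
move=> hp hn.
apply: (@from_frame (m 1 t) (m 2 t) _ t (fp t) (- fn t)); rewrite ?normrN //; try exact: mid_le.
by rewrite dif0E scaleNr.
Qed.

Lemma dif1_le t F E : `|ff t| <= F -> `|fe t| <= E -> `|d 1 t| <= 4 * (F + E).
Proof.
move=> hp hn.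
apply: (@from_frame (m 1 t) (m 2 t) _ t (ff t) (fe t)) => //; try exact: mid_le.
by rewrite dif1E.
Qed.

Lemma mid31_le t : `|m 3 t + m 1 t| <= 2 * eps.
Proof.
have -> : m 3 t + m 1 t = (m 3 t - ek 3 t) + (m 1 t - ek 1 t).
  by rewrite ekSS opprK addrACA subrr addr0.
by have := normD_le (@mid_near 3 t isT) (@mid_near 1 t isT); lra.
Qed.

(** Isolates a factor m''' + m', which is O(eps) because it vanishes on the circle. *)
Lemma fsE t : fs t = omega (d 0 t) (m 3 t + m 1 t) - fn t.
Proof. by rewrite omegaDr /fs /fn addrK. Qed.

Lemma fn_per t : fn (t + 2 * pi) = fn t.
Proof. by rewrite /fn dif_per// mid_per. Qed.
Lemma fp_per t : fp (t + 2 * pi) = fp t.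
Proof. by rewrite /fp dif_per// mid_per. Qed.
Lemma fn1_per t : fn1 (t + 2 * pi) = fn1 t.
Proof. by rewrite /fn1 /fp /fe !dif_per// !mid_per. Qed.

Section Hoelder.
Variable B : R.
Hypothesis d00 : d 0 0 = 0.
Hypothesis fn10 : fn1 0 = 0.
Hypothesis hB : forall x y, `|fn2 x - fn2 y| <= B * Num.sqrt `|x - y|.

Lemma twopi_lt8 : 2 * pi < 8 :> R.
Proof. by have := @pi_lt4 R; lra. Qed.

Lemma twopi_gt0 : 0 < 2 * pi :> R.
Proof. by have := @pi_gt0 R; lra. Qed.

Lemma sqrt_le3 (x : R) : x <= 9 -> Num.sqrt x <= 3.
Proof.
move=> x9; have -> : 3 = Num.sqrt (3 ^+ 2) :> R by rewrite sqrtr_sqr ger0_norm.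
by apply: ler_wsqrtr; rewrite expr2; lra.
Qed.

Lemma hB_ge0 : 0 <= B.
Proof. by have := hB 0 1; rewrite sub0r normrN normr1 sqrtr1 mulr1; apply: le_trans. Qed.

(** By Rolle and periodicity [fn2] has a zero within distance 2 pi < 9 of every point, so its
    Hoelder modulus also bounds its size. *)
Lemma fn2_le t : `|fn2 t| <= 3 * B.
Proof.
have p0 := twopi_gt0; have p8 := twopi_lt8.
have [||c /andP[k1 k2] e] := @rolle R fn1 fn2 t (t + 2 * pi) der_fn1.
- by rewrite ltrDl.
- by rewrite fn1_per.
have := hB t c; rewrite e subr0 => /le_trans; apply.
rewrite mulrC ler_wpM2r ?hB_ge0//; apply: sqrt_le3.
by rewrite ler_norml; apply/andP; lra.
Qed.

Lemma fn1_le t : `|fn1 t| <= 24 * B.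
Proof.
have p0 := twopi_gt0; have p8 := twopi_lt8.
have [y [k [/andP[y0 y1] ->]]] := period_reduce t p0.
rewrite (periodic_int fn1_per).
have := mvt_le (a := 0) (b := y) der_fn1 (fun t _ => fn2_le t).
rewrite fn10 !subr0 => /le_trans; apply; rewrite ger0_norm//.
by have := hB_ge0; nra.
Qed.

Lemma fn_le t : `|fn t| <= 192 * B.
Proof.
have p0 := twopi_gt0; have p8 := twopi_lt8.
have [y [k [/andP[y0 y1] ->]]] := period_reduce t p0.
rewrite (periodic_int fn_per).
have := mvt_le (a := 0) (b := y) der_fn (fun t _ => fn1_le t).
have -> : fn 0 = 0 by rewrite /fn d00 /omega /=; ring.
rewrite !subr0 => /le_trans; apply; rewrite ger0_norm//.
by have := hB_ge0; nra.
Qed.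

(** Unlike [fn1] and [fn2], the coordinate [fp] is not a derivative of [fn]. Its own derivative
    contains the whole difference of the curves through [fs], but with a factor O(eps), so that this
    part is absorbed. *)
Lemma fp_le t : `|fp t| <= (3 * 10 * 10 * 10) * B.
Proof.
have p0 := twopi_gt0; have p8 := twopi_lt8; have e0 := eps_ge0; have B0 := hB_ge0.
have -> : (3 * 10 * 10 * 10) * B = 2 * ((15 * 10 * 10) * B) by ring.
move: t; apply: (@absorb _ _ (2 * (2 * eps) * 2)) => [t|P hP t].
  by apply: omega_le; [exact: dif_le|exact: mid_le].
have [y [k [/andP[y0 y1] ->]]] := period_reduce t p0.
rewrite (periodic_int fp_per).
have P0 : 0 <= P by apply: le_trans (hP 0).
have H u : `|ff u + fs u| <= 150 * B + P / 16.
  have -> : ff u + fs u = (fn2 u + 2 * fs u) / 3 by rewrite /fn2; field.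
  have h0 := eps_small; rewrite fsE.
  have := omega_le (dif0_le (hP u) (fn_le u)) (mid31_le u).
  have := fn_le u; have := fn2_le u; rewrite !ler_norml.
  have : 2 * (4 * (P + 192 * B)) * (2 * eps) <= (P + 192 * B) * 16 / 1000 by nra.
  lra.
have := mvt_le (a := 0) (b := y) der_fp (fun t _ => H t).
have -> : fp 0 = 0 by rewrite /fp d00 /omega /=; ring.
rewrite !subr0 => /le_trans; apply; rewrite ger0_norm//.
nra.
Qed.

Lemma dif0_leB t : `|d 0 t| <= (13 * 10 * 10 * 10) * B.
Proof. by apply: (le_trans (dif0_le (fp_le t) (fn_le t))); have := hB_ge0; lra. Qed.

Lemma fs_le t : `|fs t| <= (52 * 10 * 10 * 10) * B.
Proof.
apply: (le_trans (omega_le (dif0_leB t) (@mid_le 3 t isT))).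
by have := hB_ge0; lra.
Qed.

Lemma ff_le t : `|ff t| <= (18 * 10 * 10 * 10) * B.
Proof.
have -> : ff t = (fn2 t - fs t) / 3 by rewrite /fn2; field.
by have := hB_ge0; have := fn2_le t; have := fs_le t; rewrite !ler_norml; lra.
Qed.

Lemma fe_le t : `|fe t| <= (31 * 10 * 10) * B.
Proof.
have -> : fe t = fp t - fn1 t by rewrite /fn1; ring.
by have := hB_ge0; have := fn1_le t; have := fp_le t; rewrite !ler_norml; lra.
Qed.

Lemma dif1_leB t : `|d 1 t| <= (85 * 10 * 10 * 10) * B.
Proof. by apply: (le_trans (dif1_le (ff_le t) (fe_le t))); have := hB_ge0; lra. Qed.

Lemma id_le_sqrt (z : R) : 0 <= z <= 4 -> z <= 2 * Num.sqrt z.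
Proof.
move=> /andP[z0 z4]; rewrite -{1}(sqr_sqrtr z0) expr2 ler_wpM2r ?sqrtr_ge0//.
have -> : 2 = Num.sqrt (2 ^+ 2) :> R by rewrite sqrtr_sqr ger0_norm.
by apply: ler_wsqrtr; rewrite expr2; lra.
Qed.

Lemma lin_to_sqrt (K z : R) : 0 <= K * B -> 0 <= z <= 4 ->
  K * B * z <= 2 * (K * (B * Num.sqrt z)).
Proof.
move=> KB z4; rewrite [X in _ <= 2 * X]mulrA mulrCA; apply: ler_wpM2l => //.
exact: id_le_sqrt.
Qed.

(** Up to the factor 3, [ff] is [fn2] minus the Lipschitz function [fs]; on distances at most 4 a
    Lipschitz modulus is dominated by a 1/2-Hoelder one. *)
Lemma ff_osc x y : `|x - y| <= 4 -> `|ff x - ff y| <= (3 * 10 * 10 * 10 * 10 * 10) * B * Num.sqrt `|x - y|.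
Proof.
move=> xy; have B0 := hB_ge0.
have -> : ff x - ff y = (fn2 x - fn2 y - (fs x - fs y)) / 3 by rewrite /fn2; field.
have H u : `|omega (d 1 u) (m 3 u) + omega (d 0 u) (m 4 u)| <= (392 * 10 * 10 * 10) * B.
  apply: (le_trans (ler_normD _ _)).
  have := omega_le (dif1_leB u) (@mid_le 3 u isT).
  have := omega_le (dif0_leB u) (@mid_le 4 u isT); lra.
have h1 := mvt_le_glob y x der_fs H.
have h2 := hB x y.
have h3 : 0 <= `|x - y| <= 4 by rewrite normr_ge0.
have h4 := lin_to_sqrt (le_trans (normr_ge0 _) (H 0)) h3.
rewrite -mulrA; have h6 : 0 <= B * Num.sqrt `|x - y| by apply: mulr_ge0; rewrite ?sqrtr_ge0.
move: (B * Num.sqrt _) h2 (le_trans h1 h4) h6 => z.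
by rewrite !ler_norml => /andP[? ?] /andP[? ?] ?; apply/andP; lra.
Qed.

End Hoelder.
End Pair.

(** * Taylor estimates *)

Section Taylor.
Context {R : realType}.

Lemma pow_primitive_bound (f f' : R -> R) (M : R) k : der f f' -> f 0 = 0 ->
  (forall t, `|f' t| <= M * `|t| ^+ k) -> forall t, `|f t| <= M * `|t| ^+ k.+1.
Proof.
move=> df f0 H t; have M0 : 0 <= M.
  by have := H 1; rewrite normr1 expr1n mulr1; apply: le_trans.
have := @mvt_le _ _ _ (M * `|t| ^+ k) 0 t df.
rewrite f0 !subr0 exprSr mulrA; apply => s st.
apply: (le_trans (H s)); apply: ler_wpM2l => //; apply: lerXn2r; rewrite ?nnegrE//.
have [/andP[s0 s1]|/andP[s0 s1]] := orP st.
  by rewrite !ger0_norm// (le_trans s0).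
by rewrite !ler0_norm ?lerN2// (le_trans s0).
Qed.

Lemma taylor2 (f f1 f2 : R -> R) (M a b : R) : der f f1 -> der f1 f2 ->
  (forall t, `|f2 t| <= M) -> `|f b - f a - f1 a * (b - a)| <= M * `|b - a| ^+ 2.
Proof.
move=> df df1 H.
have d (c : R) : der (fun t => c + t) (fun=> 1).
  by apply: (der_eq (der_add (der_cst c) der_id)) => t; rewrite add0r.
have D1 : der (fun t => f1 (a + t) - f1 a) (fun t => f2 (a + t)).
  by apply: (der_eq (der_sub (der_comp df1 (d a)) (der_cst (f1 a)))) => t; rewrite subr0 mulr1.
have D0 : der (fun t => f (a + t) - f a - f1 a * t) (fun t => f1 (a + t) - f1 a).
  apply: (der_eq (der_sub (der_sub (der_comp df (d a)) (der_cst (f a)))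
    (der_scale (f1 a) der_id))) => t; ring.
have H1 : forall t, `|f1 (a + t) - f1 a| <= M * `|t| ^+ 1.
  apply: (pow_primitive_bound (k := 0) D1); first by rewrite addr0 subrr.
  by move=> t; rewrite expr0 mulr1.
have := pow_primitive_bound (k := 1) D0 _ H1 (b - a).
by rewrite mulr0 addr0 subrr subr0 [a + _]addrC subrK; apply.
Qed.

End Taylor.

(** * Change of the gradient of the action along a chord *)

Section Kernel.
Context {R : realType}.
Variables (eps : R) (G0 G1 : nat -> R -> plane R).
Hypotheses (c0 : curve eps G0) (c1 : curve eps G1).
Hypothesis eps_small : eps <= 1 / 1000.

Local Notation m := (mid G0 G1).
Local Notation d := (dif G0 G1).
Local Notation fW := (fW G0 G1).
Local Notation ff := (ff G0 G1).
Local Notation fe := (fe G0 G1).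

(* [chord s t] is the contribution of the chord from s to s + t to the derivative, in
   the direction of the vertex s, of the change of the action from G0 to G1; for k > 0,
   [kern k s] is its k-th derivative in t. *)
Definition kern (k : nat) (s t : R) : R :=
  omega (d 1 s) (m k (s + t)) + omega (m 1 s) (d k (s + t)).

Definition chord (s t : R) : R :=
  omega (d 1 s) (m 0 (s + t) - m 0 s) + omega (m 1 s) (d 0 (s + t) - d 0 s).

Lemma kern_der k s : (k < 6)%N -> der (kern k s) (kern k.+1 s).
Proof.
move=> k6; have hm := vder_shift s (mid_der c0 c1 k6).
have hd := vder_shift s (dif_der c0 c1 k6).
apply: (der_eq (der_add (der_omega (vder_cst (d 1 s)) hm) (der_omega (vder_cst (m 1 s)) hd))).
by move=> t; rewrite /kern /omega /=; ring.
Qed.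

Lemma chord_der s : der (chord s) (kern 1 s).
Proof.
have hm := vder_sub (vder_shift s (@mid_der _ _ _ _ c0 c1 0 isT)) (vder_cst (m 0 s)).
have hd := vder_sub (vder_shift s (@dif_der _ _ _ _ c0 c1 0 isT)) (vder_cst (d 0 s)).
apply: (der_eq (der_add (der_omega (vder_cst (d 1 s)) hm) (der_omega (vder_cst (m 1 s)) hd))).
by move=> t; rewrite /kern /omega /=; ring.
Qed.

Lemma chord0 s : chord s 0 = 0.
Proof. by rewrite /chord addr0 !subrr /omega /=; ring. Qed.

Lemma kern1_0 s : kern 1 s 0 = 0.
Proof. by rewrite /kern addr0 [omega (m _ _) _]omegaC subrr. Qed.

Lemma kern2_0 s : kern 2 s 0 = 0.
Proof. by rewrite /kern addr0; exact: dif_constraint c0 c1 s. Qed.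

(** Derivative of the constraint, in which the terms in d'' and m'' cancel. Together with [kern1_0]
    (antisymmetry) and [kern2_0] (the constraint) it makes the chord vanish to fourth order. *)
Lemma kern3_0 s : kern 3 s 0 = 0.
Proof.
rewrite /kern addr0.
have D : der (fun t => omega (d 1 t) (m 2 t) + omega (m 1 t) (d 2 t))
  (fun t => omega (d 1 t) (m 3 t) + omega (m 1 t) (d 3 t)).
  have d1 := @dif_der _ _ _ _ c0 c1 1 isT; have d2 := @dif_der _ _ _ _ c0 c1 2 isT.
  have m1 := @mid_der _ _ _ _ c0 c1 1 isT; have m2 := @mid_der _ _ _ _ c0 c1 2 isT.
  apply: (der_eq (der_add (der_omega d1 m2) (der_omega m1 d2))) => t.
  by rewrite /omega; ring.
have E : der (fun t => omega (d 1 t) (m 2 t) + omega (m 1 t) (d 2 t)) (fun=> 0).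
  by apply: (der_ext (f := fun=> 0)) (der_cst 0) => t; rewrite (dif_constraint c0 c1).
exact: der_uniq D E s.
Qed.

Lemma kern_le k s t : (k <= 6)%N -> `|kern k s t| <= 16 * eps.
Proof.
move=> k6; apply: (le_trans (ler_normD _ _)).
have h1 := omega_le (@dif_le _ _ _ _ c0 c1 1 s isT) (mid_le c0 c1 eps_small (s + t) k6).
have h2 := omega_le (@mid_le _ _ _ _ c0 c1 eps_small 1 s isT) (dif_le c0 c1 (s + t) k6).
have := lerD h1 h2; lra.
Qed.

Lemma chord_smooth s t :
  `|chord s t - kern 4 s 0 / 24 * t ^+ 4| <= 16 * eps * `|t| ^+ 5.
Proof.
set c := kern 4 s 0.
have dX n (a : R) : der (fun u : R => a * u ^+ n.+1) (fun u => a * n.+1%:R * u ^+ n).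
  elim: n a => [|n IH] a.
    apply: (der_eq (f' := fun u => a * 1)) => [|u]; last by rewrite expr0 !mulr1.
    by apply: (der_ext (f := fun u => a * u)) (der_scale a der_id) => u; rewrite expr1.
  apply: (der_ext (f := fun u => a * u ^+ n.+1 * u)).
    by move=> u; rewrite -mulrA -exprSr.
  apply: (der_eq (der_mul (IH a) der_id)) => u.
  by rewrite -[n.+2%:R]natr1 exprS; ring.
have D4 : der (fun t => kern 4 s t - c) (kern 5 s).
  by apply: (der_eq (der_sub (@kern_der 4 s isT) (der_cst c))) => u; rewrite subr0.
have D3 : der (fun t => kern 3 s t - c * t ^+ 1) (fun t => kern 4 s t - c).
  by apply: (der_eq (der_sub (@kern_der 3 s isT) (dX 0%N c))) => u; rewrite expr0 !mulr1.
have D2 : der (fun t => kern 2 s t - c / 2 * t ^+ 2) (fun t => kern 3 s t - c * t ^+ 1).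
  by apply: (der_eq (der_sub (@kern_der 2 s isT) (dX 1%N _))) => u; field.
have D1 : der (fun t => kern 1 s t - c / 6 * t ^+ 3) (fun t => kern 2 s t - c / 2 * t ^+ 2).
  by apply: (der_eq (der_sub (@kern_der 1 s isT) (dX 2%N _))) => u; field.
have D0 : der (fun t => chord s t - c / 24 * t ^+ 4) (fun t => kern 1 s t - c / 6 * t ^+ 3).
  by apply: (der_eq (der_sub (chord_der s) (dX 3%N _))) => u; field.
have H4 : forall u, `|kern 4 s u - c| <= 16 * eps * `|u| ^+ 1.
  apply: (pow_primitive_bound (k := 0) D4 (subrr _)) => u; rewrite expr0 mulr1; exact: kern_le.
have H3 := pow_primitive_bound D3 _ H4.
have {}H3 : forall u, `|kern 3 s u - c * u ^+ 1| <= 16 * eps * `|u| ^+ 2.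
  by apply: H3; rewrite kern3_0 expr1 mulr0 subrr.
have H2 := pow_primitive_bound D2 _ H3.
have {}H2 : forall u, `|kern 2 s u - c / 2 * u ^+ 2| <= 16 * eps * `|u| ^+ 3.
  by apply: H2; rewrite kern2_0 expr0n mulr0 subrr.
have H1 := pow_primitive_bound D1 _ H2.
have {}H1 : forall u, `|kern 1 s u - c / 6 * u ^+ 3| <= 16 * eps * `|u| ^+ 4.
  by apply: H1; rewrite kern1_0 expr0n mulr0 subrr.
apply: (pow_primitive_bound D0 _ H1).
by rewrite chord0 expr0n mulr0 subrr.
Qed.

(** The leading term of the chord, of degree four, is even: between the two neighbours of a vertex
    it cancels up to the difference of the two steps. The constant is only proportional to eps,
    which is enough to locate the maximizers. *)
Lemma chord_diff_smooth (s h a b : R) : 0 <= a <= 5 * h / 4 -> 0 <= b <= 5 * h / 4 ->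
  `|chord s b - chord s (- a)| <= 200 * eps * (h ^+ 3 * `|b - a| + h ^+ 5).
Proof.
move=> /andP[a0 a1] /andP[b0 b1]; have e0 := eps_ge0 c0.
have Hb := chord_smooth s b; have Ha := chord_smooth s (- a).
have K4 := kern_le s 0 (isT : (4 <= 6)%N).
rewrite normrN (ger0_norm a0) in Ha; rewrite (ger0_norm b0) in Hb.
have E : (- a) ^+ 4 = a ^+ 4 by rewrite !exprS expr0; ring.
rewrite E in Ha.
have h0 : 0 <= h by lra.
have P5 x : 0 <= x -> x <= 5 * h / 4 -> x ^+ 5 <= (5 / 4) ^+ 5 * h ^+ 5.
  by move=> x0 x1; rewrite -exprMn; apply: lerXn2r; rewrite ?nnegrE; lra.
have P4 : `|b ^+ 4 - a ^+ 4| <= 8 * (h ^+ 3 * `|b - a|).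
  have -> : b ^+ 4 - a ^+ 4 = (b ^+ 3 + b ^+ 2 * a + b * a ^+ 2 + a ^+ 3) * (b - a).
    by rewrite !exprS !expr0; ring.
  rewrite normrM mulrA ler_wpM2r//.
  have M i j : (i + j = 3)%N -> b ^+ i * a ^+ j <= 125 / 64 * h ^+ 3.
    move=> ij; have -> : 125 / 64 * h ^+ 3 = (5 * h / 4) ^+ i * (5 * h / 4) ^+ j.
      by rewrite -exprD ij !exprS !expr0; field.
    by apply: ler_pM; rewrite ?exprn_ge0//; apply: lerXn2r; rewrite ?nnegrE; lra.
  have := M 3%N 0%N erefl; have := M 2%N 1%N erefl; have := M 1%N 2%N erefl.
  have := M 0%N 3%N erefl; rewrite !expr0 !expr1 mul1r mulr1 => ? ? ? ?.
  have h3 : 0 <= h ^+ 3 by apply: exprn_ge0.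
  have ba : 0 <= b ^+ 3 + b ^+ 2 * a + b * a ^+ 2 + a ^+ 3.
    by rewrite !addr_ge0 ?mulr_ge0 ?exprn_ge0.
  rewrite ger0_norm//; lra.
have -> : chord s b - chord s (- a) = (chord s b - kern 4 s 0 / 24 * b ^+ 4)
   - (chord s (- a) - kern 4 s 0 / 24 * a ^+ 4) + kern 4 s 0 / 24 * (b ^+ 4 - a ^+ 4) by ring.
apply: (le_trans (ler_normD _ _)).
have h5 : 0 <= h ^+ 5 by apply: exprn_ge0.
have hh : 0 <= h ^+ 3 * `|b - a| by rewrite mulr_ge0 ?exprn_ge0.
have A5 : 16 * eps * a ^+ 5 <= 16 * eps * (4 * h ^+ 5).
  by apply: ler_wpM2l; [lra|apply: (le_trans (P5 _ a0 a1)); apply: ler_wpM2r => //; lra].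
have B5 : 16 * eps * b ^+ 5 <= 16 * eps * (4 * h ^+ 5).
  by apply: ler_wpM2l; [lra|apply: (le_trans (P5 _ b0 b1)); apply: ler_wpM2r => //; lra].
have C4 : `|kern 4 s 0 / 24 * (b ^+ 4 - a ^+ 4)| <= 16 * eps / 24 * (8 * (h ^+ 3 * `|b - a|)).
  rewrite normrM; apply: ler_pM => //.
  by rewrite normrM [`|24^-1|]ger0_norm// ler_wpM2r.
apply: (le_trans (lerD (le_trans (ler_normB _ _) (lerD (le_trans Hb B5) (le_trans Ha A5))) C4)).
have eh : 0 <= eps * h ^+ 5 by apply: mulr_ge0.
have ehh : 0 <= eps * (h ^+ 3 * `|b - a|) by apply: mulr_ge0.
rewrite mulrDr; lra.
Qed.

Section Hoelder.
Variable A : R.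
Hypothesis hff : forall t, `|ff t| <= A.
Hypothesis hfe : forall t, `|fe t| <= A.
Hypothesis off : forall x y, `|x - y| <= 4 -> `|ff x - ff y| <= A * Num.sqrt `|x - y|.

Lemma inv_fW t : exists2 i : R, `|i| <= 2 & i * fW t = 1.
Proof.
have W := fW_ge c0 c1 eps_small t; exists (fW t)^-1; last by rewrite mulVf//; lra.
rewrite ger0_norm ?invr_ge0; last lra.
have -> : 2 = (1 / 2)^-1 :> R by field.
by rewrite lef_pV2 ?posrE; lra.
Qed.

Lemma mid_omega_le j k s t : (j <= 6)%N -> (k <= 6)%N -> `|omega (m j s) (m k t)| <= 8.
Proof.
move=> j6 k6; have := omega_le (mid_le c0 c1 eps_small s j6) (mid_le c0 c1 eps_small t k6).
lra.
Qed.

Lemma der_mid_omega_r j k s : (k < 6)%N ->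
  der (fun t => omega (m j s) (m k t)) (fun t => omega (m j s) (m k.+1 t)).
Proof.
move=> k6; apply: (der_eq (der_omega (vder_cst _) (mid_der c0 c1 k6))) => t.
by rewrite /omega /=; ring.
Qed.

Lemma der_mid_omega_l j k s : (j < 6)%N ->
  der (fun t => omega (m j t) (m k s)) (fun t => omega (m j.+1 t) (m k s)).
Proof.
move=> k6; apply: (der_eq (der_omega (mid_der c0 c1 k6) (vder_cst _))) => t.
by rewrite /omega /=; ring.
Qed.

(** Here the constant is proportional to the size [A] of the difference, at the price of half a
    power of t compared with smoothness. In the frames at w and v = w + t the first-order part is t
    (f(w) + f(v)) + e(v) - e(w). Since e' = - 2 f, it equals t times oscillations of f about an
    intermediate point; the other terms are quadratic in t. *)
Lemma kern1_hoelder w t : `|t| <= 4 -> `|kern 1 w t| <= 200 * A * (`|t| * Num.sqrt `|t|).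
Proof.
move=> t4; have A0 : 0 <= A by exact: (le_trans (normr_ge0 _) (hff 0)).
set v := w + t; rewrite /kern -/v.
have tE : v - w = t by rewrite /v addrC addKr.
have [iw iw2 iwE] := inv_fW w; have [iv iv2 ivE] := inv_fW v.
set X := omega (m 1 w) (m 1 v); set Y := omega (m 2 w) (m 1 v); set Z := omega (m 1 w) (m 2 v).
have d1E u i : i * fW u = 1 -> d 1 u = i *: (ff u *: m 1 u + fe u *: m 2 u).
  by move=> iE; rewrite -dif1E scalerA iE scale1r.
have -> : omega (d 1 w) (m 1 v) = iw * (ff w * X + fe w * Y).
  by rewrite (d1E _ _ iwE) omegaZl omegaDl (omegaZl (ff w)) (omegaZl (fe w)).
have -> : omega (m 1 w) (d 1 v) = iv * (ff v * X + fe v * Z).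
  by rewrite (d1E _ _ ivE) omegaZr omegaDr (omegaZr (ff v)) (omegaZr (fe v)).
have n2 : `|v - w| ^+ 2 = `|t| ^+ 2 by rewrite tE.
have hX : `|X - t * fW w| <= 8 * `|t| ^+ 2.
  have := taylor2 w v (@der_mid_omega_r 1 1 w isT) (@der_mid_omega_r 1 2 w isT)
    (fun u => @mid_omega_le 1 3 w u isT isT).
  by rewrite omegavv subr0 n2 tE mulrC.
have hY : `|Y + fW w| <= 8 * `|t| ^+ 2.
  have := taylor2 w v (@der_mid_omega_r 2 1 w isT) (@der_mid_omega_r 2 2 w isT)
    (fun u => @mid_omega_le 2 3 w u isT isT).
  by rewrite omegavv mul0r subr0 [omega (m 2 w) (m 1 w)]omegaC opprK n2.
have hZ : `|Z - fW v| <= 8 * `|t| ^+ 2.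
  have := taylor2 v w (@der_mid_omega_l 1 2 v isT) (@der_mid_omega_l 2 2 v isT)
    (fun u => @mid_omega_le 3 2 u v isT isT).
  by rewrite omegavv mul0r subr0 distrC -[`|w - v|]distrC tE [X in X <= _]distrC.
have hW : `|fW v - fW w| <= 8 * `|t|.
  have := mvt_le_glob w v (der_fW c0 c1) (fun u => @mid_omega_le 1 3 u u isT isT).
  by rewrite tE.
have hXv : `|X - t * fW v| <= 16 * `|t| ^+ 2.
  have -> : X - t * fW v = (X - t * fW w) - t * (fW v - fW w) by ring.
  apply: (le_trans (ler_normB _ _)); rewrite normrM.
  have : `|t| * `|fW v - fW w| <= `|t| * (8 * `|t|) by rewrite ler_wpM2l.
  rewrite expr2 in hX *; lra.
have [xi hxi fexi] : exists2 xi, `|xi - w| <= `|t| /\ `|xi - v| <= `|t| &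
    fe v - fe w = - (2 * ff xi) * t.
  have [t0|/ltW t0] := leP 0 t.
    have [|xi /andP[x1 x2] e] := @mvt _ _ _ w v (der_fe c0 c1); first by rewrite /v; lra.
    exists xi; last by rewrite e tE.
    by rewrite (ger0_norm t0) !ler_norml; split; apply/andP; move: x1 x2; rewrite /v; lra.
  have [|xi /andP[x1 x2] e] := @mvt _ _ _ v w (der_fe c0 c1); first by rewrite /v; lra.
  exists xi; last by rewrite -opprB e -tE -opprB mulrN opprK.
  by rewrite (ler0_norm t0) !ler_norml; split; apply/andP; move: x1 x2; rewrite /v; lra.
have -> : iw * (ff w * X + fe w * Y) + iv * (ff v * X + fe v * Z) =
  iw * (ff w * (X - t * fW w)) + iw * (fe w * (Y + fW w)) + iv * (ff v * (X - t * fW v))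
  + iv * (fe v * (Z - fW v)) + t * ((ff w - ff xi) + (ff v - ff xi)).
  transitivity (iw * (ff w * (X - t * fW w)) + iw * (fe w * (Y + fW w)) + iv * (ff v * (X - t * fW v))
    + iv * (fe v * (Z - fW v)) + ((iw * fW w) * (t * ff w - fe w) + (iv * fW v) * (t * ff v + fe v))).
    by ring.
  by rewrite iwE ivE !mul1r; congr (_ + _); have := fexi; lra.
have q2 : `|t| ^+ 2 <= 2 * (`|t| * Num.sqrt `|t|).
  have := id_le_sqrt (z := `|t|); rewrite normr_ge0 t4 => /(_ isT) h.
  by rewrite expr2 mulrCA ler_wpM2l.
have bnd i x y M : `|i| <= 2 -> `|x| <= A -> `|y| <= M -> `|i * (x * y)| <= 2 * (A * M).
  by move=> ? ? ?; rewrite !normrM; apply: ler_pM => //; apply: ler_pM.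
have b1 := bnd iw _ _ _ iw2 (hff w) hX; have b2 := bnd iw _ _ _ iw2 (hfe w) hY.
have b3 := bnd iv _ _ _ iv2 (hff v) hXv; have b4 := bnd iv _ _ _ iv2 (hfe v) hZ.
have osc y : `|xi - y| <= `|t| -> `|ff y - ff xi| <= A * Num.sqrt `|t|.
  move=> hy; rewrite distrC; apply: (le_trans (off (le_trans hy t4))).
  by apply: ler_wpM2l => //; apply: ler_wsqrtr.
have b5 : `|t * ((ff w - ff xi) + (ff v - ff xi))| <= `|t| * (2 * (A * Num.sqrt `|t|)).
  rewrite normrM ler_wpM2l//; apply: (le_trans (ler_normD _ _)).
  by have := osc _ hxi.1; have := osc _ hxi.2; lra.
have A2 : A * `|t| ^+ 2 <= 2 * (A * (`|t| * Num.sqrt `|t|)) by rewrite [X in _ <= X]mulrCA ler_wpM2l.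
have -> : 200 * A * (`|t| * Num.sqrt `|t|) = 200 * (A * (`|t| * Num.sqrt `|t|)) by ring.
have b6 : 0 <= A * (`|t| * Num.sqrt `|t|) by rewrite !mulr_ge0// sqrtr_ge0.
apply: (le_trans (ler_normD _ _)); apply: (le_trans (lerD (ler_normD _ _) b5)).
apply: (le_trans (lerD (lerD (ler_normD _ _) b4) (lexx _))).
apply: (le_trans (lerD (lerD (lerD (le_trans (ler_normD _ _) (lerD b1 b2)) b3) (lexx _)) (lexx _))).
rewrite [`|t| * (2 * _)]mulrCA [`|t| * (A * _)]mulrCA.
rewrite ![A * (_ * `|t| ^+ 2)]mulrCA; move: (A * (`|t| * _)) (A * _) A2 b6 => z y ? ?; lra.
Qed.

Lemma chord_hoelder w t : `|t| <= 4 ->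
  `|chord w t| <= 200 * A * (`|t| * Num.sqrt `|t|) * `|t|.
Proof.
move=> t4; have A0 : 0 <= A by exact: (le_trans (normr_ge0 _) (hff 0)).
have := @mvt_le _ _ _ (200 * A * (`|t| * Num.sqrt `|t|)) 0 t (chord_der w).
rewrite chord0 !subr0; apply => s st.
have ss : `|s| <= `|t|.
  have [/andP[s0 s1]|/andP[s0 s1]] := orP st.
    by rewrite !ger0_norm// (le_trans s0).
  by rewrite !ler0_norm ?lerN2// (le_trans s0).
apply: (le_trans (kern1_hoelder w (le_trans ss t4))).
apply: ler_wpM2l; first exact: mulr_ge0 (ler0n _ _) A0.
by apply: ler_pM; rewrite ?sqrtr_ge0//; apply: ler_wsqrtr.
Qed.

End Hoelder.
End Kernel.

(** * Actions of polygons *)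

Section SumTools.
Context {R : realType}.

Lemma ler_sum_abs (F G : nat -> R) n : (forall i, (i < n)%N -> `|F i| <= G i) ->
  `|\sum_(0 <= i < n) F i| <= \sum_(0 <= i < n) G i.
Proof.
move=> H; apply: (le_trans (ler_norm_sum _ _ _)).
by rewrite big_nat_cond [leRHS]big_nat_cond; apply: ler_sum => i; rewrite andbT => /andP[_ /H].
Qed.

Lemma sum_const_le (F : nat -> R) (M : R) n : (forall i, (i < n)%N -> F i <= M) ->
  \sum_(0 <= i < n) F i <= n%:R * M.
Proof.
move=> H; rewrite big_nat_cond; apply: (@le_trans _ _ (\sum_(0 <= i < n | (0 <= i < n)%N && true) M)).
  by apply: ler_sum => i; rewrite andbT => /andP[_ /H].
by rewrite -big_nat_cond sumr_const_nat subn0 mulr_natl.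
Qed.

Lemma sum_telescope (u : nat -> R) n :
  \sum_(0 <= j < n) (u j.+1 - u j) = u n - u 0%N.
Proof. exact: telescope_sumr. Qed.

Lemma cauchy_sum (f : nat -> R) n :
  (\sum_(0 <= i < n) f i) ^+ 2 <= n%:R * \sum_(0 <= i < n) f i ^+ 2.
Proof.
case: n => [|n]; first by rewrite !big_geq// expr0n mul0r.
set S := \sum_(0 <= i < _) f i; set N : R := n.+1%:R; set a := S / N.
have N0 : 0 < N by rewrite /N ltr0n.
have : 0 <= \sum_(0 <= i < n.+1) (f i - a) ^+ 2 by apply: sumr_ge0 => i _; exact: sqr_ge0.
have -> : \sum_(0 <= i < n.+1) (f i - a) ^+ 2 = \sum_(0 <= i < n.+1) f i ^+ 2 - 2 * a * S + N * a ^+ 2.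
  have -> : N * a ^+ 2 = \sum_(0 <= i < n.+1) a ^+ 2 by rewrite sumr_const_nat subn0 mulr_natl.
  rewrite /S mulr_sumr -sumrB -big_split /=; apply: eq_bigr => i _; ring.
have -> : a = S / N by [].
move=> H; have := mulr_ge0 (ltW N0) H.
have -> : N * (\sum_(0 <= i < n.+1) f i ^+ 2 - 2 * (S / N) * S + N * (S / N) ^+ 2) =
  N * \sum_(0 <= i < n.+1) f i ^+ 2 - S ^+ 2 by field; rewrite gt_eqF.
by rewrite subr_ge0.
Qed.

End SumTools.

Section Action.
Context {R : realType}.
Implicit Types (G : nat -> R -> plane R) (u : nat -> R).

(* Polygons are described by their displacement [u] from the one with equidistant
   parameters. *)
Definition pt (h : R) u (j : nat) : R := j%:R * h + u j.

Definition act G (h : R) (q : nat) u : R :=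
  \sum_(0 <= j < q) omega (G 0 (pt h u j)) (G 0 (pt h u j.+1)).

Definition grad G (h : R) u (i : nat) : R :=
  omega (G 1 (pt h u i.+1)) (G 0 (pt h u i.+2) - G 0 (pt h u i)).

Definition scl (x : R) u : nat -> R := fun j => x * u j.

Lemma pt_step h u j : pt h u j.+1 = pt h u j + (h + (u j.+1 - u j)).
Proof. by rewrite /pt -natr1; ring. Qed.

Lemma der_pt h u j (a : nat -> R) : der (fun x => pt h (fun i => a i + x * u i) j) (fun=> u j).
Proof.
apply: (der_ext (f := fun x => j%:R * h + a j + u j * x)) => [x|]; first by rewrite /pt; ring.
by apply: (der_eq (der_add (der_cst _) (der_scale (u j) der_id))) => x; rewrite add0r mulr1.
Qed.

(** Every interior vertex occurs in two consecutive terms of the action; a shift of the index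
    collects them into [grad], and the two ends do not move. *)
Lemma act_der_gen G h p u a : vder (G 0) (G 1) -> u 0%N = 0 -> u p.+1 = 0 ->
  der (fun x => act G h p.+1 (fun i => a i + x * u i))
      (fun x => \sum_(0 <= i < p) u i.+1 * grad G h (fun i => a i + x * u i) i).
Proof.
move=> dG u0 up.
set s := fun x => pt h (fun i => a i + x * u i).
have ds j : vder (fun x => G 0 (s x j)) (fun x => u j *: G 1 (s x j)).
  exact: vder_comp dG (der_pt h u j a).
apply: (der_eq (der_sum (F' := fun j x => u j * omega (G 1 (s x j)) (G 0 (s x j.+1))
    + u j.+1 * omega (G 0 (s x j)) (G 1 (s x j.+1))) _)) => [j _|x].
  apply: (der_eq (der_omega (ds j) (ds j.+1))) => x.
  by rewrite omegaZl omegaZr.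
rewrite big_split /= big_nat_recl// [X in _ + X]big_nat_recr//= u0 up !mul0r add0r addr0.
rewrite -big_split /=; apply: eq_bigr => i _.
by rewrite /grad -/(s x) omegaBr [omega (G 0%N (s x i)) _]omegaC; ring.
Qed.

Lemma act_der G h p u : vder (G 0) (G 1) -> u 0%N = 0 -> u p.+1 = 0 ->
  der (fun x => act G h p.+1 (scl x u))
      (fun x => \sum_(0 <= i < p) u i.+1 * grad G h (scl x u) i).
Proof.
move=> dG u0 up; have := act_der_gen h (fun=> 0) dG u0 up.
have E x : (fun i => 0 + x * u i) = scl x u by apply/funext => i; rewrite add0r.
move=> D t; have {D} := D t; rewrite E; congr is_derive.
by apply/funext => x; rewrite E.
Qed.

Lemma act_ek h q u : act ek h q u = \sum_(0 <= j < q) sin (h + (u j.+1 - u j)).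
Proof.
by apply: eq_bigr => j _; rewrite omega_ek pt_step addrAC subrr add0r.
Qed.

(** Treats both signs of [x] at once: the two conditions on [c] place it between 0 and [x]. *)
Lemma mvt_signed (f f' : R -> R) (x : R) : der f f' ->
  exists c, [/\ `|c| <= `|x|, 0 <= c * x & f x - f 0 = f' c * x].
Proof.
move=> df; have [x0|/ltW x0] := leP 0 x.
  have [c /andP[c0 cx] e] := mvt df x0; exists c; split; last by rewrite e subr0.
  - by rewrite !ger0_norm.
  - exact: mulr_ge0.
have [c /andP[c0 cx] e] := mvt df x0; exists c; split.
- by rewrite !ler0_norm ?lerN2.
- exact: mulr_le0.
- by rewrite -opprB e sub0r mulrN opprK.
Qed.

(** By [sin_ge_step] the second derivative of the sine is at most - h / 12 on the interval
    concerned. *)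
Lemma sin_concave (h x : R) : 0 < h <= 2 * pi / 3 -> `|x| <= h / 4 ->
  sin (h + x) <= sin h + x * cos h - h / 24 * x ^+ 2.
Proof.
move=> hh xh.
have d0 : der (fun t => h + t) (fun=> 1).
  by apply: (der_eq (der_add (der_cst h) der_id)) => t; rewrite add0r.
have D1 : der (fun t => cos (h + t) - cos h + h / 12 * t) (fun t => - sin (h + t) + h / 12).
  apply: (der_eq (der_add (der_sub (der_comp der_cos d0) (der_cst _)) (der_scale _ der_id))) => t.
  by ring.
have D0 : der (fun t => sin (h + t) - cos h * t + h / 24 * (t * t))
   (fun t => cos (h + t) - cos h + h / 12 * t).
  apply: (der_eq (der_add (der_sub (der_comp der_sin d0) (der_scale _ der_id))
     (der_scale _ (der_mul der_id der_id)))) => t.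
  by field.
have [c [cx c0 e]] := mvt_signed x D0; have [c' [c'x c'0 e']] := mvt_signed c D1.
have : sin (h + x) - cos h * x + h / 24 * (x * x) - (sin h) <= 0.
  have -> : sin h = sin (h + 0) - cos h * 0 + h / 24 * (0 * 0) by rewrite addr0; ring.
  rewrite e; have -> : cos (h + c) - cos h + h / 12 * c =
     (cos (h + c) - cos h + h / 12 * c) - (cos (h + 0) - cos h + h / 12 * 0).
    by rewrite addr0; ring.
  rewrite e' -mulrA mulr_le0_ge0//.
  have := @sin_ge_step R h (h + c') hh.
  have : `|c'| <= h / 4 by apply: (le_trans c'x); apply: (le_trans cx).
  rewrite ler_norml => /andP[k1 k2].
  have -> : 3 * h / 4 <= h + c' <= 5 * h / 4 by apply/andP; lra.
  by move=> /(_ isT); lra.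
by rewrite expr2; lra.
Qed.

(** The linear terms of [sin_concave] telescope to zero because both ends of [u] are fixed. *)
Lemma circle_concave h q u : 0 < h <= 2 * pi / 3 -> u 0%N = 0 -> u q = 0 ->
  (forall j, (j < q)%N -> `|u j.+1 - u j| <= h / 4) ->
  act ek h q u <= act ek h q (scl 0 u) - h / 24 * \sum_(0 <= j < q) (u j.+1 - u j) ^+ 2.
Proof.
move=> hh u0 uq H; rewrite !act_ek mulr_sumr -sumrB.
have -> : \sum_(0 <= j < q) (sin (h + (scl 0 u j.+1 - scl 0 u j)) - h / 24 * (u j.+1 - u j) ^+ 2) =
  \sum_(0 <= j < q) (sin h + (u j.+1 - u j) * cos h - h / 24 * (u j.+1 - u j) ^+ 2).
  transitivity (\sum_(0 <= j < q) (sin h - h / 24 * (u j.+1 - u j) ^+ 2)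
     + (\sum_(0 <= j < q) (u j.+1 - u j)) * cos h).
    rewrite sum_telescope u0 uq subrr mul0r addr0; apply: eq_bigr => j _.
    by rewrite /scl !mul0r subrr addr0.
  by rewrite mulr_suml -big_split /=; apply: eq_bigr => j _; ring.
rewrite big_nat_cond [leRHS]big_nat_cond; apply: ler_sum => j.
by rewrite andbT => /andP[_ /H]; exact: sin_concave.
Qed.

Lemma partial_le (u : nat -> R) q j : u 0%N = 0 -> (j <= q)%N ->
  `|u j| <= \sum_(0 <= i < q) `|u i.+1 - u i|.
Proof.
move=> u0 jq; have -> : u j = \sum_(0 <= i < j) (u i.+1 - u i) by rewrite sum_telescope u0 subr0.
apply: (le_trans (ler_norm_sum _ _ _)).
rewrite [leRHS](@big_cat_nat _ _ _ j)//= lerDl.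
by apply: sumr_ge0 => i _.
Qed.

End Action.

(** * Dependence of the change of the action on the displacement *)

Section Change.
Context {R : realType}.
Variables (eps : R) (G0 G1 : nat -> R -> plane R).
Hypotheses (c0 : curve eps G0) (c1 : curve eps G1).
Hypothesis eps_small : eps <= 1 / 1000.
Variables (p : nat) (u : nat -> R).
Hypothesis p2 : (2 <= p)%N.
Let h : R := 2 * pi / p.+1%:R.
Hypotheses (u0 : u 0%N = 0) (up : u p.+1 = 0).
Hypothesis uh : forall j, (j < p.+1)%N -> `|u j.+1 - u j| <= h / 4.
Let S := \sum_(0 <= i < p.+1) `|u i.+1 - u i|.

Lemma step_gt0 : 0 < h.
Proof. by rewrite /h divr_gt0// ?ltr0n// mulr_gt0// pi_gt0. Qed.

Lemma step_le : h <= 2 * pi / 3.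
Proof.
have p0 := @pi_gt0 R; rewrite /h; apply: ler_wpM2l; first lra.
by rewrite lef_pV2 ?posrE ?ltr0n// ler_nat.
Qed.

Lemma step_le3 : h <= 3.
Proof. by have := step_le; have := @pi_lt4 R; lra. Qed.

Lemma step_mul : p.+1%:R * h = 2 * pi.
Proof. by rewrite /h mulrC divfK// pnatr_eq0. Qed.

Lemma step_mul_le : p%:R * h <= 8.
Proof.
have := step_mul; rewrite -natr1 => e; have := step_gt0; have := @pi_lt4 R.
by move: e; lra.
Qed.

(** Exact, without remainder: the difference of two values of a bilinear form is its polarization at
    the midpoint. *)
Lemma grad_diff (v : nat -> R) i : grad G1 h v i - grad G0 h v i =
  chord G0 G1 (pt h v i.+1) (h + (v i.+2 - v i.+1))
  - chord G0 G1 (pt h v i.+1) (- (h + (v i.+1 - v i))).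
Proof.
rewrite /chord /grad -!pt_step.
have -> : pt h v i.+1 - (h + (v i.+1 - v i)) = pt h v i by rewrite pt_step addrK.
by rewrite /mid /dif /omega /= /GRing.scale /=; field.
Qed.

Lemma scl_step x j : 0 <= x <= 1 -> (j < p.+1)%N ->
  0 <= h + (scl x u j.+1 - scl x u j) <= 5 * h / 4.
Proof.
move=> /andP[x0 x1] jp; have := uh jp; have h0 := step_gt0.
rewrite /scl -mulrBr ler_norml => /andP[k1 k2]; apply/andP; nra.
Qed.

Lemma u_le j : (j <= p.+1)%N -> `|u j| <= S.
Proof. exact: partial_le. Qed.

(** The displacement is switched on linearly and the difference of the gradients is integrated; each
    [u j] is bounded by the total variation [S]. *)
Lemma change_mvt M :
  (forall x i, 0 <= x <= 1 -> (i < p)%N ->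
     `|grad G1 h (scl x u) i - grad G0 h (scl x u) i| <= M i) ->
  `|(act G1 h p.+1 u - act G0 h p.+1 u)
    - (act G1 h p.+1 (scl 0 u) - act G0 h p.+1 (scl 0 u))|
  <= S * \sum_(0 <= i < p) M i.
Proof.
move=> H; have D := der_sub (act_der h (curve_der c1 (isT : (0 < 6)%N)) u0 up)
  (act_der h (curve_der c0 (isT : (0 < 6)%N)) u0 up).
have E1 : scl 1 u = u by apply/funext => i; rewrite /scl mul1r.
have := @mvt_le _ _ _ (S * \sum_(0 <= i < p) M i) 0 1 D.
rewrite /= E1 subr0 normr1 mulr1; apply => x hx.
have {}hx : 0 <= x <= 1.
  by case/orP: hx => // /andP[x1 x0]; apply/andP; lra.
rewrite -sumrB mulr_sumr; apply: ler_sum_abs => i ip.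
rewrite -mulrBr normrM; apply: ler_pM => //.
  by apply: u_le; rewrite ltnS ltnW.
exact: H.
Qed.

(** The differences of consecutive steps sum to at most 2 S, and the h^5 parts of about 2 pi / h
    vertices to O(h^4). *)
Lemma change_smooth :
  `|(act G1 h p.+1 u - act G0 h p.+1 u)
    - (act G1 h p.+1 (scl 0 u) - act G0 h p.+1 (scl 0 u))|
  <= S * (200 * eps * (2 * h ^+ 3 * S + 8 * h ^+ 4)).
Proof.
pose M i := 200 * eps * (h ^+ 3 * (`|u i.+2 - u i.+1| + `|u i.+1 - u i|) + h ^+ 5).
have e0 := eps_ge0 c0; have h0 := step_gt0.
apply: (le_trans (@change_mvt M _)) => [x i x01 ip|].
  have i1 : (i.+1 < p.+1)%N by [].
  have i0 : (i < p.+1)%N by rewrite ltnS ltnW.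
  rewrite grad_diff; apply: (le_trans (chord_diff_smooth c0 c1 eps_small _
    (scl_step x01 i0) (scl_step x01 i1))).
  apply: ler_wpM2l; first exact: mulr_ge0 (ler0n _ _) e0.
  rewrite lerD2r; apply: ler_wpM2l; first by rewrite exprn_ge0// ltW.
  have -> : h + (scl x u i.+2 - scl x u i.+1) - (h + (scl x u i.+1 - scl x u i)) =
     x * ((u i.+2 - u i.+1) - (u i.+1 - u i)) by rewrite /scl; ring.
  case/andP: x01 => x0 x1; rewrite normrM (ger0_norm x0).
  have := ler_normB (u i.+2 - u i.+1) (u i.+1 - u i).
  have := normr_ge0 ((u i.+2 - u i.+1) - (u i.+1 - u i)).
  nra.
have S0 : 0 <= S by apply: sumr_ge0.
apply: ler_wpM2l => //; rewrite /M -mulr_sumr; apply: ler_wpM2l; first exact: mulr_ge0 (ler0n _ _) e0.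
rewrite big_split /= -mulr_sumr big_split /=.
have hS1 : \sum_(0 <= i < p) `|u i.+2 - u i.+1| <= S.
  by rewrite /S big_nat_recl//= lerDr.
have hS2 : \sum_(0 <= i < p) `|u i.+1 - u i| <= S.
  by rewrite /S big_nat_recr//= lerDl.
have h3 : 0 <= h ^+ 3 by rewrite exprn_ge0// ltW.
have : h ^+ 3 * (\sum_(0 <= i < p) `|u i.+2 - u i.+1| + \sum_(0 <= i < p) `|u i.+1 - u i|)
  <= h ^+ 3 * (2 * S) by apply: ler_wpM2l => //; lra.
have : \sum_(0 <= i < p) h ^+ 5 <= 8 * h ^+ 4.
  have -> : \sum_(0 <= i < p) h ^+ 5 = p%:R * h * h ^+ 4.
    by rewrite sumr_const_nat subn0 -[_ *+ p]mulr_natl; ring.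
  by apply: ler_wpM2r; [rewrite exprn_ge0// ltW|exact: step_mul_le].
lra.
Qed.

(** About 2 pi / h gradients change by O(A h^(5/2)) each. For maximizers [S] is O(eps h^2), which
    makes the total O(eps A h^(7/2)). *)
Lemma change_hoelder A :
  (forall t, `|ff G0 G1 t| <= A) -> (forall t, `|fe G0 G1 t| <= A) ->
  (forall x y, `|x - y| <= 4 -> `|ff G0 G1 x - ff G0 G1 y| <= A * Num.sqrt `|x - y|) ->
  `|(act G1 h p.+1 u - act G0 h p.+1 u)
    - (act G1 h p.+1 (scl 0 u) - act G0 h p.+1 (scl 0 u))|
  <= S * (256 * 100 * A * (h * Num.sqrt h)).
Proof.
move=> a1 a2 a3; have h0 := step_gt0; have h3 := step_le3.
have A0 : 0 <= A by exact: le_trans (a1 0).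
have S0 : 0 <= S by apply: sumr_ge0.
have sh := sqrtr_ge0 h.
pose M (_ : nat) := 3200 * (A * (h ^+ 2 * Num.sqrt h)).
have CB s t : 0 <= t <= 5 * h / 4 \/ 0 <= - t <= 5 * h / 4 ->
   `|chord G0 G1 s t| <= 1600 * (A * (h ^+ 2 * Num.sqrt h)).
  move=> ht; have {ht}[t1 t2] : `|t| <= 5 * h / 4 /\ `|t| <= 4.
    have step := step_le; have pi4 := @pi_lt4 R.
    by case: ht => /andP[? ?]; rewrite !ler_norml; split; apply/andP; lra.
  apply: (le_trans (chord_hoelder c0 c1 eps_small a1 a2 a3 s t2)).
  have st : Num.sqrt `|t| <= 2 * Num.sqrt h.
    have -> : 2 * Num.sqrt h = Num.sqrt (2 ^+ 2 * h).
      by rewrite (sqrtrM h (sqr_ge0 2)) sqrtr_sqr ger0_norm.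
    by apply: ler_wsqrtr; rewrite expr2; lra.
  have t3 : `|t| <= 2 * h by lra.
  have tt : `|t| * `|t| <= (2 * h) * (2 * h) by apply: ler_pM.
  have : `|t| * `|t| * Num.sqrt `|t| <= (2 * h) * (2 * h) * (2 * Num.sqrt h).
    by apply: ler_pM; rewrite ?mulr_ge0// sqrtr_ge0.
  move=> H; have := ler_wpM2l A0 H.
  have -> : A * (2 * h * (2 * h) * (2 * Num.sqrt h)) = 8 * (A * (h ^+ 2 * Num.sqrt h)) by ring.
  have -> : 200 * A * (`|t| * Num.sqrt `|t|) * `|t| = 200 * (A * (`|t| * `|t| * Num.sqrt `|t|)) by ring.
  lra.
apply: (le_trans (@change_mvt M _)) => [x i x01 ip|].
  have i1 : (i.+1 < p.+1)%N by [].
  have i0 : (i < p.+1)%N by rewrite ltnS ltnW.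
  rewrite grad_diff; apply: (le_trans (ler_normB _ _)).
  have := CB (pt h (scl x u) i.+1) _ (or_introl (scl_step x01 i1)).
  have := CB (pt h (scl x u) i.+1) (- (h + (scl x u i.+1 - scl x u i))).
  rewrite opprK => /(_ (or_intror (scl_step x01 i0))).
  by rewrite /M; lra.
apply: ler_wpM2l => //; rewrite /M sumr_const_nat subn0 -[_ *+ p]mulr_natl.
have := step_mul_le; have z : 0 <= A * (h * Num.sqrt h) by apply: mulr_ge0 => //; apply: mulr_ge0 => //; exact: ltW.
move=> /(ler_wpM2r z).
have -> : p%:R * h * (A * (h * Num.sqrt h)) = p%:R * (A * (h ^+ 2 * Num.sqrt h)) by ring.
have -> : p%:R * (3200 * (A * (h ^+ 2 * Num.sqrt h))) = 3200 * (p%:R * (A * (h ^+ 2 * Num.sqrt h))).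
  by rewrite mulrCA.
rewrite -[256 * 100 * A * _]mulrA; lra.
Qed.

End Change.

(** * Maximizers are close to the equidistant polygon *)

Section Maximizer.
Context {R : realType}.
Variables (eps : R) (G : nat -> R -> plane R).
Hypotheses (cG : curve eps G).
Hypothesis eps_small : eps <= 1 / (100 * 100 * 100).
Variables (p : nat) (u : nat -> R).
Hypothesis p2 : (2 <= p)%N.
Let h : R := 2 * pi / p.+1%:R.
Hypotheses (u0 : u 0%N = 0) (up : u p.+1 = 0).
Hypothesis uh : forall j, (j < p.+1)%N -> `|u j.+1 - u j| <= h / 4.
Hypothesis umax : act G h p.+1 (scl 0 u) <= act G h p.+1 u.
Let S := \sum_(0 <= i < p.+1) `|u i.+1 - u i|.

(** Comparison with the circle. There a displacement costs at least h^2 S^2 / 192, by concavity and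
    Cauchy-Schwarz, whereas passing from the circle to [G] gains at most O(eps h^3 S^2 + eps h^4 S).
    The first of these terms is absorbed since eps is tiny; dividing by h^2 S leaves the claim. *)
Lemma maximizer_close : S <= 100 * 100 * 100 * eps * h ^+ 2.
Proof.
have es := eps_small.
have e0 := eps_ge0 cG; have h0 := @step_gt0 R p; have h3 := @step_le3 R p p2; have hl := @step_le R p p2.
rewrite -/h in h0 h3 hl.
have S0 : 0 <= S by apply: sumr_ge0.
have e3 : eps <= 1 / 1000 by lra.
have H := change_smooth (curve_ek e0) cG e3 u0 up uh.
have C := @circle_concave R h p.+1 u _ u0 up uh.
rewrite -/h -/S in H.
have {C}C := C (introT andP (conj h0 hl)).
set Q := \sum_(0 <= j < p.+1) (u j.+1 - u j) ^+ 2 in C.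
have CS : S ^+ 2 <= p.+1%:R * Q.
  have -> : Q = \sum_(0 <= i < p.+1) `|u i.+1 - u i| ^+ 2.
    by apply: eq_bigr => i _; rewrite real_normK ?num_real.
  exact: cauchy_sum.
have CS' : h * S ^+ 2 <= 8 * Q.
  have Q0 : 0 <= Q by apply: sumr_ge0 => i _; exact: sqr_ge0.
  have k : h * (p.+1%:R * Q) = 2 * pi * Q by rewrite -(@step_mul R p) -/h; ring.
  have := ler_wpM2l (ltW h0) CS; rewrite k.
  have := @pi_lt4 R; nra.
have hS : 0 <= h ^+ 2 * S ^+ 2 by rewrite mulr_ge0 ?sqr_ge0.
have key : h ^+ 2 * S ^+ 2 / 192 <= S * (200 * eps * (2 * h ^+ 3 * S + 8 * h ^+ 4)).
  have := umax; have : h * (h * S ^+ 2) <= h * (8 * Q) by apply: ler_wpM2l => //; lra.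
  rewrite mulrA -expr2.
  move: H; rewrite ler_norml; move: (act ek _ _ _) (act ek _ _ _) C => x y C /andP[H1 H2].
  have hQ : h / 24 * Q = h * Q / 24 by field.
  have hQ8 : h * (8 * Q) = 8 * (h * Q) by ring.
  move: C; rewrite hQ hQ8; move: (h * Q) => z; lra.
have [->|/eqP Sn0] := eqVneq S 0; first by apply: mulr_ge0; [apply: mulr_ge0|exact: sqr_ge0].
have Sp : 0 < S by rewrite lt0r S0 andbT; apply/eqP.
have h2p : 0 < h ^+ 2 by rewrite exprn_gt0.
suff : h ^+ 2 * S * S <= h ^+ 2 * S * (100 * 100 * 100 * eps * h ^+ 2).
  by rewrite ler_pM2l// mulr_gt0.
have -> : h ^+ 2 * S * S = h ^+ 2 * S ^+ 2 by ring.
have k1 : S * (200 * eps * (2 * h ^+ 3 * S)) <= h ^+ 2 * S ^+ 2 / 800.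
  have -> : S * (200 * eps * (2 * h ^+ 3 * S)) = 400 * (eps * h) * (h ^+ 2 * S ^+ 2) by ring.
  rewrite mulrC; apply: ler_wpM2l => //.
  have : eps * h <= 1 / (100 * 100 * 100) * 3 by apply: ler_pM => //; lra.
  lra.
have -> : h ^+ 2 * S * (100 * 100 * 100 * eps * h ^+ 2) = 625 * (1600 * (eps * (h ^+ 4 * S))) by ring.
have k2 : S * (200 * eps * (8 * h ^+ 4)) = 1600 * (eps * (h ^+ 4 * S)) by ring.
move: key; rewrite mulrDr mulrDr k2 => key.
have : 0 <= eps * (h ^+ 4 * S).
  by apply: mulr_ge0 => //; apply: mulr_ge0 => //; apply: exprn_ge0; exact: ltW.
move: (eps * (_)) key => w key; lra.
Qed.

End Maximizer.

(** * Averages over equidistant nodes *)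

Section Mean.
Context {R : realType}.
Implicit Types (f g : R -> R).

Definition mean (q : nat) f : R := q%:R^-1 * \sum_(0 <= j < q) f (j%:R * (2 * pi / q%:R)).

Lemma per_nat f (n : nat) x : (forall t, f (t + 2 * pi) = f t) -> f (x + n%:R * (2 * pi)) = f x.
Proof. by move=> H; exact: (periodic_int H n%:Z x). Qed.

Lemma sum_mul_nat (F : nat -> R) q r :
  \sum_(0 <= k < q * r) F k = \sum_(0 <= j < q) \sum_(0 <= i < r) F (j * r + i)%N.
Proof.
elim: q => [|q IH]; first by rewrite mul0n !big_geq.
rewrite big_nat_recr//= -IH mulSn addnC (@big_cat_nat _ _ _ (q * r))//= ?leq_addr//.
congr (_ + _); rewrite -{1}[(q * r)%N]add0n big_addn addnC addnK.
by apply: eq_bigr => i _; rewrite addnC.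
Qed.

Lemma sum_shift_per (F : nat -> R) q : F q = F 0%N ->
  \sum_(0 <= j < q) F j.+1 = \sum_(0 <= j < q) F j.
Proof.
case: q => [|q] e; first by rewrite !big_geq.
by rewrite big_nat_recr//= e [RHS]big_nat_recl//= addrC.
Qed.

Lemma mean_le f (M : R) q : (0 < q)%N -> (forall t, `|f t| <= M) -> `|mean q f| <= M.
Proof.
move=> q0 H; rewrite /mean normrM ger0_norm ?invr_ge0// mulrC ler_pdivrMr ?ltr0n//.
apply: (le_trans (ler_sum_abs (G := fun=> M) _)) => //.
by rewrite sumr_const_nat subn0 mulr_natr.
Qed.

(* The trapezoid rule for a periodic C^{1,1/2} function has error O(h^{3/2}). *)
Lemma mean_refine g g1 (B : R) q r : (0 < q)%N -> (0 < r)%N -> der g g1 ->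
  (forall t, g (t + 2 * pi) = g t) ->
  (forall x y, `|x - y| <= 2 * pi / q%:R -> `|g1 x - g1 y| <= B * Num.sqrt `|x - y|) ->
  `|mean q g - mean (q * r) g| <= B * (2 * pi / q%:R * Num.sqrt (2 * pi / q%:R)).
Proof.
move=> q0 r0 dg per H; set h := 2 * pi / q%:R.
have qn : q%:R != 0 :> R by rewrite pnatr_eq0 -lt0n.
have rn : r%:R != 0 :> R by rewrite pnatr_eq0 -lt0n.
have q_gt : 0 < q%:R :> R by rewrite ltr0n.
have r_gt : 0 < r%:R :> R by rewrite ltr0n.
have h0 : 0 < h by rewrite /h divr_gt0// mulr_gt0// pi_gt0.
have B0 : 0 <= B.
  have := H h 0; rewrite subr0 gtr0_norm// lexx => /(_ isT) /(le_trans (normr_ge0 _)).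
  by rewrite pmulr_lge0// sqrtr_gt0.
have loc x t : 0 <= t <= h ->
    `|g (x + t) - g x - t / h * (g (x + h) - g x)| <= B * (h * Num.sqrt h).
  move=> /andP[t0 th].
  have [|xi /andP[x1 x2] e1] := @mvt _ g g1 x (x + t) dg; first lra.
  have [|ze /andP[z1 z2] e2] := @mvt _ g g1 x (x + h) dg; first lra.
  have -> : g (x + t) - g x - t / h * (g (x + h) - g x) = t * (g1 xi - g1 ze).
    by rewrite e1 e2; field; rewrite gt_eqF.
  have hx : `|xi - ze| <= h by rewrite ler_norml; apply/andP; lra.
  rewrite normrM (ger0_norm t0) [B * _]mulrCA; apply: ler_pM => //.
  by apply: (le_trans (H _ _ hx)); apply: ler_wpM2l => //; apply: ler_wsqrtr.
rewrite distrC.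
(* On each step [g] is compared with its linear interpolant. The slopes of the interpolants
   telescope over a period, so the interpolants average to the mean over the coarse nodes. *)
have -> : mean (q * r) g - mean q g = (q * r)%:R^-1 *
   \sum_(0 <= j < q) \sum_(0 <= i < r) (g (j%:R * h + i%:R * (h / r%:R)) - g (j%:R * h)
      - i%:R / r%:R * (g (j.+1%:R * h) - g (j%:R * h))).
  have -> : \sum_(0 <= j < q) \sum_(0 <= i < r) (g (j%:R * h + i%:R * (h / r%:R)) - g (j%:R * h)
      - i%:R / r%:R * (g (j.+1%:R * h) - g (j%:R * h))) =
    \sum_(0 <= j < q) \sum_(0 <= i < r) g (j%:R * h + i%:R * (h / r%:R))
    - r%:R * \sum_(0 <= j < q) g (j%:R * h)
    - (\sum_(0 <= i < r) i%:R / r%:R) * \sum_(0 <= j < q) (g (j.+1%:R * h) - g (j%:R * h)).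
    rewrite !mulr_sumr -!sumrB; apply: eq_bigr => j _.
    rewrite !sumrB sumr_const_nat subn0 -[g _ *+ r]mulr_natl; congr (_ - _).
    by rewrite mulr_suml.
  rewrite (sum_telescope (fun j => g (j%:R * h))).
  have -> : q%:R * h = 0%:R * h + 1%:R * (2 * pi) by rewrite /h; field.
  rewrite (per_nat 1) // subrr mulr0 subr0 mulrBr /mean sum_mul_nat natrM.
  congr (_ - _); last by rewrite -/h; field; rewrite rn qn.
  congr (_ * _); apply: eq_bigr => j _; apply: eq_bigr => i _; congr g.
  by rewrite natrD natrM /h; field; rewrite rn qn.
rewrite normrM ger0_norm ?invr_ge0// mulrC ler_pdivrMr ?ltr0n ?muln_gt0 ?q0//.
apply: (le_trans (ler_sum_abs (G := fun=> r%:R * (B * (h * Num.sqrt h))) _)) => [j jq|].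
  apply: (le_trans (ler_sum_abs (G := fun=> B * (h * Num.sqrt h)) _)) => [i ir|].
    have := loc (j%:R * h) (i%:R * (h / r%:R)).
    have -> : i%:R * (h / r%:R) / h = i%:R / r%:R by field; rewrite rn gt_eqF.
    rewrite -[j.+1%:R]natr1 [(_ + 1) * h]mulrDl mul1r; apply.
    apply/andP; split; first by rewrite mulr_ge0// divr_ge0// ltW.
    by rewrite mulrA ler_pdivrMr// mulrC ler_pM2l// ler_nat ltnW.
  by rewrite sumr_const_nat subn0 -[_ *+ r]mulr_natl.
rewrite sumr_const_nat subn0 -[_ *+ q]mulr_natl natrM; rewrite le_eqVlt; apply/orP; left; apply/eqP; ring.
Qed.

End Mean.

(** * Expansion of the change of the equidistant action *)

Section Expansion.
Context {R : realType}.
Variables (eps : R) (G0 G1 : nat -> R -> plane R).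
Hypotheses (c0 : curve eps G0) (c1 : curve eps G1).
Hypothesis eps_small : eps <= 1 / 1000.

Local Notation m := (mid G0 G1).
Local Notation d := (dif G0 G1).
Local Notation n := (fn G0 G1).

(** Density of the lower-order term: the coefficient of h^3 / 3 in the pairing of the difference
    with a symmetric step of the mean. It carries a factor eps, as m''' + m' vanishes on the
    circle. *)
Definition fg (t : R) := omega (d 0 t) (m 3 t + m 1 t).

(** In a symmetric difference the terms of even degree cancel, so that the expansion to third order
    has an error of order five. *)
Lemma sym_taylor (f0 f1 f2 f3 f4 f5 : R -> R) (M x t : R) :
  der f0 f1 -> der f1 f2 -> der f2 f3 -> der f3 f4 -> der f4 f5 ->
  (forall s, `|f5 s| <= M) ->
  `|f0 (x + t) - f0 (x - t) - 2 * t * f1 x - t ^+ 3 / 3 * f3 x| <= 2 * M * `|t| ^+ 5.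
Proof.
move=> d0 d1 d2 d3 d4 HM.
have dp : der (fun s => x + s) (fun=> 1).
  by apply: (der_eq (der_add (der_cst x) der_id)) => s; rewrite add0r.
have dm : der (fun s => x - s) (fun=> -1).
  by apply: (der_eq (der_sub (der_cst x) der_id)) => s; rewrite sub0r.
have D4 : der (fun s => f4 (x + s) - f4 (x - s)) (fun s => f5 (x + s) + f5 (x - s)).
  by apply: (der_eq (der_sub (der_comp d4 dp) (der_comp d4 dm))) => s; ring.
have D3 : der (fun s => f3 (x + s) + f3 (x - s) - 2 * f3 x) (fun s => f4 (x + s) - f4 (x - s)).
  by apply: (der_eq (der_sub (der_add (der_comp d3 dp) (der_comp d3 dm)) (der_cst _))) => s; ring.
have D2 : der (fun s => f2 (x + s) - f2 (x - s) - 2 * f3 x * s)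
   (fun s => f3 (x + s) + f3 (x - s) - 2 * f3 x).
  by apply: (der_eq (der_sub (der_sub (der_comp d2 dp) (der_comp d2 dm))
    (der_scale _ der_id))) => s; ring.
have D1 : der (fun s => f1 (x + s) + f1 (x - s) - 2 * f1 x - f3 x * (s * s))
   (fun s => f2 (x + s) - f2 (x - s) - 2 * f3 x * s).
  by apply: (der_eq (der_sub (der_sub (der_add (der_comp d1 dp) (der_comp d1 dm)) (der_cst _))
    (der_scale _ (der_mul der_id der_id)))) => s; ring.
have D0 : der (fun s => f0 (x + s) - f0 (x - s) - 2 * f1 x * s - f3 x / 3 * (s * (s * s)))
   (fun s => f1 (x + s) + f1 (x - s) - 2 * f1 x - f3 x * (s * s)).
  by apply: (der_eq (der_sub (der_sub (der_sub (der_comp d0 dp) (der_comp d0 dm))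
    (der_scale _ der_id)) (der_scale _ (der_mul der_id (der_mul der_id der_id))))) => s; field.
have H5 s : `|f5 (x + s) + f5 (x - s)| <= 2 * M * `|s| ^+ 0.
  by rewrite expr0 mulr1; apply: (le_trans (ler_normD _ _)); have := HM (x + s); have := HM (x - s); lra.
have H4 := pow_primitive_bound D4 _ H5; rewrite addr0 !subr0 subrr in H4.
have H3 := pow_primitive_bound D3 _ (H4 erefl); rewrite addr0 !subr0 in H3.
have H2 := pow_primitive_bound D2 _ (H3 _); rewrite addr0 !subr0 subrr in H2.
have {}H2 : forall s, `|f2 (x + s) - f2 (x - s) - 2 * f3 x * s| <= 2 * M * `|s| ^+ 3.
  by apply: H2; [ring|ring].
have H1 := pow_primitive_bound D1 _ H2; rewrite addr0 !subr0 in H1.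
have {}H1 : forall s, `|f1 (x + s) + f1 (x - s) - 2 * f1 x - f3 x * (s * s)| <= 2 * M * `|s| ^+ 4.
  by apply: H1; ring.
have H0 := pow_primitive_bound D0 _ H1; rewrite addr0 !subr0 subrr in H0.
have -> : f0 (x + t) - f0 (x - t) - 2 * t * f1 x - t ^+ 3 / 3 * f3 x =
  f0 (x + t) - f0 (x - t) - 2 * f1 x * t - f3 x / 3 * (t * (t * t)).
  by rewrite !exprS expr0; field.
by apply: H0; ring.
Qed.

Lemma sin_taylor5 (h : R) : 0 <= h -> `|2 * sin h - 2 * h + h ^+ 3 / 3| <= 2 * h ^+ 5.
Proof.
move=> h0.
have Dn : der (fun t : R => - sin t) (fun t => - cos t) by apply: der_opp; exact: der_sin.
have Dc : der (fun t : R => - cos t) (fun t => sin t).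
  by apply: (der_eq (der_opp der_cos)) => t; rewrite opprK.
have B (s : R) : `|cos s| <= 1 by rewrite ler_norml cos_geN1 cos_le1.
have := sym_taylor 0 h der_sin der_cos Dn Dc der_sin B.
rewrite add0r sub0r sinN cos0 (ger0_norm h0) !mulr1.
by have -> : 2 * sin h - 2 * h + h ^+ 3 / 3 = sin h - - sin h - 2 * h - h ^+ 3 / 3 * -1 by ring.
Qed.

(** On the circle a symmetric step is exactly 2 sin h times the tangent. The Taylor expansion is
    applied only to the deviation of m from the circle, whence 2 sin h instead of 2 h and the factor
    eps in the error. *)
Lemma mid_step (x h : R) : 0 <= h ->
  `|m 0 (x + h) - m 0 (x - h) - ((2 * sin h) *: m 1 x + (h ^+ 3 / 3) *: (m 3 x + m 1 x))|
  <= 4 * eps * h ^+ 5.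
Proof.
move=> h0.
set mu := fun k t => m k t - ek k t.
have dmu k : (k < 6)%N -> vder (mu k) (mu k.+1).
  by move=> k6; apply: vder_sub; [exact: (mid_der c0 c1)|exact: ek_der].
have mule k t : (k <= 6)%N -> `|mu k t| <= eps by move=> k6; exact: (mid_near c0 c1).
have s5 := sin_taylor5 h0; have e0 := eps_ge0 c0.
have hh5 : 0 <= h ^+ 5 by rewrite exprn_ge0.
have key (pr : plane R -> R) : (forall u v : plane R, pr (u - v) = pr u - pr v) ->
   (forall u v : plane R, pr (u + v) = pr u + pr v) ->
   (forall (c : R) (u : plane R), pr (c *: u) = c * pr u) ->
   (forall k, (k < 6)%N -> der (fun t => pr (mu k t)) (fun t => pr (mu k.+1 t))) ->
   (forall u, `|pr u| <= `|u|) ->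
   (pr (ek 0 (x + h)) - pr (ek 0 (x - h)) = 2 * sin h * pr (ek 1 x)) ->
   `|pr (m 0 (x + h) - m 0 (x - h) - ((2 * sin h) *: m 1 x + (h ^+ 3 / 3) *: (m 3 x + m 1 x)))|
     <= 4 * eps * h ^+ 5.
  move=> prB prD prZ prd prn pre.
  have B5 s : `|pr (mu 5 s)| <= eps by apply: (le_trans (prn _)); exact: mule.
  have H := sym_taylor x h (prd 0%N isT) (prd 1%N isT) (prd 2%N isT) (prd 3%N isT) (prd 4%N isT) B5.
  rewrite (ger0_norm h0) /mu !prB in H.
  have e3 : pr (ek 3 x) = - pr (ek 1 x).
    have := prB 0 (ek 1 x); rewrite sub0r -ekSS => ->.
    by have := prB 0 0; rewrite subrr => ->; rewrite subrr sub0r.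
  have E (a b c e : plane R) (k l : R) : pr (a - b - (k *: c + l *: (e + c))) =
    pr a - pr b - (k * pr c + l * (pr e + pr c)) by rewrite prB prB prD prZ prZ prD.
  rewrite E.
  have -> : pr (m 0 (x + h)) - pr (m 0 (x - h)) -
     (2 * sin h * pr (m 1 x) + h ^+ 3 / 3 * (pr (m 3 x) + pr (m 1 x))) =
     (pr (m 0 (x + h)) - pr (ek 0 (x + h)) - (pr (m 0 (x - h)) - pr (ek 0 (x - h))) -
      2 * h * (pr (m 1 x) - pr (ek 1 x)) - h ^+ 3 / 3 * (pr (m 3 x) - pr (ek 3 x)))
     - (2 * sin h - 2 * h + h ^+ 3 / 3) * (pr (m 1 x) - pr (ek 1 x)).
    rewrite e3; have -> : pr (ek 0 (x + h)) = pr (ek 0 (x - h)) + 2 * sin h * pr (ek 1 x).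
      by move: pre; lra.
    ring.
  apply: (le_trans (ler_normB _ _)); rewrite normrM.
  have : `|pr (m 1 x) - pr (ek 1 x)| <= eps by rewrite -prB; apply: (le_trans (prn _)); exact: mule.
  move=> k1; apply: (le_trans (lerD H (ler_pM (normr_ge0 _) (normr_ge0 _) s5 k1))).
  rewrite le_eqVlt; apply/orP; left; apply/eqP; ring.
rewrite norm_plane_le; apply/andP; split.
  apply: key; [by []|by []|by []|by move=> k /dmu[]|exact: norm1_le|].
  by rewrite !ek0 ek1 /= cosB cosD; ring.
apply: key; [by []|by []|by []|by move=> k /dmu[]|exact: norm2_le|].
by rewrite !ek0 ek1 /= sinB sinD; ring.
Qed.

(** Polarization at the mean and a shift of the index pair, at each node, the difference of the
    curves with the chord between the two neighbouring nodes; [mid_step] expands that chord. *)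
Lemma act_diff_mean (A h : R) q : (2 < q)%N -> (forall t, `|d 0 t| <= A) ->
  h = 2 * pi / q%:R ->
  `|act G1 h q (fun=> 0) - act G0 h q (fun=> 0)
    - (2 * q%:R * sin h * mean q n + 2 * pi / 3 * h ^+ 2 * mean q fg)|
  <= 64 * eps * A * h ^+ 4.
Proof.
move=> q3 HA hE.
have qn : q%:R != 0 :> R by rewrite pnatr_eq0 -lt0n (ltn_trans _ q3).
have q0 : 0 < q%:R :> R by rewrite ltr0n (ltn_trans _ q3).
have pi0 := @pi_gt0 R; have e0 := eps_ge0 c0.
have h0 : 0 <= h by rewrite hE divr_ge0// mulr_ge0// ltW.
have qh : q%:R * h = 2 * pi by rewrite hE; field.
have A0 : 0 <= A by exact: le_trans (HA 0).
pose x (j : nat) := j%:R * h.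
have E : act G1 h q (fun=> 0) - act G0 h q (fun=> 0) =
   \sum_(0 <= j < q) omega (d 0 (x j)) (m 0 (x j + h) - m 0 (x j - h)).
  transitivity (\sum_(0 <= j < q) omega (d 0 (x j)) (m 0 (x j.+1))
     - \sum_(0 <= j < q) omega (d 0 (x j.+1)) (m 0 (x j.+1 - h))).
    rewrite /act -!sumrB; apply: eq_bigr => j _.
    have -> : x j.+1 - h = x j by rewrite /x -natr1; ring.
    rewrite /pt !addr0 -/(x j) -/(x j.+1).
    by rewrite /mid /dif /omega /= /GRing.scale /=; field.
  rewrite (sum_shift_per (F := fun j => omega (d 0 (x j)) (m 0 (x j - h)))).
    rewrite -sumrB; apply: eq_bigr => j _; rewrite omegaBr; congr (omega _ (m _ _) - _).
    by rewrite /x -natr1; ring.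
  have -> : x q = x 0%N + 2 * pi by rewrite /x qh mul0r add0r.
  have -> : x 0%N + 2 * pi - h = (x 0%N - h) + 2 * pi by ring.
  by rewrite (dif_per c0 c1)// (mid_per c0 c1).
have -> : 2 * q%:R * sin h * mean q n + 2 * pi / 3 * h ^+ 2 * mean q fg =
   \sum_(0 <= j < q) omega (d 0 (x j)) ((2 * sin h) *: m 1 (x j) + (h ^+ 3 / 3) *: (m 3 (x j) + m 1 (x j))).
  transitivity (2 * sin h * \sum_(0 <= j < q) n (x j) + h ^+ 3 / 3 * \sum_(0 <= j < q) fg (x j)).
    rewrite /mean -hE -qh; field.
    exact: qn.
  rewrite !mulr_sumr -big_split /=; apply: eq_bigr => j _.
  by rewrite omegaDr (omegaZr (2 * sin h)) (omegaZr (h ^+ 3 / 3)).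
rewrite E -sumrB.
apply: (le_trans (ler_sum_abs (G := fun=> 8 * eps * A * h ^+ 5) _)) => [j _|].
  rewrite -omegaBr; have := omega_le (HA (x j)) (mid_step (x j) h0).
  move=> H; apply: (le_trans H); rewrite le_eqVlt; apply/orP; left; apply/eqP; ring.
rewrite sumr_const_nat subn0 -[_ *+ q]mulr_natl.
have -> : q%:R * (8 * eps * A * h ^+ 5) = (8 * eps * A * h ^+ 4) * (q%:R * h) by ring.
rewrite qh; have z : 0 <= eps * A * h ^+ 4.
  by apply: mulr_ge0; [exact: mulr_ge0|exact: exprn_ge0].
have := @pi_lt4 R.
move: (h ^+ 4) z => w z p4.
have : eps * A * w * (2 * pi) <= eps * A * w * 8 by apply: ler_wpM2l => //; lra.
lra.
Qed.

End Expansion.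

(** * Averages and Fourier coefficients *)

Section PowerSums.
Context {R : realType}.

(** The weight k^(7/2), inverse to the error h^(7/2) of the averages. *)
Definition pw (k : nat) : R := k%:R ^+ 3 * Num.sqrt k%:R.

Lemma pw_gt0 k : (0 < k)%N -> 0 < pw k.
Proof. by move=> k0; rewrite mulr_gt0 ?exprn_gt0 ?sqrtr_gt0 ?ltr0n. Qed.

Lemma pwM k l : pw (k * l) = pw k * pw l.
Proof. by rewrite /pw natrM exprMn sqrtrM//; ring. Qed.

Lemma pw_ge_cube k : (0 < k)%N -> k%:R ^+ 3 <= pw k.
Proof.
move=> k0; rewrite -[leLHS]mulr1 ler_wpM2l ?exprn_ge0//.
by rewrite -[leLHS]sqrtr1; apply: ler_wsqrtr; rewrite ler1n.
Qed.

Lemma pw_homo k l : (k <= l)%N -> pw k <= pw l.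
Proof.
move=> kl; apply: ler_pM; rewrite ?exprn_ge0 ?sqrtr_ge0//.
  by apply: lerXn2r; rewrite ?nnegrE ?ler0n// ler_nat.
by apply: ler_wsqrtr; rewrite ler_nat.
Qed.

(** Comparison with the telescoping series of 1 / ((l - 1) l (l + 1)). A sum below 1 is what makes
    the relation between averages and coefficients invertible in [coef_step]. *)
Lemma pw_sum n : \sum_(2 <= l < n) (pw l)^-1 <= 1 / 4.
Proof.
have H : forall n, (2 <= n)%N ->
    \sum_(2 <= l < n) (pw l)^-1 <= 1 / 4 - (2 * (n%:R - 1) * n%:R)^-1 :> R.
  elim=> // {}n IH; rewrite leq_eqVlt => /orP[/eqP <-|n2].
    rewrite big_geq//; have -> : 2 * (2 - 1) * 2 = 4 :> R by ring.
    by rewrite div1r subrr.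
  rewrite ltnS in n2; rewrite big_nat_recr//=.
  have n1 : 1 < n%:R :> R by rewrite ltr1n.
  have k : (pw n)^-1 <= ((n%:R - 1) * n%:R * (n%:R + 1))^-1.
    rewrite lef_pV2 ?posrE ?pw_gt0 ?(leq_trans _ n2)//; last by rewrite !mulr_gt0//; lra.
    apply: le_trans (pw_ge_cube _); last by apply: leq_trans n2.
    by rewrite !exprS expr0; nra.
  apply: (le_trans (lerD (IH n2) k)); rewrite -natr1.
  rewrite le_eqVlt; apply/orP; left; apply/eqP; field.
  by apply/andP; split; [|apply/andP; split]; rewrite gt_eqF//; lra.
have [n2|n2] := leqP 2 n; last by rewrite big_geq ?(ltnW n2)//; lra.
apply: (le_trans (H _ n2)); rewrite lerBlDr lerDl invr_ge0.
have : 1 <= n%:R :> R by rewrite ler1n (leq_trans _ n2).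
by move=> ?; rewrite !mulr_ge0//; lra.
Qed.

Lemma inv_sqrt_sum n : \sum_(1 <= w < n.+1) (Num.sqrt w%:R)^-1 <= 2 * Num.sqrt n%:R :> R.
Proof.
elim: n => [|n IH]; first by rewrite big_geq// sqrtr0 mulr0.
rewrite big_nat_recr//=; apply: (le_trans (lerD IH (lexx _))).
set a := Num.sqrt n%:R; set b := Num.sqrt n.+1%:R.
have b0 : 0 < b by rewrite sqrtr_gt0.
have a0 : 0 <= a by exact: sqrtr_ge0.
have ab : a <= b by apply: ler_wsqrtr; rewrite ler_nat.
have aE : a * a = n%:R by rewrite -expr2 sqr_sqrtr.
have bE : b * b = n%:R + 1 by rewrite -expr2 sqr_sqrtr// natr1.
have : b^-1 * b = 1 by rewrite mulVf ?gt_eqF.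
move: (b^-1) => c cb.
have : 0 <= (2 * b - 2 * a - c) * b by nra.
by rewrite pmulr_lge0//; lra.
Qed.

Lemma inv_three_half_sum m n : (0 < m)%N ->
  \sum_(m.+1 <= w < n) (w%:R * Num.sqrt w%:R)^-1 <= 2 / Num.sqrt m%:R :> R.
Proof.
move=> m0.
have H : forall n, (m < n)%N ->
    \sum_(m.+1 <= w < n) (w%:R * Num.sqrt w%:R)^-1
      <= 2 / Num.sqrt m%:R - 2 / Num.sqrt n.-1%:R :> R.
  elim=> // {}n IH; rewrite ltnS leq_eqVlt => /orP[/eqP <-|mn].
    by rewrite big_geq//= subrr.
  rewrite big_nat_recr//=; apply: (le_trans (lerD (IH mn) (lexx _))).
  have n0 : (0 < n)%N by apply: leq_trans mn.
  have -> : n%:R = n.-1%:R + 1 :> R by rewrite natr1 prednK.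
  have : (0 < n.-1)%N by rewrite -ltnS prednK// (leq_ltn_trans _ mn).
  move: (n.-1) => k k0.
  set a := Num.sqrt k%:R; set b := Num.sqrt (k%:R + 1).
  have k0' : 0 < k%:R :> R by rewrite ltr0n.
  have a0 : 0 < a by rewrite sqrtr_gt0.
  have b0 : 0 < b by rewrite sqrtr_gt0; lra.
  have ab : a <= b by apply: ler_wsqrtr; lra.
  have aE : a * a = k%:R by rewrite -expr2 sqr_sqrtr// ltW.
  have bE : b * b = k%:R + 1 by rewrite -expr2 sqr_sqrtr//; lra.
  rewrite -bE.
  have -> : (b * b * b)^-1 = (2 * b * b * (b - a) - (2 * b * b * (b - a) - a)) / (a * b * b * b).
    by field; rewrite !gt_eqF.
  have -> : 2 / Num.sqrt m%:R - 2 / b = 2 / Num.sqrt m%:R - 2 / a + 2 * b * b * (b - a) / (a * b * b * b).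
    have : Num.sqrt m%:R != 0 :> R by rewrite gt_eqF// sqrtr_gt0 ltr0n.
    by move: (Num.sqrt m%:R) => z z0; field; rewrite z0 !gt_eqF.
  rewrite lerD2l; apply: ler_wpM2r; first by rewrite invr_ge0 !mulr_ge0// ltW.
  have : 0 <= (2 * b * b * (b - a) - a) * (a + b).
    have -> : (2 * b * b * (b - a) - a) * (a + b) = 2 * (b * b) * (b * b - a * a) - a * a - a * b by ring.
    by rewrite aE bE; nra.
  by rewrite (pmulr_lge0 _ (addr_gt0 a0 b0)); lra.
have [mn|mn] := ltnP m n; last by rewrite big_geq ?(leq_trans mn)// divr_ge0// sqrtr_ge0.
by apply: (le_trans (H _ mn)); rewrite lerBlDr lerDl divr_ge0// sqrtr_ge0.
Qed.

(** The sum is split at w about 1 / t: the terms below are at most t w^(-1/2), those above at most 2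
    w^(-3/2). This is how a decay of the coefficients becomes a Hoelder modulus. *)
Lemma hoelder_sum n (t : R) : 0 <= t ->
  \sum_(1 <= w < n) (w%:R * Num.sqrt w%:R)^-1 * Num.min 2 (w%:R * t) <= 10 * Num.sqrt t.
Proof.
move=> t0; have [t1|t1] := leP 1 t.
  have s1 : 1 <= Num.sqrt t by rewrite -[leLHS]sqrtr1; apply: ler_wsqrtr.
  apply: (@le_trans _ _ (\sum_(1 <= w < n) (w%:R * Num.sqrt w%:R)^-1 * 2)).
    apply: ler_sum => w _; rewrite ler_wpM2l ?invr_ge0 ?mulr_ge0 ?sqrtr_ge0//.
    by rewrite ge_min lexx.
  rewrite -mulr_suml.
  have [n1|n1] := leqP n 1; first by rewrite big_geq// mul0r; lra.
  rewrite big_ltn// mul1r sqrtr1 invr1.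
  have := @inv_three_half_sum 1 n isT; rewrite sqrtr1; lra.
have [->|tn] := eqVneq t 0.
  rewrite sqrtr0 mulr0 big1// => w _; rewrite mulr0.
  by rewrite min_r ?mulr0.
have tp : 0 < t by rewrite lt0r tn.
pose m := Num.truncn t^-1.
have m1 : (0 < m)%N by rewrite truncn_gt0 invf_ge1// ltW.
have mle : m%:R * t <= 1.
  by rewrite -ler_pdivlMr// mul1r; have /andP[] := truncn_itv (ltW (etrans (invr_gt0 t) tp)).
have mgt : 1 < (m.+1)%:R * t.
  by rewrite -ltr_pdivrMr// mul1r truncnS_gt.
have s0 := sqrtr_ge0 t.
have sE : Num.sqrt t * Num.sqrt t = t by rewrite -expr2 sqr_sqrtr.
have F0 w : 0 <= (w%:R * Num.sqrt w%:R)^-1 * Num.min 2 (w%:R * t).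
  apply: mulr_ge0; first by rewrite invr_ge0 mulr_ge0// sqrtr_ge0.
  by rewrite le_min ler0n/= mulr_ge0.
apply: (@le_trans _ _ (\sum_(1 <= w < (n + m).+1) (w%:R * Num.sqrt w%:R)^-1 * Num.min 2 (w%:R * t))).
  have [n1|n1] := leqP n 1; first by rewrite big_geq// sumr_ge0.
  rewrite [leRHS](@big_cat_nat _ _ _ n)//= ?(ltnW n1)//; last by rewrite ltnW// ltnS leq_addr.
  by rewrite lerDl sumr_ge0.
rewrite (@big_cat_nat _ _ _ m.+1)//=; last by rewrite ltnS leq_addl.
pose smn : R := Num.sqrt m%:R.
have sm : 0 < smn by rewrite sqrtr_gt0 ltr0n.
have smE : smn * smn = m%:R by rewrite -expr2 sqr_sqrtr.
have A : \sum_(1 <= w < m.+1) (w%:R * Num.sqrt w%:R)^-1 * Num.min 2 (w%:R * t) <= 2 * smn * t.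
  apply: (@le_trans _ _ (\sum_(1 <= w < m.+1) (Num.sqrt w%:R)^-1 * t)).
    rewrite big_nat_cond [leRHS]big_nat_cond; apply: ler_sum => w.
    rewrite andbT => /andP[w0 _].
    have w0' : 0 < w%:R :> R by rewrite ltr0n.
    have sw : 0 < Num.sqrt w%:R :> R by rewrite sqrtr_gt0.
    rewrite invfM -mulrA [leLHS]mulrCA ler_pM2l ?invr_gt0// ler_pdivrMl//.
    by rewrite ge_min lexx orbT.
  by rewrite -mulr_suml ler_wpM2r// inv_sqrt_sum.
have B : \sum_(m.+1 <= w < (n + m).+1) (w%:R * Num.sqrt w%:R)^-1 * Num.min 2 (w%:R * t) <= 2 / smn * 2.
  apply: (@le_trans _ _ (\sum_(m.+1 <= w < (n + m).+1) (w%:R * Num.sqrt w%:R)^-1 * 2)).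
    apply: ler_sum => w _; rewrite ler_wpM2l ?invr_ge0 ?mulr_ge0 ?sqrtr_ge0//.
    by rewrite ge_min lexx.
  by rewrite -mulr_suml ler_wpM2r// inv_three_half_sum.
apply: (le_trans (lerD A B)).
have a1 : smn * Num.sqrt t <= 1.
  have -> : smn * Num.sqrt t = Num.sqrt (m%:R * t) by rewrite sqrtrM.
  by rewrite -[leRHS]sqrtr1; apply: ler_wsqrtr.
have b1 : smn^-1 <= 2 * Num.sqrt t.
  rewrite -div1r ler_pdivrMr//.
  have : 1 <= (2 * Num.sqrt t * smn) ^+ 2.
    rewrite !exprMn -!expr2 -/smn in sE smE *; rewrite sE smE.
    move: mgt; rewrite -natr1 mulrDl mul1r.
    have : t <= m%:R * t by rewrite ler_peMl// ler1n.
    rewrite expr2; lra.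
  by rewrite -[X in X <= _](expr1n _ 2) ler_sqr ?nnegrE// !mulr_ge0// ltW.
have : 2 * smn * t <= 2 * Num.sqrt t by rewrite -{1}sE; nra.
lra.
Qed.

End PowerSums.

(** * Discrete orthogonality of cosines *)

Section TrigSums.
Context {R : realType}.

Lemma cos_per_nat (x : R) n : cos (x + n%:R * (2 * pi)) = cos x.
Proof.
apply: (per_nat (f := @cos R)) => t.
have -> : t + 2 * pi = t + pi *+ 2 by rewrite mulr2n; ring.
exact: cosD2pi.
Qed.

Lemma sin_per_nat (x : R) n : sin (x + n%:R * (2 * pi)) = sin x.
Proof.
apply: (per_nat (f := @sin R)) => t.
have -> : t + 2 * pi = t + pi *+ 2 by rewrite mulr2n; ring.
exact: sinD2pi.
Qed.

Lemma dirichlet_kernel (x : R) n :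
  2 * sin (x / 2) * \sum_(0 <= k < n) cos (k%:R * x) = sin (n%:R * x - x / 2) + sin (x / 2).
Proof.
elim: n => [|n IH]; first by rewrite big_geq// mulr0 mul0r sub0r sinN addNr.
rewrite big_nat_recr//= mulrDr IH -[n.+1%:R]natr1.
have -> : (n%:R + 1) * x - x / 2 = n%:R * x + x / 2 by field.
by rewrite sinB sinD; ring.
Qed.

Lemma cos_sum0 (Q d : nat) : (0 < d < Q)%N ->
  \sum_(0 <= k < Q) cos (k%:R * (d%:R * (2 * pi / Q%:R))) = 0 :> R.
Proof.
move=> /andP[d0 dQ]; set x := d%:R * (2 * pi / Q%:R).
have Q0 : 0 < Q%:R :> R by rewrite ltr0n (leq_trans _ dQ).
have p0 := @pi_gt0 R.
have := dirichlet_kernel x Q.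
have -> : Q%:R * x - x / 2 = - (x / 2) + d%:R * (2 * pi) by rewrite /x; field; rewrite gt_eqF.
rewrite sin_per_nat sinN addNr => /eqP; rewrite mulf_eq0 => /orP[|/eqP//].
rewrite mulf_eq0 pnatr_eq0 /= => /eqP s0; exfalso.
have : 0 < sin (x / 2).
  apply: sin_gt0_pi; rewrite /x; apply/andP; split.
    by rewrite !mulr_gt0 ?invr_gt0// ltr0n.
  rewrite -[X in _ < X]mulr1.
  have -> : d%:R * (2 * pi / Q%:R) / 2 = pi * (d%:R / Q%:R) :> R by field; rewrite gt_eqF.
  by rewrite ltr_pM2l// ltr_pdivrMr// mul1r ltr_nat.
by rewrite s0 ltxx.
Qed.

Lemma cos_sumE (Q i j : nat) : (i < Q)%N -> (j < Q)%N ->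
  \sum_(0 <= k < Q) cos (k%:R * ((i%:R - j%:R) * (2 * pi / Q%:R))) = (if i == j then Q%:R else 0) :> R.
Proof.
wlog ij : i j / (j <= i)%N.
  move=> H iQ jQ; have [/ltnW ij|ij] := ltnP i j; last exact: H.
  rewrite eq_sym -(H j i ij jQ iQ); apply: eq_bigr => k _.
  by rewrite -cosN; congr cos; ring.
move=> iQ jQ; rewrite -natrB//.
have [->|nij] := eqVneq i j.
  rewrite subnn; under eq_bigr do rewrite mul0r mulr0 cos0.
  by rewrite sumr_const_nat subn0.
apply: cos_sum0; rewrite subn_gt0 ltn_neqAle eq_sym nij ij /=.
by apply: leq_ltn_trans iQ; rewrite leq_subr.
Qed.

End TrigSums.

(** * The discrete Fourier transform of an even periodic function *)

Section DFT.
Context {R : realType}.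
Variables (f f1 f2 f3 f4 : R -> R) (L : R).
Hypotheses (d0 : der f f1) (d1 : der f1 f2) (d2 : der f2 f3) (d3 : der f3 f4).
Hypothesis f4L : forall t, `|f4 t| <= L.
Hypothesis fper : forall t, f (t + 2 * pi) = f t.
Hypothesis feven : forall t, f (- t) = f t.

(* Coefficients of the discrete Fourier transform with Q nodes; a fixed Q avoids
   any convergence question, and Q -> oo is only taken at the end. *)
Definition coef (g : R -> R) (Q k : nat) : R :=
  Q%:R^-1 * \sum_(0 <= j < Q) g (j%:R * (2 * pi / Q%:R)) * cos (k%:R * (j%:R * (2 * pi / Q%:R))).

Lemma sin_sum0 (Q k : nat) :
  \sum_(0 <= j < Q) f (j%:R * (2 * pi / Q%:R)) * sin (k%:R * (j%:R * (2 * pi / Q%:R))) = 0.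
Proof.
case: Q => [|Q]; first by rewrite big_geq.
have Q0 : Q.+1%:R != 0 :> R by rewrite pnatr_eq0.
rewrite big_nat_recl//= !mul0r mulr0 sin0 mulr0 add0r.
set S := \sum_(0 <= i < Q) _.
suff : S = - S by lra.
rewrite {1}/S big_nat_rev /= add0n -sumrN big_nat_cond [RHS]big_nat_cond.
apply: eq_bigr => i; rewrite andbT => /andP[_ iQ].
have -> : (Q - i.+1).+1%:R * (2 * pi / Q.+1%:R) = - (i.+1%:R * (2 * pi / Q.+1%:R)) + 1%:R * (2 * pi) :> R.
  rewrite subnS prednK ?subn_gt0// natrB ?(ltnW iQ)//; field.
  by rewrite addrC natr1.
rewrite (per_nat 1)// feven -[RHS]mulrN -[X in _ = _ * X]sinN; congr (_ * _).
have -> : k%:R * (- (i.+1%:R * (2 * pi / Q.+1%:R)) + 1%:R * (2 * pi)) =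
   - (k%:R * (i.+1%:R * (2 * pi / Q.+1%:R))) + k%:R * (2 * pi) :> R by ring.
exact: sin_per_nat.
Qed.

(** Evenness makes all sine coefficients vanish, so the cosines of a full period of frequencies
    suffice. *)
Lemma dft_inversion (Q i : nat) : (0 < Q)%N ->
  f (i%:R * (2 * pi / Q%:R)) = \sum_(0 <= k < Q) coef f Q k * cos (k%:R * (i%:R * (2 * pi / Q%:R))).
Proof.
move=> Q0; have Qn : Q%:R != 0 :> R by rewrite pnatr_eq0 -lt0n.
wlog iQ : i / (i < Q)%N.
  move=> H; have := H (i %% Q)%N (ltn_pmod i Q0).
  have E : i%:R * (2 * pi / Q%:R) = (i %% Q)%:R * (2 * pi / Q%:R) + (i %/ Q)%:R * (2 * pi) :> R.
    by rewrite {1}(divn_eq i Q) natrD natrM; field.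
  rewrite E per_nat// => ->; apply: eq_bigr => k _; congr (_ * _).
  have -> : k%:R * ((i %% Q)%:R * (2 * pi / Q%:R) + (i %/ Q)%:R * (2 * pi)) =
    k%:R * ((i %% Q)%:R * (2 * pi / Q%:R)) + (k * (i %/ Q))%:R * (2 * pi) :> R by rewrite natrM; ring.
  by rewrite cos_per_nat.
transitivity (Q%:R^-1 * \sum_(0 <= j < Q) f (j%:R * (2 * pi / Q%:R)) *
    \sum_(0 <= k < Q) cos (k%:R * ((j%:R - i%:R) * (2 * pi / Q%:R)))).
  rewrite (eq_big_nat _ _ (F2 := fun j => if j == i then Q%:R * f (i%:R * (2 * pi / Q%:R)) else 0)).
    by rewrite -big_mkcond /= big_nat1_eq /= iQ mulKf.
  move=> j /andP[_ jQ]; rewrite cos_sumE//.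
  by have [->|] := eqVneq j i; rewrite ?mulr0// mulrC.
transitivity (Q%:R^-1 * \sum_(0 <= k < Q) (\sum_(0 <= j < Q) f (j%:R * (2 * pi / Q%:R)) *
    cos (k%:R * (j%:R * (2 * pi / Q%:R))) * cos (k%:R * (i%:R * (2 * pi / Q%:R)))
    + (\sum_(0 <= j < Q) f (j%:R * (2 * pi / Q%:R)) * sin (k%:R * (j%:R * (2 * pi / Q%:R))))
      * sin (k%:R * (i%:R * (2 * pi / Q%:R))))).
  congr (_ * _).
  under eq_bigr do rewrite mulr_sumr.
  rewrite exchange_big /=; apply: eq_bigr => k _; rewrite mulr_suml -big_split /=.
  apply: eq_bigr => j _.
  have -> : k%:R * ((j%:R - i%:R) * (2 * pi / Q%:R)) = k%:R * (j%:R * (2 * pi / Q%:R)) - k%:R * (i%:R * (2 * pi / Q%:R)) :> R by ring.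
  by rewrite cosB; ring.
rewrite mulr_sumr; apply: eq_bigr => k _.
by rewrite sin_sum0 mul0r addr0 -mulr_suml [LHS]mulrA.
Qed.

Lemma coef_sym (Q k : nat) : (k <= Q)%N -> coef f Q (Q - k) = coef f Q k.
Proof.
move=> kQ; congr (_ * _); apply: eq_bigr => j _; congr (_ * _).
have [->|Q0] := eqVneq Q 0%N; first by rewrite invr0 !(mulr0).
have Qn : Q%:R != 0 :> R by rewrite pnatr_eq0.
rewrite natrB//.
have -> : (Q%:R - k%:R) * (j%:R * (2 * pi / Q%:R)) = - (k%:R * (j%:R * (2 * pi / Q%:R))) + j%:R * (2 * pi) :> R.
  by field.
by rewrite cos_per_nat cosN.
Qed.

(** Aliasing, the discrete form of Poisson summation: on every P-th node the frequencies that are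
    multiples of q cannot be told from the frequency 0. *)
Lemma mean_alias (q P : nat) : (0 < q)%N -> (0 < P)%N ->
  mean q f = \sum_(0 <= l < P) coef f (q * P) (q * l).
Proof.
move=> q0 P0; have qn : q%:R != 0 :> R by rewrite pnatr_eq0 -lt0n.
have Pn : P%:R != 0 :> R by rewrite pnatr_eq0 -lt0n.
rewrite /coef -mulr_sumr exchange_big /=.
rewrite sum_mul_nat /mean.
set X := \sum_(0 <= j < q) _; set Y := \sum_(0 <= j < q) _.
suff -> : X = P%:R * Y by rewrite natrM; field; rewrite qn Pn.
rewrite /X /Y mulr_sumr; apply: eq_bigr => j _.
transitivity (\sum_(0 <= i < P) (if i == 0%N then P%:R * f (j%:R * (2 * pi / q%:R)) else 0)); last first.
  by rewrite -big_mkcond /= big_nat1_eq /= P0.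
rewrite big_nat_cond [RHS]big_nat_cond; apply: eq_bigr => i; rewrite andbT => /andP[_ iP].
rewrite -mulr_sumr natrM.
have -> : \sum_(0 <= l < P) cos ((q * l)%:R * ((j * P + i)%:R * (2 * pi / (q%:R * P%:R)))) =
   \sum_(0 <= l < P) cos (l%:R * ((i%:R - 0%:R) * (2 * pi / P%:R))) :> R.
  apply: eq_bigr => l _.
  have -> : (q * l)%:R * ((j * P + i)%:R * (2 * pi / (q%:R * P%:R))) =
     l%:R * ((i%:R - 0%:R) * (2 * pi / P%:R)) + (l * j)%:R * (2 * pi) :> R.
    by rewrite !natrM natrD natrM; field; rewrite qn Pn.
  exact: cos_per_nat.
rewrite cos_sumE//; case: eqP => [->|_]; last by rewrite mulr0.
rewrite addn0 mulrC; congr (_ * f _); rewrite natrM; field.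
by rewrite qn Pn.
Qed.

(** The absolute value of the frequency k modulo Q: with Q nodes, k and Q - k are the same
    cosine. *)
Definition freq (Q k : nat) : nat := minn k (Q - k).

(** The second difference, a substitute for H^2 times the second derivative which the discrete
    transform diagonalizes. *)
Definition sdif (H : R) (g : R -> R) (x : R) : R := g (x + H) - 2 * g x + g (x - H).

Lemma coef_sdif g (Q k : nat) : (0 < Q)%N -> (forall t, g (t + 2 * pi) = g t) ->
  coef (sdif (2 * pi / Q%:R) g) Q k = (2 * cos (k%:R * (2 * pi / Q%:R)) - 2) * coef g Q k.
Proof.
move=> Q0 gper; have Qn : Q%:R != 0 :> R by rewrite pnatr_eq0 -lt0n.
rewrite /coef [RHS]mulrCA; congr (_ * _); set H := 2 * pi / Q%:R.
have QH : Q%:R * H = 2 * pi by rewrite /H; field.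
pose F (j : nat) := g (j%:R * H) * cos (k%:R * (j%:R * H - H)).
pose E (j : nat) := g (j%:R * H - H) * cos (k%:R * (j%:R * H)).
have SF : \sum_(0 <= j < Q) F j.+1 = \sum_(0 <= j < Q) F j.
  apply: sum_shift_per; rewrite /F QH mul0r sub0r.
  have := per_nat 1 0 gper; rewrite add0r mul1r => ->; congr (_ * _).
  by rewrite mulrBr mulrN addrC cos_per_nat.
have SE : \sum_(0 <= j < Q) E j.+1 = \sum_(0 <= j < Q) E j.
  apply: sum_shift_per; rewrite /E QH !mul0r mulr0 sub0r.
  have -> : 2 * pi - H = - H + 2 * pi by ring.
  by rewrite gper -[k%:R * _]add0r cos_per_nat.
transitivity (\sum_(0 <= j < Q) F j.+1 - 2 * \sum_(0 <= j < Q) g (j%:R * H) * cos (k%:R * (j%:R * H))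
   + \sum_(0 <= j < Q) E j).
  rewrite mulr_sumr -sumrB -big_split /=; apply: eq_bigr => j _.
  by rewrite /F /E /sdif -[j.+1%:R]natr1 [(_ + 1) * H]mulrDl mul1r addrK; ring.
rewrite SF -SE mulrBl !mulr_sumr -!sumrB -big_split /=; apply: eq_bigr => j _.
rewrite /F /E -[j.+1%:R]natr1 [(_ + 1) * H]mulrDl mul1r addrK.
have -> : k%:R * (j%:R * H - H) = k%:R * (j%:R * H) - k%:R * H by ring.
have -> : k%:R * (j%:R * H + H) = k%:R * (j%:R * H) + k%:R * H by ring.
by rewrite cosB cosD; ring.
Qed.

Lemma sdif_le g g1 g2 M H x : der g g1 -> der g1 g2 -> (forall t, `|g2 t| <= M) ->
  `|sdif H g x| <= 2 * M * H ^+ 2.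
Proof.
move=> dg dg1 gM.
have h1 := taylor2 x (x + H) dg dg1 gM; have h2 := taylor2 x (x - H) dg dg1 gM.
have -> : sdif H g x = (g (x + H) - g x - g1 x * (x + H - x)) + (g (x - H) - g x - g1 x * (x - H - x)).
  by rewrite /sdif; ring.
apply: (le_trans (ler_normD _ _)); apply: (le_trans (lerD h1 h2)).
have -> : x + H - x = H by ring.
have -> : x - H - x = - H by ring.
by rewrite normrN real_normK ?num_real//; lra.
Qed.

Lemma der_sdif g g1 H : der g g1 -> der (sdif H g) (sdif H g1).
Proof.
move=> dg.
have dp : der (fun s => s + H) (fun=> 1).
  by apply: (der_eq (der_add der_id (der_cst H))) => s; rewrite addr0.
have dm : der (fun s => s - H) (fun=> 1).
  by apply: (der_eq (der_sub der_id (der_cst H))) => s; rewrite subr0.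
apply: (der_eq (der_add (der_sub (der_comp dg dp) (der_scale 2 dg)) (der_comp dg dm))) => t.
by rewrite /sdif; ring.
Qed.

Lemma cos_freq (Q k i : nat) : (k <= Q)%N ->
  cos (k%:R * (i%:R * (2 * pi / Q%:R))) = cos ((freq Q k)%:R * (i%:R * (2 * pi / Q%:R))) :> R.
Proof.
move=> kQ; rewrite /freq /minn; case: ifP => // _.
have [->|Q0] := eqVneq Q 0%N; first by rewrite invr0 !mulr0.
have Qn : Q%:R != 0 :> R by rewrite pnatr_eq0.
rewrite natrB//.
have -> : (Q%:R - k%:R) * (i%:R * (2 * pi / Q%:R)) = - (k%:R * (i%:R * (2 * pi / Q%:R))) + i%:R * (2 * pi) :> R.
  by field.
by rewrite cos_per_nat cosN.
Qed.

Lemma freq_half Q k : (k <= Q)%N -> ((freq Q k).*2 <= Q)%N.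
Proof. by rewrite /freq; lia. Qed.

(** Two second differences replace four integrations by parts. Each multiplies the coefficient by at
    least (w H)^2 / 9 in absolute value, because |w H| <= pi for the reduced frequency w; the square
    of 9 is the factor 81. *)
Lemma coef_decay (Q k : nat) : (0 < k < Q)%N ->
  `|coef f Q k| <= 4 * 81 * L / (freq Q k)%:R ^+ 4.
Proof.
move=> /andP[k0 kQ]; have Q0 : (0 < Q)%N by apply: leq_trans kQ.
have Qn : 0 < Q%:R :> R by rewrite ltr0n.
have p0 := @pi_gt0 R.
pose H : R := 2 * pi / Q%:R; have H0 : 0 < H by rewrite /H divr_gt0// mulr_gt0.
have L0 : 0 <= L by exact: le_trans (f4L 0).
set w := freq Q k; have w0 : 0 < w%:R :> R.
  by rewrite ltr0n /w /freq leq_min k0 subn_gt0.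
have sper (g : R -> R) : (forall t, g (t + 2 * pi) = g t) -> forall t, sdif H g (t + 2 * pi) = sdif H g t.
  by move=> gp t; rewrite /sdif [t + _ + H]addrAC [t + _ - H]addrAC !gp.
have E := coef_sdif k Q0 (sper _ fper); rewrite (coef_sdif k Q0 fper) mulrA in E.
have B : `|coef (sdif H (sdif H f)) Q k| <= 4 * L * H ^+ 4.
  rewrite /coef normrM ger0_norm ?invr_ge0// mulrC ler_pdivrMr//.
  apply: (le_trans (ler_sum_abs (G := fun=> 4 * L * H ^+ 4) _)) => [j _|]; last first.
    by rewrite sumr_const_nat subn0 -[_ *+ Q]mulr_natr.
  rewrite normrM -[leRHS]mulr1; apply: ler_pM => //; last by rewrite ler_norml cos_geN1 cos_le1.
  have -> : 4 * L * H ^+ 4 = 2 * (2 * L * H ^+ 2) * H ^+ 2 by ring.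
  apply: (@sdif_le (sdif H f) (sdif H f1) (sdif H f2)); try exact: der_sdif.
  by move=> t; exact: (@sdif_le f2 f3 f4).
rewrite E normrM in B.
have C : (w%:R * H) ^+ 2 / 9 <= `|2 * cos (k%:R * H) - 2|.
  have := @cos_freq Q k 1 (ltnW kQ); rewrite mul1r -/H -/w => ->.
  have wH : `|w%:R * H| <= pi.
    have wQ : w%:R * 2 <= Q%:R :> R by rewrite -natrM ler_nat muln2 freq_half// ltnW.
    have pQ : 0 <= pi / Q%:R :> R by rewrite divr_ge0// ltW.
    have -> : w%:R * H = w%:R * 2 * (pi / Q%:R) by rewrite /H; ring.
    rewrite ger0_norm; last by apply: mulr_ge0 => //; rewrite mulr_ge0// ltW.
    apply: (le_trans (ler_wpM2r pQ wQ)).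
    by rewrite mulrC divfK// gt_eqF.
  have := one_sub_cos_ge wH; rewrite -normrN => h; apply: le_trans (ler_norm _).
  by lra.
rewrite ler_pdivlMr ?exprn_gt0//.
have : ((w%:R * H) ^+ 2 / 9) * ((w%:R * H) ^+ 2 / 9) * `|coef f Q k| <= 4 * L * H ^+ 4.
  apply: le_trans B; rewrite normrM; apply: ler_wpM2r => //.
  by rewrite -/H normrM; apply: ler_pM => //; rewrite divr_ge0// sqr_ge0.
have H4 : 0 < H ^+ 4 by rewrite exprn_gt0.
have -> : (w%:R * H) ^+ 2 / 9 * ((w%:R * H) ^+ 2 / 9) * `|coef f Q k| = (`|coef f Q k| * w%:R ^+ 4 / 81) * H ^+ 4.
  by field.
by rewrite ler_pM2r//; lra.
Qed.

Lemma freq_sum (phi : nat -> R) Q : (forall w, 0 <= phi w) ->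
  \sum_(1 <= k < Q) phi (freq Q k) <= 2 * \sum_(1 <= w < Q) phi w.
Proof.
move=> p0.
apply: (@le_trans _ _ (\sum_(1 <= k < Q) (phi k + phi (Q - k)%N))).
  apply: ler_sum => k _; rewrite /freq /minn; case: ifP => _; first by rewrite lerDl.
  by rewrite lerDr.
rewrite big_split /= mulr2n mulrDl mul1r lerD2l big_nat_rev /=.
rewrite big_nat_cond [leRHS]big_nat_cond; apply: ler_sum => k /andP[/andP[k1 kQ] _].
by rewrite add1n subSS subKn// ltnW.
Qed.

End DFT.

(** * From averages over polygons to a Hoelder bound *)

Section DFTBounds.
Context {R : realType}.
Variables (f f1 f2 f3 f4 : R -> R) (L : R).
Hypotheses (d0 : der f f1) (d1 : der f1 f2) (d2 : der f2 f3) (d3 : der f3 f4).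
Hypothesis f3L : forall t, `|f3 t| <= L.
Hypothesis f4L : forall t, `|f4 t| <= L.
Hypothesis fper : forall t, f (t + 2 * pi) = f t.
Hypothesis feven : forall t, f (- t) = f t.

Lemma L_ge0 : 0 <= L.
Proof. exact: le_trans (f4L 0). Qed.

Lemma coef0_mean Q : coef f Q 0 = mean Q f.
Proof. by congr (_ * _); apply: eq_bigr => j _; rewrite mul0r cos0 mulr1. Qed.

Lemma freqM q P l : freq (q * P) (q * l) = (q * freq P l)%N.
Proof. by rewrite /freq -mulnBr minnMr. Qed.

Lemma mean_alias_tail (q P : nat) (phi : nat -> R) : (0 < q)%N -> (0 < P)%N ->
  (forall k, (0 < k < q * P)%N -> `|coef f (q * P) k| <= phi (freq (q * P) k)) ->
  (forall w, 0 <= phi w) ->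
  `|mean q f - mean (q * P) f| <= 2 * \sum_(1 <= l < P) phi (q * l)%N.
Proof.
move=> q0 P0 H phi0; rewrite (mean_alias f q0 P0) big_ltn// muln0 coef0_mean addrC addKr.
apply: (le_trans (ler_norm_sum _ _ _)).
apply: (@le_trans _ _ (\sum_(1 <= l < P) (fun l => phi (q * l)%N) (freq P l))).
  rewrite big_nat_cond [leRHS]big_nat_cond; apply: ler_sum => l /andP[/andP[l1 lP] _].
  rewrite -freqM; apply: H; rewrite muln_gt0 q0 l1/= ltn_pmul2l//.
exact: freq_sum.
Qed.

Lemma mean_converges (q r : nat) : (0 < q)%N -> (0 < r)%N ->
  `|mean q f - mean (q * r) f| <= 2 * (4 * 81 * L / q%:R ^+ 4 * 2).
Proof.
move=> q0 r0; have L0 := L_ge0; have q_gt : 0 < q%:R :> R by rewrite ltr0n.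
pose phi (w : nat) := 4 * 81 * L / w%:R ^+ 4.
have p0 w : 0 <= phi w by rewrite divr_ge0 ?exprn_ge0// mulr_ge0.
apply: (le_trans (mean_alias_tail q0 r0 _ p0)) => [k kq|].
  exact: (coef_decay d0 d1 d2 d3 f4L fper kq).
have S n : \sum_(1 <= l < n) (l%:R ^+ 4)^-1 <= 2 :> R.
  have [n1|n1] := leqP n 1; first by rewrite big_geq.
  rewrite big_ltn// expr1n invr1.
  apply: (@le_trans _ _ (1 + \sum_(2 <= l < n) (pw l)^-1)); last by have := @pw_sum R n; lra.
  rewrite lerD2l big_nat_cond [leRHS]big_nat_cond; apply: ler_sum => l /andP[/andP[l2 _] _].
  have l1 : (0 < l)%N by apply: leq_trans l2.
  have l1' : 1 <= l%:R :> R by rewrite ler1n.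
  rewrite lef_pV2 ?posrE ?exprn_gt0 ?pw_gt0 ?ltr0n// exprSr /pw; apply: ler_wpM2l.
    by rewrite exprn_ge0.
  rewrite -[leRHS]ger0_norm// -sqrtr_sqr; apply: ler_wsqrtr.
  by rewrite expr2 ler_peMl.
have -> : \sum_(1 <= l < r) phi (q * l)%N = 4 * 81 * L / q%:R ^+ 4 * \sum_(1 <= l < r) (l%:R ^+ 4)^-1.
  rewrite mulr_sumr; apply: eq_bigr => l _.
  by rewrite /phi natrM exprMn invfM mulrA.
by rewrite ler_wpM2l// ler_wpM2l// divr_ge0 ?exprn_ge0// mulr_ge0.
Qed.

Variable T : R.
Hypothesis fT : forall q, (0 < q)%N -> `|mean q f| <= T / pw q.

Section Nodes.
Variable K : nat.
Hypothesis K0 : (0 < K)%N.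

(* A common multiple of all q <= K.+3. *)
Definition nodes := (K.+3)`!.

Lemma nodes_gt0 : (0 < nodes)%N. Proof. exact: fact_gt0. Qed.

(** The factor 3 ensures that w and [nodes - w] are two distinct frequencies, to be separated from
    the sum of [mean_alias]. *)
Lemma nodes_ge w : (w <= K)%N -> (3 * w <= nodes)%N.
Proof.
move=> wK; rewrite /nodes !factS.
have f0 := fact_gt0 K.+1.
apply: (@leq_trans (K.+3 * (K.+2 * 1))); last by rewrite !leq_mul2l f0 !orbT.
by rewrite muln1; nia.
Qed.

Lemma nodes_dvd w : (0 < w <= K)%N -> (w %| nodes)%N.
Proof. by move=> /andP[w0 wK]; apply: dvdn_fact; rewrite w0 /= (leq_trans wK)// -addn3 leq_addr. Qed.

Let small : R := 4 * 81 * L / Num.sqrt K%:R.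

(** For w <= K the average over the w-gon contains the equal coefficients at w and [nodes - w], the
    average over all nodes, and coefficients at further multiples of w; by [pw_sum] the latter add
    up to at most half of N / [pw w]. For w > K the a priori decay w^(-4) is better than w^(-7/2) by
    the factor 1 / sqrt K in [small]. *)
Lemma coef_step (N : R) k : 0 <= N ->
  (forall k, (0 < k < nodes)%N -> `|coef f nodes k| <= N / pw (freq nodes k)) ->
  (0 < k < nodes)%N ->
  `|coef f nodes k| <= Num.max (T + N / 4) small / pw (freq nodes k).
Proof.
move=> N0 H /andP[k0 kQ]; have L0 := L_ge0.
set w := freq nodes k; have w0 : (0 < w)%N by rewrite /w /freq leq_min k0 subn_gt0.
have pw0 := @pw_gt0 R w w0.
have [wK|Kw] := leqP w K; last first.
  have c := coef_decay d0 d1 d2 d3 f4L fper (introT andP (conj k0 kQ)).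
  apply: (le_trans c); rewrite ler_pdivlMr//.
  rewrite le_max; apply/orP; right; rewrite -/w /small /pw.
  have w0' : 0 < w%:R :> R by rewrite ltr0n.
  have sw : 0 < Num.sqrt w%:R :> R by rewrite sqrtr_gt0.
  have swE : Num.sqrt w%:R * Num.sqrt w%:R = w%:R :> R by rewrite -expr2 sqr_sqrtr// ltW.
  have -> : 4 * 81 * L / w%:R ^+ 4 * (w%:R ^+ 3 * Num.sqrt w%:R) = 4 * 81 * L / Num.sqrt w%:R.
    have E (s W : R) : s != 0 -> s * s = W -> 4 * 81 * L / W ^+ 4 * (W ^+ 3 * s) = 4 * 81 * L / s.
      by move=> s0 <-; field.
    by apply: E => //; rewrite gt_eqF.
  apply: ler_wpM2l; first by rewrite !mulr_ge0.
  rewrite lef_pV2 ?posrE// ?sqrtr_gt0 ?ltr0n//; apply: ler_wsqrtr.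
  by rewrite ler_nat ltnW.
rewrite ler_pdivlMr// le_max; apply/orP; left.
have dw : (w %| nodes)%N by apply: nodes_dvd; rewrite w0.
set P := (nodes %/ w)%N; have QE : nodes = (w * P)%N by rewrite mulnC divnK.
have P3 : (3 <= P)%N by rewrite leq_divRL// nodes_ge.
have cw : coef f nodes k = coef f nodes w.
  rewrite /w /freq /minn; case: ifP => // _; rewrite coef_sym//; exact: ltnW.
have cP : coef f nodes (w * P.-1) = coef f nodes w.
  rewrite -(coef_sym f (k := w)) ?QE ?leq_pmulr ?(leq_trans _ P3)//.
  by rewrite -subn1 mulnBr muln1.
have E := mean_alias f w0 (leq_trans (isT : (0 < 3)%N) P3).
rewrite -QE in E.
have E' : mean w f - mean nodes f - \sum_(2 <= l < P.-1) coef f nodes (w * l) = 2 * coef f nodes w.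
  rewrite E big_ltn ?(leq_trans _ P3)// muln0 coef0_mean.
  rewrite big_ltn ?(leq_trans _ P3)// muln1.
  rewrite -(prednK (leq_trans (isT : (0 < 3)%N) P3)) big_nat_recr/=; last first.
    by rewrite -ltnS prednK ?(leq_trans _ P3).
  by rewrite cP; ring.
have tail : `|\sum_(2 <= l < P.-1) coef f nodes (w * l)| <= N / pw w / 2.
  apply: (le_trans (ler_norm_sum _ _ _)).
  apply: (@le_trans _ _ (\sum_(2 <= l < P.-1) N / pw w * ((pw l)^-1 + (pw (P - l))^-1))).
    rewrite big_nat_cond [leRHS]big_nat_cond; apply: ler_sum => l /andP[/andP[l2 lP] _].
    have lP' : (l < P)%N by apply: leq_trans (leq_pred P).
    have l0 : (0 < l)%N by apply: leq_trans l2.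
    apply: le_trans (H (w * l)%N _) _.
      by rewrite muln_gt0 w0 l0 QE ltn_pmul2l.
    have -> : freq nodes (w * l) = (w * freq P l)%N by rewrite QE freqM.
    rewrite pwM invfM mulrA; apply: ler_wpM2l; first by rewrite divr_ge0// ltW.
    rewrite /freq /minn; case: ifP => _; rewrite ?lerDl ?lerDr invr_ge0 ltW// pw_gt0//.
    by rewrite subn_gt0.
  rewrite -mulr_sumr; apply: ler_wpM2l; first by rewrite divr_ge0// ltW.
  rewrite big_split /=.
  have -> : \sum_(2 <= i < P.-1) (pw (P - i))^-1 = \sum_(2 <= i < P.-1) (pw i)^-1 :> R.
    rewrite big_nat_rev /= big_nat_cond [RHS]big_nat_cond.
    apply: eq_bigr => i /andP[/andP[i2 iP] _]; congr (pw _)^-1; lia.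
  have := @pw_sum R P.-1; lra.
have m1 := fT w0; have m2 := fT nodes_gt0.
have m3 : T / pw nodes <= T / pw w.
  have T0 : 0 <= T by have := le_trans (normr_ge0 _) m1; rewrite pmulr_lge0// invr_gt0.
  apply: ler_wpM2l => //; rewrite lef_pV2 ?posrE ?pw_gt0 ?nodes_gt0//.
  by apply: pw_homo; apply: dvdn_leq dw; exact: nodes_gt0.
have : `|2 * coef f nodes w| <= T / pw w + T / pw w + N / pw w / 2.
  rewrite -E'; apply: (le_trans (ler_normB _ _)); apply: lerD tail.
  by apply: (le_trans (ler_normB _ _)); apply: lerD => //; apply: le_trans m3.
rewrite cw normrM ger0_norm// => h.
rewrite -ler_pdivlMr// mulrDl; have -> : N / 4 / pw w = N / pw w / 4 by ring.
lra.
Qed.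

(** The best constant exists because there are finitely many coefficients, and [coef_step] applied
    to it bounds it by the maximum of T + N / 4 and [small]. *)
Lemma coef_bound : exists2 N : R, 0 <= N <= 2 * T + small &
  forall k, (0 < k < nodes)%N -> `|coef f nodes k| <= N / pw (freq nodes k).
Proof.
pose F (k : nat) := `|coef f nodes k| * pw (freq nodes k).
pose N := \big[Num.max/0]_(k < nodes | (0 < k)%N) F k.
have N0 : 0 <= N by rewrite /N; elim/big_ind: _ => // [x y x0 y0|k _]; rewrite ?le_max ?x0// mulr_ge0// /pw mulr_ge0 ?exprn_ge0 ?sqrtr_ge0.
have fpos k : (0 < k < nodes)%N -> 0 < pw (freq nodes k) :> R.
  by move=> /andP[k0 kQ]; rewrite pw_gt0// /freq leq_min k0 subn_gt0.
have NH k : (0 < k < nodes)%N -> `|coef f nodes k| <= N / pw (freq nodes k).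
  move=> kk; rewrite ler_pdivlMr ?fpos//; case/andP: kk => k0 kQ.
  by rewrite /N (bigD1 (Ordinal kQ))//= le_max lexx.
exists N => //; rewrite N0 /=.
have T0 : 0 <= T.
  by have := le_trans (normr_ge0 _) (fT nodes_gt0); rewrite pmulr_lge0// invr_gt0 pw_gt0// nodes_gt0.
have s0 : 0 <= small by rewrite /small divr_ge0 ?sqrtr_ge0// mulr_ge0// L_ge0.
have : N <= Num.max (T + N / 4) small.
  rewrite {1}/N; elim/big_ind: _ => [|x y hx hy|k k0].
  - by rewrite le_max s0 orbT.
  - by rewrite ge_max hx hy.
  - have kk : (0 < k < nodes)%N by rewrite k0 ltn_ord.
    by rewrite /F -ler_pdivlMr ?fpos//; exact: coef_step.
by rewrite le_max => /orP[]; lra.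
Qed.

Definition grid_step : R := 2 * pi / nodes%:R.

(** Second differences multiply the coefficient of frequency w by at most (w H)^2, which leaves N
    H^2 w^(-3/2), to be summed by [hoelder_sum]; each frequency w occurs at most twice. *)
Lemma grid_hoelder : exists2 N : R, 0 <= N <= 2 * T + small &
  forall i j : nat, `|sdif grid_step f (i%:R * grid_step) - sdif grid_step f (j%:R * grid_step)|
    <= 20 * N * grid_step ^+ 2 * Num.sqrt `|i%:R * grid_step - j%:R * grid_step|.
Proof.
have [N N0 HN] := coef_bound; exists N => // i j.
rewrite /grid_step; set H : R := 2 * pi / nodes%:R.
have Q0 := nodes_gt0; have p0 := @pi_gt0 R.
have Qn : 0 < nodes%:R :> R by rewrite ltr0n.
have H0 : 0 < H by rewrite /H divr_gt0// mulr_gt0.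
have sper t : sdif H f (t + 2 * pi) = sdif H f t.
  by rewrite /sdif [t + _ + H]addrAC [t + _ - H]addrAC !fper.
have sev t : sdif H f (- t) = sdif H f t.
  rewrite /sdif feven -(feven (- t + H)) -(feven (- t - H)) !opprD !opprK; ring.
set t := `|i%:R * H - j%:R * H|.
rewrite !(dft_inversion sper sev _ Q0) -sumrB big_ltn// mul0r cos0 mul0r cos0 subrr add0r.
apply: (le_trans (ler_norm_sum _ _ _)).
pose phi (w : nat) := N * H ^+ 2 * ((w%:R * Num.sqrt w%:R)^-1 * Num.min 2 (w%:R * t)).
case/andP: N0 => N0 _.
apply: (@le_trans _ _ (\sum_(1 <= k < nodes) phi (freq nodes k))).
  rewrite big_nat_cond [leRHS]big_nat_cond; apply: ler_sum => k /andP[/andP[k0 kQ] _].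
  set w := freq nodes k; have w0 : (0 < w)%N by rewrite /w /freq leq_min k0 subn_gt0.
  have w0' : 0 < w%:R :> R by rewrite ltr0n.
  have sw : 0 < Num.sqrt w%:R :> R by rewrite sqrtr_gt0.
  rewrite (coef_sdif k Q0 fper) -/H -mulrBr normrM [`|_ * coef _ _ _|]normrM.
  rewrite !(cos_freq _ (ltnW kQ)) -/w.
  have c1 : `|2 * cos (k%:R * H) - 2| <= (w%:R * H) ^+ 2.
    have := @cos_freq R nodes k 1 (ltnW kQ); rewrite mul1r -/H -/w => ->.
    have wH : 0 <= w%:R * H by rewrite mulr_ge0 ?ltW.
    have := cos_ge_quad wH; have := cos_le1 (w%:R * H).
    by move=> ? ?; rewrite ler_norml; apply/andP; split; [|have := sqr_ge0 (w%:R * H)]; lra.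
  have c2 : `|cos (w%:R * (i%:R * H)) - cos (w%:R * (j%:R * H))| <= Num.min 2 (w%:R * t).
    rewrite le_min; apply/andP; split.
      have := cos_le1 (w%:R * (i%:R * H)); have := cos_le1 (w%:R * (j%:R * H)).
      have := cos_geN1 (w%:R * (i%:R * H)); have := cos_geN1 (w%:R * (j%:R * H)).
      by move=> *; rewrite ler_norml; apply/andP; lra.
    have := @mvt_le_glob _ _ _ 1 (w%:R * (j%:R * H)) (w%:R * (i%:R * H)) der_cos.
    rewrite mul1r -mulrBr normrM (ger0_norm (ltW w0')) -/t; apply => s.
    by rewrite normrN ler_norml sin_geN1 sin_le1.
  have c3 := HN k (introT andP (conj k0 kQ)).
  have := ler_pM (mulr_ge0 (normr_ge0 _) (normr_ge0 _)) (normr_ge0 _) (ler_pM (normr_ge0 _) (normr_ge0 _) c1 c3) c2.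
  move/le_trans; apply; rewrite -/w /phi /pw le_eqVlt; apply/orP; left; apply/eqP.
  by move: (Num.min _ _) => mn; field; rewrite !gt_eqF.
apply: (le_trans (freq_sum _ _)) => [w|].
  apply: mulr_ge0; first by apply: mulr_ge0 => //; exact: sqr_ge0.
  apply: mulr_ge0; first by rewrite invr_ge0 mulr_ge0// sqrtr_ge0.
  by rewrite le_min ler0n /= mulr_ge0// normr_ge0.
rewrite /phi -mulr_sumr.
have z : 0 <= N * H ^+ 2 by rewrite mulr_ge0// sqr_ge0.
have := ler_wpM2l z (@hoelder_sum R nodes t (normr_ge0 _)).
have -> : 20 * N * H ^+ 2 * Num.sqrt t = 20 * (N * H ^+ 2 * Num.sqrt t) by ring.
rewrite [N * H ^+ 2 * (10 * _)]mulrCA; lra.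
Qed.

End Nodes.

Lemma sdif_taylor H x : `|sdif H f x - H ^+ 2 * f2 x| <= 2 * L * `|H| ^+ 3.
Proof.
have dp : der (fun s => x + s) (fun=> 1).
  by apply: (der_eq (der_add (der_cst x) der_id)) => s; rewrite add0r.
have dm : der (fun s => x - s) (fun=> -1).
  by apply: (der_eq (der_sub (der_cst x) der_id)) => s; rewrite sub0r.
have D1 : der (fun s => f1 (x + s) - f1 (x - s) - 2 * f2 x * s) (fun s => f2 (x + s) + f2 (x - s) - 2 * f2 x).
  by apply: (der_eq (der_sub (der_sub (der_comp d1 dp) (der_comp d1 dm)) (der_scale _ der_id))) => s; ring.
have D0 : der (fun s => f (x + s) + f (x - s) - 2 * f x - f2 x * (s * s))
  (fun s => f1 (x + s) - f1 (x - s) - 2 * f2 x * s).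
  by apply: (der_eq (der_sub (der_sub (der_add (der_comp d0 dp) (der_comp d0 dm)) (der_cst _))
    (der_scale _ (der_mul der_id der_id)))) => s; ring.
have B2 s : `|f2 (x + s) + f2 (x - s) - 2 * f2 x| <= 2 * L * `|s| ^+ 1.
  have -> : f2 (x + s) + f2 (x - s) - 2 * f2 x = (f2 (x + s) - f2 x) + (f2 (x - s) - f2 x) by ring.
  apply: (le_trans (ler_normD _ _)); rewrite expr1.
  have h1 := mvt_le_glob x (x + s) d2 f3L; have h2 := mvt_le_glob x (x - s) d2 f3L.
  have e1 : x + s - x = s by ring.
  have e2 : x - s - x = - s by ring.
  by rewrite e1 in h1; rewrite e2 normrN in h2; lra.
have H1 := pow_primitive_bound D1 _ B2; rewrite addr0 subr0 in H1.
have {}H1 : forall s, `|f1 (x + s) - f1 (x - s) - 2 * f2 x * s| <= 2 * L * `|s| ^+ 2.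
  by apply: H1; ring.
have := pow_primitive_bound D0 _ H1; rewrite addr0 subr0 => H0.
have -> : sdif H f x - H ^+ 2 * f2 x = f (x + H) + f (x - H) - 2 * f x - f2 x * (H * H).
  by rewrite /sdif; ring.
by apply: H0; ring.
Qed.

Lemma vanishing_inv_sqrt (a b C : R) : (forall K : nat, (0 < K)%N -> a <= b + C / Num.sqrt K%:R) -> a <= b.
Proof.
move=> H; rewrite leNgt; apply/negP => ba.
have D0 : 0 < a - b by rewrite subr_gt0.
pose K := (Num.truncn ((C / (a - b)) ^+ 2)).+1.
have Kgt : (C / (a - b)) ^+ 2 < K%:R by rewrite truncnS_gt.
have := H K isT; have K0 : 0 < K%:R :> R by rewrite ltr0n.
have s0 : 0 < Num.sqrt K%:R :> R by rewrite sqrtr_gt0.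
have : `|C / (a - b)| < Num.sqrt K%:R by rewrite -sqrtr_sqr ltr_sqrt.
rewrite ltr_norml => /andP[_]; rewrite ltr_pdivrMr// => h1.
rewrite -lerBlDl ler_pdivlMr//; lra.
Qed.

(** The limit K -> oo: both points are rounded to the grid and second derivatives are replaced by
    second differences. All errors, and the part [small] of the constant, are O(1 / sqrt K). *)
Lemma dft_hoelder x y : `|f2 x - f2 y| <= 40 * T * Num.sqrt `|x - y|.
Proof.
have L0 := L_ge0; have p0 := @pi_gt0 R; have p4 := @pi_lt4 R.
have T0 : 0 <= T.
  by have := le_trans (normr_ge0 _) (@fT 1%N isT); rewrite pmulr_lge0// invr_gt0 pw_gt0.
set t := `|x - y|; have st0 := sqrtr_ge0 t.
have f2per s : f2 (s + 2 * pi) = f2 s.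
  have D (g g1 : R -> R) : der g g1 -> (forall s, g (s + 2 * pi) = g s) -> forall s, g1 (s + 2 * pi) = g1 s.
    move=> dg gp; have dp : der (fun s : R => s + 2 * pi) (fun=> 1).
      by apply: (der_eq (der_add der_id (der_cst _))) => u; rewrite addr0.
    have E : der g (fun s => g1 (s + 2 * pi)).
      apply: (der_ext (f := fun s => g (s + 2 * pi))) => // .
      by apply: (der_eq (der_comp dg dp)) => u; rewrite mulr1.
    exact: der_uniq E dg.
  exact: (D f1 f2 d1 (D f f1 d0 fper)).
apply: (@vanishing_inv_sqrt _ _ (20 * (4 * 81 * L) * Num.sqrt t + 20 * (2 * T + 4 * 81 * L) * 4 + 6 * L * 8)) => K K0.
have [N /andP[N0 N1] HN] := grid_hoelder K0.
rewrite /grid_step in HN; set Q := nodes K in HN; set H := 2 * pi / Q%:R : R in HN.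
have Q0 : 0 < Q%:R :> R by rewrite ltr0n nodes_gt0.
have H0 : 0 < H by rewrite /H divr_gt0// mulr_gt0.
pose sK := Num.sqrt K%:R : R.
have sK0 : 0 < sK by rewrite sqrtr_gt0 ltr0n.
have K1 : 1 <= K%:R :> R by rewrite ler1n.
have sKE : sK * sK = K%:R by rewrite -expr2 sqr_sqrtr.
have sK1 : 1 <= sK by rewrite -[leLHS]sqrtr1; apply: ler_wsqrtr.
have iK1 : sK^-1 <= 1 by rewrite invf_le1.
have iK0 : 0 < sK^-1 by rewrite invr_gt0.
have HK : H <= 8 * (sK^-1 * sK^-1).
  have : K%:R <= Q%:R :> R by rewrite ler_nat; apply: leq_trans (nodes_ge K0 (leqnn K)); rewrite leq_pmull.
  rewrite /H -invfM sKE => KQ; apply: ler_pM; rewrite ?invr_ge0//; try lra.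
  by rewrite lef_pV2 ?posrE//; lra.
have HK1 : H <= 8 * sK^-1 by apply: (le_trans HK); nra.
have sH : Num.sqrt (2 * H) <= 4 * sK^-1.
  have -> : 4 * sK^-1 = Num.sqrt ((4 * sK^-1) ^+ 2) by rewrite sqrtr_sqr ger0_norm// mulr_ge0// ltW.
  by apply: ler_wsqrtr; rewrite exprMn !expr2; lra.
(* A number of periods that makes both points nonnegative, since grid points are indexed by natural
   numbers. *)
pose n := (Num.truncn (`|x| + `|y|)).+1.
have nbig : `|x| + `|y| < n%:R * (2 * pi).
  have h1 : `|x| + `|y| < n%:R by rewrite truncnS_gt.
  have h2 : 0 <= n%:R :> R by [].
  have := @pi_ge2 R; nra.
have approx z : `|z| <= `|x| + `|y| -> exists i : nat,
    `|z + n%:R * (2 * pi) - i%:R * H| <= H /\ `|f2 z - sdif H f (i%:R * H) / H ^+ 2| <= 3 * L * H.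
  move=> zxy; set z' := z + n%:R * (2 * pi).
  have z0 : 0 <= z' by move: zxy; rewrite ler_norml /z' => /andP[]; lra.
  have zH : 0 <= z' / H by rewrite divr_ge0// ltW.
  have /andP[i1 i2] := truncn_itv zH.
  exists (Num.truncn (z' / H)); move: (Num.truncn _) i1 i2 => i.
  rewrite ler_pdivlMr// ltr_pdivrMr// -natr1 mulrDl mul1r => i1 i2.
  have dz : `|z' - i%:R * H| <= H by rewrite ler_norml; apply/andP; lra.
  split=> //.
  have -> : f2 z = f2 z' by rewrite /z' per_nat.
  have h1 := mvt_le_glob (i%:R * H) z' d2 f3L.
  have h2 := sdif_taylor H (i%:R * H); rewrite (gtr0_norm H0) in h2.
  have -> : f2 z' - sdif H f (i%:R * H) / H ^+ 2 =
    (f2 z' - f2 (i%:R * H)) - (sdif H f (i%:R * H) - H ^+ 2 * f2 (i%:R * H)) / H ^+ 2.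
    by field; rewrite gt_eqF.
  apply: (le_trans (ler_normB _ _)).
  have : `|(sdif H f (i%:R * H) - H ^+ 2 * f2 (i%:R * H)) / H ^+ 2| <= 2 * L * H.
    rewrite normrM [`|_^-1|]ger0_norm ?invr_ge0 ?sqr_ge0// ler_pdivrMr ?exprn_gt0//.
    by apply: (le_trans h2); rewrite le_eqVlt; apply/orP; left; apply/eqP; ring.
  have : L * `|z' - i%:R * H| <= L * H by apply: ler_wpM2l.
  lra.
have [|i [i1 i2]] := approx x; first by rewrite lerDl.
have [|j [j1 j2]] := approx y; first by rewrite lerDr.
have := HN i j; rewrite -/H => hij.
have tij : `|i%:R * H - j%:R * H| <= t + 2 * H.
  have -> : i%:R * H - j%:R * H = (x - y) - (x + n%:R * (2 * pi) - i%:R * H) + (y + n%:R * (2 * pi) - j%:R * H) by ring.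
  apply: (le_trans (ler_normD _ _)); have := ler_normB (x - y) (x + n%:R * (2 * pi) - i%:R * H).
  by rewrite -/t; lra.
have sij : Num.sqrt `|i%:R * H - j%:R * H| <= Num.sqrt t + 4 * sK^-1.
  apply: (le_trans (ler_wsqrtr tij)); apply: le_trans (_ : Num.sqrt t + Num.sqrt (2 * H) <= _); last by rewrite lerD2l.
  have h2H : 0 <= 2 * H by rewrite mulr_ge0// ltW.
  have s2 := sqrtr_ge0 (2 * H).
  have -> : Num.sqrt t + Num.sqrt (2 * H) = Num.sqrt ((Num.sqrt t + Num.sqrt (2 * H)) ^+ 2).
    by rewrite sqrtr_sqr ger0_norm// addr_ge0.
  apply: ler_wsqrtr; rewrite sqrrD !sqr_sqrtr ?normr_ge0//.
  have : 0 <= Num.sqrt t * Num.sqrt (2 * H) by rewrite mulr_ge0.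
  rewrite mulr2n; lra.
have dij : `|sdif H f (i%:R * H) / H ^+ 2 - sdif H f (j%:R * H) / H ^+ 2| <= 20 * N * (Num.sqrt t + 4 * sK^-1).
  rewrite -mulrBl normrM [`|_^-1|]ger0_norm ?invr_ge0 ?sqr_ge0// ler_pdivrMr ?exprn_gt0//.
  apply: (le_trans hij).
  have -> : 20 * N * (Num.sqrt t + 4 * sK^-1) * H ^+ 2 = 20 * N * H ^+ 2 * (Num.sqrt t + 4 * sK^-1) by ring.
  by apply: ler_wpM2l => //; rewrite !mulr_ge0// ltW.
have -> : f2 x - f2 y = (f2 x - sdif H f (i%:R * H) / H ^+ 2) - (f2 y - sdif H f (j%:R * H) / H ^+ 2)
   + (sdif H f (i%:R * H) / H ^+ 2 - sdif H f (j%:R * H) / H ^+ 2) by ring.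
apply: (le_trans (ler_normD _ _)).
have := ler_normB (f2 x - sdif H f (i%:R * H) / H ^+ 2) (f2 y - sdif H f (j%:R * H) / H ^+ 2).
have LH : L * H <= L * (8 * sK^-1) by apply: ler_wpM2l.
rewrite -/sK in N1 *.
have NN : 20 * N * (Num.sqrt t + 4 * sK^-1) <= 20 * (2 * T + 4 * 81 * L / sK) * (Num.sqrt t + 4 * sK^-1).
  apply: ler_wpM2r; first by rewrite addr_ge0// mulr_ge0// ltW.
  by apply: ler_wpM2l.
have : 20 * (2 * T + 4 * 81 * L / sK) * (Num.sqrt t + 4 * sK^-1) <=
   40 * T * Num.sqrt t + (20 * (4 * 81 * L) * Num.sqrt t + 20 * (2 * T + 4 * 81 * L) * 4) / sK.
  move: (sK^-1) iK0 iK1 => c c0 c1.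
  have q1 : L * c * c <= L * c by rewrite -[leRHS]mulr1; apply: ler_wpM2l => //; rewrite mulr_ge0// ltW.
  have -> : 20 * (2 * T + 4 * 81 * L * c) * (Num.sqrt t + 4 * c) =
    40 * T * Num.sqrt t + 20 * (4 * 81 * L) * Num.sqrt t * c + 160 * T * c + 80 * 324 * (L * c * c) by ring.
  have -> : (20 * (4 * 81 * L) * Num.sqrt t + 20 * (2 * T + 4 * 81 * L) * 4) * c =
    20 * (4 * 81 * L) * Num.sqrt t * c + 160 * T * c + 80 * 324 * (L * c) by ring.
  lra.
rewrite [(_ + 6 * L * 8) / _]mulrDl; have -> : 6 * L * 8 / sK = 6 * (L * (8 * sK^-1)) by ring.
lra.
Qed.

End DFTBounds.

(** * Equal actions imply equal curves *)

Section Sequences.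
Context {R : realType}.

Lemma vanishing_inv (a b C : R) : 0 <= C ->
  (forall r : nat, (0 < r)%N -> a <= b + C / r%:R) -> a <= b.
Proof.
move=> C0 H; apply: (@vanishing_inv_sqrt _ a b C) => K K0; apply: (le_trans (H K K0)).
have K1 : 1 <= K%:R :> R by rewrite ler1n.
have s1 : 1 <= Num.sqrt K%:R :> R by rewrite -[leLHS]sqrtr1; apply: ler_wsqrtr.
have sE : Num.sqrt K%:R * Num.sqrt K%:R = K%:R :> R by rewrite -expr2 sqr_sqrtr.
rewrite lerD2l; apply: ler_wpM2l => //.
rewrite lef_pV2 ?posrE//; last by rewrite sqrtr_gt0; lra.
  by move: (Num.sqrt K%:R) s1 sE => s s1 <-; nra.
by lra.
Qed.

Definition stp (q : nat) : R := 2 * pi / q%:R.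

Lemma stp_gt0 q : (0 < q)%N -> 0 < stp q.
Proof. by move=> q0; rewrite /stp divr_gt0 ?ltr0n// mulr_gt0// pi_gt0. Qed.

Lemma stp_mul q : (0 < q)%N -> q%:R * stp q = 2 * pi.
Proof. by move=> q0; rewrite /stp mulrC divfK// pnatr_eq0 -lt0n. Qed.

Lemma stp_le3 q : (2 < q)%N -> stp q <= 2 * pi / 3.
Proof.
move=> q3; have p0 := @pi_gt0 R; rewrite /stp; apply: ler_wpM2l; first lra.
by rewrite lef_pV2 ?posrE ?ltr0n ?(ltn_trans _ q3)// ler_nat.
Qed.

Lemma stpM q r : (0 < q)%N -> (0 < r)%N -> stp (q * r) = stp q / r%:R.
Proof. by move=> q0 r0; rewrite /stp natrM invfM mulrA. Qed.

Lemma sin_stp q : (2 < q)%N -> 2 / 3 <= 2 * q%:R * sin (stp q) <= 16.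
Proof.
move=> q3; have q0 : (0 < q)%N by apply: ltn_trans q3.
have h0 := stp_gt0 q0; have h3 := stp_le3 q3; have qh := stp_mul q0.
have p2 := @pi_ge2 R; have p4 := @pi_lt4 R.
have s1 := @sin_ge_step R (stp q) (stp q).
have {}s1 : stp q / 12 <= sin (stp q) by apply: s1; apply/andP; lra.
have s2 := sin_le_id (ltW h0).
have qR : 0 < q%:R :> R by rewrite ltr0n.
have a : q%:R * (stp q / 12) <= q%:R * sin (stp q) by rewrite ler_pM2l.
have b : q%:R * sin (stp q) <= q%:R * stp q by rewrite ler_pM2l.
by rewrite -mulrA; apply/andP; lra.
Qed.

(* M q decays like q^-4 and g q has weight of order q^-2, so g (q r) -> 0 as r -> oo;
   this bounds g q, and then M q. *)
Lemma balance (M g : nat -> R) (D D' Gb L : R) : 0 <= D -> 0 <= D' ->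
  (forall q, (2 < q)%N -> `|2 * q%:R * sin (stp q) * M q + 2 * pi / 3 * stp q ^+ 2 * g q|
      <= D * (stp q ^+ 3 * Num.sqrt (stp q))) ->
  (forall q, (2 < q)%N -> `|g q| <= Gb) ->
  (forall q r, (2 < q)%N -> (0 < r)%N -> `|M q - M (q * r)%N| <= L / q%:R ^+ 4) ->
  (forall q r, (2 < q)%N -> (0 < r)%N -> `|g q - g (q * r)%N| <= D' * (stp q * Num.sqrt (stp q))) ->
  forall q, (2 < q)%N -> `|M q| <= 3 / 2 * (3 * D' + D) * (stp q ^+ 3 * Num.sqrt (stp q)).
Proof.
move=> D0 D'0 HE HG HM Hg.
have p2 := @pi_ge2 R; have p4 := @pi_lt4 R.
have G0 : 0 <= Gb by exact: le_trans (HG 3%N isT).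
have L0 : 0 <= L.
  by have := le_trans (normr_ge0 _) (HM 3%N 1%N isT isT); rewrite pmulr_lge0// invr_gt0 exprn_gt0.
have sq q : (2 < q)%N -> 0 < stp q /\ stp q <= 3 /\ 0 <= Num.sqrt (stp q) <= 2.
  move=> q3; have h0 := stp_gt0 (ltn_trans (isT : (0 < 2)%N) q3); have h3 := stp_le3 q3.
  split=> //; split; first lra.
  rewrite sqrtr_ge0 /=; have -> : 2 = Num.sqrt (2 ^+ 2) :> R by rewrite sqrtr_sqr ger0_norm.
  by apply: ler_wsqrtr; rewrite expr2; lra.
have Mg q : (2 < q)%N -> `|M q| <= 3 / 2 * (3 * stp q ^+ 2 * `|g q| + D * (stp q ^+ 3 * Num.sqrt (stp q))).
  move=> q3; have /andP[s1 s2] := sin_stp q3; have := HE q q3.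
  have h2 : 0 <= stp q ^+ 2 by exact: sqr_ge0.
  set X := 2 * q%:R * sin (stp q) * M q; set Y := 2 * pi / 3 * stp q ^+ 2 * g q.
  have Xn : 2 / 3 * `|M q| <= `|X|.
    by rewrite normrM ler_wpM2r// ger0_norm//; lra.
  have Yn : `|Y| <= 3 * stp q ^+ 2 * `|g q|.
    rewrite /Y normrM ler_wpM2r// normrM (ger0_norm h2) ler_wpM2r// ger0_norm; lra.
  move=> XY; have := ler_normB (X + Y) Y; rewrite addrK; lra.
(* The constants of this bound and of the next two are not small; they only serve to show that both
   sequences tend to 0 along multiples of q. *)
have M1 q : (2 < q)%N -> `|M q| <= (3 / 2 * (3 * Gb + D * 6) * 64) / q%:R.
  move=> q3; have [h0 [h3 /andP[r0 r2]]] := sq q q3; have qg : 0 < q%:R :> R by rewrite ltr0n (ltn_trans _ q3).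
  apply: (le_trans (Mg q q3)).
  have k1 : 3 * stp q ^+ 2 * `|g q| <= 3 * stp q ^+ 2 * Gb.
    by apply: ler_wpM2l; [rewrite mulr_ge0// sqr_ge0|exact: HG].
  have k2 : stp q ^+ 3 * Num.sqrt (stp q) <= stp q ^+ 2 * 6.
    rewrite exprSr -mulrA; apply: ler_wpM2l; first exact: sqr_ge0.
    have -> : 6 = 3 * 2 :> R by ring.
    by apply: ler_pM => //; exact: ltW.
  have k3 : stp q ^+ 2 <= 64 / q%:R.
    rewrite ler_pdivlMr// expr2 -mulrA [stp q * q%:R]mulrC stp_mul ?(ltn_trans _ q3)//.
    have : stp q * (2 * pi) <= 3 * 8 by apply: ler_pM; [exact: ltW|clear - p2; lra|exact: h3|clear - p4; lra].
    lra.
  have k4 := ler_wpM2l D0 k2.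
  have z : 0 <= 3 * Gb + D * 6 by rewrite addr_ge0// mulr_ge0.
  have := ler_wpM2l z k3; have -> : 3 / 2 * (3 * Gb + D * 6) * 64 / q%:R = 3 / 2 * ((3 * Gb + D * 6) * (64 / q%:R)) by ring.
  have -> : (3 * Gb + D * 6) * stp q ^+ 2 = 3 * stp q ^+ 2 * Gb + D * (stp q ^+ 2 * 6) by ring.
  lra.
have M2 q : (2 < q)%N -> `|M q| <= L / q%:R ^+ 4.
  move=> q3; have qg : 0 < q%:R :> R by rewrite ltr0n (ltn_trans _ q3).
  apply: (@vanishing_inv _ _ (3 / 2 * (3 * Gb + D * 6) * 64)) => [|r r0].
    by rewrite !mulr_ge0 ?invr_ge0// addr_ge0// mulr_ge0.
  have qr3 : (2 < q * r)%N by apply: (leq_trans q3); rewrite leq_pmulr.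
  have := ler_normD (M q - M (q * r)%N) (M (q * r)%N); rewrite subrK => /le_trans; apply.
  apply: lerD (HM q r q3 r0) _; apply: (le_trans (M1 _ qr3)).
  apply: ler_wpM2l; first by rewrite !mulr_ge0 ?invr_ge0// addr_ge0// mulr_ge0.
  rewrite lef_pV2 ?posrE ?ltr0n ?(ltn_trans _ qr3)// ler_nat leq_pmull// (ltn_trans _ q3)//.
have g1 q : (2 < q)%N -> `|g q| <= (L + 2 * D) * stp q.
  move=> q3; have [h0 [h3 /andP[r0 r2]]] := sq q q3; have q0 : (0 < q)%N by apply: ltn_trans q3.
  have qg : 0 < q%:R :> R by rewrite ltr0n.
  have /andP[s1 s2] := sin_stp q3; have := HE q q3.
  set X := 2 * q%:R * sin (stp q) * M q; set Y := 2 * pi / 3 * stp q ^+ 2 * g q.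
  have iq : q%:R^-1 = stp q / (2 * pi) :> R.
    by rewrite -(stp_mul q0); field; rewrite !gt_eqF.
  have iq4 : q%:R^-1 <= stp q / 4.
    rewrite iq; apply: ler_wpM2l; first exact: ltW.
    by rewrite lef_pV2 ?posrE; clear - p2; lra.
  have k1 : L / q%:R ^+ 4 <= L * (stp q / 4) ^+ 4.
    apply: ler_wpM2l => //; rewrite -exprVn; apply: lerXn2r; rewrite ?nnegrE ?invr_ge0//.
    by rewrite divr_ge0// ltW.
  have Xn : `|X| <= 16 * (L * (stp q / 4) ^+ 4).
    rewrite normrM ger0_norm; last lra.
    by apply: ler_pM => //; [lra|apply: (le_trans (M2 q q3))].
  have Yn : stp q ^+ 2 * `|g q| <= `|Y|.
    rewrite /Y normrM ler_wpM2r// normrM [`|stp q ^+ 2|]ger0_norm ?sqr_ge0//.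
    by rewrite ler_peMl ?sqr_ge0// ger0_norm; clear - p2; lra.
  move=> XY; have := ler_normB (X + Y) X; rewrite addrC addKr => YX.
  have k2 : stp q ^+ 3 * Num.sqrt (stp q) <= stp q ^+ 3 * 2.
    by apply: ler_wpM2l => //; rewrite exprn_ge0// ltW.
  have k3 := ler_wpM2l D0 k2.
  have h4 : stp q ^+ 4 <= 3 * stp q ^+ 3.
    by rewrite exprS; apply: ler_wpM2r => //; rewrite exprn_ge0// ltW.
  have k4 := ler_wpM2l L0 h4.
  have : stp q ^+ 2 * `|g q| <= stp q ^+ 2 * ((L + 2 * D) * stp q).
    have -> : stp q ^+ 2 * ((L + 2 * D) * stp q) = L * stp q ^+ 3 + D * (stp q ^+ 3 * 2) by ring.
    have e1 : 16 * (L * (stp q / 4) ^+ 4) = L * stp q ^+ 4 / 16 by field.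
    have e2 : L * (3 * stp q ^+ 3) = 3 * (L * stp q ^+ 3) by ring.
    have e3 : 0 <= L * stp q ^+ 3 by rewrite mulr_ge0// exprn_ge0// ltW.
    move: Xn k4; rewrite e1 e2 addrC; move: XY YX; rewrite addrC; move: Yn k3 e3; clear; lra.
  by rewrite ler_pM2l// exprn_gt0.
have g2 q : (2 < q)%N -> `|g q| <= D' * (stp q * Num.sqrt (stp q)).
  move=> q3; have [h0 [h3 _]] := sq q q3.
  apply: (@vanishing_inv _ _ ((L + 2 * D) * stp q)) => [|r r0].
    by apply: mulr_ge0; [rewrite addr_ge0// mulr_ge0|exact: ltW].
  have qr3 : (2 < q * r)%N by apply: (leq_trans q3); rewrite leq_pmulr.
  have := ler_normD (g q - g (q * r)%N) (g (q * r)%N); rewrite subrK => /le_trans; apply.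
  apply: lerD (Hg q r q3 r0) _; apply: (le_trans (g1 _ qr3)).
  by rewrite stpM ?mulrA// (ltn_trans _ q3).
move=> q q3; have [h0 [h3 /andP[r0 r2]]] := sq q q3.
apply: (le_trans (Mg q q3)); have h2 : 0 <= 3 * stp q ^+ 2 by rewrite mulr_ge0// sqr_ge0.
have := ler_wpM2l h2 (g2 q q3).
have -> : 3 * stp q ^+ 2 * (D' * (stp q * Num.sqrt (stp q))) = 3 * D' * (stp q ^+ 3 * Num.sqrt (stp q)) by ring.
by rewrite mulrDr -!mulrA; clear; lra.
Qed.

End Sequences.

(** * Symmetric polygons and normalized curves *)

Section Rigidity.
Context {R : realType}.

(** Displacements of polygons which have a vertex at the marked point and are symmetric about the
    axis. The bound on the steps makes the set compact; it turns out to be strict at a maximum, see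
    [maxi_step_lt]. *)
Definition adm (q : nat) (u : nat -> R) : Prop :=
  [/\ u 0%N = 0, u q = 0, (forall j, (j < q)%N -> `|u j.+1 - u j| <= stp q / 4) &
      forall j, (j <= q)%N -> u (q - j)%N = - u j].

Definition maxi (G : nat -> R -> plane R) (q : nat) (u : nat -> R) : Prop :=
  adm q u /\ forall v, adm q v -> act G (stp q) q v <= act G (stp q) q u.

Record canon (eps : R) (G : nat -> R -> plane R) : Prop := Canon {
  canon_curve : curve eps G;
  canon_sym : forall t, G 0%N (- t) = ((G 0%N t).1, - (G 0%N t).2);
  canon0 : G 0%N 0 = (1, 0);
  canonpi : G 0%N pi = (-1, 0) }.

Lemma adm_scl0 q u : adm q (scl 0 u).
Proof.
rewrite /scl; split=> [||j _|j _]; rewrite ?mul0r ?oppr0//.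
rewrite addr0 normr0; have := @pi_ge0 R => p0.
by rewrite /stp; apply: divr_ge0 => //; apply: divr_ge0 => //; apply: mulr_ge0.
Qed.

Lemma scl0E u : scl 0 u = (fun=> 0 : R).
Proof. by apply/funext => j; rewrite /scl mul0r. Qed.

(** Each maximizer is tested on the other curve. With equal maxima, the change of the action from G0
    to G1 is at most 0 on [u0] and at least 0 on [u1]; both values are within O(eps A h^(7/2)) of
    the change on the equidistant polygon. *)
Lemma equal_action_bound : exists2 C : R, 0 < C & forall (eps A : R) G0 G1 q u0 u1,
  eps <= 1 / (100 * 100 * 100) -> curve eps G0 -> curve eps G1 -> (2 < q)%N ->
  (forall t, `|dif G0 G1 0 t| <= A) ->
  (forall t, `|ff G0 G1 t| <= A) -> (forall t, `|fe G0 G1 t| <= A) ->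
  (forall x y, `|x - y| <= 4 -> `|ff G0 G1 x - ff G0 G1 y| <= A * Num.sqrt `|x - y|) ->
  maxi G0 q u0 -> maxi G1 q u1 -> act G0 (stp q) q u0 = act G1 (stp q) q u1 ->
  `|2 * q%:R * sin (stp q) * mean q (fn G0 G1) + 2 * pi / 3 * stp q ^+ 2 * mean q (fg G0 G1)|
    <= C * (eps * A) * (stp q ^+ 3 * Num.sqrt (stp q)).
Proof.
exists (128 + (100 * 100 * 100) * (256 * 100)) => [|eps A G0 G1 q u0 u1 es c0 c1 q3 a0 a1 a2 a3 [ad0 mx0] [ad1 mx1] E].
  have p1 : 0 < 100 :> R by rewrite ltr0n.
  have p2 : 0 < 256 :> R by rewrite ltr0n.
  have p3 : 0 < 128 :> R by rewrite ltr0n.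
  exact: addr_gt0 p3 (mulr_gt0 (mulr_gt0 (mulr_gt0 p1 p1) p1) (mulr_gt0 p2 p1)).
case: q q3 ad0 mx0 ad1 mx1 E => // p p2; set h := stp p.+1 => ad0 mx0 ad1 mx1 E.
have es3 : eps <= 1 / 1000 by lra.
have p0 : (0 < p.+1)%N by [].
have h0 : 0 < h by exact: stp_gt0.
have h3 : h <= 3 by have := @stp_le3 R _ p2; have := @pi_lt4 R; rewrite -/h; lra.
have A0 : 0 <= A by exact: le_trans (a0 0).
have e0 := eps_ge0 c0.
pose z := Num.sqrt h; have z0 : 0 <= z by exact: sqrtr_ge0.
have chg u G : curve eps G -> adm p.+1 u -> (act G h p.+1 (scl 0 u) <= act G h p.+1 u) ->
  `|(act G1 h p.+1 u - act G0 h p.+1 u) - (act G1 h p.+1 (scl 0 u) - act G0 h p.+1 (scl 0 u))|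
    <= (100 * 100 * 100 * eps * h ^+ 2) * (256 * 100 * A * (h * z)).
  move=> cG [u00 up uh _] um.
  apply: (le_trans (change_hoelder c0 c1 es3 p2 u00 up uh a1 a2 a3)).
  apply: ler_wpM2r; first by do ![exact: A0|exact: z0|exact: (ltW h0)|exact: ler0n|apply: mulr_ge0].
  exact: (maximizer_close cG es p2 u00 up uh um).
have b0 := chg u0 G0 c0 ad0 (mx0 _ (adm_scl0 _ _)).
have b1 := chg u1 G1 c1 ad1 (mx1 _ (adm_scl0 _ _)).
have l0 := mx0 _ ad1; have l1 := mx1 _ ad0.
rewrite -/h in l0 l1 E.
have := act_diff_mean c0 c1 p2 a0 (erefl (2 * pi / p.+1%:R)).
rewrite -/(stp p.+1) -/h.
have hz : h <= 2 * z by apply: id_le_sqrt; rewrite (ltW h0)/=; lra.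
have h4 : 64 * eps * A * h ^+ 4 <= 128 * (eps * A * (h ^+ 3 * z)).
  have -> : 128 * (eps * A * (h ^+ 3 * z)) = 64 * eps * A * (h ^+ 3 * (2 * z)) by ring.
  apply: ler_wpM2l; first by rewrite !mulr_ge0.
  by rewrite exprSr; apply: ler_wpM2l => //; rewrite exprn_ge0// ltW.
have E2 : 100 * 100 * 100 * eps * h ^+ 2 * (256 * 100 * A * (h * z)) =
  (100 * 100 * 100) * (256 * 100) * (eps * A * (h ^+ 3 * z)) by ring.
rewrite E2 in b0 b1.
rewrite scl0E in b0; rewrite scl0E in b1.
rewrite -/z -[(128 + _) * (eps * A) * _]mulrA (mulrDl 128).
move: (100 * 100 * 100 * (256 * 100) * _) b0 b1 => W b0 b1.
move: (128 * _) h4 => V h4.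
set X := _ + 2 * pi / 3 * _ * _.
move: b0 b1; move: E l0 l1.
move: (act G0 h p.+1 (fun=> 0)) (act G1 h p.+1 (fun=> 0)) => x0 x1.
move: (act G0 h p.+1 u0) (act G0 h p.+1 u1) (act G1 h p.+1 u0) (act G1 h p.+1 u1) => w1 w2 w3 w4.
rewrite !ler_norml => -> l0 l1 /andP[b1 b2] /andP[b3 b4] /andP[b5 b6].
by apply/andP; split; clear - h4 l0 l1 b1 b2 b3 b4 b5 b6; lra.
Qed.

End Rigidity.

(** * The contraction for two normalized curves *)

Section Uniqueness.
Context {R : realType}.
Variables (eps : R) (G0 G1 : nat -> R -> plane R).
Hypotheses (k0 : canon eps G0) (k1 : canon eps G1).
Hypothesis eps_tiny : eps <= 1 / (100 * 100 * 100).

Local Notation m := (mid G0 G1).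
Local Notation d := (dif G0 G1).
Local Notation n0 := (fn G0 G1).
Local Notation n1 := (fn1 G0 G1).
Local Notation n2 := (fn2 G0 G1).

Let c0 := canon_curve k0.
Let c1 := canon_curve k1.

Lemma eps_small' : eps <= 1 / 1000.
Proof. by have := eps_tiny; lra. Qed.

Lemma dif_canon0 : d 0 0 = 0.
Proof. by rewrite /dif (canon0 k0) (canon0 k1) subrr. Qed.

Lemma dif_canonpi : d 0 pi = 0.
Proof. by rewrite /dif (canonpi k0) (canonpi k1) subrr. Qed.

Lemma canon_sym1 G t : canon eps G -> G 1%N (- t) = (- (G 1%N t).1, (G 1%N t).2).
Proof.
move=> k; have [e1 e2] := curve_der (canon_curve k) (isT : (0 < 6)%N).
have dn : der (fun t : R => - t) (fun=> -1) by exact: der_opp der_id.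
have E1 : der (fun t => (G 0%N t).1) (fun t => - (G 1%N (- t)).1).
  apply: (der_ext (f := fun t => (G 0%N (- t)).1)) => [s|]; first by rewrite (canon_sym k).
  by apply: (der_eq (der_comp e1 dn)) => s; rewrite mulrN1.
have E2 : der (fun t => (G 0%N t).2) (fun t => (G 1%N (- t)).2).
  apply: (der_ext (f := fun t => - (G 0%N (- t)).2)) => [s|]; first by rewrite (canon_sym k) opprK.
  by apply: (der_eq (der_opp (der_comp e2 dn))) => s; rewrite mulrN1 opprK.
rewrite [LHS]surjective_pairing; congr pair.
  by rewrite (der_uniq e1 E1) opprK.
exact: der_uniq E2 e2 t.
Qed.

Lemma fn_even t : n0 (- t) = n0 t.
Proof.
rewrite /fn /dif /mid (canon_sym k0) (canon_sym k1) (canon_sym1 _ k0) (canon_sym1 _ k1).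
by rewrite /omega /= /GRing.scale /=; ring.
Qed.

Lemma fn1_canon0 : n1 0 = 0.
Proof.
have dn : der (fun t : R => - t) (fun=> -1) by exact: der_opp der_id.
have E : der n0 (fun t => - n1 (- t)).
  apply: (der_ext (f := fun t => n0 (- t))) => [s|]; first exact: fn_even.
  by apply: (der_eq (der_comp (der_fn c0 c1) dn)) => s; rewrite mulrN1.
by have := der_uniq E (der_fn c0 c1) 0; rewrite oppr0; lra.
Qed.

Lemma mean1_fn : mean 1 n0 = 0.
Proof. by rewrite /mean big_nat1 mul0r /fn dif_canon0 /omega /=; ring. Qed.

(** Since polygons have at least three vertices, the averages for q = 1 and q = 2 have to come from
    the common marked and auxiliary points. *)
Lemma mean2_fn : mean 2 n0 = 0.
Proof.
rewrite /mean big_nat_recl// big_nat1 mul0r /fn dif_canon0.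
have -> : 1%:R * (2 * pi / 2%:R) = pi :> R by field.
by rewrite dif_canonpi /omega /=; ring.
Qed.

Definition fn3 t := 3 * (omega (d 2 t) (m 2 t) + omega (d 1 t) (m 3 t)) +
  (omega (d 1 t) (m 3 t) + omega (d 0 t) (m 4 t)).
Definition fn4 t := 3 * (omega (d 3 t) (m 2 t) + omega (d 2 t) (m 3 t) +
    (omega (d 2 t) (m 3 t) + omega (d 1 t) (m 4 t))) +
  (omega (d 2 t) (m 3 t) + omega (d 1 t) (m 4 t) + (omega (d 1 t) (m 4 t) + omega (d 0 t) (m 5 t))).

Lemma der_difmid j k : (j < 6)%N -> (k < 6)%N ->
  der (fun t => omega (d j t) (m k t)) (fun t => omega (d j.+1 t) (m k t) + omega (d j t) (m k.+1 t)).
Proof. by move=> j6 k6; exact: der_omega (dif_der c0 c1 j6) (mid_der c0 c1 k6). Qed.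

Lemma der_fn2 : der n2 fn3.
Proof. exact: der_add (der_scale 3 (@der_difmid 1 2 isT isT)) (@der_difmid 0 3 isT isT). Qed.

Lemma der_fn3 : der fn3 fn4.
Proof.
exact: der_add (der_scale 3 (der_add (@der_difmid 2 2 isT isT) (@der_difmid 1 3 isT isT)))
  (der_add (@der_difmid 1 3 isT isT) (@der_difmid 0 4 isT isT)).
Qed.

Lemma difmid_le j k t : (j <= 6)%N -> (k <= 6)%N -> `|omega (d j t) (m k t)| <= 4.
Proof.
move=> j6 k6; have e := eps_small'; have e0 := eps_ge0 c0.
have h := omega_le (dif_le c0 c1 t j6) (mid_le c0 c1 e t k6).
by apply: (le_trans h); lra.
Qed.

Lemma fn3_le t : `|fn3 t| <= 64.
Proof.
have := @difmid_le 2 2 t isT isT; have := @difmid_le 1 3 t isT isT.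
have := @difmid_le 0 4 t isT isT; rewrite /fn3 !ler_norml => /andP[? ?] /andP[? ?] /andP[? ?].
by apply/andP; lra.
Qed.

Lemma fn4_le t : `|fn4 t| <= 64.
Proof.
have := @difmid_le 3 2 t isT isT; have := @difmid_le 2 3 t isT isT.
have := @difmid_le 1 4 t isT isT; have := @difmid_le 0 5 t isT isT.
rewrite /fn4 !ler_norml => /andP[? ?] /andP[? ?] /andP[? ?] /andP[? ?].
by apply/andP; lra.
Qed.

Lemma fn2_le0 t : `|n2 t| <= 16.
Proof.
have := @difmid_le 1 2 t isT isT; have := @difmid_le 0 3 t isT isT.
by rewrite /fn2 /ff /fs !ler_norml => /andP[? ?] /andP[? ?]; apply/andP; lra.
Qed.

(** Starting point of the iteration: smoothness on short distances, boundedness on long ones. *)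
Lemma fn2_hoelder0 x y : `|n2 x - n2 y| <= 128 * Num.sqrt `|x - y|.
Proof.
have [xy|/ltW xy] := leP `|x - y| 4.
  apply: (le_trans (mvt_le_glob y x der_fn2 fn3_le)).
  have := @id_le_sqrt R `|x - y|; rewrite normr_ge0 xy => /(_ isT); lra.
apply: (le_trans (ler_normB _ _)).
have : 2 <= Num.sqrt `|x - y|.
  have -> : 2 = Num.sqrt (2 ^+ 2) :> R by rewrite sqrtr_sqr ger0_norm.
  by apply: ler_wsqrtr; rewrite expr2; lra.
by have := fn2_le0 x; have := fn2_le0 y; lra.
Qed.

Section Step.
Variable B : R.
Hypothesis hB : forall x y, `|n2 x - n2 y| <= B * Num.sqrt `|x - y|.

Let B0 : 0 <= B := hB_ge0 hB.

(** The increment of d' is decomposed in the frame at x. Its coordinates are the increments of [ff]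
    and [fe], corrected by the motion of the frame, which is Lipschitz. *)
Lemma dif1_osc x y : `|x - y| <= 4 ->
  `|d 1 x - d 1 y| <= (8 * 10 * 10 * 10 * 10 * 10 * 10) * (B * Num.sqrt `|x - y|).
Proof.
move=> xy; have e := eps_small'; set r := `|x - y|; set s := Num.sqrt r.
have r0 : 0 <= r by exact: normr_ge0.
have rs : r <= 2 * s by apply: id_le_sqrt; rewrite r0.
have s0 : 0 <= s by exact: sqrtr_ge0.
have Brs : B * r <= 2 * (B * s) by rewrite mulrCA; apply: ler_wpM2l.
have Bs0 : 0 <= B * s by exact: mulr_ge0.
have D1 := dif1_leB c0 c1 e dif_canon0 fn1_canon0 hB.
have F := @ff_osc _ _ _ _ c0 c1 e _ dif_canon0 fn1_canon0 hB x y xy.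
rewrite -mulrA -/r -/s in F.
have mo k : (k < 6)%N -> `|m k x - m k y| <= 2 * r.
  by move=> k6; apply: (vmvt_le (mid_der c0 c1 k6)) => t _; exact: (mid_le c0 c1 e).
have Eo : `|fe G0 G1 x - fe G0 G1 y| <= (36 * 10 * 10 * 10) * B * r.
  apply: (mvt_le_glob y x (der_fe c0 c1)) => t.
  rewrite normrN normrM ger0_norm//.
  by have := ff_le c0 c1 e dif_canon0 fn1_canon0 hB t; have := B0; lra.
have X : `|omega (d 1 x - d 1 y) (m 2 x)| <= (10 * 10 * 10 * 10 * 10 * 10) * (B * s).
  have -> : omega (d 1 x - d 1 y) (m 2 x) = (ff G0 G1 x - ff G0 G1 y) - omega (d 1 y) (m 2 x - m 2 y).
    by rewrite omegaBl omegaBr /ff; ring.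
  have h := omega_le (D1 y) (@mo 2 isT).
  have {}h : `|omega (d 1 y) (m 2 x - m 2 y)| <= (34 * 10 * 10 * 10 * 10) * (B * r) by apply: (le_trans h); lra.
  apply: (le_trans (ler_normB _ _)).
  move: (B * r) Brs h => br Brs h; move: (B * s) Bs0 F Brs => bs Bs0 F Brs; lra.
have Y : `|omega (m 1 x) (d 1 x - d 1 y)| <= (10 * 10 * 10 * 10 * 10 * 10) * (B * s).
  have -> : omega (m 1 x) (d 1 x - d 1 y) = (fe G0 G1 x - fe G0 G1 y) - omega (m 1 x - m 1 y) (d 1 y).
    by rewrite omegaBr omegaBl /fe; ring.
  have h := omega_le (@mo 1 isT) (D1 y).
  have {}h : `|omega (m 1 x - m 1 y) (d 1 y)| <= (34 * 10 * 10 * 10 * 10) * (B * r) by apply: (le_trans h); lra.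
  rewrite -mulrA in Eo.
  apply: (le_trans (ler_normB _ _)).
  move: (B * r) Brs h Eo => br Brs h Eo; move: (B * s) Bs0 Brs => bs Bs0 Brs; lra.
have E : fW G0 G1 x *: (d 1 x - d 1 y) =
  omega (d 1 x - d 1 y) (m 2 x) *: m 1 x + omega (m 1 x) (d 1 x - d 1 y) *: m 2 x.
  by rewrite /fW cramer [omega (m 1 x) _]omegaC scaleNr.
have := from_frame c0 c1 e E (mid_le c0 c1 e x (isT : (1 <= 6)%N)) (mid_le c0 c1 e x (isT : (2 <= 6)%N)) X Y.
by move/le_trans; apply; move: (B * s) Bs0 => bs Bs0; lra.
Qed.

Definition fg1 t := omega (d 1 t) (m 3 t + m 1 t) + omega (d 0 t) (m 4 t + m 2 t).

Lemma der_fg : der (fg G0 G1) fg1.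
Proof.
exact: der_omega (dif_der c0 c1 (isT : (0 < 6)%N))
  (vder_add (mid_der c0 c1 (isT : (3 < 6)%N)) (mid_der c0 c1 (isT : (1 < 6)%N))).
Qed.

Lemma mid_two_le k t : (k <= 4)%N -> `|m k.+2 t + m k t| <= 2 * eps.
Proof.
move=> k4; have -> : m k.+2 t + m k t = (m k.+2 t - ek k.+2 t) + (m k t - ek k t).
  by rewrite ekSS opprK addrACA subrr addr0.
have h := normD_le (mid_near c0 c1 t (k4 : (k.+2 <= 6)%N)) (mid_near c0 c1 t (leq_trans k4 (isT : (4 <= 6)%N))).
by apply: (le_trans h); lra.
Qed.

(** The factor eps comes from m''' + m' and m'''' + m''; without it the lower-order term would not
    contract. *)
Lemma fg1_osc x y : `|x - y| <= 4 ->
  `|fg1 x - fg1 y| <= (4 * 10 * 10 * 10 * 10 * 10 * 10 * 10) * (eps * B) * Num.sqrt `|x - y|.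
Proof.
move=> xy; have e := eps_small'; have e0 := eps_ge0 c0.
have O1 := dif1_osc xy.
have D1 := dif1_leB c0 c1 e dif_canon0 fn1_canon0 hB.
have D0 := dif0_leB c0 c1 e dif_canon0 fn1_canon0 hB.
move: O1; set r := `|x - y|; set s := Num.sqrt r => O1.
have r0 : 0 <= r by exact: normr_ge0.
have rs : r <= 2 * s by apply: id_le_sqrt; rewrite r0.
have s0 : 0 <= s by exact: sqrtr_ge0.
have vo k : (k <= 3)%N -> `|(m k.+2 x + m k x) - (m k.+2 y + m k y)| <= 2 * eps * r.
  move=> k3; have k6 : (k < 6)%N by apply: leq_trans k3 _.
  have k26 : (k.+2 < 6)%N by apply: leq_ltn_trans (_ : 5 < 6)%N.
  apply: (vmvt_le (vder_add (mid_der c0 c1 k26) (mid_der c0 c1 k6))) => t _.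
  exact: (@mid_two_le k.+1).
have O0 : `|d 0 x - d 0 y| <= (85 * 10 * 10 * 10) * B * r.
  by apply: (vmvt_le (dif_der c0 c1 (isT : (0 < 6)%N))) => t _; exact: D1.
have -> : fg1 x - fg1 y = omega (d 1 x - d 1 y) (m 3 x + m 1 x)
    + omega (d 1 y) ((m 3 x + m 1 x) - (m 3 y + m 1 y))
    + (omega (d 0 x - d 0 y) (m 4 x + m 2 x) + omega (d 0 y) ((m 4 x + m 2 x) - (m 4 y + m 2 y))).
  by rewrite /fg1 !(omegaBl (d _ x)) !(omegaBr (m _ x + _)); ring.
have t1 := omega_le O1 (@mid_two_le 1 x isT).
have t2 := omega_le (D1 y) (@vo 1 isT).
have t3 := omega_le O0 (@mid_two_le 2 x isT).
have t4 := omega_le (D0 y) (@vo 2 isT).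
have w1 : eps * B * r <= 2 * (eps * B * s).
  by rewrite [leRHS]mulrCA; apply: ler_wpM2l => //; exact: mulr_ge0.
have w0 : 0 <= eps * B * s by rewrite !mulr_ge0.
rewrite -mulrA.
have {}t1 : `|omega (d 1 x - d 1 y) (m 3 x + m 1 x)| <= (32 * 10 * 10 * 10 * 10 * 10 * 10) * (eps * B * s).
  by apply: (le_trans t1); lra.
have {}t2 : `|omega (d 1 y) ((m 3 x + m 1 x) - (m 3 y + m 1 y))| <= (34 * 10 * 10 * 10 * 10) * (eps * B * r).
  by apply: (le_trans t2); lra.
have {}t3 : `|omega (d 0 x - d 0 y) (m 4 x + m 2 x)| <= (34 * 10 * 10 * 10 * 10) * (eps * B * r).
  by apply: (le_trans t3); lra.
have {}t4 : `|omega (d 0 y) ((m 4 x + m 2 x) - (m 4 y + m 2 y))| <= (52 * 10 * 10 * 10) * (eps * B * r).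
  by apply: (le_trans t4); lra.
apply: (le_trans (ler_normD _ _)).
apply: (le_trans (lerD (ler_normD _ _) (ler_normD _ _))).
move: (eps * B * r) w1 t2 t3 t4 => br w1 t2 t3 t4; move: (eps * B * s) w0 w1 t1 => bs w0 w1 t1; lra.
Qed.

End Step.

Definition matched q := exists u0 u1, [/\ maxi G0 q u0, maxi G1 q u1 &
  act G0 (stp q) q u0 = act G1 (stp q) q u1].

(** The factor 8^3 * 3 converts h^(7/2) into q^(-7/2), as 2 pi < 8 and sqrt (2 pi) < 3; the inner
    constants are those of [balance], and 40 is that of [dft_hoelder]. The conclusion of
    [equal_action_bound] is a hypothesis so that its constant is chosen before the curves. *)
Lemma hoelder_step C B : 0 < C -> (forall (eps A : R) G0 G1 q u0 u1,
  eps <= 1 / (100 * 100 * 100) -> curve eps G0 -> curve eps G1 -> (2 < q)%N ->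
  (forall t, `|dif G0 G1 0 t| <= A) ->
  (forall t, `|ff G0 G1 t| <= A) -> (forall t, `|fe G0 G1 t| <= A) ->
  (forall x y, `|x - y| <= 4 -> `|ff G0 G1 x - ff G0 G1 y| <= A * Num.sqrt `|x - y|) ->
  maxi G0 q u0 -> maxi G1 q u1 -> act G0 (stp q) q u0 = act G1 (stp q) q u1 ->
  `|2 * q%:R * sin (stp q) * mean q (fn G0 G1) + 2 * pi / 3 * stp q ^+ 2 * mean q (fg G0 G1)|
    <= C * (eps * A) * (stp q ^+ 3 * Num.sqrt (stp q))) ->
  (forall q, (2 < q)%N -> matched q) ->
  (forall x y, `|n2 x - n2 y| <= B * Num.sqrt `|x - y|) ->
  forall x y, `|n2 x - n2 y| <= 40 * (8 ^+ 3 * 3 * (3 / 2 * (3 * ((4 * 10 * 10 * 10 * 10 * 10 * 10 * 10) * (eps * B))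
    + C * (eps * ((3 * 10 * 10 * 10 * 10 * 10) * B))))) * Num.sqrt `|x - y|.
Proof.
move=> C0 bound mt hB; have B0 := hB_ge0 hB.
have e := eps_small'; have e0 := eps_ge0 c0.
set D' := _ * (eps * B); set D := C * _.
have D'0 : 0 <= D' by rewrite mulr_ge0 ?mulr_ge0.
have D0 : 0 <= D by rewrite /D mulr_ge0 ?(ltW C0)// mulr_ge0// mulr_ge0 ?mulr_ge0.
have p2 := @pi_ge2 R; have p4 := @pi_lt4 R.
have K q : (2 < q)%N -> `|mean q n0| <= 3 / 2 * (3 * D' + D) * (stp q ^+ 3 * Num.sqrt (stp q)).
  move: q; apply: (@balance _ _ (fun q => mean q (fg G0 G1)) D D' 8 (2 * (4 * 81 * 64 * 2))) => // q.
  - move=> q3; have [u0 [u1 [mx0 mx1 E]]] := mt q q3.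
    apply: (bound _ ((3 * 10 * 10 * 10 * 10 * 10) * B) _ _ _ _ _ eps_tiny c0 c1 q3 _ _ _ _ mx0 mx1 E) => [t|t|t|].
    + by apply: (le_trans (dif0_leB c0 c1 e dif_canon0 fn1_canon0 hB t)); lra.
    + by apply: (le_trans (ff_le c0 c1 e dif_canon0 fn1_canon0 hB t)); lra.
    + by apply: (le_trans (fe_le c0 c1 e dif_canon0 fn1_canon0 hB t)); lra.
    + exact: (ff_osc c0 c1 e dif_canon0 fn1_canon0 hB).
  - move=> q3; apply: mean_le => [|t]; first exact: ltn_trans q3.
    have h := omega_le (dif_le c0 c1 t (isT : (0 <= 6)%N)) (mid31_le c0 c1 t).
    apply: (le_trans h); have : 2 * (2 * eps) * (2 * eps) <= 8 * 1 by nra.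
    lra.
  - move=> r q3 r0; have q0 : (0 < q)%N by apply: ltn_trans q3.
    have := mean_converges (der_fn c0 c1) (der_fn1 c0 c1) der_fn2 der_fn3 fn4_le (fn_per c0 c1) q0 r0.
    by move/le_trans; apply; rewrite le_eqVlt; apply/orP; left; apply/eqP; ring.
  - move=> r q3 r0; have q0 : (0 < q)%N by apply: ltn_trans q3.
    apply: (mean_refine q0 r0 der_fg) => [t|x y xy].
      by rewrite /fg (dif_per c0 c1)// !(mid_per c0 c1).
    apply: (fg1_osc hB); apply: (le_trans xy).
    by have := @stp_le3 R q q3; rewrite /stp; lra.
apply: (dft_hoelder (der_fn c0 c1) (der_fn1 c0 c1) der_fn2 der_fn3 fn3_le fn4_le (fn_per c0 c1) fn_even) => q q0.
set T := _ * (_ * _).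
have T0 : 0 <= T by rewrite /T !mulr_ge0// ?exprn_ge0// addr_ge0// mulr_ge0.
have [q3|] := leqP 3 q; last first.
  case: q q0 => [|[|[|q]]]// _ _; rewrite ?mean1_fn ?mean2_fn normr0 divr_ge0// ltW// pw_gt0//.
apply: (le_trans (K q q3)).
have qg : 0 < q%:R :> R by rewrite ltr0n.
have h0 := stp_gt0 q0 : 0 < stp q :> R.
have s8 : (stp q : R) <= 8 / q%:R by rewrite /stp; apply: ler_wpM2r; [rewrite invr_ge0; exact: ltW|lra].
have s3 : (stp q : R) ^+ 3 <= 8 ^+ 3 / q%:R ^+ 3.
  rewrite -expr_div_n; apply: lerXn2r => //; rewrite nnegrE; [exact: ltW|exact: (le_trans (ltW h0) s8)].
have sq : Num.sqrt (stp q) <= 3 / Num.sqrt q%:R :> R.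
  rewrite ler_pdivlMr ?sqrtr_gt0// -sqrtrM ?(ltW h0)// mulrC stp_mul//.
  have -> : 3 = Num.sqrt (3 ^+ 2) :> R by rewrite sqrtr_sqr ger0_norm.
  by apply: ler_wsqrtr; rewrite expr2; lra.
have : (stp q : R) ^+ 3 * Num.sqrt (stp q) <= 8 ^+ 3 / q%:R ^+ 3 * (3 / Num.sqrt q%:R).
  by apply: ler_pM => //; rewrite ?sqrtr_ge0// exprn_ge0// ltW.
have z : 0 <= 3 / 2 * (3 * D' + D) by rewrite mulr_ge0// addr_ge0// mulr_ge0.
move/(ler_wpM2l z)/le_trans; apply.
have -> : T / pw q = 3 / 2 * (3 * D' + D) * (8 ^+ 3 / q%:R ^+ 3 * (3 / Num.sqrt q%:R)).
  by rewrite /T /pw invfM; ring.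
by [].
Qed.

End Uniqueness.

(** [K] times eps is the factor gained in one application of [hoelder_step], so eps <= 1 / (2 K)
    halves the Hoelder constant. Once this constant is 0, [dif0_leB] annihilates the whole
    difference of the curves and not only its component n. *)
Theorem rigidity {R : realType} : exists2 e0 : R, 0 < e0 & e0 <= 1 / (100 * 100 * 100) /\
  forall (eps : R) G0 G1, eps <= e0 -> canon eps G0 -> canon eps G1 ->
    (forall q, (2 < q)%N -> matched G0 G1 q) -> forall t, G0 0%N t = G1 0%N t.
Proof.
have [C C0 bound] := @equal_action_bound R.
pose K : R := 40 * (8 ^+ 3 * 3 * (3 / 2 * (3 * (4 * 10 * 10 * 10 * 10 * 10 * 10 * 10)
    + C * (3 * 10 * 10 * 10 * 10 * 10)))).
have K0 : 0 < K.
  have a : 0 < 10 :> R by rewrite ltr0n.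
  have b : 0 < 4 :> R by rewrite ltr0n.
  have c : 0 < 3 :> R by rewrite ltr0n.
  have d : 0 < 3 / 2 :> R by lra.
  have e : 0 < 40 :> R by rewrite ltr0n.
  have f : 0 < 8 ^+ 3 :> R by rewrite exprn_gt0.
  do ![exact: a|exact: b|exact: c|exact: d|exact: e|exact: f|exact: C0|apply: mulr_gt0|apply: addr_gt0].
pose e0 : R := Num.min (1 / (100 * 100 * 100)) (1 / (2 * K)).
have t0 : 0 < 1 / (100 * 100 * 100) :> R.
  by have a : 0 < 100 :> R by []; apply: divr_gt0 => //; do ![exact: a|apply: mulr_gt0].
exists e0; first by rewrite lt_min t0/= divr_gt0// mulr_gt0.
split; first by rewrite ge_min lexx.
move=> eps G0 G1; rewrite le_min => /andP[es eK] k0 k1 mt.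
have es' : eps <= 1 / 1000 by lra.
have c0 := canon_curve k0; have c1 := canon_curve k1.
have e_ge := eps_ge0 c0.
have Ke : K * eps <= 1 / 2.
  have := ler_wpM2l (ltW K0) eK; have -> : K * (1 / (2 * K)) = 1 / 2 by field; rewrite gt_eqF.
  by [].
have H n x y : `|fn2 G0 G1 x - fn2 G0 G1 y| <= 128 / 2 ^+ n * Num.sqrt `|x - y|.
  elim: n x y => [|n IH] x y.
    by rewrite expr0 divr1; exact: (fn2_hoelder0 k0 k1 es).
  apply: (le_trans (hoelder_step k0 k1 es C0 bound mt IH x y)).
  apply: ler_wpM2r; first exact: sqrtr_ge0.
  have B0 : 0 <= 128 / 2 ^+ n :> R by rewrite divr_ge0// exprn_ge0.
  have -> : 128 / 2 ^+ n.+1 = 128 / 2 ^+ n / 2 :> R by rewrite exprS invfM; ring.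
  move: (128 / 2 ^+ n) B0 => B B0.
  apply: (@le_trans _ _ (K * eps * B)).
    by rewrite le_eqVlt; apply/orP; left; apply/eqP; rewrite /K; ring.
  by have := ler_wpM2r B0 Ke; lra.
have hB x y : `|fn2 G0 G1 x - fn2 G0 G1 y| <= 0 * Num.sqrt `|x - y|.
  rewrite mul0r; apply: (@vanishing_inv _ _ 0 (128 * Num.sqrt `|x - y|)) => [|r r0].
    by rewrite mulr_ge0// sqrtr_ge0.
  rewrite add0r; apply: (le_trans (H r x y)); rewrite mulrAC; apply: ler_wpM2l.
    by rewrite mulr_ge0// sqrtr_ge0.
  rewrite lef_pV2 ?posrE ?ltr0n// ?exprn_gt0// -natrX ler_nat.
  by apply: ltnW; apply: ltn_expl.
move=> t; have := dif0_leB c0 c1 es' (dif_canon0 k0 k1) (fn1_canon0 k0 k1) hB t.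
by rewrite mulr0 normr_le0 /dif subr_eq0 => /eqP ->.
Qed.

(** * Maximal polygons are trajectories *)

Section Existence.
Context {R : realType}.

Lemma vder_continuous (u u' : R -> plane R) : vder u u' ->
  continuous (fun t => (u t).1) /\ continuous (fun t => (u t).2).
Proof. by move=> [d1 d2]; split; [exact: der_continuous d1|exact: der_continuous d2]. Qed.

Lemma continuous_sum (T : topologicalType) (F : nat -> T -> R) n : (forall i, continuous (F i)) ->
  continuous (fun t => \sum_(0 <= i < n) F i t).
Proof.
move=> cF; elim: n => [|n IH].
  by under eq_fun do rewrite big_geq//; exact: cst_continuous.
under eq_fun do rewrite big_nat_recr//=.
by move=> t; apply: continuousD; [exact: IH|exact: cF].
Qed.

Lemma adm_le q (u : nat -> R) j : adm q u -> (j <= q)%N -> `|u j| <= q%:R * stp q.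
Proof.
move=> [u0 uq us _] jq.
have : (0 <= q)%N by []; rewrite leq_eqVlt => /orP[/eqP q0|q0].
  by move: jq; rewrite -q0 leqn0 => /eqP ->; rewrite u0 normr0 mul0r.
apply: (le_trans (partial_le u0 jq)).
apply: (sum_const_le (M := stp q)) => i /us /le_trans; apply.
by have := @stp_gt0 R q q0; lra.
Qed.

Lemma act_ext (G : nat -> R -> plane R) h q u v : (forall j, (j <= q)%N -> u j = v j) ->
  act G h q u = act G h q v.
Proof.
move=> E; rewrite /act big_nat_cond [RHS]big_nat_cond; apply: eq_bigr => j; rewrite andbT => /andP[_ jq].
by rewrite /pt !E// ltnW.
Qed.

Lemma adm_ext q (u v : nat -> R) : (forall j, (j <= q)%N -> u j = v j) -> adm q u -> adm q v.
Proof.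
move=> E [u0 uq us ur]; split; rewrite -?E// => j jq.
- by rewrite -!E ?us// ltnW.
- by rewrite -!E ?ur// leq_subr.
Qed.

(** Admissible displacements form a nonempty compact set of vectors with q + 1 entries, on which the
    action is continuous. *)
Lemma maxi_exists (G : nat -> R -> plane R) q : vder (G 0%N) (G 1%N) -> exists u, maxi G q u.
Proof.
move=> dG; have [cG1 cG2] := vder_continuous dG.
(* Indices above q receive a default entry, which neither [adm] nor [act] reads. *)
pose uof (v : 'rV[R]_q.+1) (j : nat) : R := v ord0 (inord j).
have cu j : continuous (fun v => uof v j) by exact: coord_continuous.
have ofu (w : nat -> R) j : (j <= q)%N -> uof (\row_i w i) j = w j.
  by move=> jq; rewrite /uof mxE inordK.
pose A := [set v | adm q (uof v)].
have Acl : closed A.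
  have -> : A = ((fun v => uof v 0%N) @^-1` [set x | x = 0] `&` (fun v => uof v q) @^-1` [set x | x = 0])
    `&` (\bigcap_(j in [set j | (j < q)%N]) (fun v => `|uof v j.+1 - uof v j|) @^-1` [set x | x <= stp q / 4]
    `&` \bigcap_(j in [set j | (j <= q)%N]) (fun v => uof v (q - j)%N + uof v j) @^-1` [set x | x = 0]).
    apply/seteqP; split=> v /=.
      move=> [a b c d]; split; first by [].
      by split=> j /= jq; [exact: c|rewrite d// addNr].
    move=> [[a b] [c d]]; split; [exact: a|exact: b|by move=> j jq; exact: (c j jq)|move=> j jq].
    by apply/eqP; rewrite -addr_eq0; apply/eqP; exact: (d j jq).
  apply: closedI; apply: closedI.
  - by apply: preimage_closed => [v _|]; [exact: cu|exact: closed_eq].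
  - by apply: preimage_closed => [v _|]; [exact: cu|exact: closed_eq].
  - apply: closed_bigI => j _; apply: preimage_closed; last exact: closed_le.
    move=> v _; apply: (@continuous_comp _ _ _ (fun v => uof v j.+1 - uof v j) (fun x : R => `|x|)).
      by apply: continuousB; exact: cu.
    exact: norm_continuous.
  - apply: closed_bigI => j _; apply: preimage_closed; last exact: closed_eq.
    by move=> v _; apply: (@continuousD _ _ _ (fun v => uof v (q - j)%N) (fun v => uof v j) v); exact: cu.
have Acpt : compact A.
  pose M := q%:R * stp q : R.
  have Kc : compact [set v : 'rV[R]_q.+1 | forall i, `[- M, M]%classic (v ord0 i)].
    by apply: (@rV_compact _ _ (fun=> `[- M, M]%classic)) => _; exact: segment_compact.
  apply: (subclosed_compact Acl Kc) => v Av i.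
  have iq : (i <= q)%N by rewrite -ltnS.
  have := adm_le Av iq; rewrite /uof inord_val -/M ler_norml => /andP[? ?].
  by rewrite /= in_itv /=; apply/andP.
have A0 : A !=set0.
  exists (\row_i 0); apply: (adm_ext _ (adm_scl0 q (fun=> 0))) => j jq.
  by rewrite (ofu (fun=> 0)) // /scl mul0r.
have cp j : continuous (fun v => pt (stp q) (uof v) j).
  by move=> v; apply: (@continuousD _ _ _ (fun=> j%:R * stp q) (fun v => uof v j) v); [exact: cst_continuous|exact: cu].
have cact : continuous (fun v => act G (stp q) q (uof v)).
  have c1 j : continuous (fun v => (G 0%N (pt (stp q) (uof v) j)).1).
    by move=> v; apply: (@continuous_comp _ _ _ (fun v => pt (stp q) (uof v) j) (fun t => (G 0%N t).1)); [exact: cp|exact: cG1].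
  have c2 j : continuous (fun v => (G 0%N (pt (stp q) (uof v) j)).2).
    by move=> v; apply: (@continuous_comp _ _ _ (fun v => pt (stp q) (uof v) j) (fun t => (G 0%N t).2)); [exact: cp|exact: cG2].
  apply: continuous_sum => j v.
  apply: (@continuousB _ _ _ (fun v => (G 0%N (pt (stp q) (uof v) j)).1 * (G 0%N (pt (stp q) (uof v) j.+1)).2)).
    by apply: (@continuousM _ _ (fun v => (G 0%N (pt (stp q) (uof v) j)).1)); [exact: c1|exact: c2].
  by apply: (@continuousM _ _ (fun v => (G 0%N (pt (stp q) (uof v) j)).2)); [exact: c2|exact: c1].
have [c cA cmax] := compact_EVT_max A0 Acpt (continuous_subspaceT cact).
exists (uof c); split; first by move: cA; rewrite inE.
move=> w aw; have E j : (j <= q)%N -> w j = uof (\row_i w i) j by move=> jq; rewrite ofu.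
rewrite (act_ext _ _ E); apply: cmax; rewrite inE /A/=.
exact: adm_ext E aw.
Qed.

End Existence.

(** * Maximal symmetric polygons are critical *)

Section Critical.
Context {R : realType}.
Variables (eps : R) (G : nat -> R -> plane R).
Hypothesis kG : canon eps G.
Hypothesis eps_tiny : eps <= 1 / (100 * 100 * 100 * 100).
Variables (p : nat) (u : nat -> R).
Hypothesis p2 : (2 < p.+1)%N.
Hypothesis um : maxi G p.+1 u.

Let cG := canon_curve kG.
Local Notation q := p.+1.
Local Notation h := (stp p.+1 : R).

(** Half of the allowed h / 4 is kept free, so that small variations of a maximizer remain
    admissible. It holds because the total variation is at most h^2 / 100 for eps <= 10^(-8). *)
Lemma maxi_step_lt j : (j < q)%N -> `|u j.+1 - u j| < h / 8.
Proof.
move=> jq; have [[u0 uq us ur] mx] := um.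
have e6 : eps <= 1 / (100 * 100 * 100) by have := eps_tiny; lra.
have h0 : 0 < h by exact: stp_gt0.
have h3 : h <= 3 by have := @stp_le3 R q p2; have := @pi_lt4 R; lra.
have e0 := eps_ge0 cG.
have := maximizer_close cG e6 p2 u0 uq us (mx _ (adm_scl0 _ _)).
rewrite -/(stp q).
have : `|u j.+1 - u j| <= \sum_(0 <= i < q) `|u i.+1 - u i|.
  rewrite (@big_cat_nat _ _ _ j.+1)//= big_nat_recr//= -addrA.
  by rewrite addrC -addrA lerDl addr_ge0// sumr_ge0.
move=> a b; apply: (le_lt_trans a); apply: (le_lt_trans b).
have t1 : 100 * 100 * 100 * eps <= 1 / 100 by have := eps_tiny; lra.
have t2 := ler_wpM2r (sqr_ge0 h) t1.
apply: (le_lt_trans t2); rewrite expr2; nra.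
Qed.

Lemma pt_refl j : (j <= q)%N -> pt h u (q - j) = 2 * pi - pt h u j.
Proof.
move=> jq; have [[_ _ _ ur] _] := um.
by rewrite /pt ur// natrB// mulrBl stp_mul//; ring.
Qed.

Lemma G0_refl t : G 0%N (2 * pi - t) = ((G 0%N t).1, - (G 0%N t).2).
Proof. by rewrite addrC (curve_per cG)// (canon_sym kG). Qed.

Lemma G1_refl t : G 1%N (2 * pi - t) = (- (G 1%N t).1, (G 1%N t).2).
Proof. by rewrite addrC (curve_per cG)// (canon_sym1 _ kG). Qed.

Lemma grad_refl i : (i < p)%N -> grad G h u (p.-1 - i) = - grad G h u i.
Proof.
move=> ip; rewrite /grad.
have -> : (p.-1 - i).+1 = (q - i.+1)%N by lia.
have -> : (q - i.+1).+1 = (q - i)%N by lia.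
have -> : (p.-1 - i)%N = (q - i.+2)%N by lia.
rewrite !pt_refl; try lia.
by rewrite !G0_refl G1_refl /omega /=; ring.
Qed.

(** Only symmetric variations are admissible, so a vertex and its mirror image are moved together;
    by [grad_refl] both contribute the same amount to the derivative. At a vertex that is its own
    mirror image the gradient equals its opposite. *)
Lemma grad_eq0 i : (i < p)%N -> grad G h u i = 0.
Proof.
move=> ip; have [[u0 uq us ur] mx] := um.
have h0 : 0 < h by exact: stp_gt0.
have [e|ne] := eqVneq (p.-1 - i)%N i.
  by have := grad_refl ip; rewrite e; lra.
pose w (j : nat) : R := (j == i.+1)%:R - (j == (p.-1 - i).+1)%:R.
have w0 : w 0%N = 0 by rewrite /w /= subrr.
have wq : w q = 0.
  have /negPf q1 : q != i.+1 by clear -ip; apply/eqP; lia.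
  have /negPf q3 : q != (p.-1 - i).+1 by clear -ip; apply/eqP; lia.
  by rewrite /w q1 q3 subrr.
have wb j : `|w j| <= 1.
  rewrite /w; case: eqP => [->|_] /=; case: eqP => _ /=; rewrite ?subrr ?subr0 ?sub0r ?normrN ?normr0 ?normr1//.
have wr j : (j <= q)%N -> w (q - j)%N = - w j.
  move=> jq; rewrite /w.
  have -> : (q - j == i.+1)%N = (j == (p.-1 - i).+1)%N by clear -ip jq; apply/eqP/eqP; lia.
  have -> : (q - j == (p.-1 - i).+1)%N = (j == i.+1)%N by clear -ip jq; apply/eqP/eqP; lia.
  by rewrite opprB.
pose F x := act G h q (fun j => u j + x * w j).
have dF : der F (fun x => \sum_(0 <= k < p) w k.+1 * grad G h (fun j => u j + x * w j) k).
  exact: act_der_gen (curve_der cG (isT : (0 < 6)%N)) w0 wq.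
have a0 : (fun j => u j + 0 * w j) = u by apply/funext => j; rewrite mul0r addr0.
(* A step changes by at most 2 |x| < h / 8, and was less than h / 8 away from h, hence stays within
   h / 4. *)
have Fle x : x \in `]- (h / 16), (h / 16)[%R -> F x <= F 0.
  rewrite in_itv /= => /andP[x1 x2]; rewrite /F a0; apply: mx; split.
  - by rewrite u0 w0 mulr0 addr0.
  - by rewrite uq wq mulr0 addr0.
  - move=> j jq; have := maxi_step_lt jq; have := wb j; have := wb j.+1.
    rewrite !ltr_norml !ler_norml => /andP[? ?] /andP[? ?] /andP[? ?]; apply/andP; nra.
  - by move=> j jq; rewrite ur// wr//; ring.
have z0 : 0 \in `]- (h / 16), (h / 16)[%R by rewrite in_itv /=; apply/andP; lra.
have := @derive1_at_max R F (- (h / 16)) (h / 16) 0 _ _ z0 Fle.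
move=> D; have {D} [_ D] : is_derive (0 : R) 1 F 0.
  by apply: D => [|t _]; [lra|have [] := dF t].
have [_ D0] := dF 0; move: D; rewrite D0 a0 => {D0}.
rewrite big_nat_cond (eq_bigr (fun k => (k == i)%:R * grad G h u k - (k == p.-1 - i)%N%:R * grad G h u k)); last first.
  by move=> k; rewrite andbT => /andP[_ kp]; rewrite /w !eqSS mulrBl.
rewrite -big_nat_cond sumrB.
have S k : (k < p)%N -> \sum_(0 <= j < p) (j == k)%:R * grad G h u j = grad G h u k.
  move=> kp; rewrite (bigD1_seq k) ?mem_index_iota ?iota_uniq//= eqxx mul1r big1 ?addr0// => j /negPf ->.
  by rewrite mul0r.
rewrite !S//; last by clear -ip; lia.
by rewrite grad_refl//; lra.
Qed.

(* The two neighbours of the marked point are mirror images of each other. *)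
Lemma grad_marked : omega (G 1%N 0) (G 0%N (pt h u 1) - G 0%N (pt h u p)) = 0.
Proof.
have -> : pt h u p = 2 * pi - pt h u 1 by rewrite -pt_refl// subn1.
rewrite G0_refl.
have := canon_sym1 0 kG; rewrite oppr0 => e.
have -> : G 1%N 0 = (0, (G 1%N 0).2).
  by rewrite [LHS]surjective_pairing; congr pair; have := congr1 fst e => /=; lra.
by rewrite /omega /=; ring.
Qed.

End Critical.

(** * Derivatives of plane curves and of their coordinates *)

Section PlaneDerivative.
Context {R : realType}.
Implicit Types (u : R -> plane R).

Lemma is_derive_coord u t : derivable u t 1 ->
  is_derive t 1 (fun s => (u s).1) (u^`() t).1 /\ is_derive t 1 (fun s => (u s).2) (u^`() t).2.
Proof.
move=> du; rewrite derive1E; have c : (fun h => h^-1 *: ((u \o shift t) (h *: 1) - u t)) @ 0^' --> 'D_1 u t by exact: du.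
split.
  have {}c : (fun h => h^-1 *: (((fun s => (u s).1) \o shift t) (h *: 1) - (u t).1)) @ 0^' --> ('D_1 u t).1.
    by apply: (cvg_comp (G := nbhs ('D_1 u t)) _ (fun p : plane R => p.1) c); exact: cvg_fst.
  by split; [apply/cvg_ex; exists ('D_1 u t).1|exact: cvg_lim].
have {}c : (fun h => h^-1 *: (((fun s => (u s).2) \o shift t) (h *: 1) - (u t).2)) @ 0^' --> ('D_1 u t).2.
  by apply: (cvg_comp (G := nbhs ('D_1 u t)) _ (fun p : plane R => p.2) c); exact: cvg_snd.
by split; [apply/cvg_ex; exists ('D_1 u t).2|exact: cvg_lim].
Qed.

Lemma derive1_coord u (a b t : R) :
  is_derive t 1 (fun s => (u s).1) a -> is_derive t 1 (fun s => (u s).2) b ->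
  derivable u t 1 /\ u^`() t = (a, b).
Proof.
move=> [d1 e1] [d2 e2]; rewrite derive1E.
have c1 : (fun h => h^-1 *: (((fun s => (u s).1) \o shift t) (h *: 1) - (u t).1)) @ 0^' --> a by rewrite -e1; exact: d1.
have c2 : (fun h => h^-1 *: (((fun s => (u s).2) \o shift t) (h *: 1) - (u t).2)) @ 0^' --> b by rewrite -e2; exact: d2.
have c : (fun h => h^-1 *: ((u \o shift t) (h *: 1) - u t)) @ 0^' --> (a, b) by exact: cvg_pair c1 c2.
by split; [apply/cvg_ex; exists (a, b)|exact: cvg_lim].
Qed.

Lemma vder_derive1 u u' : vder u u' -> (forall t, derivable u t 1) /\ u^`() = u'.
Proof.
move=> [d1 d2]; split=> [t|]; first exact: (derive1_coord (d1 t) (d2 t)).1.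
by apply/funext => t; rewrite (derive1_coord (d1 t) (d2 t)).2 -surjective_pairing.
Qed.

Lemma derivable_vder u : (forall t, derivable u t 1) -> vder u u^`().
Proof. by move=> du; split=> t; have [] := is_derive_coord (du t). Qed.

Lemma vder_eq u u' u'' : vder u u' -> (forall t, u' t = u'' t) -> vder u u''.
Proof. by move=> d /funext <-. Qed.

Lemma vder_ext u v u' : (forall t, u t = v t) -> vder u u' -> vder v u'.
Proof. by move=> /funext <-. Qed.

Lemma vder_uniq u u1 u2 : vder u u1 -> vder u u2 -> forall t, u1 t = u2 t.
Proof. by move=> /vder_derive1[_ <-] /vder_derive1[_ <-]. Qed.

Lemma plane_continuous u : continuous (fun t => (u t).1) -> continuous (fun t => (u t).2) -> continuous u.
Proof.
move=> c1 c2 t; have h : (fun s => ((u s).1, (u s).2)) @ t --> ((u t).1, (u t).2) by exact: cvg_pair (c1 t) (c2 t).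
have {}h : u @ t --> ((u t).1, (u t).2) by move: h; under eq_fun do rewrite -surjective_pairing.
by move: h; rewrite -surjective_pairing.
Qed.

End PlaneDerivative.

(** * Strict convexity of curves close to the circle *)

Section Support.
Context {R : realType}.
Variables (eps : R) (G : nat -> R -> plane R).
Hypothesis cG : curve eps G.
Hypothesis eps_small : eps <= 1 / 1000.

Lemma per2pi k t (m : int) : (k <= 6)%N -> G k (t + m%:~R * (2 * pi)) = G k t.
Proof. by move=> k6; apply: (periodic_int (fun t => curve_per cG t k6)). Qed.

Lemma reduce_pi (x : R) : exists y (m : int), `|y| <= pi /\ x = y + m%:~R * (2 * pi).
Proof.
have p0 : 0 < 2 * pi :> R by rewrite mulr_gt0// pi_gt0.
have [y [k [/andP[y0 y1] ->]]] := period_reduce x p0.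
have [yp|py] := leP y pi; first by exists y, k; split=> //; rewrite ger0_norm.
exists (y - 2 * pi), (k + 1); split; last by rewrite intrD; ring.
by rewrite ler_norml; apply/andP; lra.
Qed.

(** For the circle the right side is 1 - cos x >= x^2 / 18. The deviation from it vanishes at x = 0
    together with its derivative, so that it is at most 5 eps x^2 and not merely O(eps). *)
Lemma support_near a x : `|x| <= pi -> x ^+ 2 / 20 <= omega (G 1%N a) (G 0%N (a + x) - G 0%N a).
Proof.
move=> xp; have es := eps_small.
have e0 : 0 <= eps by exact: (eps_ge0 cG).
have dE (c : plane R) u u' : vder u u' -> der (fun x => omega c (u x)) (fun x => omega c (u' x)).
  move=> du; apply: (der_eq (der_omega (vder_cst c) du)) => t.
  by rewrite /omega /=; ring.
have d0 k : (k < 6)%N -> vder (fun x => G k (a + x)) (fun x => G k.+1 (a + x)).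
  by move=> k6; apply: vder_shift; exact: (curve_der cG).
pose E0 x := omega (G 1%N a) (G 0%N (a + x)) - omega (ek 1 a) (ek 0 (a + x)).
pose E1 x := omega (G 1%N a) (G 1%N (a + x)) - omega (ek 1 a) (ek 1 (a + x)).
pose E2 x := omega (G 1%N a) (G 2%N (a + x)) - omega (ek 1 a) (ek 2 (a + x)).
have D0 : der E0 E1.
  by apply: der_sub; apply: dE; [exact: d0|exact: vder_shift (ek_der 0)].
have D1 : der E1 E2.
  by apply: der_sub; apply: dE; [exact: d0|exact: vder_shift (ek_der 1)].
have B t : `|E2 t| <= 5 * eps.
  rewrite /E2; have -> : omega (G 1%N a) (G 2%N (a + t)) - omega (ek 1 a) (ek 2 (a + t)) =
    omega (G 1%N a - ek 1 a) (G 2%N (a + t)) + omega (ek 1 a) (G 2%N (a + t) - ek 2 (a + t)).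
    by rewrite omegaBl omegaBr; ring.
  apply: (le_trans (ler_normD _ _)).
  have := omega_le (curve_near cG a (isT : (1 <= 6)%N)) (curve_le (a + t) cG (isT : (2 <= 6)%N)).
  have := omega_le (ek_le1 1 a) (curve_near cG (a + t) (isT : (2 <= 6)%N)).
  have : 2 * eps * (1 + eps) <= 3 * eps by nra.
  lra.
have := taylor2 0 x D0 D1 B; rewrite subr0 -normrX (ger0_norm (sqr_ge0 x)) => T.
have E10 : E1 0 = 0 by rewrite /E1 !addr0 !omegavv subrr.
have E00 : E0 0 = omega (G 1%N a) (G 0%N a) + 1.
  rewrite /E0 !addr0; have := omega_ekS 0 a a; rewrite subrr cos0 omegaC => h.
  by rewrite h.
have c : omega (ek 1 a) (ek 0 (a + x)) = - cos x.
  rewrite omegaC omega_ekS; have -> : a - (a + x) = - x by ring.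
  by rewrite cosN.
move: T; rewrite E10 E00 mul0r subr0 /E0 c opprK ler_norml => /andP[T _].
have := one_sub_cos_ge xp; rewrite omegaBr => C.
have : 5 * eps * x ^+ 2 <= 5 / 1000 * x ^+ 2 by apply: ler_wpM2r; [exact: sqr_ge0|lra].
have := sqr_ge0 x; lra.
Qed.

Lemma support_ge0 a t : 0 <= omega (G 1%N a) (G 0%N t - G 0%N a).
Proof.
have [y [m [yp e]]] := reduce_pi (t - a).
have -> : t = a + y + m%:~R * (2 * pi) by rewrite -addrA -e addrC subrK.
rewrite per2pi//; apply: le_trans (support_near a yp).
by rewrite divr_ge0// sqr_ge0.
Qed.

Lemma support_eq0 a t : omega (G 1%N a) (G 0%N t - G 0%N a) = 0 ->
  exists m : int, t = a + m%:~R * (2 * pi).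
Proof.
have [y [m [yp e]]] := reduce_pi (t - a) => h.
exists m; have := support_near a yp; rewrite -(per2pi (a + y) m)//.
have -> : a + y + m%:~R * (2 * pi) = t by rewrite -addrA -e addrC subrK.
rewrite h => y2; have y0 : y = 0.
  by apply/eqP; rewrite -sqrf_eq0 eq_le sqr_ge0 andbT; lra.
by move: e; rewrite y0 add0r; lra.
Qed.

Lemma curve_inj a t : G 0%N t = G 0%N a -> exists m : int, t = a + m%:~R * (2 * pi).
Proof. by move=> e; apply: support_eq0; rewrite e subrr /omega /=; ring. Qed.

(** The determinant of the two tangents is within 5 eps of sin d, which changes sign on this
    interval. *)
Lemma curve_opposite a : exists2 d, 3 * pi / 4 <= d <= 5 * pi / 4 & omega (G 1%N a) (G 1%N (a + d)) = 0.
Proof.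
have es := eps_small; have p2 := @pi_ge2 R; have p4 := @pi_lt4 R.
have e0 : 0 <= eps by exact: (eps_ge0 cG).
have dE : der (fun x => omega (G 1%N a) (G 1%N (a + x))) (fun x => omega (G 1%N a) (G 2%N (a + x))).
  apply: (der_eq (der_omega (vder_cst (G 1%N a)) (vder_shift a (curve_der cG (isT : (1 < 6)%N))))) => t.
  by rewrite /omega /=; ring.
have B t : `|omega (G 1%N a) (G 1%N (a + t)) - sin t| <= 5 * eps.
  have -> : sin t = omega (ek 1 a) (ek 1 (a + t)) by rewrite omega_ek addrAC subrr add0r.
  have -> : omega (G 1%N a) (G 1%N (a + t)) - omega (ek 1 a) (ek 1 (a + t)) =
    omega (G 1%N a - ek 1 a) (G 1%N (a + t)) + omega (ek 1 a) (G 1%N (a + t) - ek 1 (a + t)).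
    by rewrite omegaBl omegaBr; ring.
  apply: (le_trans (ler_normD _ _)).
  have := omega_le (curve_near cG a (isT : (1 <= 6)%N)) (curve_le (a + t) cG (isT : (1 <= 6)%N)).
  have := omega_le (ek_le1 1 a) (curve_near cG (a + t) (isT : (1 <= 6)%N)).
  have : 2 * eps * (1 + eps) <= 3 * eps by nra.
  lra.
have s : 1 / 6 <= sin (pi / 4) :> R.
  by apply: le_trans (_ : pi / 4 / 3 <= _); [lra|apply: sin_ge_third; apply/andP; lra].
have s1 : sin (3 * pi / 4) = sin (pi / 4) :> R.
  have -> : 3 * pi / 4 = pi - pi / 4 :> R by field.
  by rewrite sinB sinpi cospi; ring.
have s2 : sin (5 * pi / 4) = - sin (pi / 4) :> R.
  have -> : 5 * pi / 4 = pi / 4 + pi :> R by field.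
  by rewrite sinDpi.
apply: (ivt (der_continuous dE)); first lra.
- by have := B (3 * pi / 4); rewrite s1 ler_norml => /andP[? ?]; lra.
- by have := B (5 * pi / 4); rewrite s2 ler_norml => /andP[? ?]; lra.
Qed.

End Support.

Section Affine.
Context {R : realType}.

Definition lin (l1 l2 v : plane R) : plane R := v.1 *: l1 + v.2 *: l2.

Lemma omega_lin (l1 l2 v w : plane R) : omega (lin l1 l2 v) (lin l1 l2 w) = omega l1 l2 * omega v w.
Proof. by rewrite /omega /lin /= /GRing.scale /=; ring. Qed.

Lemma omega_translate (b v w : plane R) :
  omega (b + v) (b + w) = omega b w - omega b v + omega v w.
Proof. by rewrite /omega /=; ring. Qed.

Lemma linB (l1 l2 v w : plane R) : lin l1 l2 (v - w) = lin l1 l2 v - lin l1 l2 w.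
Proof. by rewrite /lin !scalerBl; rewrite opprD addrACA. Qed.

Lemma linZ (c : R) (l1 l2 v : plane R) : lin l1 l2 (c *: v) = c *: lin l1 l2 v.
Proof. by rewrite /lin scalerDr !scalerA. Qed.

Lemma vder_lin (l1 l2 : plane R) (u u' : R -> plane R) : vder u u' ->
  vder (fun t => lin l1 l2 (u t)) (fun t => lin l1 l2 (u' t)).
Proof.
move=> [d1 d2]; split.
  by apply: (der_eq (der_add (der_mul d1 (der_cst l1.1)) (der_mul d2 (der_cst l2.1)))) => t;
     rewrite !mulr0 !addr0.
by apply: (der_eq (der_add (der_mul d1 (der_cst l1.2)) (der_mul d2 (der_cst l2.2)))) => t;
   rewrite !mulr0 !addr0.
Qed.

End Affine.

(** The action written with the original parametrization of period 1. It does not involve the normal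
    form, whose dependence on tau is unknown, and is therefore the quantity shown to be continuous
    in tau. *)
Definition pact {R : realType} (gamma : R -> plane R) q (u : nat -> R) : R :=
  \sum_(0 <= j < q) omega (gamma (pt (stp q) u j / (2 * pi))) (gamma (pt (stp q) u j.+1 / (2 * pi))).

(** * Billiard trajectories from maximal polygons *)

Section Trajectory.
Context {R : realType}.
Variables (eps : R) (G : nat -> R -> plane R).
Hypothesis kG : canon eps G.
Hypothesis eps_tiny : eps <= 1 / (100 * 100 * 100 * 100).
Variables (b l1 l2 : plane R) (gamma : R -> plane R).
Hypothesis D0 : 0 < omega l1 l2.
Hypothesis gE : forall s, gamma s = b + lin l1 l2 (G 0%N (2 * pi * s)).

Let cG := canon_curve kG.
Let es : eps <= 1 / 1000.
Proof. by have := eps_tiny; lra. Qed.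

Lemma gamma_der : vder gamma (fun s => (2 * pi) *: lin l1 l2 (G 1%N (2 * pi * s))).
Proof.
apply: (vder_ext (u := fun s => b + lin l1 l2 (G 0%N (2 * pi * s)))) => [s|]; first by rewrite gE.
have d : der (fun s : R => 2 * pi * s) (fun=> 2 * pi).
  by apply: (der_eq (der_scale (2 * pi) der_id)) => t; rewrite mulr1.
apply: (vder_eq (vder_add (vder_cst b) (vder_lin l1 l2 (vder_comp (curve_der cG (isT : (0 < 6)%N)) d)))) => t.
by rewrite add0r linZ.
Qed.

Lemma gamma_derive1 s : gamma^`() s = (2 * pi) *: lin l1 l2 (G 1%N (2 * pi * s)).
Proof. by have [_ ->] := vder_derive1 gamma_der. Qed.

Lemma gamma_sub s t : gamma t - gamma s = lin l1 l2 (G 0%N (2 * pi * t) - G 0%N (2 * pi * s)).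
Proof. by rewrite !gE linB opprD addrACA subrr add0r. Qed.

Lemma gamma_eq s t : gamma s = gamma t -> G 0%N (2 * pi * s) = G 0%N (2 * pi * t).
Proof.
move=> e; apply/eqP; rewrite -subr_eq0.
have := gamma_sub t s; rewrite e subrr => /esym h.
have k v : omega l1 l2 * omega (G 0%N (2 * pi * s) - G 0%N (2 * pi * t)) v = 0.
  by rewrite -omega_lin h /omega /=; ring.
have {}k v : omega (G 0%N (2 * pi * s) - G 0%N (2 * pi * t)) v = 0.
  by have /eqP := k v; rewrite mulf_eq0 gt_eqF//= => /eqP.
move: (G 0%N (2 * pi * s) - _) k => w k; have := k (0, 1); have := k (1, 0); rewrite /omega /= => e1 e2.
by rewrite -subr_eq0 subr0; apply/eqP; rewrite [w]surjective_pairing; congr pair; lra.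
Qed.

Let pp0 : 0 < 2 * pi :> R.
Proof. by rewrite mulr_gt0// pi_gt0. Qed.

Let scale (t : R) : 2 * pi * (t / (2 * pi)) = t.
Proof. by rewrite mulrC divfK// gt_eqF. Qed.

(** The terms containing the translation [b] telescope around the closed polygon. *)
Lemma pact_act q u : (0 < q)%N -> u 0%N = 0 -> u q = 0 ->
  pact gamma q u = omega l1 l2 * act G (stp q) q u.
Proof.
move=> q0 u0 uq; rewrite /pact /act mulr_sumr.
rewrite (eq_bigr (fun j => (omega b (lin l1 l2 (G 0%N (pt (stp q) u j.+1))) - omega b (lin l1 l2 (G 0%N (pt (stp q) u j))))
  + omega l1 l2 * omega (G 0%N (pt (stp q) u j)) (G 0%N (pt (stp q) u j.+1)))); last first.
  by move=> j _; rewrite !gE !scale -omega_lin omega_translate.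
rewrite big_split/= -[RHS]add0r; congr (_ + _).
rewrite (sum_telescope (fun j => omega b (lin l1 l2 (G 0%N (pt (stp q) u j))))).
by rewrite {1}/pt uq addr0 stp_mul// /pt u0 mul0r addr0 -[2 * pi]add0r (curve_per cG)// subrr.
Qed.

Section Polygon.
Variables (p : nat) (u : nat -> R).
Hypothesis p2 : (2 < p.+1)%N.
Hypothesis um : maxi G p.+1 u.
Local Notation q := p.+1.
Local Notation h := (stp p.+1 : R).

(** A displacement is meaningful up to index q only, while trajectories run over all natural
    numbers; with this periodic extension the parameters advance by 2 pi per turn. *)
Let ub j := u (j %% q).
Let th j : R := pt h ub j.

Lemma th_per j m : th (j + m * q) = th j + m%:R * (2 * pi).
Proof. rewrite /th /pt /ub (_ : (j + m * q) %% q = j %% q)%N; last by rewrite addnC modnMDl.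
by rewrite natrD natrM mulrDl -mulrA stp_mul//; ring. Qed.

Lemma th_small j : (j <= q)%N -> th j = pt h u j.
Proof.
have [[u0 uq _ _] _] := um.
rewrite leq_eqVlt => /orP[/eqP ->|jq]; last by rewrite /th /pt /ub modn_small.
by rewrite /th /pt /ub modnn u0 uq.
Qed.

Lemma th_split j : exists r m, [/\ (r < q)%N & forall k, th (j + k) = th (r + k) + m%:R * (2 * pi)].
Proof.
exists (j %% q)%N, (j %/ q)%N; split=> [|k]; first by rewrite ltn_mod.
by rewrite -th_per {1}(divn_eq j q); congr th; rewrite -addnA addnC.
Qed.

Lemma th_step j : `|th j.+1 - th j - h| < h / 8.
Proof.
have [r [m [rq E]]] := th_split j.
have := E 0%N; have := E 1%N; rewrite !addn0 !addn1 => -> ->.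
rewrite !th_small//; last exact: ltnW.
have := maxi_step_lt kG eps_tiny p2 um rq.
rewrite pt_step; congr (`|_| < _); ring.
Qed.

Lemma th_crit j : omega (G 1%N (th j.+1)) (G 0%N (th j.+2) - G 0%N (th j)) = 0.
Proof.
have [r [m [rq E]]] := th_split j.
have := E 0%N; have := E 1%N; have := E 2%N; rewrite !addn0 !addn1 !addn2 => -> -> ->.
have P k t : (k <= 6)%N -> G k (t + m%:R * (2 * pi)) = G k t := @per2pi _ _ _ cG k t m%:Z.
rewrite !P//.
have [rp|] := ltnP r p.
  by rewrite !th_small ?(ltnW rq)//; exact: (grad_eq0 kG).
move=> pr; have -> : r = p by apply/eqP; rewrite eqn_leq pr andbT -ltnS.
have e1 : th q = th 0%N + 2 * pi by have := th_per 0 1; rewrite mul1n add0n mul1r.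
have e2 : th q.+1 = th 1%N + 2 * pi by have := th_per 1 1; rewrite mul1n add1n mul1r.
rewrite e1 e2 !(curve_per cG)// !th_small//.
have [[u0 _ _ _] _] := um.
have -> : pt h u 0 = 0 by rewrite /pt u0 mul0r addr0.
exact: (grad_marked kG).
Qed.

Let x j := gamma (th j / (2 * pi)).

Let dist_lt8 s t : 0 < s - t < 2 * pi -> G 0%N s <> G 0%N t.
Proof.
move=> /andP[s0 s1] /(curve_inj cG es)[m e].
have : s - t = m%:~R * (2 * pi) by rewrite e; ring.
move=> e'; move: s0 s1; rewrite e' pmulr_lgt0// gtr_pMl// ltr0z ltrz1.
by case: (m) => [[|n]|n].
Qed.

(** A step is shorter than 9 h / 8 <= 3 pi / 4, hence ends before the opposite point given by
    [curve_opposite]. Two steps are shorter than 3 pi / 2, so vertices j and j + 2 are distinct. *)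
Lemma trajectory_step j : billiard_step gamma (x j) (x j.+1) (x j.+2).
Proof.
have p4 := @pi_lt4 R; have pg2 := @pi_ge2 R.
have h0 : 0 < h by exact: stp_gt0.
have h3 := @stp_le3 R q p2.
have s1 := th_step j; have s2 := th_step j.+1.
apply: Or31; split.
  have [d /andP[d1 d2] e] := curve_opposite cG es (th j).
  exists (gamma ((th j + d) / (2 * pi))); split.
    split.
      move=> /gamma_eq; rewrite !scale => /esym; apply: dist_lt8.
      by apply/andP; lra.
    exists (th j / (2 * pi)), ((th j + d) / (2 * pi)); split=> //.
    by rewrite !gamma_derive1 !scale (omegaZl (2 * pi)) (omegaZr (2 * pi)) omega_lin e !mulr0.
  exists (th j / (2 * pi)), (th j.+1 / (2 * pi)), ((th j + d) / (2 * pi)); split=> //.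
  rewrite !ltr_pM2r ?invr_gt0//; split; first by move: s1; rewrite ltr_norml => /andP[? ?]; lra.
  split; first by move: s1; rewrite ltr_norml => /andP[? ?]; lra.
  have -> : th j / (2 * pi) + 1 = (th j + 2 * pi) / (2 * pi) by rewrite [RHS]mulrDl divff// gt_eqF.
  by rewrite ltr_pM2r ?invr_gt0//; lra.
split; first by exists (th j.+2 / (2 * pi)).
  move=> /gamma_eq; rewrite !scale; apply: dist_lt8.
  by move: s1 s2; rewrite !ltr_norml => /andP[? ?] /andP[? ?]; apply/andP; lra.
exists (th j.+1 / (2 * pi)); split=> //.
by rewrite gamma_derive1 /x gamma_sub !scale (omegaZl (2 * pi)) omega_lin th_crit !mulr0.
Qed.

Lemma maxi_trajectory : exists x, closed_trajectory gamma q x /\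
  action q x = omega l1 l2 * act G h q u.
Proof.
exists x; split; first split=> //.
- move=> j; rewrite /x; have := th_per j 1; rewrite mul1n mul1r => ->.
  by rewrite !gE !scale (curve_per cG).
- exact: trajectory_step.
have [[u0 uq _ _] _] := um.
rewrite -pact_act// /action /pact; apply: eq_big_nat => j /andP[_ jq].
by rewrite /x !th_small// ltnW.
Qed.

End Polygon.
End Trajectory.

(** * The spectrum is negligible *)

Section Null.
Context {R : realType}.
Notation mu := (@lebesgue_measure R).

(** At scale n the set is covered by n^2 intervals of length O(n^(-3)), of total length O(1 / n). *)
Lemma cover_negligible (S : set R) (C : R) : 0 <= C ->
  (forall n : nat, (0 < n)%N -> exists c : nat -> R,
    forall x, S x -> exists2 i, (i < n * n)%N & `|x - c i| <= C / n%:R ^+ 3) ->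
  mu.-negligible S.
Proof.
move=> C0 H.
pose w (n : nat) : R := C / n%:R ^+ 3.
have [c Hc] : exists c : nat -> nat -> R, forall n, (0 < n)%N ->
    forall x, S x -> exists2 i, (i < n * n)%N & `|x - c n i| <= w n.
  have h n : exists c : nat -> R, (0 < n)%N ->
      forall x, S x -> exists2 i, (i < n * n)%N & `|x - c i| <= w n.
    have [n0|] := ltnP 0 n; last by exists (fun=> 0).
    by have [c Hc] := H n n0; exists c.
  by have [c Hc] := choice h; exists c.
pose I n i : set R := `[c n i - w n, c n i + w n]%classic.
pose B n := \big[setU/set0]_(i < n.+1 * n.+1) I n.+1 i.
have mB n : measurable (B n) by apply: bigsetU_measurable => i _; exact: measurable_itv.
have w0 n : 0 <= w n by rewrite divr_ge0// exprn_ge0.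
have muB n : (mu (B n) <= (2 * C / n.+1%:R)%:E)%E.
  apply: (@le_trans _ _ (\sum_(i < n.+1 * n.+1) mu (I n.+1 i))%E).
    by apply: (@Boole_inequality _ _ _ mu (I n.+1)) => i _; exact: measurable_itv.
  have mI i : (mu (I n.+1 i) <= (2 * w n.+1)%:E)%E.
    rewrite lebesgue_measure_itv /=; case: ifP => _; last by rewrite lee_fin mulr_ge0.
    by rewrite -EFinB lee_fin; lra.
  apply: (@le_trans _ _ (\sum_(i < n.+1 * n.+1) (2 * w n.+1)%:E)%E).
    by apply: lee_sum => i _; exact: mI.
  rewrite sumEFin lee_fin sumr_const card_ord -[_ *+ (n.+1 * n.+1)]mulr_natl natrM /w.
  rewrite le_eqVlt; apply/orP; left; apply/eqP; field.
  by rewrite gt_eqF// ltr_pwDl.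
exists (\bigcap_n B n); split.
- exact: bigcapT_measurable.
- apply/eqP; rewrite eq_le measure_ge0 andbT.
  have le n : (mu (\bigcap_n B n) <= (2 * C / n.+1%:R)%:E)%E.
    apply: le_trans (muB n); apply: le_measure; rewrite ?inE//; [exact: bigcapT_measurable|exact: mB|by move=> x; apply].
  have fin : mu (\bigcap_n B n) \is a fin_num.
    by rewrite ge0_fin_numE// (le_lt_trans (le 0%N))// ltry.
  rewrite -(fineK fin) lee_fin.
  apply: (@vanishing_inv _ _ 0 (2 * C)) => [|r r0]; first by rewrite mulr_ge0.
  by rewrite add0r -lee_fin fineK//; case: r r0.
- move=> x Sx n _; have [i ni xi] := Hc n.+1 isT x Sx.
  rewrite /B -bigcup_mkord; exists i => //=.
  by rewrite /I /= in_itv /=; move: xi; rewrite ler_norml => /andP[? ?]; apply/andP; lra.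
Qed.

(** A Sard-type argument with two parameters: on each of n^2 cells of the unit square the value
    varies by O(n^(-3)). *)
Lemma cube_negligible (T : Type) (P : T -> Prop) (val p1 p2 : T -> R) (K : R) : 0 <= K ->
  (forall a, P a -> 0 <= p1 a < 1 /\ 0 <= p2 a < 1) ->
  (forall a b, P a -> P b -> `|val a - val b| <= K * (`|p1 a - p1 b| + `|p2 a - p2 b|) ^+ 3) ->
  mu.-negligible [set x | exists2 a, P a & val a = x].
Proof.
move=> K0 Pp H; apply: (@cover_negligible _ (8 * K)) => [|n n0]; first by rewrite mulr_ge0.
have nR : 0 < n%:R :> R by rewrite ltr0n.
have cellP (x : R) : 0 <= x < 1 -> exists2 i, (i < n)%N & i%:R / n%:R <= x <= i.+1%:R / n%:R.
  move=> /andP[x0 x1]; exists (Num.truncn (x * n%:R)).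
    by rewrite truncn_lt_nat ?mulr_ge0// ?ltW// gtr_pMl.
  have /andP[a b] : (Num.truncn (x * n%:R))%:R <= x * n%:R < (Num.truncn (x * n%:R)).+1%:R.
    by rewrite truncn_le ?mulr_ge0//= ?ltW//= truncnS_gt.
  by rewrite ler_pdivrMr// a ler_pdivlMr// ltW.
pose cell i j a := (i%:R / n%:R <= p1 a <= i.+1%:R / n%:R) /\ (j%:R / n%:R <= p2 a <= j.+1%:R / n%:R).
have [c Hc] : exists c : nat -> R, forall k, forall a, P a -> cell (k %/ n)%N (k %% n)%N a ->
    `|val a - c k| <= 8 * K / n%:R ^+ 3.
  suff /choice[c Hc] : forall k, exists x, forall a, P a -> cell (k %/ n)%N (k %% n)%N a ->
    `|val a - x| <= 8 * K / n%:R ^+ 3 by exists c.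
  move=> k.
  have [[b [Pb cb]]|no] := pselect (exists b, P b /\ cell (k %/ n)%N (k %% n)%N b); last first.
    by exists 0 => a Pa ca; case: no; exists a.
  exists (val b) => a Pa ca; apply: (le_trans (H a b Pa Pb)).
  have dn x y (i : nat) : i%:R / n%:R <= x <= i.+1%:R / n%:R -> i%:R / n%:R <= y <= i.+1%:R / n%:R ->
      `|x - y| <= n%:R^-1 :> R.
    move=> /andP[a1 a2] /andP[b1 b2]; rewrite -[i.+1%:R]natr1 mulrDl mul1r in a2 b2.
    by rewrite ler_norml; apply/andP; lra.
  have [ca1 ca2] := ca; have [cb1 cb2] := cb.
  have := dn _ _ _ ca1 cb1; have := dn _ _ _ ca2 cb2 => e1 e2.
  have S : `|p1 a - p1 b| + `|p2 a - p2 b| <= 2 / n%:R by lra.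
  have -> : 8 * K / n%:R ^+ 3 = K * (2 / n%:R) ^+ 3 by field; rewrite gt_eqF.
  apply: ler_wpM2l => //; have S0 : 0 <= `|p1 a - p1 b| + `|p2 a - p2 b| by rewrite addr_ge0.
  by apply: lerXn2r => //; rewrite nnegrE//; apply: le_trans S.
exists c => x [a Pa <-].
have [/cellP[i ni ci] /cellP[j nj cj]] := Pp a Pa.
exists (i * n + j)%N.
  by apply: (@leq_trans (i.+1 * n)); rewrite ?mulSn ?[(n + _)%N]addnC ?ltn_add2l// -mulSnr leq_mul2r ni orbT.
apply: Hc => //; rewrite divnMDl ?(leq_ltn_trans _ nj)// divn_small// addn0 modnMDl modn_small//.
Qed.

Lemma interval_not_negligible (S : set R) (a b : R) : a < b ->
  (forall x, a <= x <= b -> S x) -> ~ mu.-negligible S.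
Proof.
move=> ab H nS.
have nI : mu.-negligible `[a, b]%classic.
  by apply: (@negligibleS _ _ _ mu _ _ _ nS) => x /=; rewrite in_itv; exact: H.
have e : mu `[a, b]%classic = 0%E := (negligibleP mu (measurable_itv _)).1 nI.
have := lebesgue_measure_itv `[a, b]%R; rewrite e /= lte_fin ab -EFinB => -[] /esym/eqP.
by rewrite subr_eq0 gt_eqF.
Qed.

Lemma countable_negligible (T : countType) (F : T -> set R) :
  (forall i, mu.-negligible (F i)) -> mu.-negligible [set x | exists i, F i x].
Proof.
move=> H; apply: (@negligibleS _ _ _ mu (\bigcup_k (if unpickle k is Some i then F i else set0))).
  by move=> x [i Fi]; exists (pickle i) => //; rewrite pickleK.
apply: negligible_bigcup => k; case: (unpickle k) => [i|]; [exact: H|exact: (@negligible_set0 _ _ _ mu)].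
Qed.

End Null.

Lemma periodic_mod (V : Type) (c : nat -> V) q : (forall j, c (j + q)%N = c j) ->
  forall j, c j = c (j %% q)%N.
Proof.
move=> pc j; rewrite {1}(divn_eq j q); elim: (j %/ q)%N => [|m IH]; first by rewrite mul0n.
by rewrite mulSn -addnA addnC pc.
Qed.

(** * Critical values of the action *)

Section CriticalValues.
Context {R : realType}.
Variables (g : nat -> R -> plane R) (M : R).
Hypothesis gd : forall k, (k < 3)%N -> vder (g k) (g k.+1).
Hypothesis gM : forall k t, (k <= 3)%N -> `|g k t| <= M.

Lemma trapezoid (f f1 f2 f3 : R -> R) (B : R) : der f f1 -> der f1 f2 -> der f2 f3 ->
  (forall x, `|f3 x| <= B) -> `|f 1 - f 0 - (f1 0 + f1 1) / 2| <= 2 * B.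
Proof.
move=> d0 d1 d2 fB.
have B0 : 0 <= B by exact: le_trans (fB 0).
have T1 := taylor2 0 1 d1 d2 fB.
have D : der (fun x => f x - x * f1 0 - x * x / 2 * f2 0) (fun x => f1 x - f1 0 - f2 0 * x).
  apply: (der_eq (der_sub (der_sub d0 (der_mul der_id (der_cst (f1 0))))
    (der_mul (der_mul (der_mul der_id der_id) (der_cst 2^-1)) (der_cst (f2 0))))) => x; by field.
have T2 := @mvt_le _ _ _ B 0 1 D.
have {}T2 : `|f 1 - f1 0 - f2 0 / 2 - f 0| <= B.
  move: T2; rewrite /= !mul0r !mul1r !subr0 normr1 mulr1 [_ * f2 0]mulrC; apply => x.
  move=> hx; have /andP[x0 x1] : 0 <= x <= 1 by case/orP: hx => // /andP[? ?]; apply/andP; lra.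
  have := taylor2 0 x d1 d2 fB; rewrite !subr0 => /le_trans; apply.
  rewrite ger0_norm// ler_piMr// expr2; nra.
by move: T1 T2; rewrite !subr0 normr1 expr1n !mulr1 !ler_norml => /andP[? ?] /andP[? ?]; apply/andP; lra.
Qed.

(* A cyclic q-gon with parameters a is critical for the sum of the omega's; the
   last condition says that a (j + 2) is determined by a j and a (j + 1). *)
Definition critical (q : nat) (a : nat -> R) : Prop :=
  [/\ (forall j, 0 <= a j < 1), (forall j, a (j + q)%N = a j),
      (forall j, omega (g 1 (a j.+1)) (g 0 (a j.+2) - g 0 (a j)) = 0) &
      forall j, a j.+2 = a j \/ omega (g 1 (a j.+1)) (g 1 (a j.+2)) != 0].

Definition perim (q : nat) (a : nat -> R) : R := \sum_(0 <= j < q) omega (g 0 (a j)) (g 0 (a j.+1)).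

(* On such a class the dependence of a on its first two values is uniformly Lipschitz. *)
Definition sorted_class (q k N : nat) (E : seq bool) (B : seq nat) (a : nat -> R) : Prop :=
  [/\ critical q a,
      forall j, (j < q)%N -> if nth false E j then a j.+2 = a j
                 else 1 / k.+1%:R <= `|omega (g 1 (a j.+1)) (g 1 (a j.+2))| &
      forall j, (j < q)%N -> (nth 0%N B j)%:R / N%:R <= a j <= (nth 0%N B j).+1%:R / N%:R].

(** Along the segment from b to a the derivative of the action vanishes at both ends, so the
    trapezoid rule leaves only its error, governed by the third derivative. *)
Lemma cubic_bound q (a b : nat -> R) (T : R) : critical q a -> critical q b ->
  (forall j, `|a j - b j| <= T) -> `|perim q a - perim q b| <= q%:R * (32 * M ^+ 2 * T ^+ 3).
Proof.
move=> [_ pa ca _] [_ pb cb _] dT.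
have M0 : 0 <= M by exact: le_trans (gM 0 (isT : (0 <= 3)%N)).
have T0 : 0 <= T by exact: le_trans (dT 0%N).
pose d j := a j - b j; pose s j x := b j + x * d j.
have pd j : d (j + q)%N = d j by rewrite /d pa pb.
have ds j : der (s j) (fun=> d j).
  by apply: (der_eq (der_add (der_cst (b j)) (der_mul der_id (der_cst (d j))))) => x; rewrite mul1r mulr0 addr0 add0r.
have dg k j : (k < 3)%N -> vder (fun x => g k (s j x)) (fun x => d j *: g k.+1 (s j x)).
  by move=> k3; exact: vder_comp (gd k3) (ds j).
pose W i k j x := omega (g i (s j x)) (g k (s j.+1 x)).
have dW i k j : (i < 3)%N -> (k < 3)%N -> der (W i k j) (fun x => d j * W i.+1 k j x + d j.+1 * W i k.+1 j x).
  by move=> i3 k3; apply: (der_eq (der_omega (dg i j i3) (dg k j.+1 k3))) => x; rewrite omegaZl omegaZr.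
pose F x := \sum_(0 <= j < q) W 0 0 j x.
pose F1 x := \sum_(0 <= j < q) (d j * W 1 0 j x + d j.+1 * W 0 1 j x).
pose F2 x := \sum_(0 <= j < q) (d j * (d j * W 2 0 j x + d j.+1 * W 1 1 j x)
   + d j.+1 * (d j * W 1 1 j x + d j.+1 * W 0 2 j x)).
pose F3 x := \sum_(0 <= j < q) (d j * (d j * (d j * W 3 0 j x + d j.+1 * W 2 1 j x) + d j.+1 * (d j * W 2 1 j x + d j.+1 * W 1 2 j x))
   + d j.+1 * (d j * (d j * W 2 1 j x + d j.+1 * W 1 2 j x) + d j.+1 * (d j * W 1 2 j x + d j.+1 * W 0 3 j x))).
have D0 : der F F1 by apply: der_sum => j _; exact: dW.
have D1 : der F1 F2 by apply: der_sum => j _; apply: der_add; apply: der_scale; exact: dW.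
have D2 : der F2 F3.
  by apply: der_sum => j _; apply: der_add; apply: der_scale; apply: der_add; apply: der_scale; exact: dW.
have WM i k j x : (i <= 3)%N -> (k <= 3)%N -> `|W i k j x| <= 2 * M ^+ 2.
  by move=> i3 k3; have := omega_le (gM (s j x) i3) (gM (s j.+1 x) k3); rewrite expr2 mulrA.
have comb (x y w z X : R) : `|x| <= T -> `|w| <= T -> `|y| <= X -> `|z| <= X -> `|x * y + w * z| <= 2 * T * X.
  move=> xT wT yX zX; apply: (le_trans (ler_normD _ _)); rewrite !normrM.
  have : `|x| * `|y| <= T * X by apply: ler_pM.
  have : `|w| * `|z| <= T * X by apply: ler_pM.
  lra.
have B x : `|F3 x| <= q%:R * (16 * M ^+ 2 * T ^+ 3).
  have -> : q%:R * (16 * M ^+ 2 * T ^+ 3) = \sum_(0 <= j < q) (2 * T * (2 * T * (2 * T * (2 * M ^+ 2)))).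
    by rewrite sumr_const_nat subn0 -[_ *+ q]mulr_natl; ring.
  apply: ler_sum_abs => j _.
  do 3! (apply: (@comb _ _ _ _ _); [exact: dT|exact: dT| |]); exact: WM.
have crit (c : nat -> R) x : (forall j, s j x = c j) -> (forall j, c (j + q)%N = c j) ->
    (forall j, omega (g 1 (c j.+1)) (g 0 (c j.+2) - g 0 (c j)) = 0) -> F1 x = 0.
  move=> E pc cc; rewrite /F1 big_split /=.
  have -> : \sum_(0 <= j < q) d j * W 1 0 j x = \sum_(0 <= j < q) d j.+1 * W 1 0 j.+1 x.
    have H := @sum_shift_per R (fun j => d j * W 1 0 j x) q; rewrite H//.
    by rewrite -[q in LHS]add0n pd /W !E -[q.+1]/(1 + q)%N -[q]/(0 + q)%N addnA !pc add0n.
  rewrite -big_split big1// => j _; have := cc j; rewrite /= /W !E omegaBr [omega (g 0 (c j)) _]omegaC => h.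
  have -> : omega (g 1 (c j.+1)) (g 0 (c j.+2)) = omega (g 1 (c j.+1)) (g 0 (c j)) by lra.
  by ring.
have s0 j : s j 0 = b j by rewrite /s mul0r addr0.
have s1 j : s j 1 = a j by rewrite /s /d mul1r addrC subrK.
have := trapezoid D0 D1 D2 B.
rewrite (crit b 0 s0 pb cb) (crit a 1 s1 pa ca) addr0 mul0r subr0.
have -> : F 1 = perim q a by apply: eq_bigr => j _; rewrite /W !s1.
have -> : F 0 = perim q b by apply: eq_bigr => j _; rewrite /W !s0.
by move/le_trans; apply; rewrite le_eqVlt; apply/orP; left; apply/eqP; ring.
Qed.

(** A quantitative implicit function theorem: transversality bounds the linear term in z - z' from
    below, and boxes of side 1 / N are so small that the quadratic term is at most half of it. *)
Lemma class_step (k : nat) (N : nat) (x y z x' y' z' : R) : 1 <= M -> 4 * k.+1%:R * M ^+ 2 <= N%:R ->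
  omega (g 1 y) (g 0 z - g 0 x) = 0 -> omega (g 1 y') (g 0 z' - g 0 x') = 0 ->
  `|z - z'| <= N%:R^-1 -> 1 / k.+1%:R <= `|omega (g 1 y) (g 1 z)| ->
  `|z - z'| <= 8 * k.+1%:R * M ^+ 2 * (`|x - x'| + `|y - y'|).
Proof.
move=> M1 NM c c' zN tr.
have M0 : 0 <= M by lra.
have k0 : 0 < k.+1%:R :> R by rewrite ltr0n.
have lip j u v : (j < 3)%N -> `|g j u - g j v| <= M * `|u - v|.
  by move=> j3; apply: (vmvt_le (gd j3)) => t _; exact: gM.
have E : omega (g 1 y) (g 0 z - g 0 z') = omega (g 1 y) (g 0 x - g 0 x') - omega (g 1 y - g 1 y') (g 0 z' - g 0 x').
  move: c c'; rewrite !omegaBr !omegaBl => c c'.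
  have -> : omega (g 1 y) (g 0 z) = omega (g 1 y) (g 0 x) by lra.
  have -> : omega (g 1 y') (g 0 z') = omega (g 1 y') (g 0 x') by lra.
  by ring.
have S0 : 0 <= `|x - x'| + `|y - y'| by rewrite addr_ge0.
have b1 : `|omega (g 1 y) (g 0 z - g 0 z')| <= 4 * M ^+ 2 * (`|x - x'| + `|y - y'|).
  rewrite E; apply: (le_trans (ler_normB _ _)).
  have h1 := omega_le (gM y (isT : (1 <= 3)%N)) (lip 0%N x x' isT).
  have h2 := omega_le (lip 1%N y y' isT) (normB_le (gM z' (isT : (0 <= 3)%N)) (gM x' (isT : (0 <= 3)%N))).
  have p1 : 0 <= M ^+ 2 * `|x - x'| by rewrite mulr_ge0// sqr_ge0.
  apply: (le_trans (lerD h1 h2)); rewrite expr2 in p1 *; lra.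
have dz : der (fun t => omega (g 1 y) (g 0 t)) (fun t => omega (g 1 y) (g 1 t)).
  by apply: (der_eq (der_omega (vder_cst (g 1 y)) (gd (isT : (0 < 3)%N)))) => t; rewrite /omega /=; ring.
have dz1 : der (fun t => omega (g 1 y) (g 1 t)) (fun t => omega (g 1 y) (g 2 t)).
  by apply: (der_eq (der_omega (vder_cst (g 1 y)) (gd (isT : (1 < 3)%N)))) => t; rewrite /omega /=; ring.
have dz2 t : `|omega (g 1 y) (g 2 t)| <= 2 * M ^+ 2.
  by have := omega_le (gM y (isT : (1 <= 3)%N)) (gM t (isT : (2 <= 3)%N)); rewrite expr2 mulrA.
have := taylor2 z z' dz dz1 dz2; rewrite -omegaBr.
set w := omega (g 1 y) (g 1 z); set D := `|z - z'|; rewrite [`|z' - z|]distrC -/D => T.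
have D0 : 0 <= D by exact: normr_ge0.
have N0 : 0 < N%:R :> R.
  apply: (lt_le_trans _ NM); apply: mulr_gt0; first exact: mulr_gt0.
  by apply: exprn_gt0; lra.
have wD : `|w * (z' - z)| <= 4 * M ^+ 2 * (`|x - x'| + `|y - y'|) + 2 * M ^+ 2 * D ^+ 2.
  move: b1; rewrite -[g 0 z - g 0 z']opprB omegaNr normrN => b1.
  have := ler_normB (omega (g 1 y) (g 0 z' - g 0 z)) (omega (g 1 y) (g 0 z' - g 0 z) - w * (z' - z)).
  by rewrite subKr; lra.
rewrite normrM [`|z' - z|]distrC -/D in wD.
have wk : D / k.+1%:R <= `|w| * D by have := ler_wpM2r D0 tr; rewrite mulrAC mul1r mulrC.
have q1 : 2 * M ^+ 2 * D ^+ 2 <= D / k.+1%:R / 2.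
  have -> : 2 * M ^+ 2 * D ^+ 2 = 4 * k.+1%:R * M ^+ 2 * D * (D / k.+1%:R / 2).
    by field; rewrite gt_eqF// ltr_pwDl.
  apply: ler_piMl; first by rewrite !divr_ge0// ltW.
  apply: (@le_trans _ _ (N%:R * D)); first exact: ler_wpM2r.
  by apply: (@le_trans _ _ (N%:R * N%:R^-1)); [apply: ler_wpM2l => //; exact: ltW|rewrite divff// gt_eqF].
have : D / k.+1%:R <= 8 * M ^+ 2 * (`|x - x'| + `|y - y'|).
  move: (D / k.+1%:R) (2 * M ^+ 2 * D ^+ 2) (`|w| * D) wk q1 wD => d1 d2 d3 *; lra.
by rewrite ler_pdivrMr// => /le_trans; apply; rewrite le_eqVlt; apply/orP; left; apply/eqP; ring.
Qed.

Hypothesis M1 : 1 <= M.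

(** [class_step] is iterated along one period; the pattern [E] records the places where the polygon
    turns back, at which the earlier vertex is simply repeated. *)
Lemma class_lip (k N : nat) q E B a b : 4 * k.+1%:R * M ^+ 2 <= N%:R ->
  sorted_class q k N E B a -> sorted_class q k N E B b -> (0 < q)%N ->
  forall j, `|a j - b j| <= (2 * (8 * k.+1%:R * M ^+ 2)) ^+ q * (`|a 0%N - b 0%N| + `|a 1%N - b 1%N|).
Proof.
move=> NM [ca Ea Ba] [cb Eb Bb] q0 j.
have [a01 pa qa _] := ca; have [b01 pb qb _] := cb.
set L := 8 * k.+1%:R * M ^+ 2; set S := `|a 0%N - b 0%N| + _.
have S0 : 0 <= S by rewrite addr_ge0.
have L1 : 1 <= L.
  have : 1 <= M ^+ 2 by rewrite expr2; have := M1; nra.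
  have : 1 <= k.+1%:R :> R by rewrite ler1n.
  rewrite /L -mulrA; move: (k.+1%:R) (M ^+ 2) => x y ? ?; nra.
have N0 : 0 < N%:R :> R.
  apply: (lt_le_trans _ NM); apply: mulr_gt0; first by apply: mulr_gt0.
  by apply: exprn_gt0; have := M1; lra.
have box i : (i < q)%N -> `|a i - b i| <= N%:R^-1.
  move=> iq; have /andP[x1 x2] := Ba i iq; have /andP[y1 y2] := Bb i iq.
  rewrite -[_.+1%:R]natr1 mulrDl mul1r in x2 y2.
  by rewrite ler_norml; apply/andP; lra.
have K i : (i < q)%N -> `|a i - b i| <= (2 * L) ^+ i * S.
  suff : ((i < q)%N -> `|a i - b i| <= (2 * L) ^+ i * S) /\
         ((i.+1 < q)%N -> `|a i.+1 - b i.+1| <= (2 * L) ^+ i.+1 * S) by case.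
  elim: i => [|i [IH1 IH2]].
    split=> _; first by rewrite expr0 mul1r lerDl.
    rewrite expr1; apply: (@le_trans _ _ S); first by rewrite lerDr.
    by rewrite ler_peMl//; lra.
  split=> // iq; have i1 : (i.+1 < q)%N by exact: ltnW.
  have {}IH1 := IH1 (ltnW i1); have {}IH2 := IH2 i1.
  have P0 : 0 <= (2 * L) ^+ i * S by apply: mulr_ge0 => //; apply: exprn_ge0; lra.
  have IH3 : (2 * L) ^+ i * S <= (2 * L) ^+ i.+1 * S.
    by rewrite exprS -mulrA ler_peMl//; lra.
  have := Ea i (ltnW i1); have := Eb i (ltnW i1); case: ifP => _ Eb' Ea'.
    rewrite Ea' Eb'; apply: (le_trans IH1); apply: (le_trans IH3).
    have -> : (2 * L) ^+ i.+2 * S = (2 * L) * ((2 * L) ^+ i.+1 * S) by rewrite mulrA -exprS.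
    by rewrite ler_peMl//; [exact: le_trans IH3|lra].
  apply: (le_trans (class_step M1 NM (qa i) (qb i) (box _ iq) Ea')).
  have -> : (2 * L) ^+ i.+2 * S = L * (2 * ((2 * L) ^+ i.+1 * S)) by rewrite exprS; ring.
  by rewrite -/L; apply: ler_wpM2l; lra.
have jq : (j %% q < q)%N by rewrite ltn_mod.
rewrite (periodic_mod pa j) (periodic_mod pb j).
apply: (le_trans (K _ jq)); apply: ler_wpM2r => //.
by apply: ler_weXn2l; [lra|exact: ltnW].
Qed.

Lemma class_negligible (n k N : nat) q E B : 4 * k.+1%:R * M ^+ 2 <= N%:R -> (0 < q)%N ->
  (@lebesgue_measure R).-negligible
    [set x | exists2 a, sorted_class q k N E B a & n%:R * perim q a = x].
Proof.
move=> NM q0; set L := (2 * (8 * k.+1%:R * M ^+ 2)) ^+ q.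
have L0 : 0 <= L.
  by apply: exprn_ge0; do ![exact: sqr_ge0|apply: mulr_ge0].
apply: (@cube_negligible _ _ _ (fun a => n%:R * perim q a) (fun a => a 0%N) (fun a => a 1%N)
  (n%:R * (q%:R * (32 * M ^+ 2 * L ^+ 3)))) => [|a [[a01 _ _ _] _ _]|a b sa sb].
- by do ![exact: sqr_ge0|exact: L0|exact: exprn_ge0|apply: mulr_ge0].
- by split.
- have lip := class_lip NM sa sb q0; rewrite -/L in lip.
  have [ca _ _] := sa; have [cb _ _] := sb.
  rewrite -mulrBr normrM ger0_norm// -[leRHS]mulrA; apply: ler_wpM2l => //.
  apply: (le_trans (cubic_bound ca cb lip)); rewrite -[leRHS]mulrA; apply: ler_wpM2l => //.
  by rewrite exprMn mulrA.
Qed.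

Lemma uniform_transversality (f : nat -> R) (P : nat -> bool) m :
  (forall j, P j \/ f j != 0) ->
  exists k : nat, forall j, (j < m)%N -> ~~ P j -> 1 / k.+1%:R <= `|f j|.
Proof.
move=> H; elim: m => [|m [k Hk]]; first by exists 0%N.
have [Pm|Pm] := boolP (P m).
  exists k => j; rewrite ltnS leq_eqVlt => /orP[/eqP ->|]; last exact: Hk.
  by rewrite Pm.
have fm : 0 < `|f m| by have [|] := H m; rewrite ?(negPf Pm)// normr_gt0.
pose l := Num.truncn (`|f m|^-1).
exists (maxn k l) => j.
have mono (u : nat) : (u <= maxn k l)%N -> 1 / (maxn k l).+1%:R <= 1 / u.+1%:R :> R.
  by move=> ul; rewrite !mul1r lef_pV2 ?posrE// ler_nat ltnS.
rewrite ltnS leq_eqVlt => /orP[/eqP -> _|jm Pj].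
  apply: (le_trans (mono l (leq_maxr _ _))).
  by rewrite mul1r invf_ple ?posrE// ltW// truncnS_gt.
by apply: (le_trans (mono k (leq_maxl _ _))); exact: Hk.
Qed.

(** By periodicity only finitely many transversality and box conditions matter, so every critical
    polygon lies in one of countably many classes, each with a negligible set of values. *)
Theorem critical_values_negligible : (@lebesgue_measure R).-negligible
  [set x | exists n q a, [/\ (0 < q)%N, critical q a & x = n%:R * perim q a]].
Proof.
pose N k := (Num.truncn (4 * k.+1%:R * M ^+ 2)).+1.
have NM k : 4 * k.+1%:R * M ^+ 2 <= (N k)%:R by apply: ltW; exact: truncnS_gt.
pose F (i : nat * nat * nat * seq bool * seq nat) : set R :=
  let: (n, q, k, E, B) := i in
  [set x | exists2 a, sorted_class q.+1 k (N k) E B a & n%:R * perim q.+1 a = x].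
have := @countable_negligible R _ F; have nF i : (@lebesgue_measure R).-negligible (F i).
  by case: i => [[[[n q] k] E] B]; exact: class_negligible.
move=> /(_ nF); apply: (@negligibleS _ _ _ (@lebesgue_measure R)).
move=> _ [n [[|q] [a [// _ ca ->]]]]; have [a01 pa qa ta] := ca.
have [|k Hk] := @uniform_transversality (fun j => omega (g 1 (a j.+1)) (g 1 (a j.+2)))
  (fun j => a j.+2 == a j) q.+1.
  by move=> j; have [/eqP|] := ta j; [left|right].
have Nk0 : 0 < (N k)%:R :> R by rewrite ltr0n.
exists (n, q, k, mkseq (fun j => a j.+2 == a j) q.+1, mkseq (fun j => Num.truncn (a j * (N k)%:R)) q.+1).
exists a => //; split=> // j jq; rewrite nth_mkseq//.
  by case: ifP => [/eqP//|/negbT]; exact: Hk.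
have /andP[a0 _] := a01 j.
have aN : 0 <= a j * (N k)%:R by rewrite mulr_ge0// ltW.
rewrite ler_pdivrMr// ler_pdivlMr// truncn_le//= aN /=.
by apply: ltW; exact: truncnS_gt.
Qed.

End CriticalValues.

(** * Primitives of continuous functions on the line *)

Section Primitive.
Context {R : realType}.
Notation mu := (@lebesgue_measure R).

Lemma derivative_eq_on (F G f : R -> R) (a x y : R) : a < x -> a < y ->
  (forall t, a < t -> is_derive t 1 F (f t)) -> (forall t, a < t -> is_derive t 1 G (f t)) ->
  F x - F y = G x - G y.
Proof.
move=> ax ay dF dG.
have d t : a < t -> is_derive t 1 (fun t => F t - G t) 0.
  by move=> lt; have h1 := dF t lt; have h2 := dG t lt; have := is_deriveB h1 h2; rewrite subrr.
suff H u v : a < u -> u <= v -> F v - G v = F u - G u.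
  by have [xy|/ltW yx] := leP x y; [have := H x y ax xy|have := H y x ay yx]; lra.
move=> au uv; have [||c _] := @MVT_segment R (fun t => F t - G t) (fun=> 0) u v uv.
- by move=> t; rewrite in_itv /= => /andP[ut _]; apply: d; exact: lt_trans ut.
- apply: derivable_within_continuous => t; rewrite in_itv /= => /andP[ut _].
  by have [] := d t (lt_le_trans au ut).
- by rewrite mul0r => /eqP; rewrite subr_eq0 => /eqP.
Qed.

(** The integrals from - n differ by constants for different n; normalized at 0 they glue to a
    function on the whole line. *)
Lemma continuous_primitive (f : R -> R) : continuous f -> exists F, der F f.
Proof.
move=> cf.
pose P (n : nat) (x : R) := (\int[mu]_(t in `[(- n%:R)%R, x]) (f t))%R.
have dP n (t : R) : - n%:R < t -> is_derive t 1 (P n) (f t).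
  move=> nt.
  have [||d e] := @continuous_FTC1_closed R f (- n%:R) t (t + 1) _ _ nt (cf t).
  - by rewrite ltrDl.
  - apply: continuous_compact_integrable; first exact: segment_compact.
    exact: continuous_subspaceT.
  by apply: DeriveDef; [exact: d|rewrite -derive1E; exact: e].
pose n (t : R) := (Num.truncn `|t|).+1.
have nt t : `|t| < (n t)%:R by exact: truncnS_gt.
pose F t := P (n t) t - P (n t) 0.
have FE (m : nat) t : `|t| < m%:R -> F t = P m t - P m 0.
  move=> tm; have [a0 a1] := (nt t, tm).
  move: a0 a1; rewrite !ltr_norml => /andP[a0 a0'] /andP[a1 a1'].
  have [nm|/ltW mn] := leP (n t) m.
    have nm' : - m%:R <= - (n t)%:R :> R by rewrite lerN2 ler_nat.
    apply: (@derivative_eq_on _ _ f (- (n t)%:R)) => //; first by rewrite oppr_lt0 ltr0n.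
    by move=> s sn; apply: dP; exact: le_lt_trans sn.
  have nm' : - (n t)%:R <= - m%:R :> R by rewrite lerN2 ler_nat.
  apply: (@derivative_eq_on _ _ f (- m%:R)) => //; first by rewrite oppr_lt0; lra.
  by move=> s sn; apply: dP; exact: le_lt_trans sn.
exists F => t.
pose m := (n t).+1.
have mt : `|t| < m%:R - 1 by rewrite /m -natr1 addrK.
have D : is_derive t 1 (fun s => P m s - P m 0) (f t).
  have h : is_derive t 1 (P m) (f t).
    by apply: dP; move: mt; rewrite ltr_norml => /andP[? ?]; lra.
  by have := is_deriveB h (is_derive_cst (P m 0) t 1); rewrite subr0.
apply: (near_eq_is_derive _ D).
near=> s; apply: esym; apply: (FE m).
have st : ball t 1 s by near: s; exact: nbhsx_ballx.
move: st; rewrite -ball_normE /= distrC => st; have := ler_normD (s - t) t; rewrite subrK; lra.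
Unshelve. all: by end_near. Qed.

Lemma Rintegral_primitive (F f : R -> R) (t : R) : der F f -> continuous f -> 0 <= t ->
  (\int[mu]_(x in `[0%R, t]) (f x))%R = F t - F 0.
Proof.
move=> dF cf; rewrite le_eqVlt => /orP[/eqP <-|t0].
  by rewrite subrr /Rintegral set_itv1 integral_set1.
rewrite /Rintegral (@continuous_FTC2 _ f F 0 t t0) //.
- exact: continuous_subspaceT.
- have cF := der_continuous dF; split=> [x _||].
  + by have [] := dF x.
  + exact: cvg_at_right_filter (cF 0).
  + exact: cvg_at_left_filter (cF t).
- by move=> x _; rewrite derive1E; have [_ ->] := dF x.
Qed.

End Primitive.

(** * Affine parametrizations *)

Section AffineParam.
Context {R : realType}.
Implicit Types (Omega : set (plane R)) (gamma c : R -> plane R).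

Lemma cube_root_power (k : R -> R) : continuous k -> (forall t, 0 < k t) ->
  [/\ continuous (fun t => k t `^ 3^-1), forall t, 0 < k t `^ 3^-1 &
      forall t, (k t `^ 3^-1) ^+ 3 = k t].
Proof.
move=> ck k0; split=> t.
- have -> : (fun t => k t `^ 3^-1) = (fun t => expR (3^-1 * ln (k t))).
    by apply/funext => s; rewrite /powR gt_eqF.
  apply: (@continuous_comp _ _ _ (fun t => 3^-1 * ln (k t)) expR); last exact: continuous_expR.
  apply: (@continuousM _ _ (fun=> 3^-1) (fun t => ln (k t))); first exact: cst_continuous.
  by apply: (@continuous_comp _ _ _ k (@ln R)); [exact: ck|apply: continuous_ln; exact: k0].
- by rewrite powR_gt0.
- by rewrite -powR_mulrn ?powR_ge0// -powRrM mulVf ?powRr1// ltW.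
Qed.

(* The affine arc length S of an arc-length parametrization c extends to a
   diffeomorphism of the line, and gamma = c o S^-1. *)
Record reparam Omega gamma (c c1 c2 : R -> plane R) (S T k : R -> R) (L : R) : Prop := Reparam {
  rp_per : 0 < L /\ forall t, c (t + L) = c t;
  rp_inj : forall s t, 0 <= s < L -> 0 <= t < L -> c s = c t -> s = t;
  rp_range : range c = boundary Omega;
  rp_c : vder c c1;
  rp_c1 : vder c1 c2;
  rp_norm : forall t, dotp (c1 t) (c1 t) = 1;
  rp_k : forall t, 0 < k t /\ k t ^+ 3 = omega (c1 t) (c2 t);
  rp_S : der S k;
  rp_S0 : S 0 = 0;
  rp_SL : forall t, S (t + L) = S t + 1;
  rp_ST : forall s, S (T s) = s;
  rp_TS : forall t, T (S t) = t;
  rp_gamma : forall t, gamma (S t) = c t }.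

Lemma vder_periodic (u u' : R -> plane R) (L : R) : vder u u' -> (forall t, u (t + L) = u t) ->
  forall t, u' (t + L) = u' t.
Proof.
move=> du pu t; have dL : der (fun t : R => t + L) (fun=> 1).
  by apply: (der_eq (der_add der_id (der_cst L))) => s; rewrite addr0.
have := vder_comp du dL => /vder_ext -/(_ u pu) du'.
by have := vder_uniq du' du t; rewrite scale1r.
Qed.

Lemma affine_param_reparam Omega gamma : affine_param Omega gamma ->
  exists c c1 c2 S T k L, reparam Omega gamma c c1 c2 S T k L.
Proof.
move=> [L [c [[[L0 pc] [injc imc] [dc cc2] nc kc] aL pg gS]]].
have vc : vder c c^`() by apply: derivable_vder => t; exact: (dc 0%N isT t).
have vc1 : vder c^`() c^`(2) by apply: derivable_vder => t; exact: (dc 1%N isT t).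
have p1 := vder_periodic vc pc; have p2 := vder_periodic vc1 p1.
have ck : continuous (curvature c).
  have c11 := der_continuous vc1.1; have c12 := der_continuous vc1.2.
  have c21 : continuous (fun t => (c^`(2) t).1) by move=> t; apply: (@continuous_comp _ _ _ c^`(2) fst); [exact: cc2|exact: cvg_fst].
  have c22 : continuous (fun t => (c^`(2) t).2) by move=> t; apply: (@continuous_comp _ _ _ c^`(2) snd); [exact: cc2|exact: cvg_snd].
  move=> t; apply: (@continuousB _ _ _ (fun t => (c^`() t).1 * (c^`(2) t).2) (fun t => (c^`() t).2 * (c^`(2) t).1)).
    by apply: (@continuousM _ _ (fun t => (c^`() t).1)); [exact: c11|exact: c22].
  by apply: (@continuousM _ _ (fun t => (c^`() t).2)); [exact: c12|exact: c21].
have [cK K0 K3] := cube_root_power ck kc.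
set k := (fun t => curvature c t `^ 3^-1) in cK.
have [S0 dS0] := continuous_primitive cK.
pose S t := S0 t - S0 0.
have dS : der S k by apply: (der_eq (der_sub dS0 (der_cst (S0 0)))) => t; rewrite subr0.
have S00 : S 0 = 0 by rewrite /S subrr.
have SE t : 0 <= t -> affine_arclength c t = S t.
  by move=> t0; rewrite /affine_arclength (Rintegral_primitive dS cK t0) S00 subr0.
have kp t : k (t + L) = k t by rewrite /k /curvature p1 p2.
have SL t : S (t + L) = S t + 1.
  have d : der (fun t => S (t + L) - S t) (fun=> 0).
    have dL : der (fun t : R => t + L) (fun=> 1).
      by apply: (der_eq (der_add der_id (der_cst L))) => s; rewrite addr0.
    by apply: (der_eq (der_sub (der_comp dS dL) dS)) => s; rewrite mulr1 kp subrr.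
  have : S (t + L) - S t = S (0 + L) - S 0 := is_derive_0_is_cst t 0 d.
  by rewrite add0r S00 subr0 -(SE L (ltW L0)) aL; lra.
have Sn (n : int) t : S (t + n%:~R * L) = S t + n%:~R.
  have := @periodic_int R R (fun t => S t - t / L) L _ n t.
  have -> : (t + n%:~R * L) / L = t / L + n%:~R by rewrite mulrDl mulfK// gt_eqF.
  move=> H; suff : S (t + n%:~R * L) - (t / L + n%:~R) = S t - t / L by lra.
  by apply: H => u; rewrite SL mulrDl divff ?gt_eqF//; lra.
have Smono x y : x < y -> S x < S y.
  move=> xy; have [z _ e] := mvt dS (ltW xy).
  by rewrite -subr_gt0 e mulr_gt0 ?K0// subr_gt0.
have Sinj x y : S x = S y -> x = y.
  by move=> e; case: (ltgtP x y) => // /Smono; rewrite e ltxx.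
have Ssurj s : exists t, S t = s.
  pose n := Num.floor s.
  have /andP[n1 n2] : n%:~R <= s < (n + 1)%:~R by rewrite floor_le_tmp lt_succ_floor.
  have cf : continuous (fun t => s - S t).
    move=> t; apply: (@continuousB _ _ _ (fun=> s) S); first exact: cst_continuous.
    exact: der_continuous dS t.
  have [|||t _ e] := @ivt _ (fun t => s - S t) (n%:~R * L) ((n + 1)%:~R * L) cf.
  - by rewrite ler_wpM2r ?ler_int ?lerDl// ltW.
  - by rewrite -[n%:~R * L]add0r Sn S00; lra.
  - by rewrite -[(n + 1)%:~R * L]add0r Sn S00; lra.
  by exists t; lra.
have [T ST] := choice Ssurj.
have TS t : T (S t) = t by apply: Sinj; exact: ST.
exists c, c^`(), c^`(2), S, T, k, L; split=> //.
- apply/seteqP; split=> [_ [t _ <-]|x]; last by rewrite -imc => -[t _ <-]; exists t.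
  have [y [m [y0 ->]]] := period_reduce t L0.
  by rewrite (periodic_int pc) -imc; exists y.
- move=> t; have := nc t; rewrite /enorm => h.
  have d0 : 0 <= dotp (c^`() t) (c^`() t) by rewrite /dotp -!expr2 addr_ge0// sqr_ge0.
  by rewrite -(sqr_sqrtr d0) h expr1n.
- by move=> t; split; [exact: K0|exact: K3].
- move=> t; have [y [m [/andP[y0 y1] ->]]] := period_reduce t L0.
  rewrite Sn (periodic_int pc); have := periodic_int pg m (S y); rewrite mulr1 => ->.
  by rewrite -SE// gS// y0 ltW.
Qed.

Section Use.
Variables (Omega : set (plane R)) (gamma c c1 c2 : R -> plane R) (S T k : R -> R) (L : R).
Hypothesis rp : reparam Omega gamma c c1 c2 S T k L.

Lemma rp_gammaE s : gamma s = c (T s).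
Proof. by rewrite -(rp_gamma rp) (rp_ST rp). Qed.

Lemma rp_dT : der T (fun s => (k (T s))^-1).
Proof.
move=> s; rewrite -{1}(rp_ST rp s); have cS := der_continuous (rp_S rp).
apply: (@is_derive_inverse _ S T).
- by exists 1 => //= t _; exact: (rp_TS rp).
- by exists 1 => //= t _; exact: cS.
- exact: (rp_S rp).
- by rewrite gt_eqF// (rp_k rp _).1.
Qed.

Lemma rp_gamma_der : vder gamma (fun s => (k (T s))^-1 *: c1 (T s)).
Proof.
apply: (vder_ext (u := fun s => c (T s))) => [s|]; first by rewrite rp_gammaE.
exact: vder_comp (rp_c rp) rp_dT.
Qed.

Lemma rp_gamma_neq0 s : (k (T s))^-1 *: c1 (T s) != 0.
Proof.
rewrite scaler_eq0 invr_eq0 gt_eqF ?(rp_k rp _).1//=; apply/eqP => e.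
by have := rp_norm rp (T s); rewrite e /dotp /= !mulr0 addr0 => /eqP; rewrite eq_sym oner_eq0.
Qed.

Lemma rp_gamma_range : range gamma = boundary Omega.
Proof.
rewrite -(rp_range rp); apply/seteqP; split=> [_ [s _ <-]|_ [t _ <-]].
  by rewrite rp_gammaE; exists (T s).
by exists (S t) => //; exact: rp_gamma rp t.
Qed.

Lemma rp_S_lt x y : (S x < S y) = (x < y).
Proof.
have mono u v : u < v -> S u < S v.
  move=> uv; have [z _ e] := mvt (rp_S rp) (ltW uv).
  by rewrite -subr_gt0 e mulr_gt0 ?(rp_k rp _).1// subr_gt0.
case: (ltgtP x y) => [/mono//|/mono h|->]; last by rewrite ltxx.
by apply/negbTE; rewrite -leNgt ltW.
Qed.

Lemma rp_T_range s : 0 <= s < 1 -> 0 <= T s < L.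
Proof.
have SL1 : S L = 1 by rewrite -[L]add0r (rp_SL rp) (rp_S0 rp) add0r.
move=> /andP[s0 s1]; apply/andP; split.
  by rewrite leNgt -rp_S_lt (rp_ST rp) (rp_S0 rp) -leNgt.
by rewrite -rp_S_lt (rp_ST rp) SL1.
Qed.

Lemma rp_gamma_inj s t : 0 <= s < 1 -> 0 <= t < 1 -> gamma s = gamma t -> s = t.
Proof.
move=> s01 t01; rewrite !rp_gammaE => /(rp_inj rp (rp_T_range s01) (rp_T_range t01)).
by move=> /(congr1 S); rewrite !(rp_ST rp).
Qed.

Lemma rp_gamma_per s : gamma (s + 1) = gamma s.
Proof.
have := rp_SL rp (T s); rewrite (rp_ST rp) => <-.
by rewrite (rp_gamma rp) (rp_per rp).2 -rp_gammaE.
Qed.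

(** The affine speed k is only known to be continuous, so c' = k g1(S) cannot be differentiated.
    Instead the identity omega (g1(S), c') = 0 is differentiated, and it yields k^3 omega (g1, g2) =
    k^3. *)
Lemma rp_omega (g1 g2 : R -> plane R) : vder gamma g1 -> vder g1 g2 ->
  forall s, omega (g1 s) (g2 s) = 1.
Proof.
move=> dg dg1 s; rewrite -(rp_ST rp s); set t := T s.
have e1 u : c1 u = k u *: g1 (S u).
  suff d2 : vder c (fun u => k u *: g1 (S u)) by exact: vder_uniq (rp_c rp) d2 u.
  by apply: (vder_ext (u := fun u => gamma (S u))) => [v|]; [exact: (rp_gamma rp)|exact: vder_comp dg (rp_S rp)].
have z u : omega (g1 (S u)) (c1 u) = 0 by rewrite e1 omegaZr omegavv mulr0.
have D := der_omega (vder_comp dg1 (rp_S rp)) (rp_c1 rp).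
have := der_uniq D (der_ext (fun u => esym (z u)) (der_cst 0)) t.
rewrite omegaZl {1}e1 omegaZr [omega (g2 _) _]omegaC => h.
have [k0 k3] := rp_k rp t.
have : omega (c1 t) (c2 t) = k t * omega (g1 (S t)) (c2 t) by rewrite {1}e1 omegaZl.
rewrite -k3 => h3.
have : k t ^+ 3 * (omega (g1 (S t)) (g2 (S t)) - 1) = 0.
  have -> : k t ^+ 3 * (omega (g1 (S t)) (g2 (S t)) - 1) =
    k t * (k t * (k t * omega (g1 (S t)) (g2 (S t)))) - k t ^+ 3 by ring.
  have -> : k t * (k t * omega (g1 (S t)) (g2 (S t))) = omega (g1 (S t)) (c2 t) by lra.
  by rewrite -h3 subrr.
by move/eqP; rewrite mulf_eq0 expf_eq0 gt_eqF//= subr_eq0 => /eqP.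
Qed.

End Use.
End AffineParam.

(** * Trajectories are critical polygons *)

Section Spectrum.
Context {R : realType}.

Lemma parallel_trans (u v w : plane R) : u != 0 -> omega v u = 0 -> omega u w = 0 -> omega v w = 0.
Proof.
move=> u0 vu uw; have := cramer v w u; rewrite uw [omega u v]omegaC vu oppr0 !scale0r subr0.
by move=> /eqP; rewrite scaler_eq0 (negPf u0) orbF => /eqP.
Qed.

Lemma der_min0 (f f' : R -> R) b : der f f' -> (forall t, 0 <= f t) -> f b = 0 -> f' b = 0.
Proof.
move=> df f0 fb.
have z : b \in `]b - 1, b + 1[%R by rewrite in_itv /=; apply/andP; lra.
have [] := @derive1_at_min R f (b - 1) (b + 1) b _ _ z.
- by lra.
- by move=> t _; have [] := df t.
- by move=> t _; rewrite fb; exact: f0.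
- by move=> _; have [_ ->] := df b.
Qed.

Variables (Omega : set (plane R)) (gamma : R -> plane R).
Variables (eps : R) (G : nat -> R -> plane R) (b l1 l2 : plane R).
Hypothesis cG : curve eps G.
Hypothesis eps_small : eps <= 1 / 1000.
Hypothesis D0 : 0 < omega l1 l2.
Hypothesis gE : forall s, gamma s = b + lin l1 l2 (G 0%N (2 * pi * s)).
Hypothesis gO : affine_param Omega gamma.

(** The k-th derivative of [gamma]; the translation survives for k = 0 only. *)
Definition gk (k : nat) : R -> plane R :=
  if k is _.+1 then fun s => (2 * pi) ^+ k *: lin l1 l2 (G k (2 * pi * s)) else gamma.

Lemma gk_der k : (k < 6)%N -> vder (gk k) (gk k.+1).
Proof.
move=> k6; have d : der (fun s : R => 2 * pi * s) (fun=> 2 * pi).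
  by apply: (der_eq (der_scale (2 * pi) der_id)) => t; rewrite mulr1.
have dk := vder_lin l1 l2 (vder_comp (curve_der cG k6) d).
case: k k6 dk => [|k] k6 dk.
  apply: (vder_ext (u := fun s => b + lin l1 l2 (G 0%N (2 * pi * s)))) => [s|]; first by rewrite /= gE.
  by apply: (vder_eq (vder_add (vder_cst b) dk)) => t; rewrite add0r linZ /gk expr1.
by apply: (vder_eq (vder_scale ((2 * pi) ^+ k.+1) dk)) => t; rewrite linZ scalerA -exprSr.
Qed.

Lemma lin_le (v : plane R) : `|lin l1 l2 v| <= (`|l1| + `|l2|) * `|v|.
Proof.
apply: (le_trans (ler_normD _ _)); rewrite !normrZ mulrDl.
by apply: lerD; rewrite mulrC; apply: ler_wpM2l => //; [exact: norm1_le|exact: norm2_le].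
Qed.

Definition gk_bound : R := 1 + `|b| + 8 ^+ 3 * ((`|l1| + `|l2|) * 2).

Lemma gk_bound_ge1 : 1 <= gk_bound.
Proof.
rewrite /gk_bound -addrA lerDl addr_ge0// mulr_ge0// ?exprn_ge0// mulr_ge0// addr_ge0//.
Qed.

Lemma gk_le k t : (k <= 3)%N -> `|gk k t| <= gk_bound.
Proof.
move=> k3; have p0 := @pi_ge0 R; have p4 := @pi_lt4 R; have es := eps_small.
have X j : (j <= 3)%N -> `|lin l1 l2 (G j (2 * pi * t))| <= (`|l1| + `|l2|) * 2.
  move=> j3; apply: (le_trans (lin_le _)); apply: ler_wpM2l; first by rewrite addr_ge0.
  apply: (le_trans (curve_le _ cG _)); last lra.
  exact: leq_trans j3 _.
have Y : 0 <= (`|l1| + `|l2|) * 2 by rewrite mulr_ge0// addr_ge0.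
have E1 : 1 <= 8 ^+ 3 :> R by rewrite -natrX ler1n.
have Z := ler_wpM2r Y E1; rewrite mul1r in Z.
case: k k3 => [|k] k3.
  rewrite /= gE; apply: (le_trans (ler_normD _ _)); have := X 0%N isT; rewrite /gk_bound; lra.
rewrite /gk normrZ; have q : `|(2 * pi) ^+ k.+1| <= 8 ^+ 3 :> R.
  rewrite ger0_norm; last by rewrite exprn_ge0// mulr_ge0.
  apply: (@le_trans _ _ (8 ^+ k.+1)); last by apply: ler_weXn2l => //; rewrite ler1n.
  by apply: lerXn2r; rewrite ?nnegrE ?mulr_ge0//; lra.
have : `|(2 * pi) ^+ k.+1| * `|lin l1 l2 (G k.+1 (2 * pi * t))| <= 8 ^+ 3 * ((`|l1| + `|l2|) * 2).
  by apply: ler_pM => //; exact: X.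
by rewrite /gk_bound; have := normr_ge0 b; lra.
Qed.

Lemma gk1_neq0 s : gk 1 s != 0.
Proof.
rewrite /gk scaler_eq0 expf_eq0 /= negb_or; apply/andP; split.
  by rewrite gt_eqF// mulr_gt0// pi_gt0.
apply/eqP => e; have := omega_lin l1 l2 (G 1%N (2 * pi * s)) (G 2%N (2 * pi * s)).
rewrite e (curve_omega cG) mulr1 /omega /= !mul0r subrr => h.
by move: D0; rewrite -[omega l1 l2]/(l1.1 * l2.2 - l1.2 * l2.1) -h ltxx.
Qed.

Lemma gamma_subE s t : gamma t - gamma s = lin l1 l2 (G 0%N (2 * pi * t) - G 0%N (2 * pi * s)).
Proof. by rewrite !gE linB opprD addrACA subrr add0r. Qed.

Lemma gk_support s t : 0 <= omega (gk 1 s) (gamma t - gamma s).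
Proof.
rewrite gamma_subE /gk expr1 (omegaZl (2 * pi)) omega_lin; apply: mulr_ge0.
  by rewrite mulr_ge0// pi_ge0.
by apply: mulr_ge0; [exact: ltW|exact: (support_ge0 cG)].
Qed.

Lemma gk_support_eq s t : omega (gk 1 s) (gamma t - gamma s) = 0 -> gamma t = gamma s.
Proof.
have p0 : 0 < 2 * pi :> R by rewrite mulr_gt0// pi_gt0.
rewrite gamma_subE /gk expr1 (omegaZl (2 * pi)) omega_lin => /eqP.
rewrite mulf_eq0 (gt_eqF p0) orFb mulf_eq0 (gt_eqF D0) orFb => /eqP/(support_eq0 cG eps_small)[m e].
by rewrite !gE e (per2pi cG).
Qed.

Section Other.
Variables (gt : R -> plane R).
Hypothesis gtO : affine_param Omega gt.

(** The spectrum admits any affine parametrization [gt] of the same boundary. The boundary lies on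
    one side of the tangent at [gamma a], so a function of the parameter of [gt] is minimal at the
    contact, where its derivative vanishes. *)
Lemma other_tangent a s : gt s = gamma a -> omega (gk 1 a) (gt^`() s) = 0 /\ gt^`() s != 0.
Proof.
have [c [c1 [c2 [S [T [k [L rp]]]]]]] := affine_param_reparam gtO.
have [c' [c1' [c2' [S' [T' [k' [L' rp']]]]]]] := affine_param_reparam gO.
move=> e; have dg := rp_gamma_der rp; have [_ eg] := vder_derive1 dg.
rewrite eg; split; last exact: (rp_gamma_neq0 rp).
have D := der_omega (vder_cst (gk 1 a)) (vder_sub dg (vder_cst (gamma a))).
have := @der_min0 _ _ s D; rewrite e !subrr !subr0.
have -> : forall w : plane R, omega (0 : plane R) 0 + omega (gk 1 a) w = omega (gk 1 a) w.
  by move=> w; rewrite /omega /=; ring.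
apply; last by rewrite /omega /=; ring.
move=> t; have : range gt (gt t) by exists t.
rewrite (rp_gamma_range rp) -(rp_gamma_range rp') => -[u _ <-].
exact: gk_support.
Qed.

Lemma step_critical x y z a : gamma a = y -> billiard_step gt x y z -> omega (gk 1 a) (z - x) = 0.
Proof.
have z0 w : omega (gk 1 a) (w - w) = 0 by rewrite subrr /omega /=; ring.
move=> ay [[_ [_ _ [s [sy e]]]]|[_ _ ->]|[_ ->]]; try exact: z0.
have [t1 t2] : omega (gk 1 a) (gt^`() s) = 0 /\ gt^`() s != 0 by apply: other_tangent; rewrite sy ay.
exact: parallel_trans t2 t1 e.
Qed.

Lemma step_range x y z : billiard_step gt x y z -> range gt x.
Proof.
move=> [[[x' [[_ [s [_ [sx _ _]]]] _]] _]|[h _ _]|[[_ [s [_ [sx _ _]]]] _]] //; by exists s.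
Qed.

(** Parameters are taken on [gamma], reduced to one period. If the tangents at the vertices j + 1
    and j + 2 are parallel, then the chord from j to j + 2 lies on the support line at j + 2, which
    touches the boundary only once; hence the chord is trivial. *)
Lemma trajectory_critical q x : closed_trajectory gt q x ->
  exists2 a, critical gk q a & action q x = perim gk q a.
Proof.
have [c [c1 [c2 [S [T [k [L rp]]]]]]] := affine_param_reparam gtO.
have [c' [c1' [c2' [S' [T' [k' [L' rp']]]]]]] := affine_param_reparam gO.
move=> [q0 px st].
have H j : exists a, 0 <= a < 1 /\ gamma a = x j.
  have := step_range (st j); rewrite (rp_gamma_range rp) -(rp_gamma_range rp') => -[u _ <-].
  have [y [m [y01 ->]]] := period_reduce u (@ltr01 R); exists y; split=> //.
  by rewrite (periodic_int (rp_gamma_per rp')).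
have [a Ha] := choice H.
have crit j : omega (gk 1 (a j.+1)) (gk 0 (a j.+2) - gk 0 (a j)) = 0.
  rewrite /gk -/(gk 1) (Ha _).2 (Ha _).2; apply: step_critical (st j).
  exact: (Ha _).2.
exists a; last by apply: eq_bigr => j _; rewrite /gk !(Ha _).2.
split=> [j|j|j|j].
- exact: (Ha j).1.
- by apply: (rp_gamma_inj rp') (Ha _).1 (Ha _).1 _; rewrite !(Ha _).2.
- exact: crit.
- have [e|ne] := eqVneq (omega (gk 1 (a j.+1)) (gk 1 (a j.+2))) 0; last by right.
  left; apply: (rp_gamma_inj rp') (Ha _).1 (Ha _).1 _; apply: esym; apply: gk_support_eq.
  apply: (@parallel_trans (gk 1 (a j.+1))); first exact: gk1_neq0.
    by rewrite omegaC e oppr0.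
  rewrite -opprB omegaNr; apply/eqP; rewrite oppr_eq0; apply/eqP; exact: crit.
Qed.

End Other.

Theorem spectrum_negligible : (@lebesgue_measure R).-negligible (area_spectrum Omega).
Proof.
have N1 := critical_values_negligible (fun k k3 => gk_der (leq_trans k3 (isT : (3 <= 6)%N)))
  gk_le gk_bound_ge1.
have N2 : (@lebesgue_measure R).-negligible [set x | exists n : nat, x = n%:R * area Omega].
  apply: (@countable_negligible R nat (fun n => [set n%:R * area Omega])) => n.
  by exists [set n%:R * area Omega]; split=> //; exact: lebesgue_measure_set1.
apply: (@negligibleS _ _ _ (@lebesgue_measure R) _ _ _ (negligibleU N1 N2)).
move=> x [n [n0 [[gt [q [y [gtO tr ->]]]]|->]]]; [left|right; by exists n].
have [a ca ->] := trajectory_critical gtO tr.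
by exists n, q, a; split=> //; have [] := tr.
Qed.

End Spectrum.

(** * Constancy of the maximal actions *)

Section Constancy.
Context {R : realType}.

(** Two distinct values would force a whole interval of values into the null set. *)
Lemma continuous_in_null_constant (f : R -> R) (S : set R) :
  (forall t : R, -1 <= t <= 1 -> S (f t)) -> (@lebesgue_measure R).-negligible S ->
  (forall t0 : R, -1 <= t0 <= 1 -> forall e : R, 0 < e -> exists2 d : R, 0 < d &
    forall t : R, -1 <= t <= 1 -> `|t - t0| < d -> `|f t - f t0| <= e) ->
  forall s t : R, -1 <= s <= 1 -> -1 <= t <= 1 -> f s = f t.
Proof.
move=> fS nS cf.
(* Clamping to [-1, 1], a contraction, turns [f] into a continuous function on the line. *)
pose cl (t : R) := Num.max (-1) (Num.min 1 t).
have clI t : -1 <= cl t <= 1 by rewrite /cl le_max lexx /= ge_max ge_min lexx andbT; lra.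
have clE t : -1 <= t <= 1 -> cl t = t.
  by move=> /andP[a b]; rewrite /cl min_r// max_r.
have clL s t : `|cl s - cl t| <= `|s - t|.
  rewrite /cl; case: (leP 1 s) => hs; case: (leP 1 t) => ht;
    rewrite !maxEle; do ![case: ifP => ?]; rewrite ?ler_norml; 
    have := ler_norm (s - t); have := ler_norm (t - s); rewrite [`|t - s|]distrC => *; try (apply/andP; lra).
have cg : continuous (fun t => f (cl t)).
  move=> t0; apply/cvgrPdist_le => e e0.
  have [d d0 H] := cf (cl t0) (clI t0) e e0.
  exists d => //= t td; rewrite distrC; apply: H (clI t) _.
  by apply: (le_lt_trans (clL _ _)); rewrite distrC.
suff H s t : -1 <= s <= 1 -> -1 <= t <= 1 -> ~ (f s < f t).
  move=> s t hs ht; case: (ltgtP (f s) (f t)) => // h; [by case: (H s t hs ht)|by case: (H t s ht hs)].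
move=> hs ht fst; apply: (interval_not_negligible fst _ nS) => v /andP[v1 v2].
have [c _ e] : exists2 c, Num.min s t <= c <= Num.max s t & f (cl c) = v.
  have cgv : continuous (fun t => f (cl t) - v).
    by move=> x; apply: (@continuousB _ _ _ (fun t => f (cl t)) (fun=> v)); [exact: cg|exact: cst_continuous].
  have cgv' : continuous (fun t => v - f (cl t)).
    by move=> x; apply: (@continuousB _ _ _ (fun=> v) (fun t => f (cl t))); [exact: cst_continuous|exact: cg].
  have [st|/ltW ts] := leP s t.
    have [||c ? e] := ivt cgv' st; rewrite ?clE//; try lra.
    by exists c; [|lra].
  have [||c ? e] := ivt cgv ts; rewrite ?clE//; try lra.
  by exists c; [|lra].
by rewrite -e; exact: fS (clI c).
Qed.

Variables (gamma : R -> R -> plane R) (K : R).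
Hypothesis lip : forall tau s t : R, -1 <= tau <= 1 -> `|gamma tau s - gamma tau t| <= K * `|s - t|.
Hypothesis per : forall tau s : R, -1 <= tau <= 1 -> gamma tau (s + 1) = gamma tau s.
Hypothesis ptc : forall s t0 : R, -1 <= t0 <= 1 -> forall e : R, 0 < e -> exists2 d : R, 0 < d &
    forall t : R, -1 <= t <= 1 -> `|t - t0| < d -> `|gamma t s - gamma t0 s| <= e.

Lemma finite_min (P : nat -> R -> Prop) n : (forall i, exists2 d, 0 < d & P i d) ->
  (forall i d d', d' <= d -> P i d -> P i d') ->
  exists2 d, 0 < d & forall i, (i <= n)%N -> P i d.
Proof.
move=> H mono; elim: n => [|n [d d0 Hd]].
  by have [d d0 Hd] := H 0%N; exists d => // i; rewrite leqn0 => /eqP ->.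
have [d' d'0 Hd'] := H n.+1; exists (Num.min d d'); first by rewrite lt_min d0.
move=> i; rewrite leq_eqVlt => /orP[/eqP ->|].
  by apply: mono Hd'; rewrite ge_min lexx orbT.
by rewrite ltnS => /Hd; apply: mono; rewrite ge_min lexx.
Qed.

(** The family is C^1 in tau for each s separately. A Lipschitz bound in s common to all tau reduces
    the claim to finitely many values of s. *)
Lemma uniform_in_s (t0 e : R) : -1 <= t0 <= 1 -> 0 < e -> exists2 d : R, 0 < d &
    forall t s : R, -1 <= t <= 1 -> `|t - t0| < d -> `|gamma t s - gamma t0 s| <= e.
Proof.
move=> h0 e0.
have K0 : 0 <= K by have := le_trans (normr_ge0 _) (lip 0 1 h0); rewrite sub0r normrN normr1 mulr1.
pose N := (Num.truncn (3 * K / e)).+1.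
have N0 : 0 < N%:R :> R by rewrite ltr0n.
have KN : K / N%:R <= e / 3.
  rewrite ler_pdivrMr//; have : 3 * K / e < N%:R by exact: truncnS_gt.
  by rewrite ltr_pdivrMr//; lra.
have [||d d0 Hd] := @finite_min (fun i d => forall t : R, -1 <= t <= 1 ->
    `|t - t0| < d -> `|gamma t (i%:R / N%:R) - gamma t0 (i%:R / N%:R)| <= e / 3) N.
- by move=> i; apply: ptc => //; lra.
- by move=> i d d' dd H t ht td; apply: H => //; exact: lt_le_trans dd.
exists d => // t s ht td.
have [y [m [/andP[y0 y1] ->]]] := period_reduce s (@ltr01 R).
rewrite (periodic_int (fun s => per s ht)) (periodic_int (fun s => per s h0)).
pose i := Num.truncn (y * N%:R).
have yN : 0 <= y * N%:R by rewrite mulr_ge0// ltW.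
have iy : i%:R <= y * N%:R by rewrite truncn_le.
have yi : y * N%:R < i.+1%:R by exact: truncnS_gt.
have iN : (i <= N)%N.
  by rewrite -(ler_nat R); apply: (le_trans iy); rewrite ler_piMl// ltW.
have dy : `|y - i%:R / N%:R| <= N%:R^-1.
  have a1 : i%:R / N%:R <= y by rewrite ler_pdivrMr.
  have a2 : y < (i%:R + 1) / N%:R by rewrite ltr_pdivlMr// natr1.
  rewrite mulrDl mul1r in a2.
  by rewrite ler_norml; apply/andP; split; lra.
have h1 := lip y (i%:R / N%:R) ht; have h2 := lip y (i%:R / N%:R) h0.
have h3 := Hd i iN t ht td.
have h4 : K * `|y - i%:R / N%:R| <= e / 3 by apply: le_trans KN; exact: ler_wpM2l.
have -> : gamma t y - gamma t0 y = (gamma t y - gamma t (i%:R / N%:R)) +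
   (gamma t (i%:R / N%:R) - gamma t0 (i%:R / N%:R)) - (gamma t0 y - gamma t0 (i%:R / N%:R)).
  by rewrite opprB [gamma t y - _ + _]addrA subrK [RHS]addrA subrK.
have := normB_le (normD_le h1 h3) h2; lra.
Qed.

Lemma pact_close (c c' : R -> plane R) (B e : R) q u : 0 <= e ->
  (forall s, `|c s| <= B) -> (forall s, `|c' s - c s| <= e) ->
  `|pact c' q u - pact c q u| <= q%:R * (2 * e * (2 * B + e)).
Proof.
move=> e0 cB cc; have B0 : 0 <= B by exact: le_trans (cB 0).
rewrite /pact -sumrB.
have -> : q%:R * (2 * e * (2 * B + e)) = \sum_(0 <= j < q) (2 * e * (2 * B + e)).
  by rewrite sumr_const_nat subn0 mulr_natl.
apply: ler_sum_abs => j _.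
set x := _ / _; set y := pt (stp q) u j.+1 / _.
have -> : omega (c' x) (c' y) - omega (c x) (c y) = omega (c' x - c x) (c' y) + omega (c x) (c' y - c y).
  by rewrite omegaBl omegaBr; ring.
have cy : `|c' y| <= B + e.
  by rewrite -[c' y](subrK (c y)) [B + e]addrC; apply: normD_le.
have := omega_le (cc x) cy; have := omega_le (cB x) (cc y) => h1 h2.
apply: (le_trans (ler_normD _ _)); apply: (le_trans (lerD h2 h1)); lra.
Qed.

Lemma max_close (q : nat) (V V' : (nat -> R) -> R) u u' e : adm q u -> adm q u' ->
  (forall v, adm q v -> V v <= V u) -> (forall v, adm q v -> V' v <= V' u') ->
  (forall v, adm q v -> `|V' v - V v| <= e) -> `|V' u' - V u| <= e.
Proof.
move=> au au' mu mu' H; have := H u au; have := H u' au'; have := mu _ au'; have := mu' _ au.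
by rewrite !ler_norml => ? ? /andP[? ?] /andP[? ?]; apply/andP; lra.
Qed.

End Constancy.

(** * The largest actions along an isospectral family *)

Section Family.
Context {R : realType}.
Variables (Omega : R -> set (plane R)) (gamma : R -> R -> plane R).
Variables (G : R -> nat -> R -> plane R) (b l1 l2 : R -> plane R) (eps D : R).
Hypothesis eps_tiny : eps <= 1 / (100 * 100 * 100 * 100).
Hypothesis D0 : 0 < D.
Hypothesis isp : area_isospectral Omega.
Hypothesis C1 : forall s, C1_on_segment (-1) 1 (fun tau => gamma tau s).
Hypothesis nf : forall tau : R, -1 <= tau <= 1 -> [/\ canon eps (G tau),
  affine_param (Omega tau) (gamma tau), omega (l1 tau) (l2 tau) = D,
  forall s, gamma tau s = b tau + lin (l1 tau) (l2 tau) (G tau 0%N (2 * pi * s)) &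
  `|l1 tau| <= 2 /\ `|l2 tau| <= 2].

Lemma family_pointwise (s t0 : R) : -1 <= t0 <= 1 -> forall e : R, 0 < e -> exists2 d : R, 0 < d &
    forall t : R, -1 <= t <= 1 -> `|t - t0| < d -> `|gamma t s - gamma t0 s| <= e.
Proof.
move=> h0 e e0; have [F [[dF _] FE]] := C1 s.
have vF := derivable_vder (fun t => dF 0%N isT t).
have [c1 c2] := vder_continuous vF.
have /cvgrPdist_le/(_ e e0)[d1 /= d10 H1] := c1 t0.
have /cvgrPdist_le/(_ e e0)[d2 /= d20 H2] := c2 t0.
exists (Num.min d1 d2); first by rewrite lt_min d10.
move=> t ht; rewrite lt_min => /andP[t1 t2]; rewrite -!FE// norm_plane_le.
by rewrite distrC in t1; rewrite distrC in t2; rewrite distrC H1// distrC H2.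
Qed.

Lemma family_lip (tau s t : R) : -1 <= tau <= 1 -> `|gamma tau s - gamma tau t| <= 64 * `|s - t|.
Proof.
move=> ht; have [k aO d g [n1 n2]] := nf ht; have p0 := @pi_ge0 R; have p4 := @pi_lt4 R.
have es := eps_tiny.
have dg : vder (gamma tau) (fun s => (2 * pi) *: lin (l1 tau) (l2 tau) (G tau 1%N (2 * pi * s))).
  exact: (gamma_der k g).
apply: (vmvt_le dg) => r _; rewrite normrZ ger0_norm ?mulr_ge0//.
have := lin_le (l1 tau) (l2 tau) (G tau 1%N (2 * pi * r)).
have c := curve_le (2 * pi * r) (canon_curve k) (isT : (1 <= 6)%N).
have : (`|l1 tau| + `|l2 tau|) * `|G tau 1%N (2 * pi * r)| <= 4 * 2.
  by apply: ler_pM => //; lra.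
move=> h1 h2; have {h1}h2 := le_trans h2 h1.
have -> : 64 = 8 * (4 * 2) :> R by ring.
by apply: ler_pM => //; [rewrite mulr_ge0|lra].
Qed.

(** The maximizer is chosen for each tau without any continuity; the maximal value is continuous
    because it is taken over the fixed set [adm q]. The determinant [D] is the same for all tau, so
    that equal actions remain equal after normalization. *)
Lemma family_matched q : (2 < q)%N -> forall tau tau' : R, -1 <= tau <= 1 -> -1 <= tau' <= 1 ->
  matched (G tau) (G tau') q.
Proof.
move=> q3; have q0 : (0 < q)%N by exact: ltn_trans q3.
have es : eps <= 1 / 1000 by have := eps_tiny; lra.
have [u Hu] : exists u : R -> nat -> R, forall tau : R, -1 <= tau <= 1 -> maxi (G tau) q (u tau).
  have H (tau : R) : exists u : nat -> R, -1 <= tau <= 1 -> maxi (G tau) q u.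
    have [ht|nt] := boolP (-1 <= tau <= 1); last by exists (fun=> 0).
    have [k _ _ _ _] := nf ht.
    by have [u mu] := maxi_exists q (curve_der (canon_curve k) (isT : (0 < 6)%N)); exists u.
  by have [u Hu] := choice H; exists u.
have PA (tau : R) v : -1 <= tau <= 1 -> adm q v -> pact (gamma tau) q v = D * act (G tau) (stp q) q v.
  by move=> ht [v0 vq _ _]; have [k _ <- g _] := nf ht; exact: (pact_act k g).
pose f tau := pact (gamma tau) q (u tau).
have fS (t : R) : -1 <= t <= 1 -> area_spectrum (Omega 0) (f t).
  move=> ht; have z : -1 <= (0 : R) <= 1 by apply/andP; lra.
  rewrite (isp z ht); have [k aO d g _] := nf ht.
  have D0' : 0 < omega (l1 t) (l2 t) by rewrite d.
  have mu := Hu t ht; rewrite /f (PA t _ ht mu.1) -d.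
  case: (q) q3 mu => // p p2 mu.
  have [x [tr ax]] := maxi_trajectory k eps_tiny D0' g p2 mu.
  exists 1%N; split=> //; left; exists (gamma t), p.+1, x; split=> //.
  by rewrite mul1r ax.
have z : -1 <= (0 : R) <= 1 by apply/andP; lra.
have nS : (@lebesgue_measure R).-negligible (area_spectrum (Omega 0)).
  have [k aO d g _] := nf z; have D0' : 0 < omega (l1 0) (l2 0) by rewrite d.
  exact: (spectrum_negligible (canon_curve k) es D0' g aO).
have per (tau s : R) : -1 <= tau <= 1 -> gamma tau (s + 1) = gamma tau s.
  move=> ht; have [k _ _ g _] := nf ht; rewrite !g mulrDr mulr1.
  by rewrite (curve_per (canon_curve k)).
have K tau tau' := @continuous_in_null_constant R f _ fS nS _ tau tau'.
move=> tau tau' ht ht'; exists (u tau), (u tau'); split; [exact: Hu|exact: Hu|].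
apply: (mulfI (lt0r_neq0 D0)); rewrite -!PA//; try by have [] := Hu _ ht; try by have [] := Hu _ ht'.
apply: K => // t0 h0 e e0.
have [B B1 HB] : exists2 B : R, 1 <= B & forall s, `|gamma t0 s| <= B.
  have [k aO d g _] := nf h0.
  exists (gk_bound (b t0) (l1 t0) (l2 t0)); first exact: gk_bound_ge1.
  by move=> s; exact: (@gk_le _ _ _ _ _ _ _ (canon_curve k) es g 0%N s).
have qR : 0 < q%:R :> R by rewrite ltr0n.
pose e1 := Num.min 1 (e / (q%:R * (8 * B))).
have qB : 0 < q%:R * (8 * B) by rewrite mulr_gt0// mulr_gt0//; lra.
have e10 : 0 < e1 by rewrite lt_min ltr01 divr_gt0.
have [d d0 Hd] := uniform_in_s family_lip per family_pointwise h0 e10.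
exists d => // t ht1 td.
apply: (@max_close _ q (pact (gamma t0) q) (pact (gamma t) q)).
- by have [] := Hu _ h0.
- by have [] := Hu _ ht1.
- move=> v av; rewrite !PA//; last by have [] := Hu _ h0.
  by apply: ler_wpM2l; [exact: ltW|have [_ ->] := Hu _ h0].
- move=> v av; rewrite !PA//; last by have [] := Hu _ ht1.
  by apply: ler_wpM2l; [exact: ltW|have [_ ->] := Hu _ ht1].
- move=> v _; apply: (le_trans (pact_close q v (ltW e10) HB (fun s => Hd t s ht1 td))).
  have a1 : e1 <= 1 by rewrite ge_min lexx.
  have a2 : e1 <= e / (q%:R * (8 * B)) by rewrite ge_min lexx orbT.
  rewrite ler_pdivlMr// in a2; apply: le_trans a2.
  have -> : e1 * (q%:R * (8 * B)) = q%:R * (2 * e1 * (4 * B)) by ring.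
  apply: ler_wpM2l; first exact: ltW.
  by apply: ler_wpM2l; [rewrite mulr_ge0// ltW|lra].
Qed.

End Family.

(** * Affine normalization *)

Section Uniqueness.
Context {R : realType}.

Lemma taylor3 (f f1 f2 f3 : R -> R) (B a x : R) : der f f1 -> der f1 f2 -> der f2 f3 ->
  (forall t, `|f3 t| <= B) -> `|f (a + x) - f a - f1 a * x - f2 a * x ^+ 2 / 2| <= B * `|x| ^+ 3.
Proof.
move=> d0 d1 d2 fB.
have da : der (fun x => a + x) (fun=> 1).
  by apply: (der_eq (der_add (der_cst a) der_id)) => t; rewrite add0r.
pose g x := f (a + x) - f a - f1 a * x - f2 a * (x * x) / 2.
have dg : der g (fun x => f1 (a + x) - f1 a - f2 a * x).
  apply: (der_eq (der_sub (der_sub (der_sub (der_comp d0 da) (der_cst (f a))) (der_scale (f1 a) der_id))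
    (der_mul (der_scale (f2 a) (der_mul der_id der_id)) (der_cst 2^-1)))) => t.
  by field.
have g0 : g 0 = 0 by rewrite /g addr0 !mulr0; ring.
have E : `|g x| <= B * `|x| ^+ 3.
  apply: (pow_primitive_bound dg g0) => t.
  by have := taylor2 a (a + t) d1 d2 fB; rewrite [a + t - a]addrAC subrr add0r.
by move: E; rewrite /g -expr2.
Qed.

Variables (eps : R) (G H : nat -> R -> plane R) (M : R).
Hypothesis cG : curve eps G.
Hypothesis eps_small : eps <= 1 / 1000.
Hypothesis dH : forall k, (k < 3)%N -> vder (H k) (H k.+1).
Hypothesis oH : forall t, omega (H 1%N t) (H 2%N t) = 1.
Hypothesis HM : forall k t, (k <= 3)%N -> `|H k t| <= M.
Hypothesis M2 : 2 <= M.
Hypothesis HG : forall t, exists s, H 0%N t = G 0%N s.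

Let GM k t : (k <= 3)%N -> `|G k t| <= M.
Proof.
move=> k3; have := curve_le t cG (leq_trans k3 (isT : (3 <= 6)%N)).
by have := eps_small; have := M2; lra.
Qed.

Let dG k : (k < 3)%N -> vder (G k) (G k.+1).
Proof. by move=> k3; apply: (curve_der cG); exact: leq_trans k3 _. Qed.

Let der_c (c : plane R) (u u' : R -> plane R) : vder u u' ->
  der (fun t => omega c (u t)) (fun t => omega c (u' t)).
Proof.
move=> du; apply: (der_eq (der_omega (vder_cst c) du)) => t.
by rewrite /omega /=; ring.
Qed.

Let omM k (c : plane R) t : (k <= 3)%N -> `|c| <= M -> `|omega c (G k t)| <= 2 * M ^+ 2.
Proof. by move=> k3 cM; have := omega_le cM (GM t k3); rewrite expr2 mulrA. Qed.

Let omH k (c : plane R) t : (k <= 3)%N -> `|c| <= M -> `|omega c (H k t)| <= 2 * M ^+ 2.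
Proof. by move=> k3 cM; have := omega_le cM (HM t k3); rewrite expr2 mulrA. Qed.

Section Point.
Variables (s phi : R).
Hypothesis sphi : H 0%N s = G 0%N phi.

Let lam := omega (H 1%N s) (G 2%N phi).
Let mu := omega (G 1%N phi) (H 2%N s).

Lemma unique_tangent : omega (G 1%N phi) (H 1%N s) = 0.
Proof.
have D := der_c (G 1%N phi) (vder_sub (dH (isT : (0 < 3)%N)) (vder_cst (G 0%N phi))).
have := @der_min0 _ _ _ s D; rewrite sphi subrr subr0; apply; last by rewrite /omega /=; ring.
by move=> t; have [u ->] := HG t; exact: (support_ge0 cG eps_small).
Qed.

Let H1E : H 1%N s = lam *: G 1%N phi.
Proof.
have := cramer (G 1%N phi) (G 2%N phi) (H 1%N s); rewrite (curve_omega cG) scale1r.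
by rewrite [omega (H 1%N s) (G 1%N phi)]omegaC unique_tangent oppr0 scale0r subr0.
Qed.

Lemma lam_mu : lam * mu = 1.
Proof. by have := oH s; rewrite H1E (omegaZl lam). Qed.

(** The correspondence between the parameters of [H] and [G] is not known to be continuous. The
    support function bounds d in terms of x nevertheless; pairing with G' then compares d^2 with mu
    x^2, and pairing with G'' compares d with lam x. *)
Lemma unique_param (x : R) : exists d, [/\ H 0%N (s + x) = G 0%N (phi + d),
  d ^+ 2 / 20 <= mu * x ^+ 2 / 2 + 2 * M ^+ 2 * `|x| ^+ 3,
  `|d ^+ 2 - mu * x ^+ 2| <= 4 * M ^+ 2 * (`|x| ^+ 3 + `|d| ^+ 3) &
  `|d - lam * x| <= 2 * M ^+ 2 * (x ^+ 2 + d ^+ 2)].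
Proof.
have [u Hu] := HG (s + x).
have [d [m [dpi e]]] := @reduce_pi R (u - phi).
have Hd : H 0%N (s + x) = G 0%N (phi + d).
  by rewrite Hu -(per2pi cG (phi + d) m)//; congr (G 0%N _); lra.
exists d; split=> //.
- have := support_near cG eps_small phi dpi; rewrite -Hd -sphi => /le_trans; apply.
  have := taylor3 s x (der_c (G 1%N phi) (dH (isT : (0 < 3)%N))) (der_c _ (dH (isT : (1 < 3)%N)))
    (der_c _ (dH (isT : (2 < 3)%N))) (fun t => omH t (isT : (3 <= 3)%N) (GM phi (isT : (1 <= 3)%N))).
  rewrite unique_tangent mul0r subr0 -omegaBr -/mu ler_norml => /andP[_ h]; lra.
- have h1 := taylor3 s x (der_c (G 1%N phi) (dH (isT : (0 < 3)%N))) (der_c _ (dH (isT : (1 < 3)%N)))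
    (der_c _ (dH (isT : (2 < 3)%N))) (fun t => omH t (isT : (3 <= 3)%N) (GM phi (isT : (1 <= 3)%N))).
  have h2 := taylor3 phi d (der_c (G 1%N phi) (dG (isT : (0 < 3)%N))) (der_c _ (dG (isT : (1 < 3)%N)))
    (der_c _ (dG (isT : (2 < 3)%N))) (fun t => omM t (isT : (3 <= 3)%N) (GM phi (isT : (1 <= 3)%N))).
  rewrite unique_tangent mul0r subr0 -/mu Hd sphi in h1.
  rewrite omegavv mul0r subr0 (curve_omega cG) mul1r in h2.
  move: h1 h2; rewrite !ler_norml => /andP[? ?] /andP[? ?]; apply/andP; lra.
- have h1 := taylor2 s (s + x) (der_c (- G 2%N phi) (dH (isT : (0 < 3)%N))) (der_c _ (dH (isT : (1 < 3)%N)))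
    (fun t => omH t (isT : (2 <= 3)%N) _).
  have h2 := taylor2 phi (phi + d) (der_c (- G 2%N phi) (dG (isT : (0 < 3)%N))) (der_c _ (dG (isT : (1 < 3)%N)))
    (fun t => omM t (isT : (2 <= 3)%N) _).
  have nG : `|- G 2%N phi| <= M by rewrite normrN; exact: GM.
  have {h1} := h1 nG; have {h2} := h2 nG => h2 h1.
  have q1 : omega (- G 2%N phi) (H 1%N s) = lam by rewrite omegaNl [RHS]omegaC.
  have q2 : omega (- G 2%N phi) (G 1%N phi) = 1 by rewrite omegaNl -(curve_omega cG phi) [RHS]omegaC.
  rewrite [s + x - s]addrAC subrr add0r q1 Hd sphi in h1.
  rewrite [phi + d - phi]addrAC subrr add0r q2 mul1r in h2.
  rewrite -normrX (ger0_norm (sqr_ge0 x)) in h1; rewrite -normrX (ger0_norm (sqr_ge0 d)) in h2.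
  move: h1 h2; rewrite !ler_norml => /andP[? ?] /andP[? ?]; apply/andP; lra.
Qed.

Let A := 20 * (`|mu| + 2 * M ^+ 2).

Let A1 : 1 <= A.
Proof.
have : 1 <= M ^+ 2 by rewrite expr2; have := M2; nra.
by rewrite /A; have := normr_ge0 mu; lra.
Qed.

Lemma unique_param' (x : R) : `|x| <= 1 -> exists d, [/\ H 0%N (s + x) = G 0%N (phi + d),
  `|d| <= A * `|x|, `|d ^+ 2 - mu * x ^+ 2| <= 4 * M ^+ 2 * (1 + A ^+ 3) * `|x| ^+ 3 &
  `|d - lam * x| <= 2 * M ^+ 2 * (1 + A ^+ 2) * `|x| ^+ 2].
Proof.
move=> x1; have [d [e b1 b2 b3]] := unique_param x; exists d.
have M20 : 0 <= M ^+ 2 by exact: sqr_ge0.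
have xx : x ^+ 2 = `|x| ^+ 2 by rewrite -normrX ger0_norm ?sqr_ge0.
have dd : d ^+ 2 = `|d| ^+ 2 by rewrite -normrX ger0_norm ?sqr_ge0.
have x2 : 0 <= `|x| ^+ 2 by exact: sqr_ge0.
have A0 : 0 <= A by have := A1; lra.
have dA : `|d| <= A * `|x|.
  have x3 : `|x| ^+ 3 <= `|x| ^+ 2 by rewrite exprS ler_piMl.
  have m1 : mu * `|x| ^+ 2 <= `|mu| * `|x| ^+ 2 by apply: ler_wpM2r => //; exact: ler_norm.
  have m2 : M ^+ 2 * `|x| ^+ 3 <= M ^+ 2 * `|x| ^+ 2 by exact: ler_wpM2l.
  have h : `|d| ^+ 2 <= A * `|x| ^+ 2.
    have m3 : 0 <= `|mu| * `|x| ^+ 2 by rewrite mulr_ge0.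
    by rewrite -dd; rewrite xx in b1; rewrite /A; lra.
  have h2 : `|d| ^+ 2 <= (A * `|x|) ^+ 2.
    apply: (le_trans h); rewrite exprMn; apply: ler_wpM2r => //.
    by rewrite expr2 ler_peMl.
  by rewrite -(@ler_pXn2r _ 2)// ?nnegrE// mulr_ge0.
have d3 : `|d| ^+ 3 <= A ^+ 3 * `|x| ^+ 3.
  by rewrite -exprMn; apply: lerXn2r; rewrite ?nnegrE// mulr_ge0.
have d2 : `|d| ^+ 2 <= A ^+ 2 * `|x| ^+ 2.
  by rewrite -exprMn; apply: lerXn2r; rewrite ?nnegrE// mulr_ge0.
split=> //.
- apply: (le_trans b2); rewrite -[leRHS]mulrA; apply: ler_wpM2l; first by rewrite mulr_ge0.
  by rewrite mulrDl mul1r lerD2l.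
- apply: (le_trans b3); rewrite -[leRHS]mulrA; apply: ler_wpM2l; first by rewrite mulr_ge0.
  by rewrite mulrDl mul1r xx dd lerD2l.
Qed.

(** Comparing the two expansions of d gives lam^2 = mu. Since lam mu = 1 expresses that both
    parametrizations are affine, lam^3 = 1. *)
Lemma lam1 : lam = 1.
Proof.
have M20 : 0 <= M ^+ 2 by exact: sqr_ge0.
have A0 : 0 <= A by have := A1; lra.
pose E := 4 * M ^+ 2 * (1 + A ^+ 3) + 2 * M ^+ 2 * (1 + A ^+ 2) * (A + `|lam|).
have E0 : 0 <= E.
  have A2 : 0 <= A ^+ 2 by exact: sqr_ge0.
  have A3 : 0 <= A ^+ 3 by exact: exprn_ge0.
  by do ![done|apply: addr_ge0|apply: mulr_ge0].
have H0 : `|lam ^+ 2 - mu| <= 0.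
  apply: (@vanishing_inv _ _ 0 E E0) => r r0; rewrite add0r.
  have rR : 0 < r%:R :> R by rewrite ltr0n.
  pose x : R := r%:R^-1.
  have x0 : 0 < x by rewrite invr_gt0.
  have xn : `|x| = x by rewrite gtr0_norm.
  have x1 : `|x| <= 1 by rewrite xn invf_le1// ler1n.
  have [d [_ b1 b2 b3]] := unique_param' x1; rewrite xn in b1 b2 b3.
  have T : `|d ^+ 2 - (lam * x) ^+ 2| <= 2 * M ^+ 2 * (1 + A ^+ 2) * x ^+ 2 * ((A + `|lam|) * x).
    rewrite subr_sqr normrM; apply: ler_pM => //.
    apply: (le_trans (ler_normD _ _)); rewrite normrM xn mulrDl; lra.
  have S : `|lam ^+ 2 - mu| * x ^+ 2 <= E * x * x ^+ 2.
    have -> : `|lam ^+ 2 - mu| * x ^+ 2 = `|(lam * x) ^+ 2 - mu * x ^+ 2|.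
      by rewrite exprMn -mulrBl normrM [`|x ^+ 2|]ger0_norm// sqr_ge0.
    have -> : E * x * x ^+ 2 = 4 * M ^+ 2 * (1 + A ^+ 3) * x ^+ 3 +
      2 * M ^+ 2 * (1 + A ^+ 2) * x ^+ 2 * ((A + `|lam|) * x) by rewrite /E; ring.
    move: (_ * x ^+ 3) b2 (_ * ((A + `|lam|) * x)) T => X b2 Y T.
    by move: b2 T; rewrite !ler_norml => /andP[? ?] /andP[? ?]; apply/andP; lra.
  by move: S; rewrite ler_pM2r// exprn_gt0.
have {H0} e : lam ^+ 2 = mu by apply/eqP; rewrite -subr_eq0 -normr_le0.
have := lam_mu; rewrite -e => h.
have : (lam - 1) * (lam ^+ 2 + lam + 1) = 0.
  have -> : (lam - 1) * (lam ^+ 2 + lam + 1) = lam * lam ^+ 2 - 1 by ring.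
  by rewrite h subrr.
move/eqP; rewrite mulf_eq0 => /orP[|/eqP z]; first by rewrite subr_eq0 => /eqP.
have z1 : 0 < lam ^+ 2 + lam + 1 by rewrite expr2; nra.
by move: z1; rewrite z ltxx.
Qed.

End Point.

Let C := 2 * M ^+ 2 * (1 + (20 * (1 + 2 * M ^+ 2)) ^+ 2).

Lemma unique_step (s phi x : R) : H 0%N s = G 0%N phi -> `|x| <= 1 ->
  exists d, H 0%N (s + x) = G 0%N (phi + d) /\ `|d - x| <= C * x ^+ 2.
Proof.
move=> e x1; have l1 := lam1 e.
have m1 : omega (G 1%N phi) (H 2%N s) = 1 by have := lam_mu e; rewrite l1 mul1r.
have [d [ed _ _]] := unique_param' e x1; rewrite l1 m1 mul1r normr1 => h.
by exists d; split=> //; rewrite -[x ^+ 2]ger0_norm ?sqr_ge0// normrX.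
Qed.

(** The way to t is cut into n steps. Each shifts the parameter by an error O((t / n)^2), so that
    the total error is O(t^2 / n). *)
Lemma curve_unique : H 0%N 0 = G 0%N 0 -> forall t, H 0%N t = G 0%N t.
Proof.
move=> e0 t.
have C0 : 0 <= C by do ![done|exact: sqr_ge0|apply: addr_ge0|apply: mulr_ge0].
have step (n : nat) x : `|x| <= 1 -> exists phi, H 0%N (n%:R * x) = G 0%N phi /\
    `|phi - n%:R * x| <= n%:R * (C * x ^+ 2).
  move=> x1; elim: n => [|n [phi [e h]]].
    by exists 0; rewrite !mul0r subr0 normr0.
  have [d [ed hd]] := unique_step e x1.
  have E : n.+1%:R * x = n%:R * x + x by rewrite -natr1 mulrDl mul1r.
  exists (phi + d); rewrite E -ed; split=> //.
  rewrite -[n.+1%:R]natr1 [(_ + 1) * (C * _)]mulrDl mul1r.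
  have -> : phi + d - (n%:R * x + x) = (phi - n%:R * x) + (d - x) by ring.
  by apply: (le_trans (ler_normD _ _)); exact: lerD.
pose B := Num.truncn `|t|.
suff : `|H 0%N t - G 0%N t| <= 0 by rewrite normr_le0 subr_eq0 => /eqP.
apply: (@vanishing_inv _ _ 0 (M * (C * t ^+ 2))) => [|r r0].
  by apply: mulr_ge0; [have := M2; lra|apply: mulr_ge0 => //; exact: sqr_ge0].
rewrite add0r; pose n := (B.+1 * r)%N.
have n0 : 0 < n%:R :> R by rewrite ltr0n muln_gt0.
have rR : 0 < r%:R :> R by rewrite ltr0n.
have tn : `|t / n%:R| <= 1.
  rewrite normrM normfV [`|n%:R|]gtr0_norm// ler_pdivrMr// mul1r.
  have tB : `|t| < B.+1%:R by exact: truncnS_gt.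
  apply: (le_trans (ltW tB)); rewrite ler_nat leq_pmulr//.
have [phi []] := step n _ tn; rewrite [n%:R * _]mulrC divfK ?gt_eqF// => -> h.
have := vmvt_le (dG (isT : (0 < 3)%N)) (a := t) (b := phi) (fun u _ => GM u (isT : (1 <= 3)%N)).
move/le_trans; apply; rewrite -[leRHS]mulrA; apply: ler_wpM2l; first by have := M2; lra.
apply: (le_trans h).
have -> : n%:R * (C * (t / n%:R) ^+ 2) = C * t ^+ 2 / n%:R by field; rewrite gt_eqF.
apply: ler_wpM2l; first by rewrite mulr_ge0 ?sqr_ge0.
by rewrite lef_pV2 ?posrE// ler_nat leq_pmull.
Qed.

End Uniqueness.

(** * The affine parametrization of a disk *)

Section Disk.
Context {R : realType}.

Lemma angle_exists (x y : R) : x ^+ 2 + y ^+ 2 = 1 -> exists th, cos th = x /\ sin th = y.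
Proof.
move=> h; have x1 : -1 <= x <= 1 by apply/andP; have := sqr_ge0 y; rewrite !expr2 in h *; split; nra.
have e : Num.sqrt (1 - x ^+ 2) = `|y| by rewrite -h addrAC subrr add0r sqrtr_sqr.
have [y0|y0] := leP 0 y.
  by exists (acos x); rewrite acosK// sin_acos// e ger0_norm.
by exists (- acos x); rewrite cosN sinN acosK// sin_acos// e ltr0_norm// opprK.
Qed.

Lemma enorm_continuous : continuous (@enorm R).
Proof.
have c1 : continuous (fun v : plane R => v.1) by move=> v; exact: cvg_fst.
have c2 : continuous (fun v : plane R => v.2) by move=> v; exact: cvg_snd.
move=> v; apply: (@continuous_comp _ _ _ (fun v : plane R => dotp v v) Num.sqrt); last exact: sqrt_continuous.
apply: (@continuousD _ _ _ (fun v : plane R => v.1 * v.1) (fun v => v.2 * v.2)).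
  by apply: (@continuousM _ _ (fun v : plane R => v.1)); exact: c1.
by apply: (@continuousM _ _ (fun v : plane R => v.2)); exact: c2.
Qed.

Lemma enorm_ge0 (v : plane R) : 0 <= enorm v.
Proof. exact: sqrtr_ge0. Qed.

Lemma dotp_ge0 (v : plane R) : 0 <= dotp v v.
Proof. by rewrite /dotp -!expr2 addr_ge0// sqr_ge0. Qed.

Lemma enorm_sq (v : plane R) : enorm v ^+ 2 = dotp v v.
Proof. by rewrite sqr_sqrtr// dotp_ge0. Qed.

Lemma norm_le_enorm (v : plane R) : `|v| <= enorm v.
Proof.
rewrite norm_plane_le -!sqrtr_sqr; apply/andP; split; apply: ler_wsqrtr; rewrite /dotp -!expr2.
  by rewrite lerDl sqr_ge0.
by rewrite lerDr sqr_ge0.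
Qed.

Lemma boundary_disk (p : plane R) (rho : R) x : boundary (disk p rho) x -> 0 <= rho /\ enorm (x - p) = rho.
Proof.
have ct : continuous (fun x : plane R => enorm (x - p)).
  move=> v; apply: (@continuous_comp _ _ _ (fun x : plane R => x - p) (@enorm R)); last exact: enorm_continuous.
  by apply: (@continuousB _ _ _ id (fun=> p)); [exact: cvg_id|exact: cst_continuous].
move=> [cx nx].
have cl : closed [set x : plane R | enorm (x - p) <= rho].
  by apply: (@preimage_closed _ _ (fun x : plane R => enorm (x - p)) [set y | y <= rho]) => [v _|]; [exact: ct|exact: closed_le].
have le : enorm (x - p) <= rho.
  have : closure [set x : plane R | enorm (x - p) <= rho] x.
    by apply: (closureS _ cx) => y /= /ltW.
  by rewrite -(closure_id _).1.
split; first exact: le_trans (enorm_ge0 _) le.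
apply/eqP; rewrite eq_le le /= leNgt; apply/negP => lt; apply: nx.
have op : open (disk p rho).
  apply: (@open_comp _ _ (fun x : plane R => enorm (x - p)) [set y | y < rho]); last exact: open_lt.
  by move=> v _; exact: ct.
by rewrite ((interior_id _).1 op); exact: lt.
Qed.

(** Differentiating |c - p|^2 = rho^2 shows that the curvature is 1 / rho, so affine and Euclidean
    arc length are proportional, and that c' is c - p turned by a right angle and divided by rho.
    The difference from the model circle solves the same equation, hence keeps its norm, which is 0
    at the start. The length is a multiple of 2 pi rho, and injectivity over a period excludes a
    proper multiple. *)
Lemma disk_param (p : plane R) (rho : R) (gD : R -> plane R) : affine_param (disk p rho) gD ->
  [/\ 0 < rho, rho ^+ 2 * (2 * pi) ^+ 3 = 1 &
      exists th, forall s, gD s = p + rho *: ek 0 (2 * pi * s + th)].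
Proof.
move=> /affine_param_reparam[c [c1 [c2 [S [T [k [L rp]]]]]]].
have bc t : 0 <= rho /\ enorm (c t - p) = rho.
  by apply: boundary_disk; rewrite -(rp_range rp); exists t.
have rho0 := (bc 0).1.
pose n t := c t - p.
have nn t : dotp (n t) (n t) = rho ^+ 2 by rewrite -enorm_sq (bc t).2.
have dn : vder n c1 by apply: (vder_eq (vder_sub (rp_c rp) (vder_cst p))) => t; rewrite subr0.
have der_dot (u u' v v' : R -> plane R) : vder u u' -> vder v v' ->
    der (fun t => dotp (u t) (v t)) (fun t => dotp (u' t) (v t) + dotp (u t) (v' t)).
  move=> [u1 u2] [v1 v2]; apply: (der_eq (der_add (der_mul u1 v1) (der_mul u2 v2))) => t.
  by rewrite /dotp; ring.
have nc t : dotp (n t) (c1 t) = 0.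
  have := der_uniq (der_dot _ _ _ _ dn dn) (der_ext (fun t => esym (nn t)) (der_cst _)) t.
  have -> : dotp (c1 t) (n t) = dotp (n t) (c1 t) by rewrite /dotp; ring.
  lra.
have c11 := rp_norm rp.
have cc t : dotp (c1 t) (c2 t) = 0.
  have := der_uniq (der_dot _ _ _ _ (rp_c1 rp) (rp_c1 rp)) (der_ext (fun t => esym (c11 t)) (der_cst _)) t.
  have -> : dotp (c2 t) (c1 t) = dotp (c1 t) (c2 t) by rewrite /dotp; ring.
  lra.
have nc2 t : dotp (n t) (c2 t) = -1.
  have := der_uniq (der_dot _ _ _ _ dn (rp_c1 rp)) (der_ext (fun t => esym (nc t)) (der_cst _)) t.
  rewrite c11; lra.
have lag (a b d : plane R) : dotp a b * dotp d d = dotp a d * dotp b d + omega a d * omega b d.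
  by rewrite /dotp /omega; ring.
have W2 t : omega (n t) (c1 t) ^+ 2 = rho ^+ 2.
  by have := lag (n t) (n t) (c1 t); rewrite nc c11 nn mulr1 mul0r add0r -expr2.
have Wk t : omega (n t) (c1 t) * omega (c1 t) (c2 t) = 1.
  have := lag (n t) (c2 t) (c1 t); rewrite nc2 c11 nc mul0r add0r [omega (c2 t) _]omegaC; lra.
have kp t : 0 < omega (c1 t) (c2 t) by have [k0 <-] := rp_k rp t; rewrite exprn_gt0.
have W t : omega (n t) (c1 t) = rho.
  have W0 : 0 < omega (n t) (c1 t) by rewrite -(pmulr_lgt0 _ (kp t)) Wk.
  by apply/eqP; rewrite -(@eqrXn2 _ 2)// ?W2// ltW.
have rg : 0 < rho by rewrite -(W 0) -(pmulr_lgt0 _ (kp 0)) Wk.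
have rn : rho != 0 by rewrite gt_eqF.
have k3 t : k t ^+ 3 = rho^-1.
  by have [_ ->] := rp_k rp t; apply: (mulfI rn); rewrite mulfV// -(W t) Wk.
have k0 := (rp_k rp 0).1.
have kE t : k t = k 0.
  by apply/eqP; rewrite -(@eqrXn2 _ 3)// ?k3 ?eqxx// ltW// (rp_k rp _).1.
have SE t : S t = k 0 * t.
  have d : der (fun t => S t - k 0 * t) (fun=> 0).
    by apply: (der_eq (der_sub (rp_S rp) (der_scale (k 0) der_id))) => u; rewrite kE mulr1 subrr.
  have : S t - k 0 * t = S 0 - k 0 * 0 := is_derive_0_is_cst t 0 d.
  by rewrite (rp_S0 rp) mulr0; lra.
have kL : k 0 * L = 1 by rewrite -SE -[L]add0r (rp_SL rp) (rp_S0 rp) add0r.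
have L0 := (rp_per rp).1.
have c1E t : c1 t = (- (n t).2 / rho, (n t).1 / rho).
  rewrite [LHS]surjective_pairing; congr pair; apply: (mulfI rn); rewrite [RHS]mulrC divfK//.
    apply: (mulfI rn); rewrite mulrA -expr2 -(nn t).
    have -> : dotp (n t) (n t) * (c1 t).1 = dotp (n t) (c1 t) * (n t).1 - omega (n t) (c1 t) * (n t).2.
      by rewrite /dotp /omega; ring.
    by rewrite nc W; ring.
  apply: (mulfI rn); rewrite mulrA -expr2 -(nn t).
  have -> : dotp (n t) (n t) * (c1 t).2 = dotp (n t) (c1 t) * (n t).2 + omega (n t) (c1 t) * (n t).1.
    by rewrite /dotp /omega; ring.
  by rewrite nc W; ring.
have [th [th1 th2]] : exists th, cos th = (n 0).1 / rho /\ sin th = (n 0).2 / rho.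
  apply: angle_exists; have := nn 0; rewrite /dotp => h.
  have -> : ((n 0).1 / rho) ^+ 2 + ((n 0).2 / rho) ^+ 2 = ((n 0).1 * (n 0).1 + (n 0).2 * (n 0).2) / rho ^+ 2.
    by field.
  by rewrite h divff// sqrf_eq0.
have nE t : n t = rho *: ek 0 (t / rho + th).
  have de : vder (fun t => rho *: ek 0 (t / rho + th)) (fun t => ek 1 (t / rho + th)).
    have d : der (fun t : R => t / rho + th) (fun=> rho^-1).
      by apply: (der_eq (der_add (der_mul der_id (der_cst rho^-1)) (der_cst th))) => u; rewrite mulr0 !addr0 mul1r.
    by apply: (vder_eq (vder_scale rho (vder_comp (ek_der 0) d))) => u; rewrite scalerA mulfV// scale1r.
  pose w t := n t - rho *: ek 0 (t / rho + th).
  have dw : vder w (fun t => c1 t - ek 1 (t / rho + th)) by exact: vder_sub dn de.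
  have w1 u : c1 u - ek 1 (u / rho + th) = (- (w u).2 / rho, (w u).1 / rho).
    have sE (a b : R) : a *: (b : R^o) = a * b by [].
    rewrite c1E ek1 /w ek0; apply/eqP; rewrite xpair_eqE /= !sE; apply/andP.
    by split; apply/eqP; field.
  have D := der_dot _ _ _ _ dw dw.
  have D0 : der (fun t => dotp (w t) (w t)) (fun=> 0).
    by apply: (der_eq D) => u; rewrite w1 /dotp /=; ring.
  have w0 : w 0 = 0.
    rewrite /w mul0r add0r ek0 th1 th2 [n 0]surjective_pairing; apply/eqP; rewrite xpair_eqE /=.
    have sE (a b : R) : a *: (b : R^o) = a * b by [].
    by rewrite !sE !(mulrC rho) !divfK// !subrr eqxx.
  have e : (w t).1 ^+ 2 + (w t).2 ^+ 2 = 0.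
    have h : dotp (w t) (w t) = dotp (w 0) (w 0) := is_derive_0_is_cst t 0 D0.
    by rewrite !expr2 -[LHS]/(dotp (w t) (w t)) h w0 /dotp mul0r addr0.
  have : w t = 0.
    have s1 := sqr_ge0 (w t).1; have s2 := sqr_ge0 (w t).2.
    have z1 : (w t).1 = 0 by apply/eqP; rewrite -sqrf_eq0 eq_le s1 andbT; lra.
    have z2 : (w t).2 = 0 by apply/eqP; rewrite -sqrf_eq0 eq_le s2 andbT; lra.
    by rewrite [w t]surjective_pairing z1 z2.
  by move=> /eqP; rewrite subr_eq0 => /eqP.
have cE t : c t = p + rho *: ek 0 (t / rho + th) by rewrite -nE /n addrC subrK.
have pp0 : 0 < 2 * pi :> R by rewrite mulr_gt0// pi_gt0.
have LE : L = 2 * pi * rho.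
  have := (rp_per rp).2 0; rewrite add0r !cE => /addrI/(scalerI rn) e.
  have [m me] := curve_inj (curve_ek (lexx 0)) (ltac:(lra) : (0 : R) <= 1 / 1000) e.
  have {}me : L = m%:~R * (2 * pi) * rho.
    have h : L / rho = m%:~R * (2 * pi) by move: me; rewrite mul0r; lra.
    by rewrite -h divfK.
  have m0 : 0 < (m%:~R : R).
    by move: L0; rewrite me pmulr_lgt0// pmulr_lgt0.
  have [m1|m2] := leP m 1.
    have m1' : m = 1 :> int by move: m0 m1; rewrite ltr0z; clear; lia.
    by rewrite me m1' mul1r.
  have lt : 2 * pi * rho < L by rewrite me ltr_pM2r// ltr_pMl// ltr1z.
  have c0 : c (2 * pi * rho) = c 0.
    by rewrite !cE mulfK// mul0r [2 * pi + th]addrC ek_periodic add0r.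
  have h1 : 0 <= 2 * pi * rho < L by rewrite lt andbT; apply: mulr_ge0; exact: ltW.
  have h2 : (0 : R) <= 0 < L by rewrite lexx.
  have z : 2 * pi * rho = 0 by exact: (rp_inj rp h1 h2 c0).
  by have := mulr_gt0 pp0 rg; rewrite z ltxx.
split=> //.
  have kE' : k 0 = (2 * pi * rho)^-1.
    by apply: (mulIf (lt0r_neq0 L0)); rewrite kL LE mulVf// mulf_neq0// gt_eqF.
  have := k3 0; rewrite kE' => h.
  have e : (2 * pi * rho) ^+ 3 = rho.
    by apply: invr_inj; rewrite -exprVn.
  apply: (mulfI rn); rewrite mulr1 -[RHS]e; ring.
exists th => s.
have sE : s = S (L * s) by rewrite SE mulrA kL mul1r.
rewrite {1}sE (rp_gamma rp) cE LE; congr (_ + rho *: ek 0 (_ + th)).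
by field.
Qed.

Lemma class_C_vder r (f : R -> plane R) k : of_class_C r f -> (k < r)%N -> vder (f^`(k)) (f^`(k.+1)).
Proof. by move=> [d _] kr; exact: derivable_vder (d k kr). Qed.

Lemma vder_plane_continuous (u u' : R -> plane R) : vder u u' -> continuous u.
Proof. by move=> [d1 d2]; apply: plane_continuous; [exact: der_continuous d1|exact: der_continuous d2]. Qed.

Lemma class_C_continuous r (f : R -> plane R) k : of_class_C r f -> (k <= r)%N -> continuous (f^`(k)).
Proof.
move=> cf; rewrite leq_eqVlt => /orP[/eqP->|kr]; first exact: cf.2.
exact: vder_plane_continuous (class_C_vder cf kr).
Qed.

Lemma class_C_periodic r (f : R -> plane R) k : of_class_C r f -> (forall t, f (t + 1) = f t) ->
  (k <= r)%N -> forall t, f^`(k) (t + 1) = f^`(k) t.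
Proof.
move=> cf pf; elim: k => [|k IH] kr; first exact: pf.
by apply: (vder_periodic (class_C_vder cf kr)); exact: IH (ltnW kr).
Qed.

Lemma le_sup_segment (f : R -> R) t : continuous f -> 0 <= t <= 1 -> f t <= sup [set f s | s in `[0, 1]].
Proof.
move=> cf t01; apply: ub_le_sup; last by exists t.
have [c _ h] := @EVT_max R f 0 1 ler01 (continuous_subspaceT cf).
by exists (f c) => _ [s s01 <-]; exact: h.
Qed.

Lemma Cr_distance_near r (f g : R -> plane R) (delta : R) :
  of_class_C r f -> of_class_C r g ->
  (forall t, f (t + 1) = f t) -> (forall t, g (t + 1) = g t) -> Cr_distance r f g <= delta ->
  forall k t, (k <= r)%N -> `|derive1n k f t - derive1n k g t| <= delta.
Proof.
move=> cf cg pf pg le k t kr.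
have [y [m [y0 tE]]] := period_reduce t (ltr01 : (0 : R) < 1).
have per (h : R -> plane R) : (forall t, h (t + 1) = h t) -> h t = h y.
  by move=> /periodic_int ph; rewrite tE ph.
rewrite (per _ (class_C_periodic cf pf kr)) (per _ (class_C_periodic cg pg kr)).
have {}y0 : 0 <= y <= 1 by case/andP: y0 => -> /ltW ->.
have ct j : (j <= r)%N -> continuous (fun s => enorm (derive1n j g s - derive1n j f s)).
  move=> jr s; apply: (@continuous_comp _ _ _ (fun s => derive1n j g s - derive1n j f s) (@enorm R)); last exact: enorm_continuous.
  by apply: (@continuousB _ _ _ (derive1n j g) (derive1n j f)); [exact: (class_C_continuous cg jr)|exact: (class_C_continuous cf jr)].
have kr1 : (k < r.+1)%N by [].
rewrite distrC; apply: (le_trans (norm_le_enorm _)).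
apply: (le_trans (le_sup_segment (ct k kr) y0)); apply: le_trans le.
rewrite /Cr_distance (bigD1 (Ordinal kr1))//= lerDl; apply: sumr_ge0 => j _.
have jr : (j <= r)%N by rewrite -ltnS.
exact: le_trans (enorm_ge0 _) (le_sup_segment (ct j jr) y0).
Qed.

Lemma circle_derive1n (p : plane R) (rho a th : R) (g : R -> plane R) k :
  (forall s, g s = p + rho *: ek 0 (a * s + th)) ->
  forall s, g^`(k) s = (if k is 0 then p else 0) + (rho * a ^+ k) *: ek k (a * s + th).
Proof.
move=> gE; elim: k => [|k IH] s; first by rewrite expr0 mulr1; exact: gE.
have d : der (fun s => a * s + th) (fun=> a).
  by apply: (der_eq (der_add (der_scale a der_id) (der_cst th))) => t; rewrite mulr1 addr0.
have D := vder_add (vder_cst (if k is 0 then p else 0)) (vder_scale (rho * a ^+ k) (vder_comp (ek_der k) d)).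
have [_ h] := vder_derive1 (vder_ext (fun t => esym (IH t)) D).
by rewrite -[LHS]/((g^`(k))^`() s) h /= !add0r scalerA exprSr; congr (_ *: _); rewrite mulrA.
Qed.

End Disk.

(** * The affine frame given by the marked and auxiliary points *)

Section NormalForm.
Context {R : realType}.

(** Orthogonal to [l1], so that the reflection in the axis becomes a change of sign of the second
    coordinate. Its length makes the determinant r^2 = (2 pi)^(-3), the value for which omega (G',
    G'') = 1 at period 2 pi. *)
Definition frame_vec (r : R) (l1 : plane R) : plane R := (r ^+ 2 / dotp l1 l1) *: (- l1.2, l1.1).

Lemma frame_omega r (l1 : plane R) : dotp l1 l1 != 0 -> omega l1 (frame_vec r l1) = r ^+ 2.
Proof.
move=> h; rewrite /omega /frame_vec /= /GRing.scale /=.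
transitivity (r ^+ 2 / dotp l1 l1 * dotp l1 l1); last by rewrite divfK.
by rewrite [X in _ = _ * X]/dotp; ring.
Qed.

Let ler_pM1 (x y d : R) : `|x| <= 1 -> `|y| <= d -> `|x * y| <= d.
Proof. by move=> hx hy; rewrite normrM -[leRHS]mul1r; exact: ler_pM. Qed.

Lemma frame_factor (r d c s a b : R) : 1 / 23 <= r -> r <= 1 -> d <= 1 / (1000 * 1000) ->
  `|c| <= 1 -> `|s| <= 1 -> c ^+ 2 + s ^+ 2 = 1 -> `|a| <= d -> `|b| <= d ->
  0 < (r * c + a) * (r * c + a) + (r * s + b) * (r * s + b) /\
  `|r ^+ 2 / ((r * c + a) * (r * c + a) + (r * s + b) * (r * s + b)) - 1| <= 3600 * d.
Proof.
move=> r0 r1 ds c1 s1 cs ha hb; set E := _ + _.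
have d0 : 0 <= d := le_trans (normr_ge0 _) ha.
have rr : `|r| <= 1 by rewrite ger0_norm//; clear - r0; lra.
have d1 : d <= 1 by clear - ds; lra.
have hE : `|E - r ^+ 2| <= 6 * d.
  have -> : E - r ^+ 2 = r * (c * a) + r * (c * a) + r * (s * b) + r * (s * b) + a * a + b * b.
    have -> : r ^+ 2 = r ^+ 2 * (c ^+ 2 + s ^+ 2) by rewrite cs mulr1.
    by rewrite /E; ring.
  have h1 := ler_pM1 rr (ler_pM1 c1 ha); have h2 := ler_pM1 rr (ler_pM1 s1 hb).
  have h3 := ler_pM1 (le_trans ha d1) ha; have h4 := ler_pM1 (le_trans hb d1) hb.
  have -> : 6 * d = d + d + d + d + d + d by ring.
  by do 5![apply: (le_trans (ler_normD _ _)); apply: lerD => //].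
have r2 : 1 / 529 <= r ^+ 2 by clear - r0; rewrite expr2; nra.
have E0 : 1 / 600 <= E.
  have := ler_norm (r ^+ 2 - E); rewrite distrC; move: hE r2 ds; clear; move: E (r ^+ 2) => E r2; lra.
have E1 : 0 < E by apply: lt_le_trans E0; clear; lra.
split=> //.
have -> : r ^+ 2 / E - 1 = (r ^+ 2 - E) / E by field; rewrite gt_eqF.
rewrite normrM normfV (ger0_norm (ltW E1)) distrC ler_pdivrMr//.
apply: (le_trans hE); move: E0 d0; clear; move: E => E h0 h; nra.
Qed.

Lemma frame_close (r delta th : R) (l1 : plane R) : 1 / 23 <= r -> r <= 1 -> delta <= 1 / (1000 * 1000) ->
  `|l1 - r *: ek 0 th| <= delta ->
  [/\ dotp l1 l1 != 0, `|l1| <= 2, `|frame_vec r l1| <= 2 & `|frame_vec r l1 - r *: ek 1 th| <= 4000 * delta].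
Proof.
move=> r0 r1 ds h.
have d0 : 0 <= delta := le_trans (normr_ge0 _) h.
have sE (x y : R) : x *: (y : R^o) = x * y by [].
have [a [b [ha hb e1 e2]]] : exists a b, [/\ `|a| <= delta, `|b| <= delta,
    l1.1 = r * cos th + a & l1.2 = r * sin th + b].
  have := h; rewrite norm_plane_le => /andP[ha hb]; exists (l1 - r *: ek 0 th).1, (l1 - r *: ek 0 th).2.
  by split=> //; rewrite ek0 /= !sE addrC subrK.
have c1 : `|cos th| <= 1 :> R by rewrite ler_norml cos_geN1 cos_le1.
have s1 : `|sin th| <= 1 :> R by rewrite ler_norml sin_geN1 sin_le1.
have := frame_factor r0 r1 ds c1 s1 (cos2Dsin2 th) ha hb; rewrite -e1 -e2 -[_ + _]/(dotp l1 l1).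
set F := r ^+ 2 / _ => -[E0 F1].
have F2 : `|F| <= 2.
  by have := ler_normD (F - 1) 1; rewrite subrK normr1; move: F1 ds; clear; lra.
have rr : `|r| <= 1 by rewrite ger0_norm//; clear - r0; lra.
have close : `|frame_vec r l1 - r *: ek 1 th| <= 4000 * delta.
  have bnd (y z : R) : `|y| <= 1 -> `|z| <= delta -> `|(F - 1) * (r * y) + F * z| <= 4000 * delta.
    move=> hy hz; apply: (le_trans (ler_normD _ _)).
    have p1 : `|(r * y) * (F - 1)| <= 3600 * delta by apply: ler_pM1 => //; exact: ler_pM1.
    have p2 : `|F * z| <= 2 * delta by rewrite normrM; exact: ler_pM.
    by rewrite [(F - 1) * _]mulrC; move: p1 p2 d0; clear; lra.
  rewrite norm_plane_le /frame_vec -/F ek1 /= !sE e1 e2; apply/andP; split.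
    have -> : F * - (r * sin th + b) - r * - sin th = (F - 1) * (r * - sin th) + F * - b by ring.
    by apply: bnd; rewrite normrN.
  have -> : F * (r * cos th + a) - r * cos th = (F - 1) * (r * cos th) + F * a by ring.
  exact: bnd.
have rek k : `|r *: ek k th| <= 1.
  by rewrite normrZ -[leRHS]mul1r; apply: ler_pM => //; exact: ek_le1.
split=> //.
- by rewrite gt_eqF.
- by have := normD_le h (rek 0%N); rewrite subrK; clear - ds; lra.
by have := normD_le close (rek 1%N); rewrite subrK; clear - ds; lra.
Qed.

(** The inverse of [lin l1 l2] by Cramer's rule, itself written as a [lin] so that the facts about
    linear images apply. *)
Definition coord (l1 l2 v : plane R) : plane R :=
  lin ((omega l1 l2)^-1 *: (l2.2, - l1.2)) ((omega l1 l2)^-1 *: (- l2.1, l1.1)) v.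

Lemma coordE l1 l2 v : coord l1 l2 v = ((omega l1 l2)^-1 * omega v l2, (omega l1 l2)^-1 * omega l1 v).
Proof. by congr pair; rewrite /coord /lin /omega /= /GRing.scale /=; ring. Qed.

Lemma lin_coord l1 l2 v : omega l1 l2 != 0 -> lin l1 l2 (coord l1 l2 v) = v.
Proof.
move=> h; apply: (scalerI h); rewrite [RHS](cramer l1 l2 v) coordE /lin /= scalerDr !scalerA !mulrA divff// !mul1r.
by rewrite [omega l1 v]omegaC scaleNr.
Qed.

Lemma coord_lin l1 l2 v : omega l1 l2 != 0 -> coord l1 l2 (lin l1 l2 v) = v.
Proof.
move=> h; rewrite coordE /lin omegaDl omegaDr !omegaZl !omegaZr !omegavv !mulr0 addr0 add0r.
by rewrite mulrCA mulVf// mulr1 mulrCA mulVf// mulr1 -surjective_pairing.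
Qed.

Lemma omega_coord l1 l2 u v : omega l1 l2 != 0 -> omega (coord l1 l2 u) (coord l1 l2 v) = (omega l1 l2)^-1 * omega u v.
Proof.
move=> h; rewrite omega_lin; congr (_ * _); rewrite omegaZl omegaZr.
have -> : omega (l2.2, - l1.2) (- l2.1, l1.1) = omega l1 l2 by rewrite /omega /=; ring.
by rewrite mulVf// mulr1.
Qed.

Lemma omega_ek_ek1 k (t th : R) : omega (ek k (t + th)) (ek 1 th) = (ek k t).1.
Proof.
rewrite ek1 /omega /ek /= [t + th + _]addrAC; move: (t + _) => w.
by rewrite cosD sinD -[RHS]mulr1 -(cos2Dsin2 th); ring.
Qed.

Lemma omega_ek0_ek k (t th : R) : omega (ek 0 th) (ek k (t + th)) = (ek k t).2.
Proof.
rewrite ek0 /omega /ek /= [t + th + _]addrAC; move: (t + _) => w.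
by rewrite cosD sinD -[RHS]mulr1 -(cos2Dsin2 th); ring.
Qed.

Section Frame.
Variables (g : nat -> R -> plane R) (p : plane R) (r delta th : R).
Hypothesis dg : forall k, (k < 6)%N -> vder (g k) (g k.+1).
Hypothesis pg : forall k s, (k <= 6)%N -> g k (s + 1) = g k s.
Hypothesis og : forall s, omega (g 1%N s) (g 2%N s) = 1.
Hypothesis near : forall k s, (k <= 6)%N ->
  `|g k s - ((if k is 0 then p else 0) + (r * (2 * pi) ^+ k) *: ek k (2 * pi * s + th))| <= delta.
Hypothesis r0 : 0 < r.
Hypothesis rpi : r ^+ 2 * (2 * pi) ^+ 3 = 1.
Hypothesis delta_small : delta <= 1 / (1000 * 1000).

Definition frame_o : plane R := (1 / 2) *: (g 0%N 0 + g 0%N 2^-1).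
Definition frame_e : plane R := (1 / 2) *: (g 0%N 0 - g 0%N 2^-1).
Local Notation l1 := frame_e.
Local Notation l2 := (frame_vec r frame_e).

Definition frame_curve (k : nat) (t : R) : plane R :=
  ((2 * pi) ^+ k)^-1 *: coord l1 l2 (g k (t / (2 * pi)) - (if k is 0 then frame_o else 0)).

Let pp0 : 0 < 2 * pi :> R.
Proof. exact: twopi_gt0. Qed.

Let pn : 2 * pi != 0 :> R.
Proof. by rewrite gt_eqF. Qed.

(** The radius is (2 pi)^(-3/2), where (2 pi)^3 < 8^3 = 512 < 23^2. *)
Let r_ge : 1 / 23 <= r.
Proof.
have h : (2 * pi : R) ^+ 3 <= 8 ^+ 3 by apply: lerXn2r; rewrite ?nnegrE ?ltW ?twopi_lt8.
have h2 : 1 <= r ^+ 2 * 8 ^+ 3 by rewrite -[leLHS]rpi; apply: ler_wpM2l => //; exact: sqr_ge0.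
have e8 : (8 : R) ^+ 3 = 512 by rewrite -natrX.
rewrite leNgt; apply/negP => lt; move: h2; rewrite e8 leNgt => /negP; apply.
have : r ^+ 2 < 1 / 529 by have h0 := r0; clear h e8; rewrite expr2; nra.
by lra.
Qed.

Let r_le : r <= 1.
Proof.
have h : 1 <= (2 * pi : R) ^+ 3 by apply: exprn_ege1; have := pi_ge2 R; lra.
have h2 : r ^+ 2 <= 1 by rewrite -rpi ler_peMr// sqr_ge0.
by rewrite -(@expr_le1 _ 2)// ltW.
Qed.

Let rn : r != 0.
Proof. by rewrite gt_eqF. Qed.

Let ekpi : ek 0 (2 * pi * 2^-1 + th) = - ek 0 th.
Proof. by rewrite mulrAC divff// mul1r addrC !ek0 cosDpi sinDpi. Qed.

Let near_half : `|g 0%N 2^-1 - (p - r *: ek 0 th)| <= delta.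
Proof. by have := near 2^-1 (isT : (0 <= 6)%N); rewrite expr0 mulr1 ekpi scalerN. Qed.

Let near_zero : `|g 0%N 0 - (p + r *: ek 0 th)| <= delta.
Proof. by have := near 0 (isT : (0 <= 6)%N); rewrite expr0 mulr1 mulr0 add0r. Qed.

Let half_le (u v : plane R) : `|u| <= delta -> `|v| <= delta -> `|(1 / 2) *: (u + v)| <= delta.
Proof.
move=> hu hv; rewrite normrZ ger0_norm ?divr_ge0//.
by have := normD_le hu hv; lra.
Qed.

Let o_close : `|frame_o - p| <= delta.
Proof.
have -> : frame_o - p = (1 / 2) *: ((g 0%N 0 - (p + r *: ek 0 th)) + (g 0%N 2^-1 - (p - r *: ek 0 th))).
  by rewrite [LHS]surjective_pairing [RHS]surjective_pairing /= /GRing.scale /=; congr pair; field.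
exact: half_le.
Qed.

Let e_close : `|l1 - r *: ek 0 th| <= delta.
Proof.
have -> : l1 - r *: ek 0 th = (1 / 2) *: ((g 0%N 0 - (p + r *: ek 0 th)) + - (g 0%N 2^-1 - (p - r *: ek 0 th))).
  by rewrite [LHS]surjective_pairing [RHS]surjective_pairing /= /GRing.scale /=; congr pair; field.
by apply: half_le => //; rewrite normrN.
Qed.

Lemma frame_dotp : dotp l1 l1 != 0.
Proof. by case: (frame_close r_ge r_le delta_small e_close). Qed.

Lemma frame_e_le : `|l1| <= 2.
Proof. by case: (frame_close r_ge r_le delta_small e_close). Qed.

Lemma frame_vec_le : `|l2| <= 2.
Proof. by case: (frame_close r_ge r_le delta_small e_close). Qed.

Lemma frame_det : omega l1 l2 = r ^+ 2.
Proof. exact: frame_omega frame_dotp. Qed.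

Let det0 : omega l1 l2 != 0.
Proof. by rewrite frame_det sqrf_eq0. Qed.

Lemma frame_param s : g 0%N s = frame_o + lin l1 l2 (frame_curve 0 (2 * pi * s)).
Proof.
rewrite /frame_curve expr0 invr1 scale1r lin_coord// [2 * pi * s]mulrC mulfK//.
by rewrite addrC subrK.
Qed.

Lemma frame_curve0 : frame_curve 0 0 = (1, 0).
Proof.
rewrite /frame_curve expr0 invr1 scale1r mul0r.
have -> : g 0%N 0 - frame_o = lin l1 l2 (1, 0).
  by rewrite /lin scale1r scale0r addr0 [LHS]surjective_pairing [RHS]surjective_pairing /= /GRing.scale /=; congr pair; field.
exact: coord_lin.
Qed.

Lemma frame_curve_pi : frame_curve 0 pi = (-1, 0).
Proof.
rewrite /frame_curve expr0 invr1 scale1r.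
have -> : pi / (2 * pi) = 2^-1 :> R by rewrite invfM mulrCA divff ?mulr1// gt_eqF// pi_gt0.
have -> : g 0%N 2^-1 - frame_o = lin l1 l2 (-1, 0).
  by rewrite /lin scaleN1r scale0r addr0 [LHS]surjective_pairing [RHS]surjective_pairing /= /GRing.scale /=; congr pair; field.
exact: coord_lin.
Qed.

(** In the exact frame of the disk its boundary becomes the unit circle. The errors of the frame, at
    most 4000 delta, and of the derivatives, at most 2 delta, are multiplied by 1 / r <= 23 and 1 /
    r^2 <= 529. *)
Lemma frame_curveP : curve (1000 * 1000 * delta) frame_curve.
Proof.
have d0 : 0 <= delta := le_trans (normr_ge0 _) e_close.
have pk k : (2 * pi : R) ^+ k != 0 by rewrite expf_neq0.
split.
- move=> k k6; have d : der (fun t : R => t / (2 * pi)) (fun=> (2 * pi)^-1).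
    by apply: (der_eq (der_mul der_id (der_cst (2 * pi)^-1))) => t; rewrite mulr0 addr0 mul1r.
  have D := vder_scale ((2 * pi) ^+ k)^-1 (@vder_lin _ ((omega l1 l2)^-1 *: (l2.2, - l1.2)) ((omega l1 l2)^-1 *: (- l2.1, l1.1)) _ _
    (vder_sub (vder_comp (dg k6) d) (vder_cst (if k is 0 then frame_o else 0)))).
  apply: (vder_eq D) => t; rewrite /frame_curve -/(coord l1 l2 _) !subr0.
  by rewrite /coord linZ scalerA; congr (_ *: _); rewrite exprSr [RHS]invfM.
- move=> t; rewrite /frame_curve !subr0 omegaZl omegaZr omega_coord// og mulr1 frame_det.
  suff aux (T q : R) : q ^+ 2 * T ^+ 3 = 1 -> T != 0 -> q != 0 -> T ^- 1 * (T ^- 2 / q ^+ 2) = 1 by exact: aux rpi pn rn.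
  move=> e Tn qn; transitivity (q ^+ 2 * T ^+ 3)^-1; last by rewrite e invr1.
  by field; rewrite Tn.
- move=> k t k6; rewrite /frame_curve; congr (_ *: coord _ _ (_ - _)).
  by rewrite mulrDl divff// pg.
move=> k t k6; rewrite /frame_curve; set s := t / (2 * pi).
set y := (if k is 0 then frame_o else 0).
pose D := (r * (2 * pi) ^+ k) *: ek k (2 * pi * s + th).
have [x xE xle] : exists2 x, g k s - y = D + x & `|x| <= 2 * delta.
  exists (g k s - y - D); first by rewrite subrKC.
  have -> : g k s - y - D = (g k s - ((if k is 0 then p else 0) + D)) - (y - (if k is 0 then p else 0)).
    by rewrite [LHS]surjective_pairing [RHS]surjective_pairing /=; congr pair; ring.
  have yl : `|y - (if k is 0 then p else 0)| <= delta.
    by rewrite /y; case: (k) => [//|k']; rewrite subrr normr0.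
  have -> : 2 * delta = delta + delta by ring.
  exact: normB_le (near s k6) yl.
have tE : t = 2 * pi * s by rewrite /s mulrC divfK.
have [_ _ _ l2c] := frame_close r_ge r_le delta_small e_close.
have ri : r^-1 <= 23 by rewrite -(invrK 23) lef_pV2 ?posrE ?invr_gt0//; have := r_ge; lra.
have ri0 : 0 <= r^-1 by rewrite invr_ge0 ltW.
have pki : `|((2 * pi : R) ^+ k)^-1| <= 1.
  rewrite normfV invf_le1 ?normr_gt0//; apply: le_trans (ler_norm _).
  by apply: exprn_ege1; have := pi_ge2 R; lra.
have r2i : `|(r ^+ 2)^-1| <= 529.
  rewrite -exprVn normrX ger0_norm//; have -> : 529 = 23 ^+ 2 :> R by rewrite -natrX.
  by apply: lerXn2r; rewrite ?nnegrE.
have main (u v m : plane R) (c : R) : `|u| <= 1 -> `|v| <= 4000 * delta -> `|m| <= 2 ->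
    c = r^-1 * omega u v + ((2 * pi) ^+ k)^-1 * ((r ^+ 2)^-1 * omega x m) -> `|c| <= 1000 * 1000 * delta.
  move=> hu hv hm ->; apply: (le_trans (ler_normD _ _)).
  have p1 : `|r^-1 * omega u v| <= 23 * (2 * 1 * (4000 * delta)).
    by rewrite normrM; apply: ler_pM => //; [rewrite ger0_norm|exact: omega_le].
  have p2 : `|(r ^+ 2)^-1 * omega x m| <= 529 * (2 * (2 * delta) * 2).
    by rewrite normrM; apply: ler_pM => //; exact: omega_le.
  have p3 := ler_pM1 pki p2.
  by lra.
have sE (a b : R) : a *: (b : R^o) = a * b by [].
rewrite xE coordE norm_plane_le /= !sE frame_det /D -tE; apply/andP; split.
  apply: (main (ek k (t + th)) (l2 - r *: ek 1 th) l2); [exact: ek_le1|exact: l2c|exact: frame_vec_le|].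
  rewrite omegaDl omegaZl omegaBr omegaZr omega_ek_ek1.
  rewrite -[cos (t + _)]/((ek k t).1); move: (pk k) rn.
  move: ((2 * pi) ^+ k) (omega (ek k (t + th)) l2) (omega x l2) (ek k t).1 => T y1 y2 y3 Tn qn.
  by field; rewrite Tn qn.
apply: (main (ek k (t + th)) (r *: ek 0 th - l1) (- l1)); [exact: ek_le1| |by rewrite normrN; exact: frame_e_le|].
  by rewrite distrC; have := e_close; lra.
rewrite omegaNr [omega x l1]omegaC opprK omegaDr omegaZr omegaBr omegaZr [omega _ (ek 0 th)]omegaC omega_ek0_ek [omega _ l1]omegaC.
rewrite -[sin (t + _)]/((ek k t).2); move: (pk k) rn.
move: ((2 * pi) ^+ k) (omega l1 (ek k (t + th))) (omega l1 x) (ek k t).2 => T y1 y2 y3 Tn qn.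
by field; rewrite Tn qn.
Qed.

End Frame.

End NormalForm.

(** * Axial symmetry and the normal form *)

Section Normal.
Context {R : realType}.

Lemma circle_class_C (p : plane R) (rho a th : R) (g : R -> plane R) r :
  (forall s, g s = p + rho *: ek 0 (a * s + th)) -> of_class_C r g.
Proof.
move=> gE; have dk k : vder (derive1n k g) (fun s => (rho * a ^+ k) *: (a *: ek k.+1 (a * s + th))).
  have d : der (fun s => a * s + th) (fun=> a).
    by apply: (der_eq (der_add (der_scale a der_id) (der_cst th))) => t; rewrite mulr1 addr0.
  have D := vder_add (vder_cst (if k is 0 then p else 0)) (vder_scale (rho * a ^+ k) (vder_comp (ek_der k) d)).
  by apply: (vder_eq (vder_ext (fun t => esym (circle_derive1n k gE t)) D)) => t; rewrite add0r.
split=> [j _ t|]; first exact: (vder_derive1 (dk j)).1.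
exact: vder_plane_continuous (dk r).
Qed.

Lemma reflectionE (p u w : plane R) : reflection p u (p + w) = p + ((2 * dotp w u) *: u - w).
Proof. by rewrite /reflection [p + w]addrC addrK addrA. Qed.

Lemma reflection_frame (p u l1 : plane R) (r b c : R) (v : plane R) : enorm u = 1 -> l1 = c *: u ->
  reflection p u (p + b *: u + lin l1 (frame_vec r l1) v) = p + b *: u + lin l1 (frame_vec r l1) (v.1, - v.2).
Proof.
move=> u1 ->; have uu : dotp u u = 1 by rewrite -enorm_sq u1 expr1n.
rewrite /frame_vec; move: (r ^+ 2 / _) => k.
rewrite -!addrA reflectionE.
have -> : dotp (b *: u + lin (c *: u) (k *: (- (c *: u).2, (c *: u).1)) v) u = b + v.1 * c.
  rewrite -[RHS]mulr1 -uu /dotp /lin /= /GRing.scale /=; ring.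
by rewrite [LHS]surjective_pairing [RHS]surjective_pairing /lin /= /GRing.scale /=; congr pair; ring.
Qed.

Lemma reflectionK (p u : plane R) : enorm u = 1 -> involutive (reflection p u).
Proof.
move=> u1 x; have uu : dotp u u = 1 by rewrite -enorm_sq u1 expr1n.
move: (x - p) (subrKC p x) => y <-; rewrite !reflectionE.
have -> : dotp ((2 * dotp y u) *: u - y) u = dotp y u.
  transitivity (2 * dotp y u * dotp u u - dotp y u); last by rewrite uu; ring.
  by rewrite /dotp /= /GRing.scale /=; ring.
by rewrite subKr.
Qed.

Lemma reflection_continuous (p u : plane R) : continuous (reflection p u).
Proof.
have c0 : continuous (fun x : plane R => x - p).
  by move=> v; apply: (@continuousB _ _ _ id (fun=> p)); [exact: cvg_id|exact: cst_continuous].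
have c1 : continuous (fun x : plane R => (x - p).1) by move=> v; apply: (@continuous_comp _ _ _ (fun x : plane R => x - p) fst); [exact: c0|exact: cvg_fst].
have c2 : continuous (fun x : plane R => (x - p).2) by move=> v; apply: (@continuous_comp _ _ _ (fun x : plane R => x - p) snd); [exact: c0|exact: cvg_snd].
have cd : continuous (fun x : plane R => dotp (x - p) u).
  move=> v; apply: (@continuousD _ _ _ (fun x : plane R => (x - p).1 * u.1) (fun x => (x - p).2 * u.2)).
    by apply: (@continuousM _ _ (fun x : plane R => (x - p).1) (fun=> u.1)); [exact: c1|exact: cst_continuous].
  by apply: (@continuousM _ _ (fun x : plane R => (x - p).2) (fun=> u.2)); [exact: c2|exact: cst_continuous].
move=> v; apply: (@continuousB _ _ _ (fun x : plane R => p + (2 * dotp (x - p) u) *: u) (fun x => x - p)); last exact: c0.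
apply: (@continuousD _ _ _ (fun=> p) (fun x : plane R => (2 * dotp (x - p) u) *: u)); first exact: cst_continuous.
apply: (@continuousZl _ _ _ (fun x : plane R => 2 * dotp (x - p) u)).
by apply: (@continuousM _ _ (fun=> 2) (fun x : plane R => dotp (x - p) u)); [exact: cst_continuous|exact: cd].
Qed.

Lemma reflection_boundary (p u : plane R) (Omega : set (plane R)) x : enorm u = 1 -> open Omega ->
  reflection p u @` Omega = Omega -> boundary Omega x -> boundary Omega (reflection p u x).
Proof.
move=> u1 oO e [cx nx]; rewrite /boundary.
have iO : interior Omega = Omega by exact: (interior_id _).1.
split=> /=.
  move=> V /(@reflection_continuous p u x) hV; have [y [yO yV]] := cx _ hV.
  by exists (reflection p u y); split=> //; rewrite -e; exists y.
rewrite iO => h; apply: nx; rewrite iO -e.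
by exists (reflection p u x) => //; exact: reflectionK.
Qed.

(** The mirror image, run backwards to restore the orientation, again satisfies omega (H', H'') = 1,
    has its image in that of [G] and starts at the same point; [curve_unique] identifies the two
    parametrizations. *)
Lemma canon_reflection (eps : R) (G : nat -> R -> plane R) : curve eps G -> eps <= 1 / 1000 ->
  G 0%N 0 = (1, 0) -> (forall t, exists s, ((G 0%N t).1, - (G 0%N t).2) = G 0%N s) ->
  forall t, G 0%N (- t) = ((G 0%N t).1, - (G 0%N t).2).
Proof.
move=> cG es G0 h t.
pose S : plane R -> plane R := lin (1, 0) (0, -1).
have SE v : S v = (v.1, - v.2).
  by rewrite /S /lin [LHS]surjective_pairing /= /GRing.scale /=; congr pair; ring.
pose H k t := (-1) ^+ k *: S (G k (- t)).
have dn : der (fun t : R => - t) (fun=> -1) by exact: der_opp der_id.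
suff E : forall t, H 0%N t = G 0%N t.
  by have := E (- t); rewrite /H expr0 scale1r opprK SE => <-.
apply: (@curve_unique _ eps G H 2) => //.
- move=> k k3; have k6 : (k < 6)%N by apply: leq_trans k3 _.
  apply: (vder_eq (vder_scale ((-1) ^+ k) (vder_lin (1, 0) (0, -1) (vder_comp (curve_der cG k6) dn)))) => s.
  by rewrite /H /S linZ scalerA exprSr.
- move=> s; rewrite /H omegaZl omegaZr omega_lin mulrCA !mulrA (curve_omega cG) /omega /=; ring.
- move=> k s k3; have k6 : (k <= 6)%N by apply: leq_trans k3 _.
  rewrite /H normrZ normrX normrN1 expr1n mul1r SE norm_plane_le /= normrN -norm_plane_le.
  by have := curve_le (- s) cG k6; lra.
- by move=> s; have [y e] := h (- s); exists y; rewrite /H expr0 scale1r SE.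
by rewrite /H expr0 scale1r oppr0 SE G0 oppr0.
Qed.

(** The comparison disk may vary with the domain, but its affine perimeter forces its radius; hence
    one [r], and one determinant of the frame, serve for a whole family. *)
Theorem normal_form (r delta : R) (Omega : set (plane R)) (gamma : R -> plane R) :
  0 < r -> r ^+ 2 * (2 * pi) ^+ 3 = 1 -> delta <= 1 / (1000 * 1000 * 1000) ->
  of_class_C 6 gamma -> marked_AS 6 delta Omega gamma ->
  exists b l1 G, [/\ canon (1000 * 1000 * delta) G,
    forall s, gamma s = b + lin l1 (frame_vec r l1) (G 0%N (2 * pi * s)),
    omega l1 (frame_vec r l1) = r ^+ 2, `|l1| <= 2 & `|frame_vec r l1| <= 2].
Proof.
move=> r0 rpi ds c6 [[[oO _ _] _] [ap [p0 [u [u1 inv axis]]]] [p [rho [gD [apD _ _ dist]]]]].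
have [rho0 rhopi [th gDE]] := disk_param apD.
have er : rho = r.
  apply/eqP; rewrite -(@eqrXn2 _ 2)// ?ltW//; apply/eqP; apply: (mulIf (_ : (2 * pi) ^+ 3 != 0)); last by rewrite rhopi rpi.
  by rewrite expf_neq0// gt_eqF// twopi_gt0.
subst rho.
have [c [c1 [c2 [S [T [k' [L rp]]]]]]] := affine_param_reparam ap.
have pg := rp_gamma_per rp.
have pgD : forall t, gD (t + 1) = gD t.
  by have [L' [c' [_ _ h _]]] := apD.
pose g k := derive1n k gamma.
have dg k : (k < 6)%N -> vder (g k) (g k.+1) by exact: class_C_vder c6.
have per k s : (k <= 6)%N -> g k (s + 1) = g k s by move=> k6; exact: (class_C_periodic c6 pg k6).
have og s : omega (g 1%N s) (g 2%N s) = 1 by exact: (rp_omega rp (dg 0%N isT) (dg 1%N isT)).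
have near k s : (k <= 6)%N ->
  `|g k s - ((if k is 0 then p else 0) + (r * (2 * pi) ^+ k) *: ek k (2 * pi * s + th))| <= delta.
  move=> k6; rewrite -(circle_derive1n k gDE).
  exact: (Cr_distance_near c6 (circle_class_C 6 gDE) pg pgD dist).
have ds' : delta <= 1 / (1000 * 1000) by lra.
have cG := frame_curveP dg per og near r0 rpi ds'.
pose l1 := frame_e g; pose o := frame_o g.
have gE s : gamma s = o + lin l1 (frame_vec r l1) (frame_curve g r 0%N (2 * pi * s)) by exact: (frame_param near r0 rpi ds').
have [a ea] : exists a, gamma 0 = p0 + a *: u.
  have : (line p0 u `&` boundary Omega) (gamma 0) by rewrite axis; left.
  by move=> [[a _ e] _]; exists a.
have [a' ea'] : exists a, gamma 2^-1 = p0 + a *: u.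
  have : (line p0 u `&` boundary Omega) (gamma 2^-1) by rewrite axis; right.
  by move=> [[a' _ e] _]; exists a'.
have l1E : l1 = ((a - a') / 2) *: u.
  rewrite /l1 /frame_e /g /= ea ea' [LHS]surjective_pairing [RHS]surjective_pairing /= /GRing.scale /=.
  by congr pair; field.
have oE : o = p0 + ((a + a') / 2) *: u.
  rewrite /o /frame_o /g /= ea ea' [LHS]surjective_pairing [RHS]surjective_pairing /= /GRing.scale /=.
  by congr pair; field.
have det : omega l1 (frame_vec r l1) = r ^+ 2 := frame_det near r0 rpi ds'.
have dn : omega l1 (frame_vec r l1) != 0 by rewrite det sqrf_eq0 gt_eqF.
exists o, l1, (frame_curve g r); split=> //.
- split=> //; last 2 first.
  + exact: (frame_curve0 near r0 rpi ds').
  + exact: (frame_curve_pi near r0 rpi ds').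
  apply: (canon_reflection cG); [lra|exact: (frame_curve0 near r0 rpi ds')|] => t.
  have := reflection_boundary u1 oO inv (x := gamma (t / (2 * pi))).
  rewrite -(rp_gamma_range rp) => /(_ (ex_intro2 _ _ _ I erefl))[s _].
  have pn : 2 * pi != 0 :> R by rewrite gt_eqF// twopi_gt0.
  rewrite !gE {2}oE (reflection_frame _ _ _ _ u1 l1E) -oE [2 * pi * (t / _)]mulrC divfK// => /addrI e.
  by exists (2 * pi * s); apply/esym; rewrite -[LHS](coord_lin _ dn) e coord_lin.
- exact: (frame_e_le near r0 rpi ds').
exact: (frame_vec_le near r0 rpi ds').
Qed.

End Normal.

(** * Rigidity *)

Section Final.
Context {R : realType}.

Lemma segment_continuous (z v : plane R) : continuous (fun s : R => z + s *: v).
Proof.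
have c (x y : R) : continuous (fun s : R => x + s * y).
  exact: der_continuous (der_add (der_cst x) (der_mul der_id (der_cst y))).
by apply: plane_continuous; exact: c.
Qed.

(** The supremum of the parameters at which the ray lies in the domain gives a point outside the
    open domain but in its closure. *)
Lemma ray_boundary (Omega : set (plane R)) z v : open Omega -> bounded_set Omega -> Omega z -> v != 0 ->
  exists2 s : R, 0 < s & boundary Omega (z + s *: v).
Proof.
move=> oO bO Oz v0; have iO : interior Omega = Omega by exact: (interior_id _).1.
pose E := [set s : R | 0 <= s /\ Omega (z + s *: v)].
have E0 : E 0 by split=> //; rewrite scale0r addr0.
have v1 : 0 < `|v| by rewrite normr_gt0.
have hs : has_sup E.
  split; first by exists 0.
  have [M [_ HM]] := bO; exists ((`|z| + (`|M| + 1)) / `|v|) => s [s0 Os].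
  rewrite ler_pdivlMr// -[s in leLHS](ger0_norm s0) -normrZ.
  have h : `|z + s *: v| <= `|M| + 1.
    by apply: (HM (`|M| + 1)) => //; have := ler_norm M; lra.
  have -> : s *: v = (z + s *: v) - z by rewrite addrC addKr.
  by rewrite [leRHS]addrC; exact: normB_le.
have nb (W : set (plane R)) : nbhs (z + sup E *: v) W -> exists2 e : R, 0 < e & forall s, `|s - sup E| < e -> W (z + s *: v).
  move=> /(@segment_continuous z v (sup E))/nbhs_ballP[e /= e0 h]; exists e => // s se.
  by apply: h; rewrite /ball /= distrC.
have s0 : 0 <= sup E by apply: ub_le_sup E0; exact: hs.2.
have nO : ~ Omega (z + sup E *: v).
  move=> h; have [e e0 he] := nb _ (open_nbhs_nbhs (conj oO h)).
  have : E (sup E + e / 2).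
    split; first by rewrite addr_ge0// divr_ge0// ltW.
    by apply: he; rewrite addrAC subrr add0r ger0_norm; lra.
  by move=> /(ub_le_sup hs.2); lra.
exists (sup E).
  rewrite lt_neqAle s0 andbT; apply/eqP => e; apply: nO.
  by rewrite -e scale0r addr0.
split=> /=; last by rewrite iO.
move=> W /nb[e e0 he]; have [s Es sE] := sup_adherent e0 hs.
exists (z + s *: v); split; first exact: Es.2.
apply: he; have := ub_le_sup hs.2 Es => s1.
by rewrite distrC ger0_norm; lra.
Qed.

(** A horizontal line through an interior point meets the boundary on both sides of it. The domain
    is thus recovered from its boundary, to which the conclusions on curves refer. *)
Lemma domain_chords (Omega : set (plane R)) : strictly_convex_domain Omega ->
  Omega = [set z | exists x y (t : R), [/\ boundary Omega x, boundary Omega y, x <> y, 0 < t < 1 &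
                                          z = (1 - t) *: x + t *: y]].
Proof.
move=> [oO bO cO]; apply/seteqP; split=> [z Oz|z /= [x [y [t [[cx _] [cy _] xy t01 ->]]]]]; last exact: cO.
pose v : plane R := (1, 0).
have v0 : v != 0 by apply/eqP => -[] /eqP; rewrite oner_eq0.
have [a a0 ba] := ray_boundary oO bO Oz v0.
have [b b0 bb] : exists2 b : R, 0 < b & boundary Omega (z + b *: - v) by apply: ray_boundary => //; rewrite oppr_eq0.
have ab : a + b != 0 by rewrite gt_eqF// addr_gt0.
exists (z + a *: v), (z + b *: - v), (a / (a + b)); split=> //.
- move=> /addrI /(congr1 fst) /=; rewrite /GRing.scale /= => h.
  by lra.
- by rewrite divr_gt0 ?addr_gt0//= ltr_pdivrMr ?addr_gt0// mul1r ltrDl.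
rewrite [LHS]surjective_pairing [RHS]surjective_pairing /= /GRing.scale /=.
by congr pair; field.
Qed.

Lemma domain_eq (Omega Omega' : set (plane R)) : strictly_convex_domain Omega -> strictly_convex_domain Omega' ->
  boundary Omega = boundary Omega' -> Omega = Omega'.
Proof. by move=> cO cO' e; rewrite (domain_chords cO) (domain_chords cO') e. Qed.

Lemma domain_affine (Omega Omega' : set (plane R)) (c q1 q2 : plane R) :
  strictly_convex_domain Omega -> strictly_convex_domain Omega' -> omega q1 q2 != 0 ->
  boundary Omega' = (fun x => c + lin q1 q2 x) @` boundary Omega -> Omega' = (fun x => c + lin q1 q2 x) @` Omega.
Proof.
move=> cO cO' q0 e.
have lc x y (t : R) : (1 - t) *: (c + lin q1 q2 x) + t *: (c + lin q1 q2 y) = c + lin q1 q2 ((1 - t) *: x + t *: y).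
  by rewrite [LHS]surjective_pairing [RHS]surjective_pairing /lin /= /GRing.scale /=; congr pair; ring.
have inj x y : c + lin q1 q2 x = c + lin q1 q2 y -> x = y.
  by move=> /addrI h; rewrite -(coord_lin x q0) h coord_lin.
rewrite [LHS](domain_chords cO') [X in _ @` X](domain_chords cO) e; apply/seteqP; split.
  move=> _ [_ [_ [t [[x bx <-] [y by_ <-] xy t01 ->]]]]; exists ((1 - t) *: x + t *: y); last by rewrite lc.
  by exists x, y, t; split=> // h; apply: xy; rewrite h.
move=> _ [_ [x [y [t [bx by_ xy t01 ->]]]] <-]; exists (c + lin q1 q2 x), (c + lin q1 q2 y), t.
by split=> //; [exists x|exists y|move=> /inj].
Qed.

Lemma affine_map_lin (q1 q2 c : plane R) : exists B : 'M[R]_2,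
  \det B = omega q1 q2 /\ forall x, affine_map B c x = c + lin q1 q2 x.
Proof.
exists (\matrix_(i, j) (if i == 0 then (if j == 0 then q1.1 else q2.1) else (if j == 0 then q1.2 else q2.2))).
split; last first.
  by move=> x; rewrite /affine_map !mxE /lin [RHS]surjective_pairing /= /GRing.scale /=; congr pair; ring.
rewrite (expand_det_row _ 0) !big_ord_recl big_ord0 /cofactor !det_mx11 !mxE /= /omega; ring.
Qed.

Lemma affine_radius : 0 < (2 * pi : R) `^ (- (3 / 2)) /\ ((2 * pi) `^ (- (3 / 2))) ^+ 2 * (2 * pi) ^+ 3 = 1 :> R.
Proof.
have p0 : 0 < 2 * pi :> R := twopi_gt0.
split; first exact: powR_gt0.
rewrite -powR_mulrn ?powR_ge0// -powRrM.
have -> : - (3 / 2) * 2%:R = - 3%:R :> R by field.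
by rewrite powRN powR_mulrn ?(ltW p0)// mulVf// expf_neq0// gt_eqF.
Qed.

(** Common source of both conclusions: all members of the family share one normalized curve, and
    only the frames depend on tau. *)
Lemma family_rigid (r : R) : 0 < r -> r ^+ 2 * (2 * pi) ^+ 3 = 1 -> exists2 delta : R, 0 < delta &
  forall (Omega : R -> set (plane R)) (gamma : R -> R -> plane R),
  AS_family 6 delta Omega gamma -> area_isospectral Omega ->
  exists (b l1 : R -> plane R) (G : R -> plane R), [/\ G 0 = (1, 0), G pi = (-1, 0) &
    forall tau, -1 <= tau <= 1 -> [/\ strictly_convex_domain (Omega tau),
      range (gamma tau) = boundary (Omega tau),
      omega (l1 tau) (frame_vec r (l1 tau)) = r ^+ 2 &
      forall s, gamma tau s = b tau + lin (l1 tau) (frame_vec r (l1 tau)) (G (2 * pi * s))]].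
Proof.
move=> r0 rpi; have [e0 e00 [_ rig]] := @rigidity R.
pose eps := Num.min e0 (1 / (100 * 100 * 100 * 100)).
have eps0 : 0 < eps by rewrite lt_min e00; apply: divr_gt0; [exact: ltr01|rewrite !mulr_gt0 ?ltr0n].
have eps1 : eps <= e0 by rewrite ge_min lexx.
have eps2 : eps <= 1 / (100 * 100 * 100 * 100) by rewrite ge_min lexx orbT.
have t0 : 0 < 1000 * 1000 :> R by apply: mulr_gt0; rewrite ltr0n.
(* Compensates the loss of a factor 10^6 in [normal_form]. *)
exists (eps / (1000 * 1000)); first exact: divr_gt0.
move=> Omega gamma [[C1 C2] mk] iso.
have D (tau : R) : exists d : plane R * plane R * (nat -> R -> plane R), -1 <= tau <= 1 -> [/\ canon eps d.2,
    forall s, gamma tau s = d.1.1 + lin d.1.2 (frame_vec r d.1.2) (d.2 0%N (2 * pi * s)),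
    omega d.1.2 (frame_vec r d.1.2) = r ^+ 2, `|d.1.2| <= 2 & `|frame_vec r d.1.2| <= 2].
  have [ht|nt] := boolP (-1 <= tau <= 1); last by exists (0, 0, fun _ _ => 0).
  have [_ _ c6] := C1 tau ht.
  have ds : eps / (1000 * 1000) <= 1 / (1000 * 1000 * 1000) by rewrite ler_pdivrMr//; lra.
  have [b [l1 [G]]] := normal_form r0 rpi ds c6 (mk tau ht).
  rewrite mulrC divfK ?gt_eqF// => h.
  by exists (b, l1, G).
have [d Hd] := choice D.
pose b tau := (d tau).1.1; pose l1 tau := (d tau).1.2; pose G tau := (d tau).2.
have r20 : 0 < r ^+ 2 by rewrite exprn_gt0.
have nf tau : -1 <= tau <= 1 -> [/\ canon eps (G tau), affine_param (Omega tau) (gamma tau),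
    omega (l1 tau) (frame_vec r (l1 tau)) = r ^+ 2,
    forall s, gamma tau s = b tau + lin (l1 tau) (frame_vec r (l1 tau)) (G tau 0%N (2 * pi * s)) &
    `|l1 tau| <= 2 /\ `|frame_vec r (l1 tau)| <= 2].
  by move=> ht; have [? ? ? ? ?] := Hd tau ht; have [_ ? _] := C1 tau ht.
have z1 : -1 <= (0 : R) <= 1 by rewrite lerN10 ler01.
have Geq tau : -1 <= tau <= 1 -> forall t, G tau 0%N t = G 0 0%N t.
  move=> ht; have [k _ _ _ _] := nf tau ht; have [k0 _ _ _ _] := nf 0 z1.
  by apply: (rig eps) => // q q2; exact: (family_matched eps2 r20 iso C2 nf q2 ht z1).
exists b, l1, (G 0 0%N); have [k0 _ _ _ _] := nf 0 z1.
split; [exact: canon0 k0|exact: canonpi k0|] => tau ht.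
have [k ap det gE _] := nf tau ht; have [[cO _] _ _] := C1 tau ht.
split=> //; last by move=> s; rewrite gE (Geq tau ht).
by have [c [c1 [c2 [S [T [k' [L rp]]]]]]] := affine_param_reparam ap; exact: rp_gamma_range rp.
Qed.

End Final.

Theorem theorem3p1 (R : realType) :
  exists delta : R, 0 < delta /\
    forall Omega : set (plane R), calAS 6 delta Omega ->
      spectrally_rigid 6 delta Omega /\ normalized_rigid 6 delta Omega.
Proof.
have [r0 rpi] := @affine_radius R.
have [delta delta0 H] := family_rigid r0 rpi.
set r := (2 * pi) `^ _ in r0 rpi H.
have z1 : -1 <= (0 : R) <= 1 by rewrite lerN10 ler01.
exists delta; split=> // Omega0 _; split=> Omega gamma.
  move=> fam iso _ tau ht; have [b [l1 [G [_ _ nf]]]] := H _ _ fam iso.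
  have [c0 rg0 det0 g0] := nf 0 z1; have [c rg det g] := nf tau ht.
  (* [lin q1 q2] takes coordinates in the frame at 0 and reads them in the frame at tau; the frames
     have equal determinants, so it has determinant 1. *)
  pose a1 := (omega (l1 0) (frame_vec r (l1 0)))^-1 *: ((frame_vec r (l1 0)).2, - (l1 0).2).
  pose a2 := (omega (l1 0) (frame_vec r (l1 0)))^-1 *: (- (frame_vec r (l1 0)).1, (l1 0).1).
  pose q1 := lin (l1 tau) (frame_vec r (l1 tau)) a1; pose q2 := lin (l1 tau) (frame_vec r (l1 tau)) a2.
  have rn : r ^+ 2 != 0 by rewrite expf_neq0// gt_eqF.
  have q12 : omega q1 q2 = 1.
    rewrite omega_lin det /a1 /a2 det0; move: (frame_vec r (l1 0)) det0 => m det0; rewrite omegaZl omegaZr.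
    have -> : omega (m.2, - (l1 0).2) (- m.1, (l1 0).1) = r ^+ 2.
      by rewrite -det0 /omega /=; ring.
    by rewrite mulVf// mulr1 mulfV.
  have qE v : lin q1 q2 v = lin (l1 tau) (frame_vec r (l1 tau)) (coord (l1 0) (frame_vec r (l1 0)) v).
    rewrite /coord -/a1 -/a2 /q1 /q2 [LHS]surjective_pairing [RHS]surjective_pairing /lin /= /GRing.scale /=.
    by congr pair; ring.
  pose c' := b tau - lin q1 q2 (b 0).
  have gq s : gamma tau s = c' + lin q1 q2 (gamma 0 s).
    rewrite /c' -addrA [- _ + _]addrC -linB g g0 [b 0 + _]addrC addrK qE coord_lin ?det0//.
  have [B [dB BE]] := affine_map_lin q1 q2 c'.
  exists B, c'; split; first by rewrite dB.
  have -> : affine_map B c' = (fun x => c' + lin q1 q2 x) by apply/funext.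
  apply: domain_affine => //; first by rewrite q12 oner_neq0.
  rewrite -rg -rg0; apply/seteqP; split=> [_ [s _ <-]|_ [_ [s _ <-] <-]].
    by exists (gamma 0 s); [exists s|rewrite gq].
  by exists s; rewrite ?gq.
move=> fam nrm iso _ tau ht; have [b [l1 [G [G0 Gpi nf]]]] := H _ _ fam iso.
(* The normalization prescribes the marked and auxiliary points, whose midpoint and half difference
   are the origin and the first vector of the frame. *)
have frame t : -1 <= t <= 1 -> b t = (r, 0) /\ l1 t = (- r, 0).
  move=> h; have [_ _ _ g] := nf t h; have [e1 _ _ e2] := nrm t h.
  move: e1 e2; rewrite !g mulr0 G0 mulrAC divff// mul1r Gpi /lin !scale0r !addr0 scale1r scaleN1r -/r.
  move=> /(congr1 (fun v => (v.1, v.2))) /= [] h1 h2 [] h3 h4.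
  by split; rewrite [LHS]surjective_pairing; congr pair; lra.
have [c0 rg0 _ g0] := nf 0 z1; have [c rg _ g] := nf tau ht.
apply: domain_eq => //; rewrite -rg -rg0; congr (_ @` _); apply/funext => s.
by rewrite g g0; have [-> ->] := frame tau ht; have [-> ->] := frame 0 z1.
Qed.
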